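(* Assume that $X\subset N_{\mathbb R}$ is a connected, one-dimensional, polyhedrally smooth, balanced polyhedral space. For any positive at infinity function $\gamma\in\mathrm{PAPC}(X)$ and any compactly supported (positive) Radon measure $\mu$ on $X$ of total mass $\deg(\gamma)$, there exists a unique (up to additive constant) function $\phi\in\mathrm{PSH}(X,\gamma)$ solving the Monge--Ampère equation $\mathrm{MA}_{\mathrm{poly}}(\phi)=\mu$. Moreover, if $\gamma$ is strictly convex, then $\phi\in\mathrm{PC}^{\mathrm{reg}}(X,\gamma)$.
   Context: Polyhedral spaces. $N$ is a lattice (free abelian group of finite rank), $M=\mathrm{Hom}(N,\mathbb Z)$, $N_R=N\otimes R$, $M_R=M\otimes R$. A rational polyhedron in $N_{\mathbb R}$ is a subset defined by finitely many conditions $f(n)+b=0$ or $f(n)+b\ge 0$ with $f\in M$, $b\in\mathbb Z$. For a polyhedron $\sigma$: $N_{\sigma,\mathbb R}$ is the linear span of all $x-y$, $x,y\in\sigma$; $N_\sigma=N_{\sigma,\mathbb R}\cap N$; $M_\sigma$ is the dual lattice of $N_\sigma$; $\mathrm{relint}(\sigma)$ is the relative interior; $\mathrm{rec}(\sigma)=\{v: x+tv\in\sigma\ \forall x\in\sigma,t\ge0\}$. A rational polyhedral complex $\Pi$ is a finite collection of rational polyhedra (its faces), closed under taking faces, two of which meet in the empty set or in a common face; $|\Pi|$ is its support, $\Pi^{(k)}$ its set of $k$-dimensional faces, $\tau\prec\sigma$ means $\tau$ is a face of $\sigma$. A one-dimensional polyhedral space is a set $X=|\Pi|$ where all inclusion-maximal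 faces of $\Pi$ have dimension $1$; any rational polyhedral complex with support $X$ is called a polyhedral structure on $X$. A $k$-dimensional polyhedron is simplicial if it is the sum of an $l$-simplex and a simplicial cone of dimension $k-l$; $\Pi$ is simplicial if all its faces are. Balancing and smoothness. For an edge $e\in\Pi^{(1)}$ adjacent to a vertex $v\in\Pi^{(0)}$, $n_{e/v}\in N_e$ is the primitive vector pointing from $v$ into $e$. A balanced one-dimensional polyhedral space carries weights $[X](e)\in\mathbb Q_{>0}$ on the edges of some polyhedral structure (transported to refinements by restriction) with $\sum_{e\succ v}[X](e)n_{e/v}=0$ at each vertex $v$. $X$ is polyhedrally smooth if for every polyhedral structure $\Pi$ on which $[X]$ is defined and every $v\in\Pi^{(0)}$, $\mathrm{Span}_{\mathbb Z}(n_{e/v}: e\succ v)$ is a saturated sublattice of $N$ of rank $\mathrm{val}(v)-1$, where $\mathrm{val}(v)$ is the number of edges adjacent to $v$. Functions. A continuous $\phi:X\to\mathbb R$ is piecewise affine on $\Pi$ if on each $\sigma\in\Pi$ it is the restriction of an affine function with linear part $\phi_\sigma\in M_\sigma\otimes\mathbb Q$ and rational constant term; $\mathrm{PA}(\Pi)$ is the set of these, $\mathrm{PA}(X)=\bigcup_\Pi\mathrm{PA}(\Pi)$. $\gamma\in\mathrm{PA}(\Pi)$ is positive at infinity if $\gamma_\sigma(v)>0$ for every $\sigma\in\Pi$ and non-zero $v\in\mathrm{rec}(\sigma)$. A polyhedral convex combination on $\Pi$ is a triple $(x,(x_i)_{i\in I},(\alpha_i)_{i\in I})$ with $I$ finite,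 $x_i\in X\cap N_{\mathbb Q}$, $\alpha_i\in[0,1]$, $\sum\alpha_i=1$, $x=\sum\alpha_ix_i\in X$, such that there are faces $\tau,\sigma_i\in\Pi$ with $x\in\tau$, $x_i\in\sigma_i$, and $\tau$ a (not necessarily proper) face of every $\sigma_i$; one in $X$ is one on some polyhedral structure $\Pi$. $\mathrm{PC}(X)$ is the set of continuous $\phi:X\to\mathbb R$ with $\phi(x)\le\sum\alpha_i\phi(x_i)$ for all polyhedral convex combinations in $X$; $\mathrm{PAPC}(X)=\mathrm{PA}(X)\cap\mathrm{PC}(X)$; $\mathrm{PAPC}(X,\gamma)$ is the subset of $\phi$ with $\phi-\gamma$ bounded. $\mathrm{PSH}(X,\gamma)$ is the set of $\phi:X\to\mathbb R$ that are pointwise limits of decreasing sequences in $\mathrm{PAPC}(X,\gamma)$; $\mathrm{PC}^{\mathrm{reg}}(X,\gamma)$ is the set of uniform limits on $X$ of sequences in $\mathrm{PAPC}(X,\gamma)$. $\gamma$ is strictly convex if for some simplicial polyhedral structure $\Pi$ we have $\gamma\in\mathrm{PA}(\Pi)$ and $\gamma(x)<\sum\alpha_i\gamma(x_i)$ for every polyhedral convex combination on $\Pi$ with $x\in\mathrm{relint}(\tau)$, $x_i\in\mathrm{relint}(\sigma_i)$ and $\tau$ a proper face of $\sigma_i$ for at least two indices $i$. Monge--Ampère in dimension one. For $\phi\in\mathrm{PA}(\Pi)$, with $[X]$ defined on $\Pi$, $\mathrm{MA}_{\mathrm{poly}}(\phi)=\sum_{v\in\Pi^{(0)}}\Big(\sum_{e\succ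 v}[X](e)\phi_e(n_{e/v})\Big)\delta_v$; $\deg(\gamma)$ is the total mass of $\mathrm{MA}_{\mathrm{poly}}(\gamma)$. For $\phi\in\mathrm{PC}^{\mathrm{reg}}(X,\gamma)$, $\mathrm{MA}_{\mathrm{poly}}(\phi)$ is the positive Radon measure on $X$ of mass $\deg(\gamma)$ that is the weak limit of $\mathrm{MA}_{\mathrm{poly}}(\phi_j)$ for any sequence $\phi_j\in\mathrm{PAPC}(X,\gamma)$ converging uniformly to $\phi$ (it exists and is independent of choices). For $\phi\in\mathrm{PSH}(X,\gamma)$, put $\phi^{\langle t\rangle}=\max(\phi,\gamma-t)\in\mathrm{PC}^{\mathrm{reg}}(X,\gamma)$ and define $\int g\,\mathrm{MA}_{\mathrm{poly}}(\phi)=\lim_{t\to\infty}\int_{\{\phi>\gamma-t\}}g\,\mathrm{MA}_{\mathrm{poly}}(\phi^{\langle t\rangle})$ for $g\ge0$ bounded continuous. *)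

(* Defs.v *)
From HB Require Import structures.
From mathcomp Require Import all_boot all_order all_algebra finmap.
From mathcomp Require Import all_classical all_reals all_analysis.

Set Implicit Arguments.
Unset Strict Implicit.
Unset Printing Implicit Defensive.

Import Order.TTheory GRing.Theory Num.Theory.
Import numFieldNormedType.Exports.

Local Open Scope classical_set_scope.
Local Open Scope ring_scope.

(* The lattice is N = Z^n, as row vectors 'rV[int]_n, with dual M = Hom(N, Z)
   the column vectors 'cV[int]_n. Accordingly N_R = 'rV[R]_n, and M_Q, M_R are
   the columns over rat, R. *)

Section Polyhedra.
Variables (R : realType) (n : nat).
Local Notation V := 'rV[R]_n.
Implicit Types (sigma tau e : set V) (x y v : V).

Definition pairing x (f : 'cV[R]_n) : R := (x *m f) 0 0.

Definition latv (u : 'rV[int]_n) : V := map_mx intr u.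

Definition rational_points : set V :=
  [set x | exists q : 'rV[rat]_n, x = map_mx ratr q].

Definition rational_polyhedron sigma : Prop :=
  exists eqs ineqs : seq ('cV[int]_n * int),
    sigma = [set x |
      (forall c, c \in eqs -> pairing x (map_mx intr c.1) + c.2%:~R = 0) /\
      (forall c, c \in ineqs -> 0 <= pairing x (map_mx intr c.1) + c.2%:~R)].

(* Faces are nonempty; [sigma] is a face of itself (take f = 0 and b = 0). *)
Definition face sigma tau : Prop :=
  tau !=set0 /\
  exists (f : 'cV[R]_n) (b : R),
    (forall x, sigma x -> 0 <= pairing x f + b) /\
    tau = sigma `&` [set x | pairing x f + b = 0].

Definition lin_span sigma : set V :=
  [set v | exists (k : nat) (a : 'I_k -> R) (x y : 'I_k -> V),
    (forall i, sigma (x i) /\ sigma (y i)) /\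
    v = \sum_(i < k) a i *: (x i - y i)].

Definition has_dim sigma (k : nat) : Prop :=
  exists U : {vspace V}, [set v | v \in U] = lin_span sigma /\ \dim U = k.

(* The affine hull of [sigma] at a point x of [sigma] is x + lin_span sigma. *)
Definition relint sigma : set V :=
  [set x | sigma x /\ exists2 eps : R, 0 < eps &
     forall y, lin_span sigma (y - x) -> `|y - x| < eps -> sigma y].

Definition recession sigma : set V :=
  [set v | forall x (t : R), sigma x -> 0 <= t -> sigma (x + t *: v)].

Definition is_simplex (l : nat) sigma : Prop :=
  exists p : 'I_l.+1 -> V,
    free [seq p (lift ord0 i) - p ord0 | i : 'I_l] /\
    sigma = [set x | exists a : 'I_l.+1 -> R,
      [/\ forall i, 0 <= a i, \sum_i a i = 1 & x = \sum_i a i *: p i]].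

Definition is_simplicial_cone (m : nat) sigma : Prop :=
  exists r : 'I_m -> V,
    free [seq r i | i : 'I_m] /\
    sigma = [set x | exists a : 'I_m -> R,
      (forall i, 0 <= a i) /\ x = \sum_i a i *: r i].

Definition simplicial sigma : Prop :=
  exists (k l : nat) (S C : set V),
    [/\ has_dim sigma k, (l <= k)%N, is_simplex l S,
        is_simplicial_cone (k - l) C
      & sigma = [set x + y | x in S & y in C]].

Definition polyhedral_complex (Pi : set (set V)) : Prop :=
  [/\ finite_set Pi,
      forall sigma, Pi sigma -> rational_polyhedron sigma /\ sigma !=set0,
      forall sigma tau, Pi sigma -> face sigma tau -> Pi tau
    & forall sigma sigma', Pi sigma -> Pi sigma' ->
        sigma `&` sigma' = set0 \/
        (face sigma (sigma `&` sigma') /\ face sigma' (sigma `&` sigma'))].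

Definition polyhedral_structure (X : set V) (Pi : set (set V)) : Prop :=
  polyhedral_complex Pi /\ \bigcup_(sigma in Pi) sigma = X.

Definition one_dim_polyhedral_space (X : set V) : Prop :=
  exists2 Pi, polyhedral_structure X Pi &
    forall sigma, Pi sigma ->
      (forall sigma', Pi sigma' -> sigma `<=` sigma' -> sigma' = sigma) ->
      has_dim sigma 1.

Definition edges (Pi : set (set V)) : set (set V) :=
  [set e | Pi e /\ has_dim e 1].

(* A vertex is the point v of a zero-dimensional face {v}. *)
Definition vertices (Pi : set (set V)) : set V :=
  [set v | Pi [set v] /\ has_dim [set v] 0].

Definition star (Pi : set (set V)) v : set (set V) :=
  [set e | edges Pi e /\ face e [set v]].

Definition valence (Pi : set (set V)) v : nat := #|` fset_set (star Pi v)|%fset.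

Definition is_primitive_vector e v (u : 'rV[int]_n) : Prop :=
  [/\ lin_span e (latv u),
      forall (w : 'rV[int]_n) (k : nat),
        lin_span e (latv w) -> u = w *+ k -> k = 1%N
    & exists2 t : R, 0 < t & e (v + t *: latv u)].

(* The vector n_{e/v}, which is unique when v is a vertex of the edge e. *)
Definition primitive_vector e v : 'rV[int]_n :=
  xget 0 [set u | is_primitive_vector e v u].

End Polyhedra.

Section Lattices.
Variable n : nat.
Implicit Type L : set 'rV[int]_n.

Definition saturated L : Prop :=
  forall (u : 'rV[int]_n) (k : int), k != 0 -> L (k *: u) -> L u.

(* The rows of B form a Z-basis of L. *)
Definition lattice_rank L (r : nat) : Prop :=
  exists B : 'M[int]_(r, n),
    (forall a : 'rV[int]_r, a *m B = 0 -> a = 0) /\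
    L = [set a *m B | a in [set: 'rV[int]_r]].

End Lattices.

Section Weights.
Variables (R : realType) (n : nat).
Local Notation V := 'rV[R]_n.
Variable X : set V.

Definition balanced (Pi0 : set (set V)) (w0 : set V -> rat) : Prop :=
  [/\ polyhedral_structure X Pi0,
      forall e, edges Pi0 e -> 0 < w0 e
    & forall v, vertices Pi0 v ->
        \sum_(e \in star Pi0 v)
           w0 e *: map_mx intr (primitive_vector e v) = 0 :> 'rV[rat]_n].

(* The class [X] is the datum of weights w0 on the edges of a structure Pi0. Its
   weight on a segment e of X is q when the restrictions of q and w0 to the
   common refinement of e and Pi0 agree. *)
Variables (Pi0 : set (set V)) (w0 : set V -> rat).

Definition has_weight (e : set V) (q : rat) : Prop :=
  forall e0, edges Pi0 e0 -> has_dim (e `&` e0) 1 -> q = w0 e0.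

Definition weight (e : set V) : rat := xget 0 [set q | has_weight e q].

Definition weight_defined_on (Pi : set (set V)) : Prop :=
  polyhedral_structure X Pi /\
  forall e, edges Pi e -> exists q, has_weight e q.

Definition primitive_lattice (Pi : set (set V)) (v : V) : set 'rV[int]_n :=
  [set u | exists a : set V -> int,
     u = \sum_(e \in star Pi v) a e *: primitive_vector e v].

Definition polyhedrally_smooth : Prop :=
  forall Pi, weight_defined_on Pi -> forall v, vertices Pi v ->
    saturated (primitive_lattice Pi v) /\
    exists2 r, lattice_rank (primitive_lattice Pi v) r & valence Pi v = r.+1.

End Weights.

Section Functions.
Variables (R : realType) (n : nat).
Local Notation V := 'rV[R]_n.
Variable X : set V.
Implicit Types (phi gamma : V -> R) (Pi : set (set V)) (sigma tau : set V).

(* Functions on X are total functions on N_R of which only the values on X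
   matter. *)

(* Every element of the dual of N_sigma tensored with Q lifts to M_Q. *)
Definition is_linear_part phi sigma (f : 'cV[rat]_n) : Prop :=
  exists c : rat,
    forall x, sigma x -> phi x = pairing x (map_mx ratr f) + ratr c.

(* phi_sigma, evaluated at vectors of N_{sigma, R}, where its value does not
   depend on the lift to M_Q. *)
Definition linear_part phi sigma (v : V) : R :=
  pairing v (map_mx ratr (xget 0 [set f | is_linear_part phi sigma f])).

Definition PA_on Pi phi : Prop :=
  {within X, continuous phi} /\
  forall sigma, Pi sigma -> exists f, is_linear_part phi sigma f.

Definition PA phi : Prop := exists2 Pi, polyhedral_structure X Pi & PA_on Pi phi.

Definition positive_at_infinity gamma : Prop :=
  exists Pi, [/\ polyhedral_structure X Pi, PA_on Pi gamma
    & forall sigma v, Pi sigma -> recession sigma v -> v != 0 ->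
        0 < linear_part gamma sigma v].

(* The polyhedral convex combination x = \sum_i alpha_i x_i, together with faces
   tau and sigma_i witnessing that it is one on Pi. *)
Definition convex_combination_with Pi (m : nat) (x : V) (xs : 'I_m -> V)
    (alpha : 'I_m -> R) (tau : set V) (sigma : 'I_m -> set V) : Prop :=
  [/\ X x /\ (forall i, (X `&` @rational_points R n) (xs i)),
      (forall i, 0 <= alpha i <= 1) /\ \sum_i alpha i = 1,
      x = \sum_i alpha i *: xs i,
      Pi tau /\ tau x
    & forall i, [/\ Pi (sigma i), sigma i (xs i) & face (sigma i) tau]].

Definition convex_combination Pi (m : nat) (x : V) (xs : 'I_m -> V)
    (alpha : 'I_m -> R) : Prop :=
  exists tau (sigma : 'I_m -> set V),
    convex_combination_with Pi x xs alpha tau sigma.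

Definition PC phi : Prop :=
  {within X, continuous phi} /\
  forall Pi, polyhedral_structure X Pi ->
  forall (m : nat) (x : V) (xs : 'I_m -> V) (alpha : 'I_m -> R),
    convex_combination Pi x xs alpha ->
    phi x <= \sum_i alpha i * phi (xs i).

Definition PAPC phi : Prop := PA phi /\ PC phi.

(* PAPC(X, gamma) *)
Definition PAPC_bdd gamma phi : Prop :=
  PAPC phi /\ [bounded phi x - gamma x | x in X].

Definition PSH gamma phi : Prop :=
  exists phi_ : nat -> V -> R,
    [/\ forall j, PAPC_bdd gamma (phi_ j),
        forall x, X x -> nonincreasing_seq (fun j => phi_ j x)
      & forall x, X x -> phi_ j x @[j --> \oo] --> phi x].

Definition PCreg gamma phi : Prop :=
  exists2 phi_ : nat -> V -> R,
    forall j, PAPC_bdd gamma (phi_ j) & {uniform X, phi_ @ \oo --> phi}.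

(* The two distinguished indices must carry positive coefficients: terms with
   coefficient 0 can be added to the trivial combination x = 1 x, for which
   strict inequality fails. *)
Definition strictly_convex gamma : Prop :=
  exists Pi,
    [/\ polyhedral_structure X Pi, forall sigma, Pi sigma -> simplicial sigma,
        PA_on Pi gamma
      & forall (m : nat) (x : V) (xs : 'I_m -> V) (alpha : 'I_m -> R)
          (tau : set V) (sigma : 'I_m -> set V),
          convex_combination_with Pi x xs alpha tau sigma ->
          relint tau x -> (forall i, relint (sigma i) (xs i)) ->
          (exists i j, [/\ i != j, 0 < alpha i, 0 < alpha j,
             sigma i <> tau & sigma j <> tau]) ->
          gamma x < \sum_i alpha i * gamma (xs i)].

End Functions.

Section RadonMeasures.
Variables (R : realType) (n : nat).

Definition borelV : measurableType _ := g_sigma_algebraType (@open 'rV[R]_n).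

(* Measures on the closed set X are Borel measures on N_R concentrated on X. *)
Definition radon_on (X : set 'rV[R]_n) (mu : {measure set borelV -> \bar R}) :
    Prop :=
  [/\ forall K : set 'rV[R]_n, compact K -> (mu K < +oo)%E,
      forall B : set borelV, measurable B ->
        mu B = ereal_sup [set mu K | K in
                 [set K : set 'rV[R]_n | compact K /\ K `<=` B]]
    & mu (~` X) = 0%E].

Definition compactly_supported (X : set 'rV[R]_n)
    (mu : {measure set borelV -> \bar R}) : Prop :=
  exists K : set 'rV[R]_n, [/\ compact K, K `<=` X & mu (~` K) = 0%E].

End RadonMeasures.

Section MongeAmpere.
Variables (R : realType) (n : nat).
Local Notation V := 'rV[R]_n.
Variables (X : set V) (Pi0 : set (set V)) (w0 : set V -> rat).
Implicit Types (phi gamma g : V -> R) (Pi : set (set V)).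

Definition MA_atom Pi phi (v : V) : R :=
  \sum_(e \in star Pi v)
    ratr (weight Pi0 w0 e) * linear_part phi e (latv R (primitive_vector e v)).

(* A structure on which both phi and [X] are defined; MA_poly(phi) does not
   depend on it. *)
Definition MA_structure phi : set (set V) :=
  xget set0 [set Pi | weight_defined_on X Pi0 w0 Pi /\ PA_on X Pi phi].

(* The integral of g against the finite signed measure
   MA_poly(phi) = \sum_v MA_atom v * delta_v, for phi in PA(X). *)
Definition integral_MA_PA phi g : R :=
  \sum_(v \in vertices (MA_structure phi))
    MA_atom (MA_structure phi) phi v * g v.

Definition deg gamma : R := integral_MA_PA gamma (cst 1).

(* nu = MA_poly(phi), for phi in PCreg(X, gamma) *)
Definition is_MA_reg gamma phi (nu : {measure set (borelV R n) -> \bar R}) :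
    Prop :=
  [/\ PCreg X gamma phi, radon_on X nu, nu setT = (deg gamma)%:E
    & forall phi_ : nat -> V -> R,
        (forall j, PAPC_bdd X gamma (phi_ j)) ->
        {uniform X, phi_ @ \oo --> phi} ->
        forall g, {within X, continuous g} -> [bounded g x | x in X] ->
          (integral_MA_PA (phi_ j) g)%:E @[j --> \oo]
            --> (\int[nu]_(x in X) (g x)%:E)%E].

Definition truncation gamma phi (t : R) : V -> R :=
  fun x => Num.max (phi x) (gamma x - t).

(* mu = MA_poly(phi), for phi in PSH(X, gamma) *)
Definition is_MA_PSH gamma phi (mu : {measure set (borelV R n) -> \bar R}) :
    Prop :=
  exists nu : R -> {measure set (borelV R n) -> \bar R},
    (forall t, is_MA_reg gamma (truncation gamma phi t) (nu t)) /\
    forall g, {within X, continuous g} -> (forall x, X x -> 0 <= g x) ->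
      [bounded g x | x in X] ->
      (\int[nu t]_(x in X `&` [set x | (gamma x - t < phi x)%R]) (g x)%:E)%E
        @[t --> +oo] --> (\int[mu]_(x in X) (g x)%:E)%E.

End MongeAmpere.

(* Main.v *)
Require Import Defs.
From mathcomp Require Import all_boot all_order all_algebra finmap.
From mathcomp Require Import all_classical all_reals all_analysis.
From mathcomp Require Import ring lra zify.

Set Implicit Arguments.
Unset Strict Implicit.
Unset Printing Implicit Defensive.

Import Order.TTheory GRing.Theory Num.Theory.
Import numFieldNormedType.Exports.

Local Open Scope classical_set_scope.
Local Open Scope ring_scope.

(** Locally the space is a finite star of rays, and everything is phrased through the
    germs of the space at its points: the primitive directions [dir v], their weights,
    the slopes of a function, and their weighted sum, the Laplacian, whose value at [v]
    is the mass at [v] of the Monge-Ampere measure ([MA_atomE], [integral_MA_PAE]).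

    Smoothness says that the balancing condition is the only linear relation between
    the directions at a point ([tangent_relation]). Hence a piecewise affine function is
    polyhedrally convex if and only if its Laplacian is nonnegative ([laplacian_PC],
    [PC_laplacian]), and the Monge-Ampere equation becomes a Poisson equation on a
    metric graph. In dimension one this equation is linear, and it can be solved by hand.

    Bounded piecewise affine functions satisfy Green's identity ([green]) and the maximum
    principle ([maximum_principle]). Together they give, for rational points [x] and [y],
    a bounded piecewise affine dipole with Laplacian [delta_x - delta_y]
    ([dipole_exists]). Its oscillation is at most the distance of [x] and [y] divided by
    the weight when both lie on one edge ([dipole_oscillation]), so bounded piecewise
    affine functions are Lipschitz along edges with a constant proportional to the mass
    of their Laplacian ([edge_lipschitz_bound]).

    Existence. A compactly supported measure is approximated by rational atoms, with an
    error controlled by the Lipschitz constant along edges ([atomic_approximation]). For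
    atoms the equation is solved by adding dipoles to [gamma] ([atoms_solution]). Testing
    against dipoles turns the quality of the approximation of the measure into uniform
    closeness of the solutions, so these converge uniformly, and small constants make the
    sequence decrease ([solution]). The limit differs from [gamma] by a bounded function
    and, the convergence being uniform, lies in PC^reg.

    Green's identity also moves the Laplacian to the test function: the pairing
    [MA_form f g], which needs [f] only at finitely many points, extends the integral of
    [g] against MA(f) to all [f]. A measure is MA(f) as soon as it computes this pairing
    on bounded piecewise affine functions ([form_MA_reg]). The definition of MA on PSH
    asks for the measures of all truncations max(phi, gamma - t). Where phi > gamma - t
    such a measure is mu, in the interior of the complement it is MA(gamma), and the
    boundary between these two regions is finite because phi - gamma is convex wherever
    gamma is affine; the atoms there are obtained from the pairing
    ([truncation_measure]).

    Uniqueness. If psi solves the equation, the pairing of its truncations with a test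
    function tends to the integral against mu ([truncations_pairing]). For a dipole this
    determines the difference of the values of psi at the two poles, and psi is
    continuous ([solution_unique]). *)

(** * Row vectors, affine functions and continuity on a subset *)

Section Basics.
Variables (R : realType) (n : nat).
Local Notation V := 'rV[R]_n.
Implicit Types (x y v : V) (f g : 'cV[R]_n).

Lemma pairingE x f : pairing x f = \sum_j x 0 j * f j 0.
Proof. by rewrite /pairing mxE. Qed.

Lemma pairingD x y f : pairing (x + y) f = pairing x f + pairing y f.
Proof. by rewrite /pairing mulmxDl mxE. Qed.

Lemma pairingZ a x f : pairing (a *: x) f = a * pairing x f.
Proof. by rewrite /pairing -scalemxAl mxE. Qed.

Lemma pairingN x f : pairing (- x) f = - pairing x f.
Proof. by rewrite -scaleN1r pairingZ mulN1r. Qed.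

Lemma pairingB x y f : pairing (x - y) f = pairing x f - pairing y f.
Proof. by rewrite pairingD pairingN. Qed.

Lemma pairingDr x f g : pairing x (f + g) = pairing x f + pairing x g.
Proof. by rewrite /pairing mulmxDr [LHS]mxE. Qed.

Lemma pairingZr a x f : pairing x (a *: f) = a * pairing x f.
Proof. by rewrite /pairing -scalemxAr [LHS]mxE. Qed.

Lemma pairing0r x : pairing x 0 = 0.
Proof. by rewrite /pairing mulmx0 mxE. Qed.

Lemma pairing_delta x k : pairing x (delta_mx k 0) = x 0 k.
Proof.
rewrite pairingE (bigD1 k) //= mxE !eqxx mulr1 big1 ?addr0 // => j /negPf jk.
by rewrite mxE jk mulr0.
Qed.

Lemma rV_normE x : `|x| = \big[Num.max/0]_(ij : 'I_1 * 'I_n) `|x ij.1 ij.2|.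
Proof. exact: mx_normrE. Qed.

Lemma coord_le_norm x j : `|x 0 j| <= `|x|.
Proof.
by rewrite rV_normE; apply: (le_bigmax _ (fun ij : 'I_1 * 'I_n => `|x ij.1 ij.2|) (0, j)).
Qed.

Lemma norm_lt_coord x e : 0 < e -> (forall j, `|x 0 j| < e) -> `|x| < e.
Proof.
by move=> e0 h; rewrite rV_normE; apply: bigmax_lt => // -[i j] _; rewrite ord1.
Qed.

Lemma norm_le_coord x e : 0 <= e -> (forall j, `|x 0 j| <= e) -> `|x| <= e.
Proof.
by move=> e0 h; rewrite rV_normE; apply: bigmax_le => // -[i j] _; rewrite ord1.
Qed.

Lemma pairing_bound f : exists2 K, 0 < K & forall x, `|pairing x f| <= K * `|x|.
Proof.
exists (1 + \sum_j `|f j 0|); first by rewrite ltr_pwDl // sumr_ge0.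
move=> x; rewrite pairingE; apply: le_trans (ler_norm_sum _ _ _) _.
rewrite mulrDl mul1r; apply: le_trans (_ : (\sum_j `|f j 0|) * `|x| <= _); last first.
  by rewrite lerDr.
rewrite mulr_suml; apply: ler_sum => j _; rewrite normrM mulrC.
by rewrite ler_wpM2l // coord_le_norm.
Qed.

Lemma seq_eps (T : eqType) (s : seq T) (P : T -> R -> Prop) :
  (forall a e e', P a e -> 0 < e' -> e' <= e -> P a e') ->
  (forall a, a \in s -> exists2 e, 0 < e & P a e) ->
  exists2 e, 0 < e & forall a, a \in s -> P a e.
Proof.
move=> mono; elim: s => [|a s IH] h; first by exists 1.
have [|e e0 he] := IH; first by move=> b bs; apply: h; rewrite inE bs orbT.
have [|d d0 hd] := h a; first by rewrite inE eqxx.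
have m0 : 0 < Num.min e d by rewrite lt_min e0 d0.
exists (Num.min e d) => // b; rewrite inE => /orP[/eqP ->|bs].
  by apply: mono hd _ _ => //; rewrite ge_min lexx orbT.
by apply: mono (he _ bs) _ _ => //; rewrite ge_min lexx.
Qed.

Lemma set_eps (T : eqType) (A : set T) (P : T -> R -> Prop) : finite_set A ->
  (forall a e e', P a e -> 0 < e' -> e' <= e -> P a e') ->
  (forall a, A a -> exists2 e, 0 < e & P a e) ->
  exists2 e, 0 < e & forall a, A a -> P a e.
Proof. by move=> /finite_seqP[s ->] mono h; exact: seq_eps. Qed.

Lemma within_continuousP (W : normedModType R) (X : set W) (h : W -> R) :
  {within X, continuous h} <->
  forall a, X a -> forall e, 0 < e -> exists2 d, 0 < d &
    forall b, X b -> `|b - a| < d -> `|h b - h a| < e.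
Proof.
rewrite continuous_subspace_in; split=> [ch a Xa e e0|hd a].
  have := ch a (mem_set Xa); move/cvgrPdist_lt => /(_ _ e0).
  rewrite /prop_near1 /nbhs /= -(nbhs_subspace_in Xa) => /nbhs_ballP[d d0 hd].
  exists d => // b Xb ba; rewrite distrC; apply: hd => //.
  by rewrite -ball_normE /= distrC.
rewrite inE => Xa; apply/cvgrPdist_lt => e /(hd a Xa)[d d0 hda].
rewrite /prop_near1 /nbhs /= -(nbhs_subspace_in Xa); apply/nbhs_ballP; exists d => // b.
by rewrite -ball_normE /= distrC => ba Xb; rewrite distrC; apply: hda.
Qed.

Lemma closed_epsP (A : set V) :
  closed A <-> forall x, (forall e, 0 < e -> exists2 y, A y & `|y - x| < e) -> A x.
Proof.
split=> [cA x h|h x cx]; [apply: cA => B /nbhs_ballP[e e0 eB]|apply: h => e e0].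
  have [y Ay yx] := h _ e0; exists y; split=> //; apply: eB.
  by rewrite -ball_normE /= distrC.
have [y [Ay]] := cx _ (nbhsx_ballx x e e0).
by rewrite -ball_normE /= distrC => yx; exists y.
Qed.

Lemma open_epsP (A : set V) :
  open A <-> forall x, A x -> exists2 e, 0 < e & forall y, `|y - x| < e -> A y.
Proof.
rewrite openE; split=> h x Ax.
  have /nbhs_ballP[e e0 he] := h x Ax; exists e => // y yx; apply: he.
  by rewrite -ball_normE /= distrC.
have [e e0 he] := h x Ax; apply/nbhs_ballP; exists e => // y.
by rewrite -ball_normE /= distrC => yx; apply: he.
Qed.

(** Clopen subsets are described by tolerances, which is how they arise below. *)
Lemma connected_clopen (X Q : set V) : connected X -> Q `<=` X -> Q !=set0 ->
  (forall x, X x -> (forall e, 0 < e -> exists2 y, Q y & `|y - x| < e) -> Q x) ->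
  (forall x, Q x -> exists2 e, 0 < e & forall y, X y -> `|y - x| < e -> Q y) ->
  forall x, X x -> Q x.
Proof.
move=> cX QX Q0 clQ opQ x Xx; suff E : Q = X by rewrite E.
apply: cX Q0 _ _ => //; last first.
  exists (closure Q); first exact: closed_closure.
  apply/seteqP; split=> [y Qy|y [Xy cy]].
    by split; [exact: QX|exact: subset_closure].
  apply: clQ => // e e0; have [z [Qz]] := cy _ (nbhsx_ballx y e e0).
  by rewrite -ball_normE /= distrC => zy; exists z.
exists [set y | exists2 z, Q z & exists2 e, `|y - z| < e &
   forall w, X w -> `|w - z| < e -> Q w].
  apply/open_epsP => y [z Qz [e yz he]].
  exists (e - `|y - z|); first by rewrite subr_gt0.
  move=> w wy; exists z => //; exists e => //.
  rewrite (_ : w - z = (w - y) + (y - z)); last by rewrite addrA subrK.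
  by apply: le_lt_trans (ler_normD _ _) _; rewrite -ltrBrDr.
apply/seteqP; split=> [y Qy|y [Xy [z Qz [e yz he]]]]; last exact: he.
split; first exact: QX.
by have [e e0 he] := opQ _ Qy; exists y => //; exists e => //; rewrite subrr normr0.
Qed.

End Basics.

(** * Rational polyhedra *)

Section RationalPolyhedra.
Variables (R : realType) (n : nat).
Local Notation V := 'rV[R]_n.
Implicit Types (x y v : V) (sigma : set V) (c : 'cV[int]_n * int).

Definition affine_form x c : R := pairing x (map_mx intr c.1) + c.2%:~R.

Lemma affine_form_convex x y t c :
  affine_form (x + t *: (y - x)) c = (1 - t) * affine_form x c + t * affine_form y c.
Proof. by rewrite /affine_form pairingD pairingZ pairingB; ring. Qed.

Lemma affine_form_bound c : exists2 K, 0 < K &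
  forall x y, `|affine_form y c - affine_form x c| <= K * `|y - x|.
Proof.
have [K K0 hK] := pairing_bound (map_mx intr c.1 : 'cV[R]_n).
exists K => // x y; rewrite /affine_form.
rewrite (_ : _ - _ = pairing (y - x) (map_mx intr c.1)) ?hK//.
by rewrite pairingB; ring.
Qed.

Lemma affine_form_limit x sigma c :
  (forall e, 0 < e -> exists2 y, sigma y & `|y - x| < e) ->
  (forall y, sigma y -> 0 <= affine_form y c) -> 0 <= affine_form x c.
Proof.
move=> h pos; rewrite leNgt; apply/negP => neg.
have [K K0 hK] := affine_form_bound c.
have [|y sy yx] := h (- affine_form x c / K); first by rewrite divr_gt0 // oppr_gt0.
have := hK x y; rewrite leNgt => /negP; apply.
apply: lt_le_trans (_ : - affine_form x c <= _); first by rewrite mulrC -ltr_pdivlMr.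
apply: le_trans (ler_norm _); have := pos _ sy; lra.
Qed.

Lemma polyhedron_closed sigma : rational_polyhedron sigma -> closed sigma.
Proof.
move=> [eqs [ineqs ->]]; apply/closed_epsP => x h; split=> c cs; last first.
  apply: affine_form_limit h _ => y [_ /(_ c cs)] //.
apply/eqP; rewrite eq_le; apply/andP; split.
  have := @affine_form_limit x _ (- c.1, - c.2) h; rewrite /affine_form /= map_mxN.
  have pN y : pairing y (- map_mx intr c.1) = - pairing y (map_mx intr c.1 : 'cV[R]_n).
    by rewrite /pairing mulmxN mxE.
  rewrite rmorphN /= pN -opprD oppr_ge0; apply=> y [/(_ c cs) e _].
  by rewrite pN -opprD oppr_ge0 e.
by apply: affine_form_limit h _ => y [/(_ c cs) e _]; rewrite /affine_form e.
Qed.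

Lemma polyhedron_convex sigma x y t : rational_polyhedron sigma ->
  sigma x -> sigma y -> 0 <= t <= 1 -> sigma (x + t *: (y - x)).
Proof.
move=> [eqs [ineqs ->]] [ex ix] [ey iy] /andP[t0 t1]; split=> c cs.
  have := affine_form_convex x y t c; rewrite /affine_form => ->.
  by rewrite ex // ey // !mulr0 addr0.
have := affine_form_convex x y t c; rewrite /affine_form => ->.
by rewrite addr_ge0 // mulr_ge0 ?subr_ge0 ?ix ?iy.
Qed.

Lemma polyhedronI_ineq sigma c : rational_polyhedron sigma ->
  rational_polyhedron (sigma `&` [set x | 0 <= affine_form x c]).
Proof.
move=> [eqs [ineqs ->]]; exists eqs, (c :: ineqs); apply/seteqP; split=> x /=.
  by move=> [[ex ix] cx]; split=> // d; rewrite inE => /orP[/eqP ->|]; [exact: cx|exact: ix].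
move=> [ex ix]; split; first split=> // d ds; first by apply: ix; rewrite inE ds orbT.
by apply: ix; rewrite inE eqxx.
Qed.

Lemma ratr_denq (q : rat) : (denq q)%:~R * ratr q = (numq q)%:~R :> R.
Proof.
rewrite -!(ratr_int R) -rmorphM /= -[q in _ * q]divq_num_den mulrC divfK //.
by rewrite intr_eq0 denq_neq0.
Qed.

Lemma denq_gt0R (q : rat) : 0 < (denq q)%:~R :> R.
Proof. by rewrite ltr0z denq_gt0. Qed.

Lemma coord_formE k (q : rat) x :
  affine_form x (denq q *: delta_mx k 0, - numq q) = (denq q)%:~R * (x 0 k - ratr q).
Proof.
rewrite /affine_form /= map_mxZ map_delta_mx /= mulrBr ratr_denq rmorphN /=.
by congr (_ - _); rewrite /pairing -scalemxAr mxE -/(pairing _ _) pairing_delta.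
Qed.

Lemma polyhedronI_ge sigma k (q : rat) : rational_polyhedron sigma ->
  rational_polyhedron (sigma `&` [set x | ratr q <= x 0 k]).
Proof.
move=> /(polyhedronI_ineq (denq q *: delta_mx k 0, - numq q)); congr rational_polyhedron.
apply/seteqP; split=> x [sx] /=; rewrite coord_formE pmulr_rge0 ?denq_gt0R // subr_ge0;
  by split.
Qed.

Lemma polyhedronI_le sigma k (q : rat) : rational_polyhedron sigma ->
  rational_polyhedron (sigma `&` [set x | x 0 k <= ratr q]).
Proof.
move=> /(polyhedronI_ineq (- (denq q *: delta_mx k 0), - - numq q)); congr rational_polyhedron.
have E x : affine_form x (- (denq q *: delta_mx k 0), - - numq q) =
           - affine_form x (denq q *: delta_mx k 0, - numq q).
  by rewrite /affine_form /= map_mxN [in RHS]rmorphN /= opprK opprD opprK /pairing mulmxN mxE.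
apply/seteqP; split=> x [sx] /=;
  by rewrite E coord_formE oppr_ge0 pmulr_rle0 ?denq_gt0R // subr_le0; split.
Qed.

Lemma polyhedronI_coord sigma k (q : rat) : rational_polyhedron sigma ->
  rational_polyhedron (sigma `&` [set x | x 0 k = ratr q]).
Proof.
move=> /(polyhedronI_ge k q) /(polyhedronI_le k q); congr rational_polyhedron.
apply/seteqP; split=> x /= [].
  by move=> [sx h1] h2; split=> //; apply/eqP; rewrite eq_le h1 h2.
by move=> sx ->.
Qed.

Lemma polyhedron_point (q : 'rV[rat]_n) :
  rational_polyhedron [set (map_mx ratr q : V)].
Proof.
pose P (s : seq 'I_n) := [set x : V | forall k, k \in s -> x 0 k = ratr (q 0 k)].
suff h s : rational_polyhedron (P s).
  rewrite (_ : [set _] = P (enum 'I_n)) //; apply/seteqP; split=> x /=.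
    by move=> -> k _; rewrite mxE.
  by move=> h'; apply/rowP => k; rewrite mxE h' // mem_enum.
elim: s => [|k s IH].
  exists [::], [::]; apply/seteqP; split=> x //= _; by split.
have := polyhedronI_coord k (q 0 k) IH; congr rational_polyhedron.
apply/seteqP; split=> x /=.
  by move=> [h hk] j; rewrite inE => /orP[/eqP ->|/h].
move=> h; split; last by apply: h; rewrite inE eqxx.
by move=> j js; apply: h; rewrite inE js orbT.
Qed.

Lemma rational_row_dense m (z : 'rV[R]_m) e : 0 < e ->
  exists q : 'rV[rat]_m, `|map_mx ratr q - z| < e.
Proof.
move=> e0.
have h k : exists q : rat, `|ratr q - z 0 k| < e.
  have [|q] := @rat_in_itvoo R (z 0 k - e) (z 0 k + e); first by lra.
  by rewrite in_itv /= => /andP[h1 h2]; exists q; rewrite ltr_distl h1 h2.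
have [q hq] := choice h; exists (\row_k q k); apply: norm_lt_coord => // k.
by rewrite !mxE.
Qed.

Lemma mulmx_bound m (A : 'M[R]_(m, n)) :
  exists2 K, 0 < K & forall z : 'rV[R]_m, `|z *m A| <= K * `|z|.
Proof.
have [K K0 hK] : exists2 K, 0 < K & forall j, `|\sum_i `|A i j| | <= K.
  exists (1 + \sum_j `|\sum_i `|A i j| |); first by rewrite ltr_pwDl // sumr_ge0.
  by move=> j; rewrite (bigD1 j) //= addrCA lerDl addr_ge0 // sumr_ge0.
exists K => // z; apply: norm_le_coord; first by rewrite mulr_ge0 // ltW.
move=> j; rewrite mxE; apply: le_trans (ler_norm_sum _ _ _) _.
apply: le_trans (_ : (\sum_i `|A i j|) * `|z| <= _); last first.
  by rewrite ler_wpM2r //; apply: le_trans (hK j); apply: ler_norm.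
rewrite mulr_suml; apply: ler_sum => i _; rewrite normrM mulrC.
by rewrite ler_wpM2l // coord_le_norm.
Qed.

(** The constraints active at x0 form a rational linear system. Its real solutions
    are a rational point plus real combinations of rational kernel vectors, so
    rational solutions are dense among them; near x0 they satisfy the other
    constraints as well. *)
Lemma polyhedron_rational_dense sigma x0 e : rational_polyhedron sigma ->
  sigma x0 -> 0 < e ->
  exists q : 'rV[rat]_n, sigma (map_mx ratr q) /\ `|map_mx ratr q - x0| < e.
Proof.
move=> [eqs [ineqs sE]] sx0 e0.
have [ex ix] : (forall c, c \in eqs -> affine_form x0 c = 0) /\
  (forall c, c \in ineqs -> 0 <= affine_form x0 c) by move: sx0; rewrite sE.
pose act := eqs ++ [seq c <- ineqs | affine_form x0 c == 0].
have actP c : c \in act -> affine_form x0 c = 0.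
  by rewrite mem_cat => /orP[/ex //|]; rewrite mem_filter => /andP[/eqP].
pose m := size act.
pose A : 'M[rat]_(n, m) := \matrix_(i, j) ((nth (0, 0) act j).1 i 0)%:~R.
pose b : 'rV[rat]_m := \row_j (- (nth (0, 0) act j).2%:~R).
have solP x : x *m map_mx ratr A = map_mx ratr b <->
    forall c, c \in act -> affine_form x c = 0.
  have E (j : 'I_m) : (x *m map_mx ratr A) 0 j - (map_mx ratr b : 'rV[R]_m) 0 j =
      affine_form x (nth (0, 0) act j).
    rewrite /affine_form pairingE !mxE rmorphN /= ratr_int opprK; congr (_ + _).
    by apply: eq_bigr => i _; rewrite !mxE ratr_int.
  split=> [xA c /(nthP (0, 0))[j jm <-]|h].
    by rewrite -(E (Ordinal jm)) xA subrr.
  apply/rowP => j; apply/eqP; rewrite -subr_eq0 E; apply/eqP; apply: h.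
  by rewrite mem_nth.
have x0A : x0 *m map_mx ratr A = map_mx ratr b by apply/solP.
have bA : (b <= A)%MS by rewrite -(map_submx (@ratr R)) -x0A submxMl.
pose p := b *m pinvmx A; have pA : p *m A = b by rewrite mulmxKpV.
have : (x0 - map_mx ratr p <= kermx (map_mx ratr A : 'M[R]__))%MS.
  by apply/sub_kermxP; rewrite mulmxBl x0A -map_mxM pA subrr.
rewrite -map_kermx => /submxP[z hz].
have [d d0 hd] : exists2 d, 0 < d & forall c, c \in ineqs ->
    (affine_form x0 c = 0 \/ forall y, `|y - x0| < d -> 0 <= affine_form y c).
  apply: seq_eps => [c d d' [h|h] _ d'd|c cs]; first by left.
    by right=> y yx; apply: h; apply: lt_le_trans yx d'd.
  have [->|c0] := eqVneq (affine_form x0 c) 0; first by exists 1 => //; left.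
  have cp : 0 < affine_form x0 c by rewrite lt_neqAle eq_sym c0 ix.
  have [K K0 hK] := affine_form_bound c.
  exists (affine_form x0 c / K); first by rewrite divr_gt0.
  right=> y; rewrite ltr_pdivlMr // mulrC => yx.
  by have := le_lt_trans (hK x0 y) yx; rewrite ltr_norml => /andP[+ _]; lra.
have [K K0 hK] := mulmx_bound (map_mx ratr (kermx A) : 'M[R]__).
have m0 : 0 < Num.min d e by rewrite lt_min d0 e0.
have [z' hz'] := rational_row_dense z (divr_gt0 m0 K0).
exists (p + z' *m kermx A).
have close : `|map_mx ratr (p + z' *m kermx A) - x0| < Num.min d e.
  rewrite map_mxD (map_mxM _ z') /= (_ : _ - _ = (map_mx ratr z' - z) *m map_mx ratr (kermx A)).
    by apply: le_lt_trans (hK _) _; rewrite mulrC -ltr_pdivlMr.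
  by rewrite mulmxBl -hz opprB [RHS]addrCA addrA.
have act0 : forall c, c \in act -> affine_form (map_mx ratr (p + z' *m kermx A)) c = 0.
  apply/solP; rewrite -map_mxM mulmxDl pA -mulmxA mulmx_ker mulmx0 addr0 //.
split; last by apply: lt_le_trans close _; rewrite ge_min lexx orbT.
rewrite sE; split=> c cs; first by apply: act0; rewrite mem_cat cs.
have [c0|h] := hd c cs.
  by have := act0 c; rewrite /affine_form => -> //; rewrite mem_cat mem_filter c0 eqxx cs orbT.
by apply: h; apply: lt_le_trans close _; rewrite ge_min lexx.
Qed.

Lemma polyhedron_point_rational v : rational_polyhedron [set v] ->
  rational_points v.
Proof.
move=> pv; have [q [qv _]] := polyhedron_rational_dense pv erefl ltr01.
by exists q; rewrite qv.
Qed.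

End RationalPolyhedra.

(** * Primitive integer vectors *)

Section Primitive.
Variables (R : realType) (n : nat).
Implicit Types (u w z : 'rV[int]_n).

Definition prim u : Prop := forall w (k : nat), u = w *+ k -> k = 1%N.

Lemma prim_neq0 u : prim u -> u != 0.
Proof. by move=> pu; apply/eqP => u0; have := pu 0 2%N; rewrite mul0rn => /(_ u0). Qed.

Lemma primN u : prim u -> prim (- u).
Proof. by move=> pu w k h; apply: (pu (- w)); rewrite mulNrn -h opprK. Qed.

Lemma latv0 : latv R (0 : 'rV[int]_n) = 0.
Proof. by apply/rowP => j; rewrite !mxE. Qed.

Lemma latvN u : latv R (- u) = - latv R u.
Proof. by apply/rowP => j; rewrite !mxE rmorphN. Qed.

Lemma latvMn u k : latv R (u *+ k) = k%:R *: latv R u.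
Proof.
by apply/rowP => j; rewrite !mxE mulmxnE rmorphMn /= mulr_natl.
Qed.

Lemma latv_inj : injective (@latv R n).
Proof.
move=> u w /rowP h; apply/rowP => j; have := h j.
by rewrite !mxE => /eqP; rewrite eqr_int => /eqP.
Qed.

Lemma latv_eq0 u : (latv R u == 0) = (u == 0).
Proof. by apply/eqP/eqP => [|->]; rewrite -?latv0 // => /latv_inj. Qed.

Lemma row_neq0 (T : zmodType) (x : 'rV[T]_n) : x != 0 -> exists j, x 0 j != 0.
Proof.
move=> x0; apply: contrapT => h; move/eqP: x0; apply; apply/rowP => j; rewrite mxE.
by apply/eqP; apply: contrapT => /negP xj; apply: h; exists j.
Qed.

Lemma primitive_multiple z : z != 0 -> exists u (k : nat), prim u /\ z = u *+ k.
Proof.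
move=> z0; have [j zj] := row_neq0 z0.
pose P k := `[< exists w, z = w *+ k >].
have P1 : exists k, P k by exists 1%N; apply/asboolP; exists z.
have Pb k : P k -> (k <= absz (z 0%R j))%N.
  move=> /asboolP[w zw]; have := zj; rewrite {1 2}zw mulmxnE -mulr_natr abszM.
  by move=> h; rewrite natz absz_nat leq_pmull // absz_gt0; apply: contraNneq h => ->; rewrite mul0r.
have [k /asboolP[w zw] kmax] := ex_maxnP P1 Pb.
have k0 : (0 < k)%N by case: k zw {kmax} => // zw; rewrite zw mulr0n eqxx in z0.
exists w, k; split => // w' l wE.
have l0 : l != 0%N.
  by apply: contraNneq z0 => l0; rewrite zw wE l0 mulr0n mul0rn.
have : (l * k <= k)%N by apply: kmax; apply/asboolP; exists w'; rewrite mulrnA -wE.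
by rewrite -{2}[k]mul1n leq_pmul2r //; case: l l0 {wE} => [|[|l]].
Qed.

Lemma clear_denominators (q : 'rV[rat]_n) :
  exists (z : 'rV[int]_n) (d : rat), 0 < d /\ q = d *: map_mx intr z.
Proof.
pose D : int := \prod_j denq (q 0 j).
have D0 : 0 < D by apply: prodr_gt0 => j _; exact: denq_gt0.
exists (\row_j (numq (q 0 j) * \prod_(i | i != j) denq (q 0 i))), (D%:~R^-1).
split; first by rewrite invr_gt0 ltr0z.
apply/rowP => j; rewrite !mxE; apply: (canRL (mulKf _)); first by rewrite intr_eq0 gt_eqF.
rewrite -[q 0 j in LHS]divq_num_den intrM mulrA /D (bigD1 j) //= intrM.
rewrite [X in X / _](_ : _ = (numq (q 0 j))%:~R * (\prod_(i | i != j) denq (q 0 i))%:~R * (denq (q 0 j))%:~R).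
  by rewrite mulfK // intr_eq0 denq_neq0.
by ring.
Qed.

Lemma primitive_of_rational (q : 'rV[rat]_n) : q != 0 ->
  exists u (r : rat), [/\ prim u, 0 < r & q = r *: map_mx intr u].
Proof.
move=> q0; have [z [d [d0 qE]]] := clear_denominators q.
have z0 : z != 0.
  apply: contraNneq q0 => z0; rewrite qE z0; apply/eqP/rowP => j.
  by rewrite !mxE mulr0.
have [u [k [pu zE]]] := primitive_multiple z0.
have k0 : (0 < k)%N by case: k zE => // zE; rewrite zE mulr0n eqxx in z0.
exists u, (d * k%:R); split=> //; first by rewrite mulr_gt0 // ltr0n.
rewrite qE zE; apply/rowP => j; rewrite !mxE mulmxnE rmorphMn /= -mulrA; congr (_ * _).
by rewrite mulr_natl.
Qed.

(** Comparing coordinates shows that [r] is rational; in lowest terms its denominator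
    divides [w] and its numerator divides [u]. *)
Lemma prim_uniq u w (r : R) : prim u -> prim w -> 0 < r ->
  latv R u = r *: latv R w -> u = w.
Proof.
move=> pu pw r0 uw; have [j wj] := row_neq0 (prim_neq0 pw).
have E i : (u 0 i)%:~R = r * (w 0 i)%:~R :> R by move/rowP: uw => /(_ i); rewrite !mxE.
have [a [b [a0 [b0 rE]]]] : exists a b : nat, [/\ (0 < a)%N, (0 < b)%N & r = a%:R / b%:R].
  exists (absz (u 0 j)), (absz (w 0 j)).
  have uj : u 0 j != 0.
    by rewrite -(intr_eq0 R) E mulf_eq0 gt_eqF //= intr_eq0.
  rewrite !absz_gt0 wj uj; split=> //.
  rewrite !natr_absz !intr_norm E normrM mulfK; first by rewrite gtr0_norm.
  by rewrite normr_eq0 intr_eq0 wj.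
have g0 : (0 < gcdn a b)%N by rewrite gcdn_gt0 a0.
pose a1 := (a %/ gcdn a b)%N; pose b1 := (b %/ gcdn a b)%N.
have aE : a = (a1 * gcdn a b)%N by rewrite divnK // dvdn_gcdl.
have bE : b = (b1 * gcdn a b)%N by rewrite divnK // dvdn_gcdr.
have cop : coprime a1 b1.
  rewrite /coprime -(eqn_pmul2r g0) mul1n muln_gcdl -aE -bE //.
have b10 : (0 < b1)%N by rewrite lt0n; apply: contraTneq b0 => h; rewrite bE h.
have a10 : (0 < a1)%N by rewrite lt0n; apply: contraTneq a0 => h; rewrite aE h.
have F i : (b1%:Z * u 0 i = a1%:Z * w 0 i)%R.
  have ab : b1%:R * a%:R = a1%:R * b%:R :> R.
    by rewrite -!natrM [in LHS]aE [in RHS]bE mulnCA.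
  apply/eqP; rewrite -(eqr_int R) !intrM E rE; apply/eqP.
  rewrite [LHS](_ : _ = (b1%:R * a%:R) / b%:R * (w 0 i)%:~R); last by rewrite !mulrA.
  by rewrite ab mulfK // pnatr_eq0 -lt0n.
have dv (c d : nat) (x y : 'rV[int]_n) : coprime c d -> prim y ->
    (forall i, c%:Z * x 0 i = d%:Z * y 0 i) -> c = 1%N.
  move=> cd py h; pose y' := \row_i divz (y 0 i) c%:Z.
  apply: (py y'); apply/rowP => i; rewrite mulmxnE !mxE -mulr_natr natz divzK //.
  rewrite -(@Gauss_dvdzr _ d%:Z) // -h dvdz_mulr //.
have b11 : b1 = 1%N by apply: (dv b1 a1 u w) => //; rewrite coprime_sym.
have a11 : a1 = 1%N by apply: (dv a1 b1 w u) => // i; rewrite F.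
by apply/rowP => i; have := F i; rewrite a11 b11 !mul1r.
Qed.

End Primitive.

(** * Cells of a polyhedral structure on a one-dimensional space *)

Section Cells.
Variables (R : realType) (n : nat).
Local Notation V := 'rV[R]_n.
Implicit Types (x y z v d : V) (A B sigma tau e : set V) (Pi : set (set V)).

(** Recording segments, not limits of directions, gives the tangent cone of a finite
    union of polyhedra in a form that can be intersected with cells. *)
Definition germ A v d : Prop :=
  exists2 t : R, 0 < t & forall s, 0 <= s <= t -> A (v + s *: d).

Lemma germ_at A v d : germ A v d -> A v.
Proof. by move=> [t t0 /(_ 0)]; rewrite scale0r addr0 lexx ltW //; apply. Qed.

Lemma germS A B v d : A `<=` B -> germ A v d -> germ B v d.
Proof. by move=> AB [t t0 h]; exists t => // s st; exact/AB/h. Qed.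

Lemma germI A B v d : germ A v d -> germ B v d -> germ (A `&` B) v d.
Proof.
move=> [t t0 h] [t' t'0 h']; exists (Num.min t t'); first by rewrite lt_min t0.
move=> s /andP[s0]; rewrite le_min => /andP[st st'].
by split; [apply: h|apply: h']; rewrite s0.
Qed.

Lemma germ_convex sigma v d t : rational_polyhedron sigma -> 0 < t ->
  sigma v -> sigma (v + t *: d) -> germ sigma v d.
Proof.
move=> ps t0 sv svt; exists t => // s /andP[s0 st].
have := @polyhedron_convex _ _ _ _ _ (s / t) ps sv svt.
rewrite [v + t *: d - v]addrC addKr scalerA divfK ?gt_eqF //; apply.
by rewrite divr_ge0 ?(ltW t0) //= ler_pdivrMr // mul1r.
Qed.

(** If no cell contained an initial segment then, cells being closed and convex,
    each would miss all points of the ray near its origin. *)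
Lemma germ_cover Pi v d : finite_set Pi ->
  (forall sigma, Pi sigma -> rational_polyhedron sigma) ->
  germ (\bigcup_(sigma in Pi) sigma) v d -> exists2 sigma, Pi sigma & germ sigma v d.
Proof.
move=> fPi pPi [t t0 cov]; apply: contrapT => none.
have [e e0 he] : exists2 e, 0 < e &
    forall sigma, Pi sigma -> forall s, 0 < s <= e -> ~ sigma (v + s *: d).
  apply: set_eps fPi _ _ => [sigma e e' h e'0 ee' s /andP[s0 se]|sigma Ps].
    by apply: h; rewrite s0 (le_trans se).
  apply: contrapT => hn; apply: none; exists sigma => //.
  have h (r : R) : 0 < r -> exists2 s, 0 < s <= r & sigma (v + s *: d).
    move=> r0; apply: contrapT => hs; apply: hn; exists r => // s se ss.
    by apply: hs; exists s.
  have sv : sigma v.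
    have /closed_epsP := polyhedron_closed (pPi _ Ps); apply => e e0.
    have D0 : 0 < 1 + `|d| by rewrite ltr_pwDl.
    have [s /andP[s0 se] ss] := h _ (divr_gt0 e0 D0).
    exists (v + s *: d) => //; rewrite addrC addKr normrZ gtr0_norm //.
    move: se; rewrite ler_pdivlMr //; apply: lt_le_trans.
    by rewrite ltr_pM2l // ltrDr.
  have [s /andP[s0 _] ss] := h _ ltr01.
  exact: germ_convex (pPi _ Ps) s0 sv ss.
have m0 : 0 < Num.min e t by rewrite lt_min e0.
have [|sigma Ps ss] := cov (Num.min e t); first by rewrite ltW //= ge_min lexx orbT.
by apply: (he _ Ps (Num.min e t)) ss; rewrite m0 ge_min lexx.
Qed.

Definition collinear A : Prop :=
  forall x y z, A x -> A y -> A z -> x <> y -> exists t, z = x + t *: (y - x).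

Lemma subcollinear A B : A `<=` B -> collinear B -> collinear A.
Proof. by move=> AB cB x y z /AB Bx /AB By /AB Bz; exact: cB. Qed.

Lemma lin_span_sub sigma x y : sigma x -> sigma y -> lin_span sigma (y - x).
Proof.
move=> sx sy; exists 1%N, (fun=> 1), (fun=> y), (fun=> x); split=> //.
by rewrite big_ord1 scale1r.
Qed.

Lemma has_dim1_collinear sigma : has_dim sigma 1 -> collinear sigma.
Proof.
move=> [U [UE dU]] x y z sx sy sz xy.
have mU w w' : sigma w -> sigma w' -> w' - w \in U.
  by move=> sw sw'; have : [set v | v \in U] (w' - w) by rewrite UE; exact: lin_span_sub.
have yx0 : y - x != 0 by rewrite subr_eq0; apply/eqP => h; apply: xy.
have : z - x \in <[y - x]>%VS.
  rewrite (_ : <[y - x]>%VS = U) ?mU //; apply/eqP.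
  by rewrite eqEdim dim_vline yx0 dU /= -memvE mU.
by move=> /vlineP[t zx]; exists t; rewrite -zx addrC subrK.
Qed.

Lemma has_dim1_two sigma : has_dim sigma 1 -> exists x y, [/\ sigma x, sigma y & x <> y].
Proof.
move=> [U [UE dU]]; apply: contrapT => h.
have : lin_span sigma (vpick U) by rewrite -UE /=; exact: memv_pick.
have v0 : vpick U != 0 by rewrite vpick0 -dimv_eq0 dU.
move=> -[k [a [x [y [xy E]]]]].
move: v0; rewrite E big1 ?eqxx // => i _; have [sx sy] := xy i.
rewrite (_ : x i = y i) ?subrr ?scaler0 //; apply: contrapT => ne.
by apply: h; exists (x i), (y i).
Qed.

Lemma lin_span_collinear sigma x y : collinear sigma -> sigma x -> sigma y -> x <> y ->
  lin_span sigma = [set v | exists t, v = t *: (y - x)].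
Proof.
move=> cs sx sy xy; apply/seteqP; split=> v.
  move=> [k [a [p [q [pq ->]]]]].
  have h i : exists t, p i - q i = t *: (y - x).
    have [[t pE] [t' qE]] := (cs x y (p i) sx sy (pq i).1 xy, cs x y (q i) sx sy (pq i).2 xy).
    by exists (t - t'); rewrite pE qE scalerBl opprD addrACA subrr add0r.
  have [t tE] := choice h; exists (\sum_i a i * t i); rewrite scaler_suml.
  by apply: eq_bigr => i _; rewrite tE scalerA.
move=> [t ->]; exists 1%N, (fun=> t), (fun=> y), (fun=> x); split=> //.
by rewrite big_ord1.
Qed.

Lemma collinear_has_dim1 sigma x y : collinear sigma -> sigma x -> sigma y -> x <> y ->
  has_dim sigma 1.
Proof.
move=> cs sx sy xy; exists <[y - x]>%VS; split.
  rewrite (lin_span_collinear cs sx sy xy); apply/seteqP; split=> v /=.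
    by move=> /vlineP[t ->]; exists t.
  by move=> [t ->]; apply/vlineP; exists t.
by rewrite dim_vline subr_eq0; case: eqP => // /esym.
Qed.

Lemma has_dim0_point v : has_dim [set v] 0.
Proof.
exists 0%VS; split; last exact: dimv0.
apply/seteqP; split=> u /=.
  rewrite memv0 => /eqP ->; exists 0%N, (fun=> 0), (fun=> v), (fun=> v).
  by rewrite big_ord0; split=> // -[].
move=> [k [a [p [q [pq ->]]]]]; rewrite memv0 big1 // => i _.
by have [-> ->] := pq i; rewrite subrr scaler0.
Qed.

Lemma maximal_cell Pi sigma : finite_set Pi -> Pi sigma ->
  exists tau, [/\ Pi tau, sigma `<=` tau &
    forall tau', Pi tau' -> tau `<=` tau' -> tau' = tau].
Proof.
move=> /finite_seqP[s sE]; rewrite {}sE /= => ss.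
suff [tau [ts st mt]] : exists tau, [/\ tau = sigma \/ tau \in s, sigma `<=` tau &
    forall tau', tau' \in s -> tau `<=` tau' -> tau' = tau].
  by exists tau; split=> //; case: ts => [->|].
elim: s {ss} => [|a s [tau [ts st mt]]]; first by exists sigma; split=> //; left.
have [ta|nta] := pselect (tau `<=` a); last first.
  exists tau; split=> //; first by case: ts => [|ts]; [left|right; rewrite inE ts orbT].
  by move=> tau'; rewrite inE => /orP[/eqP -> /nta|/mt].
exists a; split; [by right; rewrite inE eqxx|exact: subset_trans ta|].
move=> tau'; rewrite inE => /orP[/eqP ->//|/mt h] aa.
by have e := h (subset_trans ta aa); apply/seteqP; split=> //; rewrite e.
Qed.

End Cells.

Section Structures.
Variables (R : realType) (n : nat) (X : set 'rV[R]_n).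
Hypothesis X1 : one_dim_polyhedral_space X.
Local Notation V := 'rV[R]_n.
Implicit Types (x y z v d : V) (A B sigma tau e : set V) (Pi : set (set V)).

Lemma structure_finite Pi : polyhedral_structure X Pi -> finite_set Pi.
Proof. by case=> -[]. Qed.

Lemma cell_polyhedron Pi sigma : polyhedral_structure X Pi -> Pi sigma ->
  rational_polyhedron sigma.
Proof. by case=> -[_ h _ _] _ /h[]. Qed.

Lemma cell_sub Pi sigma : polyhedral_structure X Pi -> Pi sigma -> sigma `<=` X.
Proof. by case=> _ <- Ps x sx; exists sigma. Qed.

Lemma space_germ Pi v d : polyhedral_structure X Pi -> germ X v d ->
  exists2 sigma, Pi sigma & germ sigma v d.
Proof.
move=> PS gX; apply: germ_cover; [exact: structure_finite PS| |by case: PS => _ ->].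
by move=> sigma; exact: cell_polyhedron.
Qed.

Lemma space_closed : closed X.
Proof.
have [Pi PS _] := X1; have := PS => -[[fPi _ _ _] <-].
by apply: closed_bigcup => // sigma Ps; exact: (polyhedron_closed (cell_polyhedron PS Ps)).
Qed.

Lemma space_direction x : X x -> exists d, d != 0 /\ germ X x d.
Proof.
move=> Xx; have [Pi PS mx] := X1.
have [sigma Ps sx] : (\bigcup_(sigma in Pi) sigma) x by case: PS => _ ->.
have [tau [Pt st mt]] := maximal_cell (structure_finite PS) Ps.
have d1 := mx _ Pt mt; have [y [z [ty tz yz]]] := has_dim1_two d1.
have pt := cell_polyhedron PS Pt.
have [w tw wx] : exists2 w, tau w & w <> x.
  have [yx|] := eqVneq y x; last by move=> /eqP ?; exists y.
  by exists z => // zx; apply: yz; rewrite yx zx.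
exists (w - x); split; first by rewrite subr_eq0; apply/eqP.
apply: germS (cell_sub PS Pt) _; apply: germ_convex ltr01 _ _ => //; first exact: st.
by rewrite scale1r addrC subrK.
Qed.

Lemma pigeonhole (T : eqType) (A : set T) (f : nat -> T) : finite_set A ->
  (forall k, A (f k)) -> exists i j, i <> j /\ f i = f j.
Proof.
move=> /finite_seqP[s ->] fs; apply: contrapT => h.
have inj : injective f by move=> i j e; apply: contrapT => ij; apply: h; exists i, j.
have sub : {subset [seq f i | i <- iota 0 (size s).+1] <= s}.
  by move=> z /mapP[i _ ->]; exact: fs.
by have := uniq_leq_size _ sub; rewrite map_inj_uniq // iota_uniq size_map size_iota ltnn => /(_ isT).
Qed.

(** A cell through two points a and b and a third point c off their line would
    contain infinitely many segments issued from a, two of them inside the same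
    one-dimensional cell. *)
Lemma convex_collinear sigma : rational_polyhedron sigma -> sigma `<=` X ->
  collinear sigma.
Proof.
move=> ps sX a b c sa sb sc ab; have [Pi PS mx] := X1.
apply: contrapT => h.
pose r (k : nat) : R := k.+1%:R^-1.
pose w k := c + r k *: (b - c).
have r01 k : 0 <= r k <= 1.
  by rewrite invr_ge0 ler0n /= invf_le1 ?ler1n // ltr0n.
have sw k : sigma (w k) by apply: polyhedron_convex.
have cell k : exists tau, [/\ Pi tau, collinear tau & germ tau a (w k - a)].
  have [|tau Pt gt] := @space_germ Pi a (w k - a) PS.
    apply: germS sX _; apply: germ_convex ltr01 _ _ => //.
    by rewrite scale1r addrC subrK.
  have [tau' [Pt' tt' mt']] := maximal_cell (structure_finite PS) Pt.
  exists tau; split => //; apply: subcollinear tt' _.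
  exact/has_dim1_collinear/mx.
have [tau htau] := choice cell.
have [i [j [ij tij]]] := pigeonhole (structure_finite PS) (fun k => let: And3 p _ _ := htau k in p).
have [Pt ct gi] := htau i; have [_ _ gj] := htau j; rewrite -tij in gj.
have ta := germ_at gi; have [ti ti0 hi] := gi; have [tj tj0 hj] := gj.
have ca : c - a != 0.
  rewrite subr_eq0; apply/eqP => ca; apply: h; exists 0.
  by rewrite scale0r addr0.
have wa k : w k <> a.
  move=> wa; apply: h.
  have rk : r k != 1.
    apply/eqP => rk; apply: ab; rewrite -wa /w rk scale1r addrC subrK //.
  exists (- r k / (1 - r k)); have r1 : 1 - r k != 0 by rewrite subr_eq0 eq_sym.
  apply/rowP => l; move/rowP: wa => /(_ l); rewrite /w !mxE => wal.
  rewrite -{1 2}wal; field; exact: r1.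
have [t E] : exists t, a + tj *: (w j - a) = a + t *: (a + ti *: (w i - a) - a).
  apply: ct => //; [by apply: hi; rewrite lexx ltW|by apply: hj; rewrite lexx ltW|].
  move=> /(congr1 (fun z => z - a)); rewrite subrr addrC addKr => /esym/eqP.
  by rewrite scaler_eq0 gt_eqF //= subr_eq0 => /eqP /wa.
move: E; rewrite [LHS]addrC [RHS]addrC => /addIr; rewrite [a + ti *: _]addrC addrK scalerA => E.
pose q := t * ti / tj.
have {}E : w j - a = q *: (w i - a).
  by apply: (scalerI (lt0r_neq0 tj0)); rewrite E scalerA /q [tj * _]mulrC divfK // lt0r_neq0.
have wE k : w k - a = (1 - r k) *: (c - a) + r k *: (b - a).
  rewrite /w !scalerBr !scalerBl !scale1r.
  by apply/rowP => l; rewrite !mxE; ring.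
rewrite !wE in E.
have F : (1 - r j - q * (1 - r i)) *: (c - a) = (q * r i - r j) *: (b - a).
  move/rowP: E => E; apply/rowP => l; have := E l; rewrite !mxE => El.
  have : forall u v w z : R, u + v = w + z -> u - w = z - v by move=> ? ? ? ?; lra.
  by rewrite !mulrDr => El'; rewrite !mulrBl; lra.
have [k0|k0] := eqVneq (1 - r j - q * (1 - r i)) 0; last first.
  apply: h; exists ((q * r i - r j) / (1 - r j - q * (1 - r i))).
  by rewrite mulrC -scalerA -F scalerA mulVf // scale1r addrC subrK.
have l0 : q * r i - r j = 0.
  move/eqP: F; rewrite k0 scale0r eq_sym scaler_eq0 => /orP[/eqP //|].
  by rewrite subr_eq0 => /eqP ba; case: ab.
have q1 : q = 1 by lra.
apply: ij; have : r i = r j by move: l0; rewrite q1 mul1r => /eqP; rewrite subr_eq0 => /eqP.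
by move=> /invr_inj/eqP; rewrite eqr_nat => /eqP [].
Qed.

Lemma cell_collinear Pi sigma : polyhedral_structure X Pi -> Pi sigma ->
  collinear sigma.
Proof. by move=> PS Ps; apply: convex_collinear; [exact: cell_polyhedron Ps|exact: cell_sub Ps]. Qed.

Lemma cell_edge Pi sigma x y : polyhedral_structure X Pi -> Pi sigma ->
  sigma x -> sigma y -> x <> y -> edges Pi sigma.
Proof. by move=> PS Ps sx sy xy; split=> //; apply: collinear_has_dim1 sx sy xy; exact: cell_collinear Ps. Qed.

Lemma space_edge Pi x : polyhedral_structure X Pi -> X x ->
  exists2 e, edges Pi e & e x.
Proof.
move=> PS Xx; have [d [d0 gd]] := space_direction Xx.
have [sigma Ps gs] := space_germ PS gd; have sx := germ_at gs.
exists sigma => //; have [t t0 h] := gs.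
apply: (cell_edge PS Ps sx (h t _)); first by rewrite lexx ltW.
move=> /(congr1 (fun z => z - x)); rewrite subrr addrC addKr => /esym/eqP.
by rewrite scaler_eq0 (negPf d0) gt_eqF.
Qed.

(** ** Directions of edges *)

(** The coordinate [k] parametrizes the line of direction [u] that carries [e]; a
    coordinate of the ambient space is an affine form with integer coefficients, which
    is what rational polyhedra are made of. *)
Definition edge_direction e (k : 'I_n) (u : 'rV[int]_n) : Prop :=
  [/\ prim u, 0 < u 0 k & forall x y, e x -> e y ->
    y = x + ((y 0 k - x 0 k) / (u 0 k)%:~R) *: latv R u].

(** Two distinct rational points of [e] span a rational line, and the sign of the
    direction is adjusted to make some coordinate positive. *)
Lemma edge_directionP e x y : rational_polyhedron e -> collinear e ->
  e x -> e y -> x <> y -> exists k u, edge_direction e k u.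
Proof.
move=> pe ce ex ey xy.
have D0 : 0 < `|y - x| / 2 by rewrite divr_gt0 // normr_gt0 subr_eq0; apply/eqP => /esym.
have [q1 [eq1 h1]] := polyhedron_rational_dense pe ex D0.
have [q2 [eq2 h2]] := polyhedron_rational_dense pe ey D0.
have q12 : q2 - q1 != 0.
  rewrite subr_eq0; apply/eqP => q21.
  suff : `|y - x| < `|y - x| by rewrite ltxx.
  rewrite {1}(_ : y - x = (map_mx ratr q1 - x) - (map_mx ratr q2 - y)).
    by apply: le_lt_trans (ler_normB _ _) _; lra.
  by rewrite q21; apply/rowP => l; rewrite !mxE; ring.
have [u [r [pu r0 E]]] := primitive_of_rational q12.
have EV : map_mx ratr q2 - map_mx ratr q1 = ratr r *: latv R u.
  have -> : map_mx ratr q2 - map_mx ratr q1 = map_mx ratr (q2 - q1) :> V by rewrite map_mxB.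
  by rewrite E; apply/rowP => l; rewrite !mxE rmorphM /= ratr_int.
have rR : 0 < ratr r :> R by rewrite ltr0q.
have q12' : map_mx ratr q1 <> map_mx ratr q2 :> V.
  move=> h; move: EV; rewrite h subrr => /esym/eqP.
  by rewrite scaler_eq0 gt_eqF //= latv_eq0 (negPf (prim_neq0 pu)).
have key a b : e a -> e b -> exists t, b = a + t *: latv R u.
  move=> ea eb; have [[t aE] [t' bE]] := (ce _ _ _ eq1 eq2 ea q12', ce _ _ _ eq1 eq2 eb q12').
  exists ((t' - t) * ratr r); rewrite -scalerA -EV scalerBl {1}aE {1}bE.
  by rewrite -addrA; congr (_ + _); rewrite addrC subrK.
have fin w k : prim w -> 0 < w 0 k -> (forall a b, e a -> e b -> exists t, b = a + t *: latv R w) ->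
    edge_direction e k w.
  move=> pw wk kw; split=> // a b ea eb; have [t bE] := kw _ _ ea eb.
  rewrite [LHS]bE; congr (_ + _ *: _); rewrite bE !mxE [_ + _ - _]addrC addKr mulfK //.
  by rewrite intr_eq0 gt_eqF.
have [k uk] := row_neq0 (prim_neq0 pu); case: (ltgtP (u 0 k) 0) uk => // uk _.
  exists k, (- u); apply: fin; [exact: primN|by rewrite mxE oppr_gt0|].
  by move=> a b ea eb; have [t ->] := key _ _ ea eb; exists (- t); rewrite latvN scalerN scaleNr opprK.
by exists k, u; exact: fin.
Qed.

Lemma cell_direction Pi e : polyhedral_structure X Pi -> edges Pi e ->
  exists k u, edge_direction e k u.
Proof.
move=> PS [Pe d1]; have [x [y [ex ey xy]]] := has_dim1_two d1.
apply: edge_directionP ex ey xy; [exact: cell_polyhedron Pe|exact: cell_collinear Pe].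
Qed.

End Structures.

(** * Tangent directions, weights and the Laplacian *)

Section Local.
Variables (R : realType) (n : nat) (X : set 'rV[R]_n).
Variables (Pi0 : set (set 'rV[R]_n)) (w0 : set 'rV[R]_n -> rat).
Hypothesis X1 : one_dim_polyhedral_space X.
Hypothesis balX : balanced X Pi0 w0.
Local Notation V := 'rV[R]_n.
Local Notation "'lat' u" := (latv R u) (at level 10, u at level 8).
Implicit Types (x y z v d : V) (A B sigma tau e : set V) (Pi : set (set V)).
Implicit Types (u : 'rV[int]_n) (phi f g : V -> R).

Definition dir v : set 'rV[int]_n := [set u | prim u /\ germ X v (lat u)].

Definition wgt v u : rat :=
  xget 0 [set q | exists2 e, edges Pi0 e & germ e v (lat u) /\ q = w0 e].

Definition has_slope phi v u (m : R) : Prop :=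
  exists2 t, 0 < t & forall s, 0 <= s <= t -> phi (v + s *: lat u) = phi v + s * m.

Definition slope phi v u : R := xget 0 [set m | has_slope phi v u m].

(** The mass of the Monge-Ampere measure at [v], without choosing a structure on which
    [phi] is piecewise affine. *)
Definition laplacian phi v : R := \sum_(u \in dir v) ratr (wgt v u) * slope phi v u.

Lemma structure0 : polyhedral_structure X Pi0.
Proof. by case: balX. Qed.

Lemma cell_vertex_face Pi sigma v : polyhedral_structure X Pi -> Pi sigma ->
  Pi [set v] -> sigma v -> face sigma [set v].
Proof.
move=> [[_ _ _ h] _] Ps Pv sv; have [s0|[+ _]] := h _ _ Ps Pv.
  by have : (sigma `&` [set v]) v by []; rewrite s0.
rewrite (_ : sigma `&` [set v] = [set v]) //; apply/seteqP; split=> x /=; first by case.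
by move=> ->.
Qed.

(** The affine function that defines the face vanishes at [v] and is nonnegative on both
    sides of it, hence vanishes along [d]. *)
Lemma face_extreme sigma v d s r : face sigma [set v] -> 0 < s -> 0 < r ->
  d != 0 -> sigma (v + s *: d) -> sigma (v - r *: d) -> False.
Proof.
move=> [_ [f [b [pos E]]]] s0 r0 d0 s1 s2.
have fv : pairing v f + b = 0 by have : [set v] v by []; rewrite E => -[].
have := pos _ s1; have := pos _ s2; rewrite pairingB pairingD !pairingZ => h1 h2.
have fd : pairing d f = 0.
  apply/eqP; rewrite eq_le -(pmulr_rle0 _ r0) -(pmulr_rge0 _ s0); lra.
have : [set v] (v + s *: d) by rewrite E; split=> //=; rewrite pairingD pairingZ fd; lra.
move=> /= /(congr1 (fun z => z - v)); rewrite subrr addrC addKr => /eqP.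
by rewrite scaler_eq0 (negPf d0) gt_eqF.
Qed.

Lemma face_two sigma tau x y : collinear sigma -> face sigma tau -> tau x -> tau y ->
  x <> y -> tau = sigma.
Proof.
move=> cs [_ [f [b [_ ->]]]] [sx fx] [sy fy] xy; apply/seteqP; split=> [z []//|z sz].
split=> //=; have [t ->] := cs _ _ _ sx sy sz xy.
rewrite /= in fx fy; rewrite pairingD pairingZ pairingB.
have -> : pairing y f = pairing x f by lra.
by rewrite subrr mulr0 addr0.
Qed.

Lemma germ_two A v d : d != 0 -> germ A v d -> exists x y, [/\ A x, A y & x <> y].
Proof.
move=> d0 gA; have Av := germ_at gA; have [t t0 h] := gA.
exists v, (v + t *: d); split => //; first by apply: h; rewrite lexx ltW.
move=> /(congr1 (fun z => z - v)); rewrite subrr addrC addKr => /esym/eqP.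
by rewrite scaler_eq0 (negPf d0) gt_eqF.
Qed.

(** The intersection of the two cells is a common face that contains a segment. *)
Lemma germ_unique Pi sigma tau v d : polyhedral_structure X Pi -> d != 0 ->
  Pi sigma -> Pi tau -> germ sigma v d -> germ tau v d -> sigma = tau.
Proof.
move=> PS d0 Ps Pt gs gt; have [x [y [[sx tx] [sy ty] xy]]] := germ_two d0 (germI gs gt).
have := PS => -[[_ _ _ h] _]; have [E|[h1 h2]] := h _ _ Ps Pt.
  by have : (sigma `&` tau) x by []; rewrite E.
rewrite -(face_two (cell_collinear X1 PS Ps) h1 (conj sx tx) (conj sy ty) xy).
by rewrite {1}(face_two (cell_collinear X1 PS Pt) h2 (conj sx tx) (conj sy ty) xy).
Qed.

(** Otherwise the coordinate along [e] would be extremal at [v], and [v] would be a face. *)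
Lemma edge_interior Pi e k u v : polyhedral_structure X Pi -> edges Pi e ->
  edge_direction e k u -> e v -> ~ Pi [set v] ->
  germ e v (lat u) /\ germ e v (- lat u).
Proof.
move=> PS [Pe d1] [pu uk eu] ev nPv.
have uk0 : 0 < (u 0 k)%:~R :> R by rewrite ltr0z.
have pe := cell_polyhedron PS Pe.
have fc : forall (l : 'cV[R]_n) b, (forall x, e x -> 0 <= pairing x l + b) ->
    (forall x, e x -> pairing x l + b = 0 <-> x = v) -> False.
  move=> l b h1 h2; apply: nPv; have := PS => -[[_ _ + _] _] => /(_ _ _ Pe); apply.
  split; first by exists v.
  exists l, b; split=> //; apply/seteqP; split=> x /=.
    by move=> ->; split=> //; apply/h2.
  by move=> [ex /(h2 _ ex)].
have veq x : e x -> x 0 k = v 0 k -> x = v.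
  by move=> ex E; rewrite (eu v x) // E subrr mul0r scale0r addr0.
split; apply: contrapT => ng.
  apply: (fc (- delta_mx k 0) (v 0 k)) => x ex.
    rewrite /pairing mulmxN mxE -/(pairing _ _) pairing_delta addrC subr_ge0 leNgt.
    apply/negP => lt; apply: ng; apply: (@germ_convex _ _ _ _ _ ((x 0 k - v 0 k) / (u 0 k)%:~R)) => //.
      by rewrite divr_gt0 // subr_gt0.
    by rewrite -eu.
  rewrite /pairing mulmxN mxE -/(pairing _ _) pairing_delta; split=> [h|->]; last by rewrite addNr.
  by apply: veq => //; lra.
apply: (fc (delta_mx k 0) (- v 0 k)) => x ex; rewrite pairing_delta.
  rewrite subr_ge0 leNgt.
  apply/negP => lt; apply: ng; apply: (@germ_convex _ _ _ _ _ ((v 0 k - x 0 k) / (u 0 k)%:~R)) => //.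
    by rewrite divr_gt0 // subr_gt0.
  by rewrite scalerN -scaleNr -mulNr opprB -eu.
split=> [h|->]; last by rewrite subrr.
by apply: veq => //; lra.
Qed.

Lemma edge_prims e k u0 u v : edge_direction e k u0 -> prim u -> germ e v (lat u) ->
  u = u0 \/ u = - u0.
Proof.
move=> [pu0 uk eu] pu gu; have ev := germ_at gu; have [t t0 h] := gu.
have := eu v (v + t *: lat u) ev (h t _); rewrite lexx ltW // => /(_ isT).
rewrite !mxE => /addrI; set c := _ / _ => E.
have {}E : lat u = (t^-1 * c) *: lat u0.
  by rewrite -scalerA -E scalerA mulVf ?scale1r // gt_eqF.
case: (ltgtP 0 (t^-1 * c)) => c0.
- by left; apply: prim_uniq c0 E.
- right; apply: (@prim_uniq R _ _ _ (- (t^-1 * c))) => //; first exact: primN.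
    by rewrite oppr_gt0.
  by rewrite latvN scalerN scaleNr opprK.
- move: E; rewrite -c0 scale0r => /eqP; rewrite latv_eq0 => /eqP u00.
  by have := prim_neq0 pu; rewrite u00 eqxx.
Qed.

Lemma lat_neq0 u : prim u -> lat u != 0.
Proof. by move=> /prim_neq0; rewrite latv_eq0. Qed.

Lemma dir_edge Pi v u : polyhedral_structure X Pi -> dir v u ->
  exists2 e, edges Pi e & germ e v (lat u).
Proof.
move=> PS [pu gu]; have [e Pe ge] := space_germ PS gu; exists e => //.
have [x [y [ex ey xy]]] := germ_two (lat_neq0 pu) ge.
exact: (cell_edge X1 PS Pe ex ey).
Qed.

Lemma germ_dir Pi e v u : polyhedral_structure X Pi -> Pi e -> prim u ->
  germ e v (lat u) -> dir v u.
Proof. by move=> PS Pe pu ge; split=> //; apply: germS ge; exact: cell_sub Pe. Qed.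

(** Two edges through [v] would have only [v] in common, which would then be a vertex. *)
Lemma dir_interior Pi v : polyhedral_structure X Pi -> X v -> ~ Pi [set v] ->
  exists e u, [/\ edges Pi e, prim u, germ e v (lat u), germ e v (lat (- u)) &
    dir v = [set u; - u]].
Proof.
move=> PS Xv nPv; have [e Ee ev] := space_edge X1 PS Xv.
have [k [u ku]] := cell_direction X1 PS Ee; have [pu uk _] := ku.
have [gu gNu] := edge_interior PS Ee ku ev nPv.
exists e, u; split=> //; first by rewrite latvN.
apply/seteqP; split=> w /=; last first.
  by case=> ->; [|rewrite /dir /=]; apply: germ_dir PS Ee.1 _ _ => //; rewrite ?latvN //; exact: primN.
move=> dw; have [e' Ee' ge'] := dir_edge PS dw.
suff ee : e' = e. apply: (edge_prims ku dw.1 _). rewrite -ee. exact: ge'.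
have ev' := germ_at ge'.
have [x [y [ex ey xy]]] := germ_two (lat_neq0 dw.1) ge'.
have := PS => -[[_ _ cl h] _]; have [E|[h1 h2]] := h _ _ Ee.1 Ee'.1.
  by have : (e `&` e') v by []; rewrite E.
have [z [z1 z2 zv]] : exists z, [/\ e z, e' z & z <> v].
  apply: contrapT => hz; apply: nPv; apply: cl Ee.1 _.
  rewrite (_ : [set v] = e `&` e') //; apply/seteqP; split=> z /=; first by move=> ->.
  by move=> [z1 z2]; apply: contrapT => zv; apply: hz; exists z.
rewrite -(face_two (cell_collinear X1 PS Ee'.1) h2 (conj z1 z2) (conj ev ev') zv).
exact: face_two (cell_collinear X1 PS Ee.1) h1 (conj z1 z2) (conj ev ev') zv.
Qed.

Lemma is_primitive_vectorP Pi e v u : polyhedral_structure X Pi -> edges Pi e -> e v ->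
  is_primitive_vector e v u <-> prim u /\ germ e v (lat u).
Proof.
move=> PS [Pe d1] ev; have pe := cell_polyhedron PS Pe; split.
  move=> [lu pu [t t0 et]]; split; last exact: germ_convex t0 ev et.
  have l0 : lin_span e 0 by rewrite -(subrr v); exact: lin_span_sub.
  have u0 : u != 0.
    by apply/eqP => u0; have := pu 0 2%N; rewrite latv0 mul0rn => /(_ l0 u0).
  move=> w k uk; apply: pu (uk).
  have k0 : (k%:R : R) != 0.
    by rewrite pnatr_eq0; apply: contraNneq u0 => k0; rewrite uk k0 mulr0n.
  have wE : lat w = k%:R^-1 *: lat u by rewrite uk latvMn scalerA mulVf // scale1r.
  have [m [a [x [y [xy uE]]]]] := lu.
  exists m, (fun i => k%:R^-1 * a i), x, y; split=> //.
  by rewrite wE uE scaler_sumr; apply: eq_bigr => i _; rewrite scalerA.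
move=> [pu [t t0 h]]; split; last by exists t => //; apply: h; rewrite lexx ltW.
  exists 1%N, (fun=> t^-1), (fun=> v + t *: lat u), (fun=> v); split.
    by move=> _; split=> //; apply: h; rewrite lexx ltW.
  by rewrite big_ord1 addrC addKr scalerA mulVf ?scale1r // gt_eqF.
by move=> w k _; exact: pu.
Qed.

Lemma primitive_vectorP Pi e v : polyhedral_structure X Pi -> star Pi v e ->
  prim (primitive_vector e v) /\ germ e v (lat (primitive_vector e v)).
Proof.
move=> PS [Ee fe]; have ev : e v by have := fe => -[_ [f [b [_ E]]]]; have : [set v] v by []; rewrite E => -[].
apply/(is_primitive_vectorP _ PS Ee ev).
have pe := cell_polyhedron PS Ee.1.
have [k [u [pu uk eu]]] := cell_direction X1 PS Ee.
have uk0 : 0 < (u 0 k)%:~R :> R by rewrite ltr0z.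
have [y ey yv] : exists2 y, e y & y <> v.
  have [x [y [ex ey xy]]] := has_dim1_two Ee.2.
  by have [xv|/eqP xv] := eqVneq x v; [exists y => // yv; apply: xy; rewrite xv yv|exists x].
have yE := eu _ _ ev ey.
apply: xgetPex.
case: (ltgtP (y 0 k) (v 0 k)) => yk.
- exists (- u); apply/(is_primitive_vectorP _ PS Ee ev); split; first exact: primN.
  rewrite latvN; apply: (@germ_convex _ _ _ _ _ ((v 0 k - y 0 k) / (u 0 k)%:~R)) => //.
    by rewrite divr_gt0 // subr_gt0.
  by rewrite scalerN -scaleNr -mulNr opprB -yE.
- exists u; apply/(is_primitive_vectorP _ PS Ee ev); split; first exact: pu.
  apply: (@germ_convex _ _ _ _ _ ((y 0 k - v 0 k) / (u 0 k)%:~R)) => //.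
    by rewrite divr_gt0 // subr_gt0.
  by rewrite -yE.
- by case: yv; rewrite yE yk subrr mul0r scale0r addr0.
Qed.

Lemma primitive_vector_eq Pi e v u : polyhedral_structure X Pi -> star Pi v e ->
  prim u -> germ e v (lat u) -> primitive_vector e v = u.
Proof.
move=> PS Se pu gu; have [pp gp] := primitive_vectorP PS Se.
have [k [u0 ku]] := cell_direction X1 PS Se.1.
have opp w : prim w -> germ e v (lat w) -> germ e v (lat (- w)) -> False.
  move=> pw [t t0 h] [r r0 h']; apply: (face_extreme Se.2 t0 r0 (lat_neq0 pw)).
    by apply: h; rewrite lexx ltW.
  by rewrite -scalerN -latvN; apply: h'; rewrite lexx ltW.
have [E|E] := edge_prims ku pp gp; have [E'|E'] := edge_prims ku pu gu; rewrite E E' //.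
  by exfalso; apply: (opp u) => //; rewrite E' opprK -E.
by exfalso; apply: (opp u) => //; rewrite E' -E.
Qed.

Lemma star_dir_bij Pi v : polyhedral_structure X Pi -> Pi [set v] ->
  set_bij (star Pi v) (dir v) (fun e => primitive_vector e v).
Proof.
move=> PS Pv; split.
- by move=> e Se; have [pp gp] := primitive_vectorP PS Se; apply: germ_dir PS Se.1.1 pp gp.
- move=> e e'; rewrite !inE => Se Se' E.
  have [pp gp] := primitive_vectorP PS Se; have [pp' gp'] := primitive_vectorP PS Se'.
  by apply: germ_unique PS (lat_neq0 pp) Se.1.1 Se'.1.1 gp _; rewrite E.
move=> u du; have [e Ee ge] := dir_edge PS du.
have Se : star Pi v e by split=> //; apply: cell_vertex_face PS Ee.1 Pv (germ_at ge).
by exists e => //; apply: primitive_vector_eq PS Se du.1 ge.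
Qed.

Lemma star_finite Pi v : polyhedral_structure X Pi -> finite_set (star Pi v).
Proof.
by move=> PS; apply: sub_finite_set (structure_finite PS) => e [[]].
Qed.

Lemma dir_finite v : X v -> finite_set (dir v).
Proof.
move=> Xv; have PS := structure0.
have [Pv|nPv] := pselect (Pi0 [set v]); last first.
  have [e [u [_ _ _ _ ->]]] := dir_interior PS Xv nPv.
  by rewrite finite_setU; split; exact: finite_set1.
have [h1 h2 h3] := star_dir_bij PS Pv.
by apply: sub_finite_set h3 _; apply: finite_image; exact: star_finite.
Qed.

Lemma wgtP v u : dir v u ->
  exists2 e, edges Pi0 e & germ e v (lat u) /\ wgt v u = w0 e.
Proof.
move=> du; have [e Ee ge] := dir_edge structure0 du.
have ex : exists q, [set q | exists2 e, edges Pi0 e & germ e v (lat u) /\ q = w0 e] q.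
  by exists (w0 e), e.
exact: (xgetPex 0 ex).
Qed.

Lemma wgt_edge e v u : prim u -> edges Pi0 e -> germ e v (lat u) -> wgt v u = w0 e.
Proof.
move=> pu Ee ge; have [e' Ee' [ge' ->]] := wgtP (germ_dir structure0 Ee.1 pu ge).
by rewrite (germ_unique structure0 (lat_neq0 pu) Ee.1 Ee'.1 ge ge').
Qed.

Lemma wgt_gt0 v u : dir v u -> 0 < wgt v u.
Proof. by move=> /wgtP[e Ee [_ ->]]; case: balX => _ + _; apply. Qed.

Lemma weight_germ Pi e v u : weight_defined_on X Pi0 w0 Pi -> edges Pi e ->
  prim u -> germ e v (lat u) -> weight Pi0 w0 e = wgt v u.
Proof.
move=> [PS wd] Ee pu ge; have [e0 Ee0 [ge0 ->]] := wgtP (germ_dir PS Ee.1 pu ge).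
have : has_weight Pi0 w0 e (weight Pi0 w0 e) by apply: xgetPex; exact: wd.
apply=> //; have [x [y [ex ey xy]]] := germ_two (lat_neq0 pu) (germI ge ge0).
apply: collinear_has_dim1 ex ey xy.
by apply: subcollinear (cell_collinear X1 PS Ee.1); exact: subIsetl.
Qed.

Lemma slopeE phi v u m : has_slope phi v u m -> slope phi v u = m.
Proof.
move=> hm; have : has_slope phi v u (slope phi v u) by apply: (xgetPex 0 (ex_intro [set m | has_slope phi v u m] m hm)).
move: hm => [t t0 h] [t' t'0 h'].
have m0 : 0 < Num.min t t' by rewrite lt_min t0.
have c1 : 0 <= Num.min t t' <= t by rewrite ltW //= ge_min lexx.
have c2 : 0 <= Num.min t t' <= t' by rewrite ltW //= ge_min lexx orbT.
have := h _ c1; rewrite (h' _ c2) => /addrI; apply: mulfI.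
by rewrite gt_eqF.
Qed.

Lemma linear_part_slope phi sigma (l : 'cV[rat]_n) v u : is_linear_part phi sigma l ->
  germ sigma v (lat u) -> has_slope phi v u (pairing (lat u) (map_mx ratr l)).
Proof.
move=> [c h] gs; have sv := germ_at gs; have [t t0 hs] := gs.
by exists t => // s st; rewrite !h ?pairingD ?pairingZ; [ring|by []|apply: hs].
Qed.

Lemma PA_on_slope Pi phi v u : polyhedral_structure X Pi -> PA_on X Pi phi -> dir v u ->
  has_slope phi v u (slope phi v u).
Proof.
move=> PS [_ pa] du; have [e Ee ge] := dir_edge PS du.
have [l hl] := pa _ Ee.1; have := linear_part_slope hl ge.
by move=> h; rewrite (slopeE h).
Qed.

Lemma MA_atomE Pi phi v : weight_defined_on X Pi0 w0 Pi -> PA_on X Pi phi -> Pi [set v] ->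
  MA_atom Pi0 w0 Pi phi v = laplacian phi v.
Proof.
move=> wd pa Pv; have [PS _] := wd; rewrite /MA_atom /laplacian.
rewrite (reindex_fsbig _ _ _ _ (star_dir_bij PS Pv)); apply: eq_fsbigr => e; rewrite inE => Se.
have [pp gp] := primitive_vectorP PS Se; rewrite (weight_germ wd Se.1 pp gp); congr (_ * _).
have := xgetPex 0 (pa.2 _ Se.1.1) => hl.
by rewrite (slopeE (linear_part_slope hl gp)).
Qed.

Lemma slope_opp phi sigma (l : 'cV[rat]_n) v u : is_linear_part phi sigma l ->
  germ sigma v (lat u) -> germ sigma v (lat (- u)) -> slope phi v (- u) = - slope phi v u.
Proof.
move=> hl g1 g2; rewrite (slopeE (linear_part_slope hl g1)) (slopeE (linear_part_slope hl g2)).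
by rewrite latvN pairingN.
Qed.

Lemma prim_neq_opp u : prim u -> u <> - u.
Proof.
move=> /prim_neq0 u0 E; move/eqP: u0; apply; apply/rowP => j; move/rowP: E => /(_ j).
rewrite !mxE => h; have /eqP : u 0 j *+ 2 = 0 by rewrite mulr2n {1}h addNr.
by rewrite mulrn_eq0 => /eqP.
Qed.

Lemma fsbig_opp (W : zmodType) (F : 'rV[int]_n -> W) u : prim u ->
  \sum_(w \in [set u; - u]) F w = F u + F (- u).
Proof.
move=> pu; have d : [set u] `&` [set - u] `<=` set0 by move=> w [-> /(prim_neq_opp pu)].
by rewrite (fsbigU0 _ _ (finite_set1 u) (finite_set1 (- u)) d) !fsbig_set1.
Qed.

(** Near such a point the space is a line of constant weight, and the two slopes cancel. *)
Lemma laplacian_interior Pi phi v : weight_defined_on X Pi0 w0 Pi -> PA_on X Pi phi ->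
  X v -> ~ Pi [set v] -> laplacian phi v = 0.
Proof.
move=> wd pa Xv nPv; have [PS _] := wd.
have [e [u [Ee pu g1 g2 dE]]] := dir_interior PS Xv nPv.
have [l hl] := pa.2 _ Ee.1.
rewrite /laplacian dE fsbig_opp // (slope_opp hl g1 g2).
rewrite -(weight_germ wd Ee pu g1) -(weight_germ wd Ee (primN pu) g2).
by rewrite mulrN subrr.
Qed.

(** At a vertex of [Pi0] this is the balancing hypothesis; elsewhere the two directions
    are opposite and have the same weight. *)
Lemma balance v : X v -> \sum_(u \in dir v) ratr (wgt v u) *: lat u = 0.
Proof.
move=> Xv; have PS := structure0.
have wd : weight_defined_on X Pi0 w0 Pi0.
  split=> // e Ee; exists (w0 e) => e0 Ee0 d1.
  have [x [y [[ex e0x] [ey e0y] xy]]] := has_dim1_two d1.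
  have := PS => -[[_ _ _ h] _]; have [E|[h1 h2]] := h _ _ Ee.1 Ee0.1.
    by have : (e `&` e0) x by []; rewrite E.
  congr w0; rewrite -(face_two (cell_collinear X1 PS Ee.1) h1 (conj ex e0x) (conj ey e0y) xy).
  exact: face_two (cell_collinear X1 PS Ee0.1) h2 (conj ex e0x) (conj ey e0y) xy.
have [Pv|nPv] := pselect (Pi0 [set v]); last first.
  have [e [u [Ee pu g1 g2 ->]]] := dir_interior PS Xv nPv.
  rewrite fsbig_opp //.
  rewrite -(weight_germ wd Ee pu g1) -(weight_germ wd Ee (primN pu) g2).
  by rewrite latvN scalerN subrr.
rewrite (reindex_fsbig _ _ _ _ (star_dir_bij PS Pv)).
case: balX => _ _ /(_ v (conj Pv (has_dim0_point v))) /(congr1 (map_mx (@ratr R))).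
rewrite fsbig_finite; last exact: star_finite.
rewrite fsbig_finite /=; last exact: star_finite.
rewrite raddf_sum map_mx0 => E; rewrite -[RHS]E !big_seq; apply: eq_bigr => e.
rewrite in_fset_set ?inE; last exact: star_finite.
move=> Se; have [pp gp] := primitive_vectorP PS Se.
rewrite (wgt_edge pp Se.1 gp); apply/rowP => j; rewrite !mxE.
by rewrite -[RHS]/(ratr _) rmorphM /= ratr_int.
Qed.

End Local.

(** * Refining the given structure at finitely many rational points *)

Section Refinement.
Variables (R : realType) (n : nat) (X : set 'rV[R]_n).
Variables (Pi0 : set (set 'rV[R]_n)) (w0 : set 'rV[R]_n -> rat).
Hypothesis X1 : one_dim_polyhedral_space X.
Hypothesis balX : balanced X Pi0 w0.
Local Notation V := 'rV[R]_n.
Local Notation "'lat' u" := (latv R u) (at level 10, u at level 8).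
Implicit Types (x y z v d s : V) (A B sigma tau e S : set V) (Pi : set (set V)).
Implicit Types (u : 'rV[int]_n) (phi f g : V -> R).

Let PS0 := structure0 balX.

(** Dividing by the coordinate of [u] makes [u] a vector of unit speed, so that slopes are
    derivatives with respect to [p]. *)
Definition edge_coordinate e u (p : V -> R) : Prop :=
  exists2 k, edge_direction e k u & forall x, p x = x 0 k / (u 0 k)%:~R.

Lemma edge_coordinateP : exists (ud : set V -> 'rV[int]_n) (par : set V -> V -> R),
  forall e, edges Pi0 e -> edge_coordinate e (ud e) (par e).
Proof.
have h e : exists up : 'rV[int]_n * (V -> R), edges Pi0 e -> edge_coordinate e up.1 up.2.
  have [Ee|nEe] := pselect (edges Pi0 e); last by exists (0, fun=> 0).
  have [k [u ku]] := cell_direction X1 PS0 Ee.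
  by exists (u, fun x => x 0 k / (u 0 k)%:~R) => _; exists k.
have [up hup] := choice h.
by exists (fun e => (up e).1), (fun e => (up e).2).
Qed.

Variables (ud : set V -> 'rV[int]_n) (par : set V -> V -> R).
Hypothesis hpar : forall e, edges Pi0 e -> edge_coordinate e (ud e) (par e).

Lemma par_pt e x y : edges Pi0 e -> e x -> e y ->
  y = x + (par e y - par e x) *: lat (ud e).
Proof.
move=> /hpar[k [_ _ eu] pE] ex ey; rewrite !pE -mulrBl; exact: eu.
Qed.

Lemma par_shift e x (t : R) : edges Pi0 e -> par e (x + t *: lat (ud e)) = par e x + t.
Proof.
move=> /hpar[k [_ uk _] pE]; rewrite !pE !mxE mulrDl mulfK //.
by rewrite intr_eq0 gt_eqF.
Qed.

Lemma ud_prim e : edges Pi0 e -> prim (ud e).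
Proof. by move=> /hpar[k []]. Qed.

Lemma par_inj e x y : edges Pi0 e -> e x -> e y -> par e x = par e y -> x = y.
Proof. by move=> Ee ex ey h; rewrite (par_pt Ee ex ey) h subrr scale0r addr0. Qed.

Lemma par_between e x y (r : R) : edges Pi0 e -> e x -> e y -> par e x <= r <= par e y ->
  e (x + (r - par e x) *: lat (ud e)).
Proof.
move=> Ee ex ey /andP[xr ry]; have [xy|xy] := eqVneq (par e x) (par e y).
  have -> : r = par e x by apply/eqP; rewrite eq_le xr xy ry.
  by rewrite subrr scale0r addr0.
have lt : 0 < par e y - par e x by rewrite subr_gt0 lt_neqAle xy (le_trans xr).
have := @polyhedron_convex _ _ _ _ _ ((r - par e x) / (par e y - par e x))
  (cell_polyhedron PS0 Ee.1) ex ey.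
have -> : y - x = (par e y - par e x) *: lat (ud e) by rewrite {1}(par_pt Ee ex ey) addrC addKr.
rewrite scalerA divfK ?gt_eqF //; apply.
rewrite divr_ge0 ?subr_ge0 ?(ltW lt) ?xr //= ?ler_pdivrMr ?mul1r ?lerB //.
by rewrite -subr_ge0 ltW.
Qed.

(** The points at which [Pi0] is subdivided. A point on every edge rules out cells that
    are full lines, on which the values on [S] would not determine a bounded function. *)
Definition good S : Prop :=
  [/\ finite_set S, S `<=` X, S `<=` @rational_points R n,
      forall v, Pi0 [set v] -> S v & forall e, edges Pi0 e -> exists2 s, S s & e s].

(** Comparisons with all points of [S] on [e] avoid naming the two neighbours of [x],
    which need not exist. *)
Definition cellS S e x : set V :=
  [set y | e y /\ forall s, S s -> e s ->
    (par e s < par e x -> par e s <= par e y) /\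
    (par e x < par e s -> par e y <= par e s)].

Definition refinement S : set (set V) :=
  [set sigma | (exists2 s, S s & sigma = [set s]) \/
    (exists e x, [/\ edges Pi0 e, e x, ~ S x & sigma = cellS S e x])].

Section Fixed.
Variable S : set V.
Hypothesis gS : good S.

Lemma cellS_sub e x : cellS S e x `<=` e.
Proof. by move=> y []. Qed.

Lemma cellS_self e x : e x -> cellS S e x x.
Proof. by move=> ex; split=> // s _ _; split; exact: ltW. Qed.

Lemma par_neq e s x : edges Pi0 e -> S s -> e s -> e x -> ~ S x -> par e s != par e x.
Proof. by move=> Ee Ss es ex Sx; apply/eqP => /(par_inj Ee es ex) h; apply: Sx; rewrite -h. Qed.

Lemma cellS_eq e x y : edges Pi0 e -> e x -> ~ S x -> cellS S e x y -> ~ S y ->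
  cellS S e y = cellS S e x.
Proof.
move=> Ee ex Sx [ey hy] Sy.
have h s : S s -> e s -> (par e s < par e y) = (par e s < par e x).
  move=> Ss es; have [h1 h2] := hy s Ss es.
  have := par_neq Ee Ss es ex Sx; have := par_neq Ee Ss es ey Sy.
  case: (ltgtP (par e s) (par e x)) => [/h1|/h2|//]; case: (ltgtP (par e s) (par e y)) => //.
have h' s : S s -> e s -> (par e y < par e s) = (par e x < par e s).
  move=> Ss es; have := h s Ss es.
  have := par_neq Ee Ss es ex Sx; have := par_neq Ee Ss es ey Sy.
  by case: (ltgtP (par e s) (par e x)); case: (ltgtP (par e s) (par e y)).
by apply/seteqP; split=> z [ez hz]; split=> // s Ss es; have := hz s Ss es; rewrite h ?h'.
Qed.

(** Cells of one edge that differ lie on different sides of some point of [S]. *)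
Lemma cellS_meet e x y z : edges Pi0 e -> e x -> ~ S x -> e y -> ~ S y ->
  cellS S e x <> cellS S e y -> exists2 s, S s & cellS S e x `&` cellS S e y `<=` [set s].
Proof.
move=> Ee ex Sx ey Sy ne.
have ny : ~ cellS S e x y by move=> h; apply: ne; rewrite (cellS_eq Ee ex Sx h Sy).
have [s [Ss es h]] : exists s, [/\ S s, e s &
    (par e s < par e x /\ par e y < par e s) \/ (par e x < par e s /\ par e s < par e y)].
  apply: contrapT => hn; apply: ny; split=> // s Ss es; split=> h; rewrite leNgt; apply/negP => h'.
    by apply: hn; exists s; split=> //; left.
  by apply: hn; exists s; split=> //; right.
exists s => // w [[ew hx] [_ hy]] /=; apply: (par_inj Ee ew es).
have [a1 a2] := hx s Ss es; have [b1 b2] := hy s Ss es.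
by apply/eqP; rewrite eq_le; case: h => -[h1 h2]; rewrite ?(a1 h1) ?(b2 h2) ?(a2 h1) ?(b1 h2).
Qed.

Lemma cellS_interior e x y : edges Pi0 e -> e x -> ~ S x -> cellS S e x y -> ~ S y ->
  germ (cellS S e x) y (lat (ud e)) /\ germ (cellS S e x) y (- lat (ud e)).
Proof.
move=> Ee ex Sx cy Sy; have [k ku _] := hpar Ee; have ey := cellS_sub cy.
have [fS _ _ vS _] := gS.
have [[t t0 h] [t' t'0 h']] := edge_interior PS0 Ee ku ey (fun p => Sy (vS _ p)).
have [r r0 hr] : exists2 r : R, 0 < r &
    forall s, S s -> e s -> r <= `|par e s - par e y|.
  apply: set_eps fS _ _ => [s a b ha b0 ba es|s Ss]; first exact: le_trans ba (ha es).
  have [es|nes] := pselect (e s); last by exists 1.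
  by exists `|par e s - par e y| => //; rewrite normr_gt0 subr_eq0 par_neq.
rewrite -(cellS_eq Ee ex Sx cy Sy).
have key (q : R) : `|q| <= r -> e (y + q *: lat (ud e)) -> cellS S e y (y + q *: lat (ud e)).
  move=> qr eq; split=> // s Ss es; rewrite par_shift //.
  have := hr s Ss es; move: qr; rewrite ler_norml => /andP[q1 q2].
  by rewrite real_ler_normr ?num_real // => /orP[] ?; split=> ?; lra.
split.
  exists (Num.min t r); first by rewrite lt_min t0.
  move=> q /andP[q0]; rewrite le_min => /andP[qt qr]; apply: key; first by rewrite ger0_norm.
  by apply: h; rewrite q0.
exists (Num.min t' r); first by rewrite lt_min t'0.
move=> q /andP[q0]; rewrite le_min => /andP[qt qr]; rewrite scalerN -scaleNr; apply: key.
  by rewrite normrN ger0_norm.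
by rewrite scaleNr -scalerN; apply: h'; rewrite q0.
Qed.

(** Each of the finitely many points of [S] contributes at most one rational inequality. *)
Lemma cellS_polyhedron e x : edges Pi0 e -> rational_polyhedron (cellS S e x).
Proof.
move=> Ee; have [fS _ rS _ _] := gS; have [k [_ uk _] pE] := hpar Ee.
have parE s y : (par e s <= par e y) = (s 0 k <= y 0 k).
  by rewrite !pE ler_pM2r // invr_gt0 ltr0z.
pose Q (A : set V) := [set y | e y /\ forall s, A s -> e s ->
    (par e s < par e x -> par e s <= par e y) /\
    (par e x < par e s -> par e y <= par e s)].
have [l SE] := (finite_seqP S).1 fS.
have rl : {subset l <= S} by move=> s sl; rewrite inE SE.
rewrite (_ : cellS S e x = Q [set` l]); last by rewrite /cellS /Q SE.
elim: l {SE} rl => [|s l IH] rl.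
  rewrite (_ : Q _ = e); first exact: cell_polyhedron PS0 Ee.1.
  by apply/seteqP; split=> [y []|y ey] //; split.
have {}IH : rational_polyhedron (Q [set` l]).
  by apply: IH => z zl; apply: rl; rewrite inE zl orbT.
have [q sE] : rational_points s by apply: rS; apply/set_mem/rl; rewrite inE eqxx.
have sk : s 0 k = ratr (q 0 k) by rewrite sE mxE.
have QS y : Q [set` s :: l] y <-> Q [set` l] y /\ (e s ->
    (par e s < par e x -> par e s <= par e y) /\ (par e x < par e s -> par e y <= par e s)).
  split=> [[ey h]|[[ey h] hs]].
    split; [split=> // z zl; apply: h; rewrite /= inE (_ : z \in l) ?orbT //|].
    by apply: h; rewrite /= inE eqxx.
  by split=> // z /=; rewrite inE => /orP[/eqP ->|zl]; [exact: hs|exact: h].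
have [es|nes] := pselect (e s); last first.
  rewrite (_ : Q _ = Q [set` l]) //; apply/seteqP; split=> y; first by move/QS => [].
  by move=> h; apply/QS; split.
have [lt|lt|eq] := ltgtP (par e s) (par e x).
- have := polyhedronI_ge k (q 0 k) IH; congr rational_polyhedron.
  apply/seteqP; split=> y.
    move=> [Qy /= yk]; apply/QS; split=> // _; rewrite parE sk; split=> // h.
    by have := lt_trans lt h; rewrite ltxx.
  by move/QS => [Qy /(_ es)[/(_ lt) + _]]; rewrite parE sk.
- have := polyhedronI_le k (q 0 k) IH; congr rational_polyhedron.
  apply/seteqP; split=> y.
    move=> [Qy /= yk]; apply/QS; split=> // _; rewrite !parE sk; split=> // h.
    by have := lt_trans lt h; rewrite ltxx.
  by move/QS => [Qy /(_ es)[_ /(_ lt)]]; rewrite parE sk.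
rewrite (_ : Q _ = Q [set` l]) //; apply/seteqP; split=> y; first by move/QS => [].
by move=> h; apply/QS; split=> // _; rewrite eq ltxx.
Qed.

(** A cell is determined by its edge and by the sides of the points of [S] on which it lies. *)
Lemma refinement_finite : finite_set (refinement S).
Proof.
have [fS _ _ _ _] := gS; have [l SE] := (finite_seqP S).1 fS.
pose G (e : set V) (b : (size l).-tuple bool) : set V :=
  [set y | e y /\ forall i : 'I_(size l), e (nth 0 l i) ->
     if tnth b i then par e (nth 0 l i) <= par e y else par e y <= par e (nth 0 l i)].
have f1 : finite_set [set [set s] | s in S] by exact: finite_image.
have f2 : finite_set [set G e b | e in Pi0 & b in [set: (size l).-tuple bool]].
  by apply: finite_image2; [exact: structure_finite PS0|exact: finite_finset].
apply: (@sub_finite_set _ _ ([set [set s] | s in S] `|`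
    [set G e b | e in Pi0 & b in [set: (size l).-tuple bool]])); last by rewrite finite_setU.
move=> sigma [[s Ss ->]|[e [x [Ee ex Sx ->]]]]; first by left; exists s.
right; exists e; first exact: Ee.1.
exists [tuple (par e (nth 0 l i) < par e x)%R | i < size l] => //.
have mem s : S s <-> exists i : 'I_(size l), s = nth 0 l i.
  rewrite SE; split=> [/(nthP 0)[i il <-]|[i ->]]; first by exists (Ordinal il).
  by rewrite /= mem_nth.
apply/seteqP; split=> y [ey h]; split=> // s.
  move=> /mem[i ->] es; have := h i es; rewrite tnth_mktuple.
  case: ltgtP => // lt h'; split=> //; rewrite ?lt ?ltxx // => h2.
move=> es; rewrite tnth_mktuple.
have Ss : S (nth 0 l s) by apply/mem; exists s.
have := par_neq Ee Ss es ex Sx; have [h1 h2] := h _ Ss es.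
by case: ltgtP h1 h2 => // ? h1 h2 _; auto.
Qed.

Lemma face_refl sigma : sigma !=set0 -> face sigma sigma.
Proof.
move=> s0; split=> //; exists 0, 0; split=> [x _|].
  by rewrite /pairing mulmx0 mxE addr0.
by apply/seteqP; split=> x //=; [move=> sx; split=> //; rewrite /pairing mulmx0 mxE addr0|case].
Qed.

Lemma cellS_face e x s : edges Pi0 e -> e x -> ~ S x -> S s -> cellS S e x s ->
  face (cellS S e x) [set s].
Proof.
move=> Ee ex Sx Ss [es hs]; have [k [_ uk _] pE] := hpar Ee.
have uk0 : 0 < (ud e 0 k)%:~R :> R by rewrite ltr0z.
have parE y z : (par e y <= par e z) = (y 0 k <= z 0 k).
  by rewrite !pE ler_pM2r // invr_gt0.
have inj y : e y -> y 0 k = s 0 k -> y = s.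
  by move=> ey h; apply: (par_inj Ee ey es); rewrite !pE h.
split; first by exists s.
have := par_neq Ee Ss es ex Sx; case: ltgtP => // lt _.
  exists (delta_mx k 0), (- s 0 k); split=> [y [ey hy]|].
    by rewrite pairing_delta subr_ge0 -parE; have [h _] := hy s Ss es; exact: h.
  apply/seteqP; split=> y /=; rewrite pairing_delta; first by move=> ->; rewrite subrr.
  by move=> [[ey _] h]; apply: inj => //; lra.
exists (- delta_mx k 0), (s 0 k); split=> [y [ey hy]|].
  rewrite /pairing mulmxN mxE -/(pairing _ _) pairing_delta addrC subr_ge0 -parE.
  by have [_ h] := hy s Ss es; exact: h.
apply/seteqP; split=> y /=; rewrite /pairing mulmxN mxE -/(pairing _ _) pairing_delta.
  by move=> ->; rewrite addNr.
by move=> [[ey _] h]; apply: inj => //; lra.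
Qed.

Lemma share_two Pi e e' x y : polyhedral_structure X Pi -> Pi e -> Pi e' ->
  e x -> e y -> e' x -> e' y -> x <> y -> e = e'.
Proof.
move=> PS Pe Pe' ex ey e'x e'y xy.
have := PS => -[[_ _ _ h] _]; have [E|[h1 h2]] := h _ _ Pe Pe'.
  by have : (e `&` e') x by []; rewrite E.
rewrite -(face_two (cell_collinear X1 PS Pe) h1 (conj ex e'x) (conj ey e'y) xy).
exact: face_two (cell_collinear X1 PS Pe') h2 (conj ex e'x) (conj ey e'y) xy.
Qed.

(** Distinct edges meet in vertices of [Pi0], which belong to [S], and distinct cells of
    one edge are separated by a point of [S]. *)
Lemma refinement_meet sigma tau : refinement S sigma -> refinement S tau ->
  sigma = tau \/ exists2 s, S s & sigma `&` tau `<=` [set s].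
Proof.
have [_ _ _ vS _] := gS.
move=> [[s Ss ->]|[e [x [Ee ex Sx ->]]]]; first by right; exists s => // y [].
move=> [[s Ss ->]|[e' [x' [Ee' ex' Sx' ->]]]]; first by right; exists s => // y [].
have [ee|ne] := pselect (e = e'); last first.
  right; have := PS0 => -[[_ _ cl h] _]; have [E|[h1 h2]] := h _ _ Ee.1 Ee'.1.
    have [s [Ss es]] : exists s, S s /\ e s.
      by have [_ _ _ _ /(_ e Ee)[s]] := gS; exists s.
    by exists s => // y [[ey _] [e'y _]]; have : (e `&` e') y by []; rewrite E.
  have [[v [ev ev']] _] := h1.
  have E : e `&` e' = [set v].
    apply/seteqP; split=> y /=; last by move=> ->.
    move=> [ey ey']; apply: contrapT => yv; apply: ne.
    exact: (share_two PS0 Ee.1 Ee'.1 ey ev ey' ev').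
  exists v; first by apply: vS; rewrite -E; apply: (cl _ _ Ee.1 h1).
  by move=> y [[ey _] [ey' _]]; rewrite -E.
rewrite -ee in Ee' ex' *; have [E|ne] := pselect (cellS S e x = cellS S e x'); first by left.
by right; exact: cellS_meet.
Qed.

Lemma refinement_vertex sigma s : refinement S sigma -> S s -> sigma s -> face sigma [set s].
Proof.
move=> [[s' Ss' ->]|[e [x [Ee ex Sx ->]]]] Ss; last exact: cellS_face.
by move=> /= ->; apply: face_refl; exists s'.
Qed.

(** A proper face of a cell is a point, and it belongs to [S] because a point off [S] has
    the cell on both of its sides. *)
Lemma refinement_structure : polyhedral_structure X (refinement S).
Proof.
have [fS SX rS vS mS] := gS; split; last first.
  apply/seteqP; split=> x.
    move=> [sigma [[s Ss ->] /= ->|[e [y [Ee ey Sy ->]]]]]; first exact: SX.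
    by move=> [ex _]; exact: cell_sub PS0 Ee.1 _ ex.
  move=> Xx; have [Sx|Sx] := pselect (S x).
    by exists [set x] => //; left; exists x.
  have [e Ee ex] := space_edge X1 PS0 Xx.
  by exists (cellS S e x); [right; exists e, x|exact: cellS_self].
split; first exact: refinement_finite.
- move=> sigma [[s Ss ->]|[e [x [Ee ex Sx ->]]]]; split.
  + by have [q ->] := rS _ Ss; exact: polyhedron_point.
  + by exists s.
  + exact: cellS_polyhedron.
  + by exists x; exact: cellS_self.
- move=> sigma tau [[s Ss ->]|[e [x [Ee ex Sx ->]]]] ft.
    left; exists s => //; have [[y ty] [f [b [_ tE]]]] := ft.
    have ys : y = s by move: ty; rewrite tE => -[].
    apply/seteqP; split=> z /=; first by rewrite tE => -[].
    by move=> ->; rewrite -ys.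
  have [[y ty] _] := ft.
  have st : tau `<=` cellS S e x by have [_ [f [b [_ ->]]]] := ft; exact: subIsetl.
  have [two|one] := pselect (exists2 z, tau z & z <> y).
    have [z tz zy] := two.
    have cc : collinear (cellS S e x).
      by apply: subcollinear (cell_collinear X1 PS0 Ee.1); exact: cellS_sub.
    by right; exists e, x; split=> //; exact: face_two cc ft tz ty zy.
  have tE : tau = [set y].
    apply/seteqP; split=> z /=; last by move=> ->.
    by move=> tz; apply: contrapT => zy; apply: one; exists z.
  have [Sy|Sy] := pselect (S y); first by left; exists y.
  have [[t t0 h] [t' t'0 h']] := cellS_interior Ee ex Sx (st _ ty) Sy.
  exfalso; rewrite tE in ft; apply: (face_extreme ft t0 t'0 (lat_neq0 R (ud_prim Ee))).
    by apply: h; rewrite lexx ltW.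
  by rewrite -scalerN; apply: h'; rewrite lexx ltW.
move=> sigma tau Rs Rt.
have [E|[s Ss sub]] := refinement_meet Rs Rt.
  have [s0|/set0P s0] := eqVneq sigma set0; first by left; rewrite s0 set0I.
  by right; rewrite -E setIid; split; exact: face_refl.
have [[st ss]|ns] := pselect (sigma s /\ tau s); last first.
  left; apply/seteqP; split=> // y sty; apply: ns.
  by have := sub _ sty => /= ys; rewrite -ys.
right; rewrite (_ : sigma `&` tau = [set s]); last first.
  by apply/seteqP; split=> // y /= ->.
by split; exact: refinement_vertex.
Qed.

Lemma refinement_edge sigma : edges (refinement S) sigma ->
  exists e x, [/\ edges Pi0 e, e x, ~ S x & sigma = cellS S e x].
Proof.
move=> [[[s _ ->] /has_dim1_two[x [y [/= -> -> //]]]|//] _].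
Qed.

Lemma refinement_weight : weight_defined_on X Pi0 w0 (refinement S).
Proof.
split; first exact: refinement_structure.
move=> sigma /refinement_edge[e [x [Ee ex Sx ->]]]; exists (w0 e) => e0 Ee0 d1.
have [y [z [[cy e0y] [cz e0z] yz]]] := has_dim1_two d1.
by congr w0; exact: (share_two PS0 Ee.1 Ee0.1 (cellS_sub cy) (cellS_sub cz) e0y e0z).
Qed.

Lemma refinement_point s : S s -> refinement S [set s].
Proof. by move=> Ss; left; exists s. Qed.

End Fixed.
End Refinement.

(** * Piecewise affine functions as continuous selections *)

Section OneVariable.
Variable R : realType.

Lemma ivt (f : R -> R) (a b v : R) : a <= b ->
  (forall x, a <= x <= b -> forall r, 0 < r -> exists2 d, 0 < d &
    forall y, a <= y <= b -> `|y - x| < d -> `|f y - f x| < r) ->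
  Num.min (f a) (f b) <= v <= Num.max (f a) (f b) -> exists2 c, a <= c <= b & f c = v.
Proof.
move=> ab cf vf; have cw : {within `[a, b], continuous f}.
  apply/within_continuousP => x /=; rewrite in_itv /= => xab r r0.
  have [d d0 h] := cf x xab r r0; exists d => // y; rewrite /= in_itv /=; exact: h.
by have [c ch fc] := IVT ab cw vf; exists c => //; move: ch; rewrite in_itv.
Qed.

(** An affine function without zeros on the segment stays away from 0 on smaller
    segments, so [D] could not take the small nonzero values it meets, by the intermediate
    value theorem, on its way from 0. *)
Lemma selection_zero (D : R -> R) (ds : seq (R * R)) :
  (forall x, 0 <= x <= 1 -> forall r, 0 < r -> exists2 d, 0 < d &
    forall y, 0 <= y <= 1 -> `|y - x| < d -> `|D y - D x| < r) ->
  (forall r, 0 <= r <= 1 -> exists2 d, d \in ds & D r = d.1 + r * d.2) ->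
  (forall d, d \in ds -> (d.1 = 0 /\ d.2 = 0) \/
     forall r, 0 <= r < 1 -> d.1 + r * d.2 <> 0) ->
  D 0 = 0 -> forall r, 0 <= r <= 1 -> D r = 0.
Proof.
move=> cD sel nz D0.
have lt1 r0 : 0 <= r0 < 1 -> D r0 = 0.
  move=> /andP[r00 r01]; apply/eqP; apply: contrapT => /negP Dr0.
  have [q q0 hq] : exists2 q : R, 0 < q & forall d, d \in ds -> (d.1 = 0 /\ d.2 = 0) \/
      forall r, 0 <= r <= r0 -> q <= `|d.1 + r * d.2|.
    apply: seq_eps => [d a b [h|h] b0 ba|d dds]; first by left.
      by right=> r /h; exact: le_trans ba.
    have [h|h] := nz d dds; first by exists 1 => //; left.
    exists (Num.min `|d.1| `|d.1 + r0 * d.2|).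
      rewrite lt_min !normr_gt0; apply/andP; split; apply/eqP; last by apply: h; rewrite r00.
      by have := h 0; rewrite mul0r addr0 lexx ltr01; apply.
    right=> r /andP[r_0 r_1]; rewrite ge_min.
    have a0 : d.1 != 0 by apply/eqP; have := h 0; rewrite mul0r addr0 lexx ltr01; apply.
    have [p|p] := leP 0 (d.1 * d.2).
      apply/orP; left; have [a1|a1] : 0 < d.1 \/ d.1 < 0 by move: a0; case: (ltgtP d.1 0); [right|left|].
        have b1 : 0 <= d.2 by rewrite -(pmulr_rge0 _ a1).
        by rewrite !ger0_norm ?lerDl ?mulr_ge0 ?addr_ge0 ?mulr_ge0 // ltW.
      have b1 : d.2 <= 0 by rewrite -(nmulr_rge0 _ a1).
      rewrite !ler0_norm ?lerN2 ?gerDl ?mulr_ge0_le0 // ltW //.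
      by rewrite -[ltRHS]add0r ltr_leD // mulr_ge0_le0.
    apply/orP; right.
    have e0 : d.1 + r0 * d.2 != 0 by apply/eqP/h; rewrite r00.
    have [a1|a1] : 0 < d.1 \/ d.1 < 0 by move: a0; case: (ltgtP d.1 0); [right|left|].
      have b1 : d.2 < 0 by rewrite -(pmulr_rlt0 _ a1).
      have e1 : 0 < d.1 + r0 * d.2.
        rewrite ltNge; apply/negP => e1.
        apply: (h (- d.1 / d.2)).
          rewrite mulNr -mulrN -invrN divr_ge0 ?ltW ?oppr_gt0 //=.
          apply: le_lt_trans r01; rewrite ler_pdivrMr ?oppr_gt0 //; lra.
        by field; rewrite lt_eqF.
      have e2 : d.1 + r0 * d.2 <= d.1 + r * d.2 by rewrite lerD2l ler_wnM2r // ltW.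
      by rewrite !gtr0_norm // (lt_le_trans e1).
    have b1 : 0 < d.2 by rewrite -(nmulr_rlt0 _ a1).
    have e1 : d.1 + r0 * d.2 < 0.
      rewrite ltNge; apply/negP => e1.
      apply: (h (- d.1 / d.2)).
        rewrite divr_ge0 ?(ltW b1) ?oppr_ge0 ?(ltW a1) //=.
        apply: le_lt_trans r01; rewrite ler_pdivrMr //; lra.
      by field; rewrite gt_eqF.
    have e2 : d.1 + r * d.2 <= d.1 + r0 * d.2 by rewrite lerD2l ler_wpM2r // ltW.
    by rewrite !ltr0_norm ?lerN2 // (le_lt_trans e2).
  have pD : 0 < `|D r0| by rewrite normr_gt0.
  pose th := Num.min 2^-1 (q / (2 * `|D r0|)).
  have th0 : 0 < th by rewrite lt_min invr_gt0 ltr0n divr_gt0 // mulr_gt0.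
  have th1 : th <= 2^-1 by rewrite ge_min lexx.
  have th2 : th * `|D r0| < q.
    have : th <= q / (2 * `|D r0|) by rewrite ge_min lexx orbT.
    rewrite ler_pdivlMr ?mulr_gt0 //; lra.
  have [|||s /andP[s0 sr] Ds] := @ivt D 0 r0 (th * D r0) => //.
  - move=> x /andP[x0 xr] r r_0; have [|d d0 h] := cD x _ r r_0.
      by rewrite x0 (le_trans xr) // ltW.
    exists d => // y /andP[y0 yr]; apply: h; by rewrite y0 (le_trans yr) // ltW.
  - rewrite D0; have := th1; case: (ltgtP (D r0) 0) Dr0 => // lt _ ht.
      by apply/andP; split; nra.
    by apply/andP; split; nra.
  have [|d dds Dd] := sel s; first by rewrite s0 (le_trans sr) // ltW.
  have [[d1 d2]|h] := hq d dds.
    move: Ds; rewrite Dd d1 d2 mulr0 addr0 => /esym/eqP.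
    by rewrite mulf_eq0 gt_eqF //= (negPf Dr0).
  have := h s; rewrite s0 sr => /(_ isT); rewrite -Dd Ds normrM gtr0_norm //.
  by rewrite leNgt th2.
move=> r /andP[r0]; rewrite le_eqVlt => /orP[/eqP ->|r1]; last by apply: lt1; rewrite r0.
apply/eqP; apply: contrapT => /negP D1.
have [||d d0 h] := cD 1 _ `|D 1|; rewrite ?normr_gt0 ?lexx ?ler01 //.
pose y := Num.max 0 (1 - d / 2).
have y1 : 0 <= y < 1.
  by rewrite le_max lexx /= gt_max ltr01 /= ltrBlDr ltrDl divr_gt0.
have := h y; rewrite (lt1 y y1) sub0r normrN ltxx => /(_ _ _)/negP; apply => //.
  by case/andP: y1 => -> /ltW ->.
rewrite ltr0_norm; last by rewrite subr_lt0; case/andP: y1.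
have : 1 - d / 2 <= y by rewrite le_max lexx orbT.
lra.
Qed.

End OneVariable.

Section Selections.
Variables (R : realType) (n : nat) (X : set 'rV[R]_n).
Variables (Pi0 : set (set 'rV[R]_n)) (w0 : set 'rV[R]_n -> rat).
Hypothesis X1 : one_dim_polyhedral_space X.
Hypothesis balX : balanced X Pi0 w0.
Local Notation V := 'rV[R]_n.
Local Notation "'lat' u" := (latv R u) (at level 10, u at level 8).
Implicit Types (x y z v d s : V) (A B sigma tau e S : set V) (Pi : set (set V)).
Implicit Types (u : 'rV[int]_n) (phi f g : V -> R) (c : 'cV[rat]_n * rat).

Let PS0 := structure0 balX.

Definition qform c (x : V) : R := pairing x (map_mx ratr c.1) + ratr c.2.

(** The functions of PA(X) without reference to a structure: in this form sums and maxima
    need no common refinement. *)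
Definition selection phi : Prop := {within X, continuous phi} /\
  exists L : seq ('cV[rat]_n * rat), forall x, X x -> exists2 c, c \in L & phi x = qform c x.

Lemma PA_selection phi : PA X phi -> selection phi.
Proof.
move=> [Pi PS [cphi pa]]; split=> //.
have [l PE] := (finite_seqP Pi).1 (structure_finite PS).
have h sigma : exists c, Pi sigma -> forall x, sigma x -> phi x = qform c x.
  have [Ps|nPs] := pselect (Pi sigma); last by exists (0, 0).
  by have [f [b hf]] := pa _ Ps; exists (f, b) => _ x /hf.
have [c hc] := choice h; exists [seq c sigma | sigma <- l] => x Xx.
have [sigma Ps sx] : (\bigcup_(sigma in Pi) sigma) x by case: PS => _ ->.
exists (c sigma); last exact: hc.
by apply/mapP; exists sigma => //; move: Ps; rewrite PE.
Qed.

Definition qval c (q : 'rV[rat]_n) : rat := (q *m c.1) 0 0 + c.2.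

Lemma qform_rat c (q : 'rV[rat]_n) : qform c (map_mx ratr q) = ratr (qval c q).
Proof. by rewrite /qform /pairing -map_mxM mxE rmorphD. Qed.

Lemma qform_line c x d (t : R) :
  qform c (x + t *: d) = qform c x + t * pairing d (map_mx ratr c.1).
Proof. by rewrite /qform pairingD pairingZ addrAC. Qed.

Lemma two_rational_points Pi e : polyhedral_structure X Pi -> edges Pi e ->
  exists q1 q2 : 'rV[rat]_n, [/\ e (map_mx ratr q1), e (map_mx ratr q2) & q1 <> q2].
Proof.
move=> PS [Pe d1]; have pe := cell_polyhedron PS Pe.
have [x [y [ex ey xy]]] := has_dim1_two d1.
have D0 : 0 < `|y - x| / 2 by rewrite divr_gt0 // normr_gt0 subr_eq0; apply/eqP => /esym.
have [q1 [eq1 h1]] := polyhedron_rational_dense pe ex D0.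
have [q2 [eq2 h2]] := polyhedron_rational_dense pe ey D0.
exists q1, q2; split=> // q12; rewrite q12 in h1.
suff : `|y - x| < `|y - x| by rewrite ltxx.
rewrite {1}(_ : y - x = (map_mx ratr q2 - x) - (map_mx ratr q2 - y)).
  by apply: le_lt_trans (ler_normB _ _) _; lra.
by apply/rowP => l; rewrite !mxE; ring.
Qed.

Lemma map_ratr_inj : injective (map_mx ratr : 'rV[rat]_n -> V).
Proof. by apply: map_mx_inj; exact: fmorph_inj. Qed.

Lemma qform_agree e c c' x y z : collinear e -> e x -> e y -> e z -> x <> y ->
  qform c x = qform c' x -> qform c y = qform c' y -> qform c z = qform c' z.
Proof.
move=> ce ex ey ez xy hx hy; have [t ->] := ce _ _ _ ex ey ez xy.
rewrite !qform_line hx; congr (_ + _ * _).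
rewrite !pairingB; move: hx hy; rewrite /qform; lra.
Qed.

(** Once these points belong to [S], a cell contains no point off [S] where the selection can
    change from one affine function to another. *)
Definition crossings (L : seq ('cV[rat]_n * rat)) : set V :=
  [set x | exists e, [/\ edges Pi0 e, e x & exists c c', [/\ c \in L, c' \in L,
     qform c x = qform c' x & exists2 y, e y & qform c y <> qform c' y]]].

Lemma crossings_finite L : finite_set (crossings L).
Proof.
pose p (e : set V) (cc : ('cV[rat]_n * rat) * ('cV[rat]_n * rat)) : V :=
  xget 0 [set x | [/\ e x, qform cc.1 x = qform cc.2 x &
    exists2 y, e y & qform cc.1 y <> qform cc.2 y]].
have f : finite_set [set p e cc | e in Pi0 & cc in [set` [seq (c, c') | c <- L, c' <- L]]].
  by apply: finite_image2; [exact: structure_finite PS0|exact: finite_seq].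
apply: sub_finite_set f => x [e [Ee ex [c [c' [cL c'L xE [y ey yE]]]]]].
exists e; first exact: Ee.1.
exists (c, c'); first by apply/allpairsP; exists (c, c').
have := @xgetPex _ 0 [set x | [/\ e x, qform c x = qform c' x &
    exists2 y, e y & qform c y <> qform c' y]].
case=> [|ep pE _]; first by exists x; split=> //; exists y.
rewrite -/(p e (c, c')) in ep pE *; apply: contrapT => ne; apply: yE.
exact: qform_agree (cell_collinear X1 PS0 Ee.1) ep ex ey ne pE xE.
Qed.

Lemma crossings_rational L : crossings L `<=` X `&` @rational_points R n.
Proof.
move=> x [e [Ee ex [c [c' [cL c'L xE [y ey yE]]]]]].
split; first exact: cell_sub PS0 Ee.1 _ ex.
have [q1 [q2 [e1 e2 q12]]] := two_rational_points PS0 Ee.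
have ce := cell_collinear X1 PS0 Ee.1.
have q12' : map_mx ratr q1 <> map_mx ratr q2 :> V by move=> /map_ratr_inj.
pose D q := qval c q - qval c' q.
have DE q : qform c (map_mx ratr q) - qform c' (map_mx ratr q) = ratr (D q) :> R.
  by rewrite !qform_rat rmorphB.
have D12 : D q2 - D q1 != 0.
  apply/eqP => D0; apply: yE.
  have [t hy] := ce _ _ _ e1 e2 ey q12'; have [t' hx] := ce _ _ _ e1 e2 ex q12'.
  have E : pairing (map_mx ratr q2 - map_mx ratr q1) (map_mx ratr c.1) =
           pairing (map_mx ratr q2 - map_mx ratr q1) (map_mx ratr c'.1) :> R.
    have := congr1 (@ratr R) D0; rewrite rmorphB /= -!DE rmorph0 /qform !pairingB; lra.
  move: xE; rewrite hx hy !qform_line E; lra.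
exists (q1 + (- D q1 / (D q2 - D q1)) *: (q2 - q1)).
have [t hx] := ce _ _ _ e1 e2 ex q12'.
have D12R : ratr (D q2) - ratr (D q1) != 0 :> R by rewrite -rmorphB fmorph_eq0.
have tE : t = - ratr (D q1) / (ratr (D q2) - ratr (D q1)).
  apply: (canRL (mulfK D12R)); move: xE; rewrite hx !qform_line -!DE !pairingB /qform; lra.
rewrite hx tE; apply/rowP => l; rewrite !mxE.
by rewrite !(rmorphD, rmorphM, rmorphN, fmorphV) /=.
Qed.

Variables (ud : set V -> 'rV[int]_n) (par : set V -> V -> R).
Hypothesis hpar : forall e, edges Pi0 e -> edge_coordinate e (ud e) (par e).
Local Notation good := (good X Pi0).
Local Notation refinement := (refinement Pi0 par).

(** Along a cell the difference with the affine function chosen at one point takes its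
    values among affine functions that vanish identically or have no zero off [S]. *)
Lemma selection_refinement phi : selection phi -> exists B, [/\ finite_set B,
  B `<=` X `&` @rational_points R n &
  forall S, good S -> B `<=` S -> PA_on X (refinement S) phi].
Proof.
move=> [cphi [L hL]]; exists (crossings L).
split; [exact: crossings_finite|exact: crossings_rational|move=> S gS BS].
have PS := refinement_structure X1 balX hpar gS.
split=> // sigma [[s Ss ->]|[e [x [Ee ex Sx ->]]]].
  have [_ SX _ _ _] := gS; have [c _ hc] := hL _ (SX _ Ss).
  by exists c.1, c.2 => y /= ->.
have eX := cell_sub PS0 Ee.1; have [c cL hc] := hL _ (eX _ ex).
exists c.1, c.2 => y cy; have ey := cellS_sub cy; rewrite -/(qform c y).
have xy1 : y = x + 1 *: (y - x) by rewrite scale1r addrC subrK.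
have seg (r : R) : 0 <= r <= 1 -> e (x + r *: (y - x)).
  by move=> r01; apply: polyhedron_convex r01; first exact: cell_polyhedron PS0 Ee.1.
have /within_continuousP cf := cphi.
pose D (r : R) := phi (x + r *: (y - x)) - qform c (x + r *: (y - x)).
pose ds := [seq (qform c0 x - qform c x, pairing (y - x) (map_mx ratr c0.1) -
  pairing (y - x) (map_mx ratr c.1)) | c0 <- L].
have DE c0 (r : R) : qform c0 (x + r *: (y - x)) - qform c (x + r *: (y - x)) =
    (qform c0 x - qform c x) + r * (pairing (y - x) (map_mx ratr c0.1) -
     pairing (y - x) (map_mx ratr c.1)) by rewrite !qform_line; ring.
suff : D 1 = 0 by rewrite /D -xy1 => /eqP; rewrite subr_eq0 => /eqP.
apply: (@selection_zero R D ds); last by rewrite ler01 lexx.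
- move=> r r01 eps eps0.
  have e20 : 0 < eps / 2 by rewrite divr_gt0.
  have [d d0 hd] := cf _ (eX _ (seg _ r01)) _ e20.
  have N0 : 0 < 1 + `|y - x| by rewrite ltr_pwDl.
  pose a := pairing (y - x) (map_mx ratr c.1 : 'cV[R]_n).
  have A0 : 0 < 1 + `|a| by rewrite ltr_pwDl.
  exists (Num.min (d / (1 + `|y - x|)) (eps / 2 / (1 + `|a|))).
    by rewrite lt_min !divr_gt0.
  move=> q q01; rewrite lt_min => /andP[].
  rewrite !ltr_pdivlMr // => h1 h2.
  have -> : D q - D r = (phi (x + q *: (y - x)) - phi (x + r *: (y - x))) - (q - r) * a.
    by rewrite /D !qform_line -/a; ring.
  apply: le_lt_trans (ler_normB _ _) _; rewrite [ltRHS]splitr ltrD //.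
    apply: hd; first exact/eX/seg.
    have -> : x + q *: (y - x) - (x + r *: (y - x)) = (q - r) *: (y - x).
      by rewrite scalerBl opprD addrACA subrr add0r.
    by rewrite normrZ; apply: le_lt_trans h1; rewrite ler_wpM2l // lerDr.
  by rewrite normrM ltr_pdivlMr //; apply: le_lt_trans h2; rewrite ler_wpM2r // ler_wpM2l // lerDr.
- move=> r r01; have [d dL hd] := hL _ (eX _ (seg _ r01)).
  exists (qform d x - qform c x, pairing (y - x) (map_mx ratr d.1) -
    pairing (y - x) (map_mx ratr c.1)); first by apply/mapP; exists d.
  by rewrite /D hd DE.
- move=> _ /mapP[d dL ->] /=.
  have [agree|] := pselect (forall z, e z -> qform d z = qform c z).
    left; have := agree _ ex => h; split; first by rewrite h subrr.
    by have := DE d 1; rewrite -xy1 (agree _ ey) h; lra.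
  move=> nag; right=> r /andP[r0 r1] h.
  have [z ez zE] : exists2 z, e z & qform d z <> qform c z.
    by apply: contrapT => hn; apply: nag => z ez; apply: contrapT => ne; apply: hn; exists z.
  have r01 : 0 <= r <= 1 by rewrite r0 ltW.
  have Sz : S (x + r *: (y - x)).
    apply: BS; exists e; split=> //; first exact: seg.
    exists d, c; split=> //; last by exists z.
    by apply/eqP; rewrite -subr_eq0 DE h.
  have yx : y - x = (par e y - par e x) *: lat (ud e).
    by rewrite {1}(par_pt hpar Ee ex ey) addrC addKr.
  have pE : par e (x + r *: (y - x)) = par e x + r * (par e y - par e x).
    by rewrite yx scalerA (par_shift hpar).
  have xne := par_neq hpar Ee Sz (seg _ r01) ex Sx.
  have [h1 h2] := cy.2 _ Sz (seg _ r01).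
  move: xne h1 h2; rewrite pE; case: ltgtP => // lt _ h1 h2.
    by have := h1 isT; nra.
  by have := h2 isT; nra.
by rewrite /D scale0r addr0 hc subrr.
Qed.

Lemma good_extend S1 : finite_set S1 -> S1 `<=` X `&` @rational_points R n ->
  exists2 S, good S & S1 `<=` S.
Proof.
move=> f1 S1X.
pose P := [set v | Pi0 [set v]].
have hp e : exists q : 'rV[rat]_n, edges Pi0 e -> e (map_mx ratr q).
  have [Ee|] := pselect (edges Pi0 e); last by exists 0.
  by have [q [_ [eq _ _]]] := two_rational_points PS0 Ee; exists q.
have [q hq] := choice hp.
pose Q := [set (map_mx ratr (q e) : V) | e in edges Pi0].
exists (S1 `|` (P `|` Q)); last by move=> x; left.
split.
- rewrite !finite_setU; split=> //; split.
    apply: (@sub_finite_set _ _ ((fun e : set V => xget 0 e) @` Pi0)).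
      move=> v Pv; exists [set v] => //.
      by have := @xgetPex _ 0 [set v] (ex_intro _ v erefl).
    exact: finite_image (structure_finite PS0).
  apply: finite_image; apply: sub_finite_set (structure_finite PS0) => e; exact: proj1.
- move=> x [/S1X[]//|[Pv|[e Ee <-]]]; first by apply: (cell_sub PS0 Pv).
  by apply: (cell_sub PS0 Ee.1); exact: hq.
- move=> x [/S1X[]//|[Pv|[e Ee <-]]]; last by exists (q e).
  exact: polyhedron_point_rational (cell_polyhedron PS0 Pv).
- by move=> v Pv; right; left.
by move=> e Ee; exists (map_mx ratr (q e)); [right; right; exists e|exact: hq].
Qed.

Lemma selection_PA phi : selection phi -> PA X phi.
Proof.
move=> sp; have [B [fB BX hB]] := selection_refinement sp.
have [S gS BS] := good_extend fB BX.
by exists (refinement S); [exact: (refinement_structure X1 balX hpar gS)|exact: hB].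
Qed.

End Selections.

(** * Operations on piecewise affine functions and their Laplacians *)

Section Operations.
Variables (R : realType) (n : nat) (X : set 'rV[R]_n).
Variables (Pi0 : set (set 'rV[R]_n)) (w0 : set 'rV[R]_n -> rat).
Hypothesis X1 : one_dim_polyhedral_space X.
Hypothesis balX : balanced X Pi0 w0.
Variables (ud : set 'rV[R]_n -> 'rV[int]_n) (par : set 'rV[R]_n -> 'rV[R]_n -> R).
Hypothesis hpar : forall e, edges Pi0 e -> edge_coordinate e (ud e) (par e).
Local Notation V := 'rV[R]_n.
Local Notation "'lat' u" := (latv R u) (at level 10, u at level 8).
Local Notation dir := (dir X).
Local Notation wgt := (wgt Pi0 w0).
Local Notation lap := (laplacian X Pi0 w0).
Local Notation good := (good X Pi0).
Local Notation refinement := (refinement Pi0 par).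
Local Notation selection := (selection X).
Implicit Types (x y z v : V) (S : set V) (u : 'rV[int]_n) (f g h : V -> R).

Lemma continuous_lipschitz2 (F : R -> R -> R) K f g : 0 < K ->
  (forall a b a' b', `|F a b - F a' b'| <= K * (`|a - a'| + `|b - b'|)) ->
  {within X, continuous f} -> {within X, continuous g} ->
  {within X, continuous (fun x => F (f x) (g x))}.
Proof.
move=> K0 hF /within_continuousP cf /within_continuousP cg.
apply/within_continuousP => x Xx e e0.
have e1 : 0 < e / K / 2 by rewrite !divr_gt0.
have [d d0 hd] := cf x Xx _ e1; have [d' d'0 hd'] := cg x Xx _ e1.
exists (Num.min d d'); first by rewrite lt_min d0.
move=> y Xy; rewrite lt_min => /andP[yx yx'].
apply: le_lt_trans (hF _ _ _ _) _; rewrite mulrC -ltr_pdivlMr // [ltRHS]splitr ltrD //.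
  exact: hd.
exact: hd'.
Qed.

Lemma within_continuous_eq f g : {within X, continuous f} -> (forall x, X x -> g x = f x) ->
  {within X, continuous g}.
Proof.
move=> /within_continuousP cf E; apply/within_continuousP => x Xx e e0.
have [d d0 hd] := cf x Xx e e0; exists d => // y Xy yx.
by rewrite !E //; exact: hd.
Qed.

Lemma selection_eq f g : selection f -> (forall x, X x -> g x = f x) -> selection g.
Proof.
move=> [cf [L hL]] E; split; first exact: within_continuous_eq cf E.
by exists L => x Xx; rewrite E //; exact: hL.
Qed.

Lemma selection_form c : selection (qform c : V -> R).
Proof.
split; last by exists [:: c] => x _; exists c => //; rewrite inE.
have [K K0 hK] := pairing_bound (map_mx ratr c.1 : 'cV[R]_n).
apply/within_continuousP => x _ e e0; exists (e / K); first by rewrite divr_gt0.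
move=> y _; rewrite ltr_pdivlMr // mulrC => yx; apply: le_lt_trans yx.
apply: le_trans (hK _); rewrite /qform pairingB.
by rewrite (_ : _ + _ - _ = pairing y (map_mx ratr c.1) - pairing x (map_mx ratr c.1)) //; ring.
Qed.

Lemma selection_cst (r : rat) : selection (fun=> ratr r).
Proof.
apply: selection_eq (selection_form (0, r)) _ => x _.
by rewrite /qform /= map_mx0 pairing0r add0r.
Qed.

Lemma selection_op (F : R -> R -> R) (G : 'cV[rat]_n * rat -> 'cV[rat]_n * rat -> seq ('cV[rat]_n * rat)) K f g :
  0 < K ->
  (forall a b a' b', `|F a b - F a' b'| <= K * (`|a - a'| + `|b - b'|)) ->
  (forall c d x, exists2 c', c' \in G c d & F (qform c x) (qform d x) = qform c' x :> R) ->
  selection f -> selection g -> selection (fun x => F (f x) (g x)).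
Proof.
move=> K0 hF hG [cf [L hL]] [cg [L' hL']]; split; first exact: continuous_lipschitz2 K0 hF cf cg.
exists (flatten [seq G c d | c <- L, d <- L']) => x Xx.
have [c cL ->] := hL _ Xx; have [d dL ->] := hL' _ Xx.
have [c' c'G ->] := hG c d x; exists c' => //; apply/flattenP; exists (G c d) => //.
by apply/allpairsP; exists (c, d).
Qed.

Lemma selectionD f g : selection f -> selection g -> selection (fun x => f x + g x).
Proof.
apply: (@selection_op _ (fun c d => [:: (c.1 + d.1, c.2 + d.2)]) 1) => //.
  by move=> a b a' b'; rewrite mul1r opprD addrACA ler_normD.
move=> c d x; exists (c.1 + d.1, c.2 + d.2); first by rewrite inE.
by rewrite /qform /= map_mxD rmorphD pairingDr addrACA.
Qed.

Lemma selection_max f g : selection f -> selection g ->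
  selection (fun x => Num.max (f x) (g x)).
Proof.
apply: (@selection_op _ (fun c d => [:: c; d]) 1) => //.
  move=> a b a' b'; rewrite mul1r.
  have na := ler_norm (a - a'); have nb := ler_norm (b - b').
  have na' := ler_norm (a' - a); have nb' := ler_norm (b' - b).
  have := normr_ge0 (a - a'); have := normr_ge0 (b - b').
  rewrite distrC in na'; rewrite distrC in nb'.
  by rewrite ler_norml; case: (leP a b); case: (leP a' b') => *; apply/andP; split; lra.
move=> c d x; case: leP => _; [exists d|exists c] => //; by rewrite !inE eqxx ?orbT.
Qed.

Lemma selectionZ (r : rat) f : selection f -> selection (fun x => ratr r * f x).
Proof.
move=> sf.
apply: (@selection_op (fun a _ => ratr r * a) (fun c _ => [:: (r *: c.1, r * c.2)]) (1 + `|ratr r|) f f) => //.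
  by move=> a b a' b'; rewrite -mulrBr normrM ler_pM ?lerDr ?lerDl.
move=> c d x; exists (r *: c.1, r * c.2); first by rewrite inE.
by rewrite /qform /= map_mxZ rmorphM pairingZr mulrDr.
Qed.

Lemma selectionN f : selection f -> selection (fun x => - f x).
Proof.
by move=> /(selectionZ (-1))/selection_eq; apply=> x _; rewrite rmorphN rmorph1 mulN1r.
Qed.

Lemma selectionB f g : selection f -> selection g -> selection (fun x => f x - g x).
Proof. by move=> sf /selectionN; exact: selectionD. Qed.

Lemma selection_min f g : selection f -> selection g ->
  selection (fun x => Num.min (f x) (g x)).
Proof.
move=> /selectionN sf /selectionN sg; apply: selection_eq (selectionN (selection_max sf sg)) _.
by move=> x _; rewrite oppr_max !opprK.
Qed.

(** ** The Laplacian *)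

Definition locally_affine f : Prop :=
  forall v u, X v -> dir v u -> has_slope f v u (slope f v u).

Lemma selection_locally_affine f : selection f -> locally_affine f.
Proof.
move=> /(selection_PA X1 balX hpar)[Pi PS pa] v u Xv du.
exact: (PA_on_slope X1 PS pa du).
Qed.

Lemma has_slopeD f g v u a b : has_slope f v u a -> has_slope g v u b ->
  has_slope (fun x => f x + g x) v u (a + b).
Proof.
move=> [t t0 h] [t' t'0 h']; exists (Num.min t t'); first by rewrite lt_min t0.
move=> s /andP[s0]; rewrite le_min => /andP[st st'].
by rewrite h ?s0 // h' ?s0 //; ring.
Qed.

Lemma has_slopeZ (r : R) f v u a : has_slope f v u a ->
  has_slope (fun x => r * f x) v u (r * a).
Proof. by move=> [t t0 h]; exists t => // s /h ->; ring. Qed.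

Lemma has_slope_cst (r : R) v u : has_slope (fun=> r) v u 0.
Proof. by exists 1 => // s _; rewrite mulr0 addr0. Qed.

Lemma has_slope_near f g v u a : has_slope f v u a -> f v = g v ->
  germ [set y | f y = g y] v (lat u) -> has_slope g v u a.
Proof.
move=> [t t0 h] fg [t' t'0 h']; exists (Num.min t t'); first by rewrite lt_min t0.
move=> s /andP[s0]; rewrite le_min => /andP[st st'].
by have := h' s; rewrite s0 st' => /(_ isT) /= <-; rewrite h ?s0 // fg.
Qed.

Lemma slope_near f g v u : f v = g v -> germ [set y | f y = g y] v (lat u) ->
  slope f v u = slope g v u.
Proof.
move=> fg gfg; rewrite /slope; congr xget; apply/seteqP; split=> a /= ha.
  exact: has_slope_near ha fg gfg.
apply: (has_slope_near ha) (esym fg) _.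
by apply: germS gfg => y /= ->.
Qed.

Lemma laplacian_near f g v r : X v -> 0 < r ->
  (forall y, X y -> `|y - v| < r -> f y = g y) -> lap f v = lap g v.
Proof.
move=> Xv r0 h; apply: eq_fsbigr => u; rewrite inE => -[pu [t t0 gX]]; congr (_ * _).
apply: slope_near; first by apply: h => //; rewrite subrr normr0.
have N0 : 0 < 1 + `|lat u| by rewrite ltr_pwDl.
exists (Num.min t (r / 2 / (1 + `|lat u|))); first by rewrite lt_min t0 !divr_gt0.
move=> s /andP[s0]; rewrite le_min ler_pdivlMr // => /andP[st sr] /=.
apply: h; first by apply: gX; rewrite s0.
rewrite addrC addKr normrZ ger0_norm //; apply: le_lt_trans (_ : r / 2 < r); last by lra.
by apply: le_trans sr; rewrite ler_wpM2l // lerDr.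
Qed.

Lemma laplacian_eq f g v : X v -> (forall y, X y -> f y = g y) -> lap f v = lap g v.
Proof. by move=> Xv h; apply: (laplacian_near Xv ltr01) => y /h. Qed.

Lemma laplacianD f g v : X v -> locally_affine f -> locally_affine g ->
  lap (fun x => f x + g x) v = lap f v + lap g v.
Proof.
move=> Xv lf lg; rewrite /laplacian -fsbig_split; last exact: dir_finite X1 balX _ Xv.
apply: eq_fsbigr => u; rewrite inE => du /=; rewrite -mulrDr; congr (_ * _).
by apply: slopeE; apply: has_slopeD; [exact: lf|exact: lg].
Qed.

Lemma laplacianZ (r : R) f v : X v -> locally_affine f ->
  lap (fun x => r * f x) v = r * lap f v.
Proof.
move=> Xv lf; rewrite /laplacian mulr_fsumr.
apply: eq_fsbigr => u; rewrite inE => du /=; rewrite mulrCA; congr (_ * _).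
by apply: slopeE; apply: has_slopeZ; exact: lf.
Qed.

Lemma laplacian_cst (r : R) v : lap (fun=> r) v = 0.
Proof.
apply: fsbig1 => u _; rewrite (slopeE (has_slope_cst r v u)) mulr0 //.
Qed.

Lemma locally_affineD f g : locally_affine f -> locally_affine g ->
  locally_affine (fun x => f x + g x).
Proof.
move=> lf lg v u Xv du; have h := has_slopeD (lf v u Xv du) (lg v u Xv du).
by rewrite (slopeE h).
Qed.

Lemma locally_affineZ (r : R) f : locally_affine f -> locally_affine (fun x => r * f x).
Proof. by move=> lf v u Xv du; have h := has_slopeZ r (lf v u Xv du); rewrite (slopeE h). Qed.

Lemma locally_affine_cst (r : R) : locally_affine (fun=> r).
Proof. by move=> v u _ _; have h := has_slope_cst r v u; rewrite (slopeE h). Qed.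

Lemma locally_affine_sum (T : Type) (r : seq T) (c : T -> R) (F : T -> V -> R) :
  (forall i, locally_affine (F i)) ->
  locally_affine (fun x => \sum_(i <- r) c i * F i x).
Proof.
move=> h; elim: r => [|i r IH].
  have -> : (fun x => \sum_(i <- [::]) c i * F i x) = fun=> 0 by apply/funext => x; rewrite big_nil.
  exact: locally_affine_cst.
have -> : (fun x => \sum_(j <- i :: r) c j * F j x) =
   fun x => c i * F i x + \sum_(j <- r) c j * F j x by apply/funext => x; rewrite big_cons.
by apply: locally_affineD => //; exact: locally_affineZ.
Qed.

Lemma laplacian_sum (T : Type) (r : seq T) (c : T -> R) (F : T -> V -> R) v : X v ->
  (forall i, locally_affine (F i)) ->
  lap (fun x => \sum_(i <- r) c i * F i x) v = \sum_(i <- r) c i * lap (F i) v.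
Proof.
move=> Xv h; elim: r => [|i r IH].
  have -> : (fun x => \sum_(i <- [::]) c i * F i x) = fun=> 0 by apply/funext => x; rewrite big_nil.
  by rewrite laplacian_cst big_nil.
have -> : (fun x => \sum_(j <- i :: r) c j * F j x) =
   fun x => c i * F i x + \sum_(j <- r) c j * F j x by apply/funext => x; rewrite big_cons.
rewrite big_cons laplacianD //; [|exact: locally_affineZ|exact: locally_affine_sum].
by rewrite laplacianZ // IH.
Qed.

(** ** The measure of a piecewise affine function *)

Definition mint f g : R := \sum_(v \in X) lap f v * g v.

Lemma good_rational S v : good S -> S v -> rational_points v.
Proof. by case=> _ _ h _ _; exact: h. Qed.

Lemma selections_good f g S1 : selection f -> selection g -> finite_set S1 ->
  S1 `<=` X `&` @rational_points R n ->
  exists S, [/\ good S, S1 `<=` S, PA_on X (refinement S) f & PA_on X (refinement S) g].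
Proof.
move=> sf sg f1 r1.
have [B [fB rB hB]] := selection_refinement X1 balX hpar sf.
have [B' [fB' rB' hB']] := selection_refinement X1 balX hpar sg.
have [||S gS sub] := @good_extend _ _ _ _ _ balX (S1 `|` (B `|` B')).
- by rewrite !finite_setU.
- by move=> x [/r1//|[/rB//|/rB'//]].
exists S; split=> //; first by move=> x ?; apply: sub; left.
  by apply: hB => // x ?; apply: sub; right; left.
by apply: hB' => // x ?; apply: sub; right; right.
Qed.

Lemma refinement_pointP S v : good S -> refinement S [set v] -> S v.
Proof.
move=> gS [[s Ss E]|[e [x [Ee ex Sx E]]]].
  by have -> : v = s; [have : [set v] v by []|]; rewrite ?E.
have xv : x = v by have := cellS_self par S ex; rewrite -E.
have [gu _] := cellS_interior balX hpar gS Ee ex Sx (cellS_self par S ex) Sx.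
have [y [z [+ + yz]]] := germ_two (lat_neq0 R (ud_prim hpar Ee)) gu.
by rewrite -E /= => yv zv; case: yz; rewrite yv zv.
Qed.

Lemma laplacian_outside S f v : good S -> PA_on X (refinement S) f -> X v -> ~ S v ->
  lap f v = 0.
Proof.
move=> gS pa Xv Sv; apply: (laplacian_interior X1 balX (refinement_weight X1 balX hpar gS) pa Xv).
by move/(refinement_pointP gS).
Qed.

Lemma mintE S f g : good S -> PA_on X (refinement S) f ->
  mint f g = \sum_(v <- fset_set S) lap f v * g v.
Proof.
move=> gS pa; have [fS SX _ _ _] := gS; rewrite -fsbig_finite //.
symmetry; apply: fsbig_widen => // v [Xv Sv] /=.
by rewrite (laplacian_outside gS pa Xv Sv) mul0r.
Qed.

Lemma integral_MA_PAE f g : PA X f -> integral_MA_PA X Pi0 w0 f g = mint f g.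
Proof.
move=> pf; have sf := PA_selection pf.
have [||S [gS _ pa _]] := @selections_good f f set0 sf sf => //.
have : [set Pi | weight_defined_on X Pi0 w0 Pi /\ PA_on X Pi f] (MA_structure X Pi0 w0 f).
  apply: xgetPex; exists (refinement S); split=> //.
  exact: (refinement_weight X1 balX hpar gS).
set Pi := MA_structure X Pi0 w0 f => -[wd paf]; have [PS _] := wd.
have E : vertices Pi = [set v | Pi [set v]].
  by apply/seteqP; split=> v /= => [[]//|Pv]; split=> //; exact: has_dim0_point.
rewrite /integral_MA_PA -/Pi E /mint.
transitivity (\sum_(v \in [set v | Pi [set v]]) lap f v * g v).
  by apply: eq_fsbigr => v; rewrite inE /= => Pv; rewrite (MA_atomE X1 balX wd paf Pv).
apply: fsbig_widen => v /= => [Pv|[Xv Pv]]; first by apply: (cell_sub PS Pv).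
by rewrite (laplacian_interior X1 balX wd paf Xv Pv) mul0r.
Qed.

Lemma mint_eqr f g h : (forall x, X x -> g x = h x) -> mint f g = mint f h.
Proof. by move=> E; apply: eq_fsbigr => v; rewrite inE => Xv; rewrite E. Qed.

Lemma mint_eql f g h : (forall x, X x -> f x = g x) -> mint f h = mint g h.
Proof. by move=> E; apply: eq_fsbigr => v; rewrite inE => Xv; rewrite (laplacian_eq Xv E). Qed.

Lemma mintDl f g h : selection f -> selection g ->
  mint (fun x => f x + g x) h = mint f h + mint g h.
Proof.
move=> sf sg; have [||S [gS _ pf pg]] := @selections_good f g set0 sf sg => //.
have [_ SX _ _ _] := gS; have fS : finite_set S by case: gS.
have pfg : PA_on X (refinement S) (fun x => f x + g x).
  have [cf hf] := pf; have [cg hg] := pg; split.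
    by apply: (@continuous_lipschitz2 (fun a b => a + b) 1) => // *; rewrite mul1r opprD addrACA ler_normD.
  move=> sigma Rs; have [[l [c hl]] [l' [c' hl']]] := (hf _ Rs, hg _ Rs).
  exists (l + l'), (c + c') => x sx.
  by rewrite (hl _ sx) (hl' _ sx) map_mxD rmorphD /= pairingDr addrACA.
rewrite !(mintE _ gS) // -big_split /= !big_seq; apply: eq_bigr => v.
rewrite in_fset_set // inE => Sv; rewrite -mulrDl; congr (_ * _).
by apply: laplacianD; [exact: SX|exact: selection_locally_affine|exact: selection_locally_affine].
Qed.

Lemma mintDr f g h : selection f -> mint f (fun x => g x + h x) = mint f g + mint f h.
Proof.
move=> sf; have [||S [gS _ pf _]] := @selections_good f f set0 sf sf => //.
by rewrite !(mintE _ gS) // -big_split /=; apply: eq_bigr => v _; rewrite mulrDr.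
Qed.

Lemma mintZr f g (r : R) : mint f (fun x => r * g x) = r * mint f g.
Proof. by rewrite /mint mulr_fsumr; apply: eq_fsbigr => v _; rewrite mulrCA. Qed.

Lemma mintNr f g : mint f (fun x => - g x) = - mint f g.
Proof.
rewrite -mulN1r -mintZr; congr mint; apply/funext => x; by rewrite mulN1r.
Qed.

Lemma mintZl f g (r : R) : selection f -> mint (fun x => r * f x) g = r * mint f g.
Proof.
move=> sf; rewrite /mint mulr_fsumr; apply: eq_fsbigr => v; rewrite inE => Xv.
by rewrite laplacianZ ?mulrA //; exact: selection_locally_affine.
Qed.

Lemma mint_le f g h : selection f -> (forall x, X x -> 0 <= lap f x) ->
  (forall x, X x -> g x <= h x) -> mint f g <= mint f h.
Proof.
move=> sf pos gh; have [||S [gS _ pf _]] := @selections_good f f set0 sf sf => //.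
have [fS SX _ _ _] := gS; rewrite !(mintE _ gS) // !big_seq; apply: ler_sum => v.
by rewrite in_fset_set // inE => /SX Xv; rewrite ler_wpM2l ?pos ?gh.
Qed.

End Operations.

(** * Polyhedral convexity means nonnegative Laplacian *)

Section OneVariableConvexity.
Variable R : realType.

(** Otherwise let [k] be [F] minus its chord, with a small multiple of the square of the
    parameter added; at an interior maximum of [k] the two one-sided slopes of [F] would
    have a negative sum. *)
Lemma slope_chord (F : R -> R) (T m : R) : 0 < T ->
  (forall x, 0 <= x <= T -> forall r, 0 < r -> exists2 d, 0 < d &
    forall y, 0 <= y <= T -> `|y - x| < d -> `|F y - F x| < r) ->
  (forall s, 0 < s < T -> exists r l e, [/\ 0 < e, 0 <= r + l,
     forall h, 0 <= h <= e -> F (s + h) = F s + h * r &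
     forall h, 0 <= h <= e -> F (s - h) = F s + h * l]) ->
  (exists2 e, 0 < e & forall h, 0 <= h <= e -> F h = F 0 + h * m) ->
  F 0 + T * m <= F T.
Proof.
move=> T0 cF conv [e0 e00 he0]; rewrite leNgt; apply/negP => lt.
pose c := (F T - F 0) / T.
have cm : c < m by rewrite /c ltr_pdivrMr // ltrBlDl mulrC.
have FT : F T = F 0 + c * T by rewrite /c divfK ?gt_eqF // addrC subrK.
pose h0 := Num.min e0 (T / 2).
have h00 : 0 < h0 by rewrite lt_min e00 divr_gt0.
have h0T : h0 < T by rewrite /h0 gt_min; apply/orP; right; lra.
have Fh0 : F h0 = F 0 + h0 * m by apply: he0; rewrite ltW //= ge_min lexx.
pose eta := (m - c) * h0 / (2 * T ^+ 2).
have T2 : 0 < T ^+ 2 by rewrite exprn_gt0.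
have eta0 : 0 < eta by rewrite divr_gt0 ?mulr_gt0 // subr_gt0.
have etaT : eta * T ^+ 2 = (m - c) * h0 / 2.
  by rewrite /eta; field; rewrite gt_eqF.
pose K s := F s - F 0 - c * s + eta * s ^+ 2.
have cK : {within `[0, T], continuous K}.
  apply/within_continuousP => x /=; rewrite in_itv /= => xT r r0.
  have r2 : 0 < r / 2 by rewrite divr_gt0.
  have [d d0 hd] := cF x xT _ r2.
  pose C := `|c| + eta * (2 * T) + 1.
  have C0 : 0 < C.
    by rewrite /C; have := mulr_gt0 eta0 T0; have := normr_ge0 c; lra.
  exists (Num.min d (r / 2 / C)); first by rewrite lt_min d0 divr_gt0.
  move=> y; rewrite /= in_itv /= lt_min => yT /andP[yd]; rewrite ltr_pdivlMr // => yC.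
  have -> : K y - K x = (F y - F x) + (y - x) * (eta * (y + x) - c) by rewrite /K; ring.
  apply: le_lt_trans (ler_normD _ _) _; rewrite [ltRHS]splitr ltrD ?hd // normrM.
  apply: le_lt_trans yC; rewrite ler_wpM2l //.
  apply: le_trans (ler_normB _ _) _; rewrite /C addrC -addrA lerD2l.
  move: xT yT => /andP[x0 xT] /andP[y0 yT].
  rewrite ger0_norm; last by apply: mulr_ge0; [exact: ltW|exact: addr_ge0].
  apply: le_trans (_ : eta * (2 * T) <= _); last by rewrite lerDl.
  by apply: ler_wpM2l; [exact: ltW|lra].
have [z] := EVT_max (ltW T0) cK; rewrite in_itv /= => /andP[z0 zT] zmax.
have Kh0 : (m - c) * h0 < K h0.
  by rewrite /K Fh0 -subr_gt0; have := mulr_gt0 eta0 (exprn_gt0 2 h00); lra.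
have Kz : (m - c) * h0 < K z.
  by apply: lt_le_trans Kh0 (zmax _ _); rewrite in_itv /= !ltW.
have mh : 0 < (m - c) * h0 by rewrite mulr_gt0 // subr_gt0.
have zz : 0 < z.
  rewrite lt_neqAle z0 andbT; apply/eqP => zE; move: Kz; rewrite -zE /K expr0n /=; lra.
have zT' : z < T.
  rewrite lt_neqAle zT andbT; apply/eqP => zE; move: Kz; rewrite zE /K FT etaT; lra.
have [|r [l [e [e1 rl hr hl]]]] := conv z; first by rewrite zz.
pose h := Num.min e (Num.min z (T - z)).
have h1 : 0 < h by rewrite !lt_min e1 zz subr_gt0.
have he : h <= e by rewrite ge_min lexx.
have hz : h <= z by rewrite !ge_min lexx orbT.
have hT : h <= T - z by rewrite !ge_min lexx !orbT.
have K1 : K (z - h) <= K z by apply: zmax; rewrite in_itv /=; apply/andP; split; lra.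
have K2 : K (z + h) <= K z by apply: zmax; rewrite in_itv /=; apply/andP; split; lra.
have hh0 : 0 <= h <= e by rewrite he ltW.
move: K1 K2; rewrite /K (hr _ hh0) (hl _ hh0) => K1 K2.
have hh := mulr_gt0 eta0 (exprn_gt0 2 h1).
have := mulr_ge0 (ltW h1) rl; nra.
Qed.

End OneVariableConvexity.

Section Convexity.
Variables (R : realType) (n : nat) (X : set 'rV[R]_n).
Variables (Pi0 : set (set 'rV[R]_n)) (w0 : set 'rV[R]_n -> rat).
Hypothesis X1 : one_dim_polyhedral_space X.
Hypothesis balX : balanced X Pi0 w0.
Variables (ud : set 'rV[R]_n -> 'rV[int]_n) (par : set 'rV[R]_n -> 'rV[R]_n -> R).
Hypothesis hpar : forall e, edges Pi0 e -> edge_coordinate e (ud e) (par e).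
Local Notation V := 'rV[R]_n.
Local Notation "'lat' u" := (latv R u) (at level 10, u at level 8).
Local Notation dir := (dir X).
Local Notation wgt := (wgt Pi0 w0).
Local Notation lap := (laplacian X Pi0 w0).
Local Notation good := (good X Pi0).
Local Notation refinement := (refinement Pi0 par).
Local Notation selection := (selection X).
Implicit Types (x y z v : V) (S sigma tau e : set V) (u : 'rV[int]_n) (f g h : V -> R).
Implicit Types (Pi : set (set V)).

Lemma dir_nonempty x : X x -> exists u, dir x u.
Proof.
move=> Xx; have PS := structure0 balX.
have [Px|nPx] := pselect (Pi0 [set x]); last first.
  by have [e [u [_ _ _ _ ->]]] := dir_interior X1 PS Xx nPx; exists u; left.
have [e Ee ex] := space_edge X1 PS Xx.
have Se : star Pi0 x e by split=> //; exact: cell_vertex_face PS Ee.1 Px ex.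
have [pp gp] := primitive_vectorP X1 PS Se.
by exists (primitive_vector e x); exact: germ_dir PS Ee.1 pp gp.
Qed.

Lemma wgt_opp x u : X x -> prim u -> dir x = [set u; - u] -> wgt x u = wgt x (- u).
Proof.
move=> Xx pu E; have := balance X1 balX Xx; rewrite E fsbig_opp // latvN scalerN.
move=> /eqP; rewrite subr_eq0 => /eqP /(congr1 (fun z => z - ratr (wgt x (- u)) *: lat u)).
rewrite subrr -scalerBl => /eqP; rewrite scaler_eq0 (negPf (lat_neq0 R pu)) orbF subr_eq0.
by move=> /eqP /fmorph_inj.
Qed.

Lemma laplacian_line f x u : X x -> prim u -> dir x = [set u; - u] ->
  lap f x = ratr (wgt x u) * (slope f x u + slope f x (- u)).
Proof.
by move=> Xx pu E; rewrite /laplacian E fsbig_opp // -(wgt_opp Xx pu E) mulrDr.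
Qed.

(** Such a point is not extremal in its cell, hence not a vertex of the structure. *)
Lemma dir_segment Pi sigma v u (t s : R) : polyhedral_structure X Pi -> Pi sigma -> prim u ->
  sigma v -> sigma (v + t *: lat u) -> 0 < s < t ->
  [/\ X (v + s *: lat u), dir (v + s *: lat u) u, dir (v + s *: lat u) (- u) &
      dir (v + s *: lat u) = [set u; - u]].
Proof.
move=> PS Ps pu sv svt /andP[s0 st]; have ps := cell_polyhedron PS Ps.
set y := v + s *: lat u.
have t0 : 0 < t by apply: lt_trans st.
have sy : sigma y.
  have := @polyhedron_convex _ _ _ _ _ (s / t) ps sv svt.
  rewrite [v + _ - v]addrC addKr scalerA divfK ?gt_eqF //; apply.
  by rewrite divr_ge0 ?(ltW s0) ?(ltW t0) //= ler_pdivrMr // mul1r ltW.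
have ts : 0 < t - s by rewrite subr_gt0.
have yt : y + (t - s) *: lat u = v + t *: lat u by rewrite /y -addrA -scalerDl [s + _]addrC subrK.
have yv : y + s *: lat (- u) = v by rewrite /y latvN scalerN addrK.
have g1 : germ sigma y (lat u) by apply: germ_convex ts sy _ => //; rewrite yt.
have g2 : germ sigma y (lat (- u)) by apply: germ_convex s0 sy _ => //; rewrite yv.
have d1 : dir y u := germ_dir PS Ps pu g1.
have d2 : dir y (- u) := germ_dir PS Ps (primN pu) g2.
have Xy : X y := cell_sub PS Ps sy.
split=> //; have nPy : ~ Pi [set y].
  move=> Py; have fy := cell_vertex_face PS Ps Py sy.
  apply: (face_extreme fy ts s0 (lat_neq0 R pu)); first by rewrite yt.
  by rewrite -scalerN -latvN yv.
have [e [u' [Ee pu' _ _ E]]] := dir_interior X1 PS Xy nPy.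
have := d1; rewrite {1}E => -[->|->]; first exact: E.
by rewrite E opprK setUC.
Qed.

Lemma segment_continuous f v d (T : R) : {within X, continuous f} ->
  (forall r, 0 <= r <= T -> X (v + r *: d)) ->
  forall a, 0 <= a <= T -> forall r, 0 < r -> exists2 q, 0 < q &
    forall b, 0 <= b <= T -> `|b - a| < q -> `|f (v + b *: d) - f (v + a *: d)| < r.
Proof.
move=> /within_continuousP cf sX a aT r r0.
have [q q0 hq] := cf _ (sX _ aT) _ r0.
have N0 : 0 < 1 + `|d| by rewrite ltr_pwDl.
exists (q / (1 + `|d|)); first by rewrite divr_gt0.
move=> b bT; rewrite ltr_pdivlMr // => ba; apply: hq; first exact: sX.
have -> : v + b *: d - (v + a *: d) = (b - a) *: d.
  by rewrite scalerBl opprD addrACA subrr add0r.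
by rewrite normrZ; apply: le_lt_trans ba; rewrite ler_wpM2l // lerDr.
Qed.

Lemma convex_segment Pi sigma v d (t : R) : polyhedral_structure X Pi -> Pi sigma ->
  sigma v -> sigma (v + t *: d) -> 0 < t -> forall r, 0 <= r <= t -> sigma (v + r *: d).
Proof.
move=> PS Ps sv svt t0 r /andP[r0 rt].
have := @polyhedron_convex _ _ _ _ _ (r / t) (cell_polyhedron PS Ps) sv svt.
rewrite [v + _ - v]addrC addKr scalerA divfK ?gt_eqF //; apply.
by rewrite divr_ge0 ?(ltW t0) //= ler_pdivrMr // mul1r.
Qed.

(** On a segment of a cell the Laplacian is a positive multiple of the sum of the two
    one-sided slopes, so that [f] is convex there. *)
Lemma laplacian_gradient f Pi sigma v u (t : R) : selection f ->
  (forall s, 0 < s < t -> 0 <= lap f (v + s *: lat u)) ->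
  polyhedral_structure X Pi -> Pi sigma -> prim u ->
  sigma v -> sigma (v + t *: lat u) -> 0 < t ->
  f v + t * slope f v u <= f (v + t *: lat u).
Proof.
move=> sf lf PS Ps pu sv svt t0.
have seg := convex_segment PS Ps sv svt t0.
have la := selection_locally_affine X1 balX hpar sf.
have Xv := cell_sub PS Ps sv.
have du : dir v u by apply: (germ_dir PS Ps pu); exact: germ_convex (cell_polyhedron PS Ps) t0 sv svt.
have := @slope_chord R (fun s => f (v + s *: lat u)) t (slope f v u) t0.
rewrite scale0r addr0; apply.
- apply: segment_continuous; first by case: sf.
  by move=> r /seg /(cell_sub PS Ps).
- move=> s st; have [Xy d1 d2 E] := dir_segment PS Ps pu sv svt st.
  set y := v + s *: lat u in Xy d1 d2 E *.
  have [e1 e10 h1] := la _ _ Xy d1; have [e2 e20 h2] := la _ _ Xy d2.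
  exists (slope f y u), (slope f y (- u)), (Num.min e1 e2); split.
  + by rewrite lt_min e10.
  + have := lf s st; rewrite (laplacian_line _ Xy pu E) pmulr_rge0 // ltr0q.
    exact: (wgt_gt0 X1 balX d1).
  + move=> h /andP[h0]; rewrite le_min => /andP[he _].
    by rewrite scalerDl addrA h1 // h0.
  move=> h /andP[h0]; rewrite le_min => /andP[_ he].
  by rewrite scalerBl addrA -scalerN -latvN h2 // h0.
have [e e0 he] := la _ _ Xv du.
by exists e.
Qed.

Hypothesis smX : polyhedrally_smooth X Pi0 w0.

Lemma dir_sum_ord (W : zmodType) (F : 'rV[int]_n -> W) x : X x ->
  \sum_(u \in dir x) F u =
  \sum_(i < size (fset_set (dir x))) F (nth 0 (fset_set (dir x)) i).
Proof.
move=> Xx; rewrite fsbig_finite; last exact: (dir_finite X1 balX Xx).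
by rewrite (big_nth 0) big_mkord.
Qed.

Lemma row_free_real r m (B : 'M[int]_(r, m)) :
  (forall a : 'rV[int]_r, a *m B = 0 -> a = 0) -> row_free (map_mx intr B : 'M[R]_(r, m)).
Proof.
move=> h.
have -> : map_mx intr B = map_mx ratr (map_mx intr B : 'M[rat]_(r, m)) :> 'M[R]_(r, m).
  by apply/matrixP => i j; rewrite !mxE ratr_int.
rewrite row_free_map -kermx_eq0; apply/eqP/row_matrixP => i; rewrite row0.
have : row i (kermx (map_mx intr B : 'M[rat]_(r, m))) *m map_mx intr B = 0.
  by rewrite -row_mul mulmx_ker row0.
set q := row i _ => qB; have [z [d [d0 qE]]] := clear_denominators q.
have zB : z *m B = 0.
  apply/rowP => j; rewrite [RHS]mxE; move/rowP: qB => /(_ j).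
  rewrite qE -scalemxAl -map_mxM [RHS]mxE [LHS]mxE [X in _ * X]mxE => /eqP.
  by rewrite mulf_eq0 gt_eqF //= intr_eq0 => /eqP.
by rewrite qE (h _ zB); apply/rowP => j; rewrite !mxE mulr0.
Qed.

(** Smoothness makes the rank of the span of the directions one less than their number,
    so their linear relations form a line, and balancing provides a generator of it. *)
Lemma tangent_relation x (a : 'rV[int]_n -> R) : X x ->
  \sum_(u \in dir x) a u *: lat u = 0 ->
  exists c, forall u, dir x u -> a u = c * ratr (wgt x u).
Proof.
move=> Xx aE; have fd := dir_finite X1 balX Xx.
have w0R u : dir x u -> 0 < ratr (wgt x u) :> R.
  by move=> du; rewrite ltr0q; exact: (wgt_gt0 X1 balX du).
(* Smoothness is a condition at vertices, and these are rational; elsewhere the space is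
   locally a line. *)
have [rx|nrx] := pselect (rational_points x); last first.
  have PS := structure0 balX.
  have nP : ~ Pi0 [set x].
    by move=> P0; apply: nrx; exact: polyhedron_point_rational (cell_polyhedron PS P0).
  have [e [u [Ee pu g1 g2 E]]] := dir_interior X1 PS Xx nP.
  have du : dir x u by rewrite E; left.
  exists (a u / ratr (wgt x u)); rewrite E => w /= [->|->].
    by rewrite divfK // gt_eqF // w0R.
  rewrite -(wgt_opp Xx pu E) divfK ?gt_eqF ?w0R //.
  move: aE; rewrite E fsbig_opp // latvN scalerN -scalerBl => /eqP.
  by rewrite scaler_eq0 (negPf (lat_neq0 R pu)) orbF subr_eq0 => /eqP ->.
have [||S gS Sx] := @good_extend _ _ X Pi0 w0 balX [set x]; [exact: finite_set1|by move=> y ->|].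
have {}Sx : S x by apply: Sx.
have Px := refinement_point Pi0 par Sx.
have wd := refinement_weight X1 balX hpar gS.
have PS := refinement_structure X1 balX hpar gS.
have [_ [r [B [hB LB]] val]] := smX wd (conj Px (has_dim0_point x)).
have bij := star_dir_bij X1 PS Px.
have sf := star_finite x PS.
pose L : seq 'rV[int]_n := fset_set (dir x).
have memL u : (u \in L) = (u \in dir x) by rewrite /L in_fset_set.
have sizeL : size L = r.+1.
  rewrite -val /valence /L.
  have -> : dir x = (fun e => primitive_vector e x) @` star (refinement S) x.
    by have [i1 _ i2] := bij; apply/seteqP; split=> // u [e Se <-]; exact: i1.
  rewrite fset_set_image // card_in_imfset //= => e e'; rewrite !in_fset_set // => Se Se'.
  by have [_ inj _] := bij; exact: inj.
pose m := size L; pose N : 'M[int]_(m, n) := \matrix_(i < m) nth 0 L i.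
have rowN i : row i N = nth 0 L i by rewrite rowK.
have lattN (z : 'rV[int]_n) : primitive_lattice (refinement S) x z <-> exists b : 'rV[int]_m, z = b *m N.
  have sumE (b : 'rV[int]_n -> int) : \sum_(e \in star (refinement S) x)
      b (primitive_vector e x) *: primitive_vector e x = (\row_i b (nth 0 L i)) *m N.
    rewrite -(reindex_fsbig _ _ _ (fun u => b u *: u) bij) (dir_sum_ord _ Xx) mulmx_sum_row.
    by apply: eq_bigr => i _; rewrite rowN mxE.
  split=> [[b ->]|[b ->]].
    have [g hg] : exists g : 'rV[int]_n -> int, forall e, star (refinement S) x e ->
        g (primitive_vector e x) = b e.
      have ex u : exists k, forall e, star (refinement S) x e -> primitive_vector e x = u -> k = b e.
        have [[e Se eu]|ne] := pselect (exists2 e, star (refinement S) x e & primitive_vector e x = u).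
          exists (b e) => e' Se' e'u; congr b; have [_ inj _] := bij.
          by apply: inj; rewrite ?inE // eu e'u.
        by exists 0 => e Se eu; case: ne; exists e.
      by have [g hg] := choice ex; exists g => e Se; apply: hg.
    exists (\row_i g (nth 0 L i)); rewrite -sumE; apply: eq_fsbigr => e.
    by rewrite inE => Se; rewrite hg.
  exists (fun e => if insub (index (primitive_vector e x) L) is Some i then b 0 i else 0).
  pose bb (u : 'rV[int]_n) := if insub (index u L) is Some i then b 0 i else 0 : int.
  rewrite (sumE bb); congr (_ *m _); apply/rowP => i; rewrite mxE /bb.
  rewrite index_uniq //; last exact: fset_uniq.
  by rewrite insubT //= => lt; congr (b 0 _); apply: val_inj.
pose NR := map_mx intr N : 'M[R]_(m, n); pose BR := map_mx intr B : 'M[R]_(r, n).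
have rB : \rank BR = r by apply/eqP; exact: row_free_real.
have BN : (BR <= NR)%MS.
  apply/row_subP => i.
  have : primitive_lattice (refinement S) x (row i B).
    by rewrite LB; exists (delta_mx 0 i); rewrite // -rowE.
  move=> /lattN[b hb]; rewrite /BR -map_row hb map_mxM; exact: submxMl.
have rN : (r <= \rank NR)%N by rewrite -{1}rB mxrankS.
have rK : (\rank (kermx NR) <= 1)%N by rewrite mxrank_ker leq_subLR addn1; apply: leq_trans (eq_leq sizeL) _.
pose av (b : 'rV[int]_n -> R) : 'rV[R]_m := \row_i b (nth 0 L i).
have avK b : \sum_(u \in dir x) b u *: lat u = 0 -> (av b <= kermx NR)%MS.
  move=> bE; apply/sub_kermxP; rewrite -[RHS]bE (dir_sum_ord _ Xx) mulmx_sum_row.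
  by apply: eq_bigr => i _; rewrite /NR -map_row rowN mxE.
pose ww u := ratr (wgt x u) : R.
have wK : (av ww <= kermx NR)%MS by apply: avK; exact: (balance X1 balX Xx).
have m0 : (0 < m)%N by rewrite /m sizeL.
have dL i : (i < m)%N -> dir x (nth 0 L i).
  by move=> im; apply/set_mem; rewrite -memL mem_nth.
have w_neq0 : av ww != 0.
  apply/eqP => /rowP /(_ (Ordinal m0)); rewrite !mxE => /eqP.
  by rewrite gt_eqF //; exact: w0R (dL _ m0).
have : (av a <= av ww)%MS.
  apply: submx_trans (avK _ aE) _; move: wK => /mxrank_leqif_sup [_ <-].
  rewrite rank_rV w_neq0 eqn_leq rK andbT lt0n mxrank_eq0; apply/eqP => K0.
  by move: (avK _ (balance X1 balX Xx)); rewrite K0 submx0 (negPf w_neq0).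
move=> /sub_rVP[c hc]; exists c => u du.
have uL : u \in L by rewrite memL inE.
have im : (index u L < m)%N by rewrite index_mem.
by move/rowP: hc => /(_ (Ordinal im)); rewrite !mxE /= nth_index.
Qed.

End Convexity.

Section Subharmonic.
Variables (R : realType) (n : nat) (X : set 'rV[R]_n).
Variables (Pi0 : set (set 'rV[R]_n)) (w0 : set 'rV[R]_n -> rat).
Hypothesis X1 : one_dim_polyhedral_space X.
Hypothesis balX : balanced X Pi0 w0.
Variables (ud : set 'rV[R]_n -> 'rV[int]_n) (par : set 'rV[R]_n -> 'rV[R]_n -> R).
Hypothesis hpar : forall e, edges Pi0 e -> edge_coordinate e (ud e) (par e).
Local Notation V := 'rV[R]_n.
Local Notation "'lat' u" := (latv R u) (at level 10, u at level 8).
Local Notation dir := (dir X).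
Local Notation wgt := (wgt Pi0 w0).
Local Notation lap := (laplacian X Pi0 w0).
Local Notation mint := (mint X Pi0 w0).
Local Notation good := (good X Pi0).
Local Notation refinement := (refinement Pi0 par).
Local Notation selection := (selection X).
Local Notation locally_affine := (locally_affine X).
Implicit Types (x y z v : V) (S sigma tau e : set V) (u : 'rV[int]_n) (f g h : V -> R).
Implicit Types (Pi : set (set V)).

Lemma cell_ray Pi sigma x y : polyhedral_structure X Pi -> Pi sigma -> sigma x -> sigma y ->
  exists (u : 'rV[int]_n) (t : R), [/\ dir x u, 0 <= t & y = x + t *: lat u].
Proof.
move=> PS Ps sx sy; have Xx := cell_sub PS Ps sx.
have [<-|/eqP xy] := eqVneq x y.
  have [u du] := dir_nonempty X1 balX Xx.
  by exists u, 0; rewrite scale0r addr0.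
have Ee := cell_edge X1 PS Ps sx sy xy.
have [k [u [pu uk eu]]] := cell_direction X1 PS Ee.
have := eu _ _ sx sy; set c := _ / _ => yE.
have ps := cell_polyhedron PS Ps.
case: (ltgtP 0 c) => c0.
- exists u, c; split=> //; last exact: ltW.
  by apply: germ_dir PS Ps pu _; apply: germ_convex ps c0 sx _; rewrite -yE.
- exists (- u), (- c); rewrite latvN scaleNr scalerN opprK; split=> //; last by rewrite oppr_ge0 ltW.
  apply: germ_dir PS Ps (primN pu) _; apply: (@germ_convex _ _ _ _ _ (- c)) => //.
    by rewrite oppr_gt0.
  by rewrite latvN scaleNr scalerN opprK -yE.
by case: xy; rewrite yE -c0 scale0r addr0.
Qed.

(** The points of a convex combination centred at [x] are reached along directions at [x].
    The total displacement being 0, the lengths travelled form a relation between the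
    directions, hence are proportional to the weights; so the tangents of [f] at [x] change
    its value by a nonnegative multiple of the Laplacian. *)
Lemma laplacian_PC f : polyhedrally_smooth X Pi0 w0 -> selection f ->
  (forall x, X x -> 0 <= lap f x) -> PC X f.
Proof.
move=> smX sf lf; split; first by case: sf.
move=> Pi PS m x xs a [tau [sigma [[Xx _] [a01 a1] xE [Pt tx] hs]]].
have ray i : exists ut : 'rV[int]_n * R,
    [/\ dir x ut.1, 0 <= ut.2 & xs i = x + ut.2 *: lat ut.1].
  have [Ps sxi [_ [l [b [_ tE]]]]] := hs i.
  have sx : sigma i x by move: tx; rewrite tE => -[].
  by have [u [t h]] := cell_ray PS Ps sx sxi; exists (u, t).
have [ut hut] := choice ray.
have fd := dir_finite X1 balX Xx.
have above i : f x + (ut i).2 * slope f x (ut i).1 <= f (xs i).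
  have [du t0 E] := hut i; have [Ps sxi [_ [l [b [_ tE]]]]] := hs i.
  have sx : sigma i x by move: tx; rewrite tE => -[].
  have [t00|tn0] := eqVneq (ut i).2 0; first by rewrite E t00 mul0r addr0 scale0r addr0.
  have tp : 0 < (ut i).2 by rewrite lt_neqAle eq_sym tn0.
  rewrite E; apply: (laplacian_gradient X1 balX hpar sf _ PS Ps du.1 sx) => //; last by rewrite -E.
  move=> s /andP[s0 st]; apply: lf; apply: (cell_sub PS Ps).
  apply: (convex_segment PS Ps sx _ tp); first by rewrite -E.
  by rewrite !ltW.
pose c (u : 'rV[int]_n) := \sum_(i < m) (if (ut i).1 == u then a i * (ut i).2 else 0).
have sumE (W : lmodType R) (F : 'rV[int]_n -> W) :
    \sum_(u \in dir x) c u *: F u = \sum_(i < m) (a i * (ut i).2) *: F (ut i).1.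
  rewrite fsbig_finite //=.
  transitivity (\sum_(u <- fset_set (dir x)) \sum_(i < m)
      (if (ut i).1 == u then a i * (ut i).2 else 0) *: F u).
    by apply: eq_bigr => u _; rewrite scaler_suml.
  rewrite exchange_big /=; apply: eq_bigr => i _.
  have [du _ _] := hut i.
  rewrite (bigD1_seq (ut i).1) //=; [|by rewrite in_fset_set // inE|exact: fset_uniq].
  rewrite eqxx big1 ?addr0 // => u /negPf.
  by rewrite eq_sym => ->; rewrite scale0r.
have c0 : \sum_(u \in dir x) c u *: lat u = 0.
  rewrite sumE; transitivity (\sum_i a i *: (xs i - x)).
    by apply: eq_bigr => i _; have [_ _ ->] := hut i; rewrite addrC addKr scalerA.
  under eq_bigr do rewrite scalerBr.
  by rewrite sumrB -xE -scaler_suml a1 scale1r subrr.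
have [k hk] := tangent_relation X1 balX hpar smX Xx c0.
have [u0 du0] := dir_nonempty X1 balX Xx.
have k0 : 0 <= k.
  have w0R : 0 < ratr (wgt x u0) :> R by rewrite ltr0q; exact: (wgt_gt0 X1 balX du0).
  rewrite -(pmulr_lge0 _ w0R) -hk //; apply: sumr_ge0 => i _; case: ifP => // _.
  by have [_ t0 _] := hut i; rewrite mulr_ge0 //; have /andP[] := a01 i.
apply: le_trans (_ : \sum_i a i * (f x + (ut i).2 * slope f x (ut i).1) <= _); last first.
  by apply: ler_sum => i _; rewrite ler_wpM2l ?above //; have /andP[] := a01 i.
under eq_bigr do rewrite mulrDr.
rewrite big_split /= -mulr_suml a1 mul1r lerDl.
have := sumE R^o (fun u => slope f x u); rewrite /GRing.scale /= => E.
under eq_bigr do rewrite mulrA.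
rewrite -E; have -> : \sum_(u \in dir x) c u * slope f x u = k * lap f x.
  rewrite /laplacian mulr_fsumr; apply: eq_fsbigr => u; rewrite inE => du.
  by rewrite (hk _ du); exact: (esym (mulrA _ _ _)).
by rewrite mulr_ge0 // lf.
Qed.

Lemma rat_between (e : R) : 0 < e -> exists q : rat, 0 < ratr q :> R /\ ratr q < e.
Proof.
by move=> /rat_in_itvoo[q]; rewrite in_itv /= => /andP[h1 h2]; exists q.
Qed.

(** By balancing, the points reached from [x] by the same small rational step in all
    directions form a convex combination centred at [x], with coefficients proportional to
    the weights. Convexity for it is the claim. *)
Lemma PC_laplacian f : selection f -> PC X f -> forall x, X x -> 0 <= lap f x.
Proof.
move=> sf [_ pcf] x Xx.
have [||S [gS _ pa _]] := @selections_good _ _ _ _ _ X1 balX _ _ hpar f f set0 sf sf => //.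
have [Sx|Sx] := pselect (S x); last by rewrite (laplacian_outside X1 balX hpar gS pa Xx Sx).
have PS := refinement_structure X1 balX hpar gS.
have [q xq] := good_rational gS Sx.
have fd := dir_finite X1 balX Xx.
pose L : seq 'rV[int]_n := fset_set (dir x).
have dL i : (i < size L)%N -> dir x (nth 0 L i).
  by move=> im; apply/set_mem; rewrite -(in_fset_set fd); apply: mem_nth.
have la := selection_locally_affine X1 balX hpar sf.
have [e e0 he] : exists2 e : R, 0 < e & forall u, dir x u ->
    exists2 sigma, refinement S sigma & forall s, 0 <= s <= e ->
      sigma (x + s *: lat u) /\ f (x + s *: lat u) = f x + s * slope f x u.
  apply: set_eps fd _ _ => [u a b [sigma Rs h] b0 ba|u du].
    by exists sigma => // s /andP[s0 sb]; apply: h; rewrite s0 (le_trans sb).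
  have [sigma Es [t t0 ht]] := dir_edge X1 PS du; have [t' t'0 ht'] := la _ _ Xx du.
  exists (Num.min t t'); first by rewrite lt_min t0.
  exists sigma; first exact: Es.1.
  move=> s /andP[s0]; rewrite le_min => /andP[st st'].
  by split; [apply: ht|apply: ht']; rewrite s0.
have [r [r0 re]] := rat_between e0.
have r01 : 0 <= (ratr r : R) <= e by rewrite (ltW r0) (ltW re).
have cellP i : exists sigma, (i < size L)%N -> [/\ refinement S sigma, sigma x,
    sigma (x + ratr r *: lat (nth 0 L i)) &
    f (x + ratr r *: lat (nth 0 L i)) = f x + ratr r * slope f x (nth 0 L i)].
  have [iL|] := boolP (i < size L)%N; last by exists set0.
  have [sigma Rs h] := he _ (dL _ iL); exists sigma => _; have [h1 h2] := h _ r01.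
  have e01 : 0 <= (0 : R) <= e by rewrite lexx ltW.
  by split=> //; have [] := h 0 e01; rewrite scale0r addr0.
have [sigma hsigma] := choice cellP.
have wp (i : 'I_(size L)) : 0 < ratr (wgt x (nth 0 L i)) :> R.
  by rewrite ltr0q; apply: (wgt_gt0 X1 balX); exact: dL.
pose W : R := \sum_(i < size L) ratr (wgt x (nth 0 L i)).
have Wge (i : 'I_(size L)) : ratr (wgt x (nth 0 L i)) <= W.
  by rewrite /W (bigD1 i) //= lerDl sumr_ge0 // => j _; exact: ltW.
have W0 : 0 < W.
  have [u du] := dir_nonempty X1 balX Xx.
  have uL : (index u L < size L)%N by rewrite index_mem in_fset_set // inE.
  exact: lt_le_trans (wp (Ordinal uL)) (Wge _).
(* The coefficients are the normalized weights. *)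
pose a (i : 'I_(size L)) : R := ratr (wgt x (nth 0 L i)) / W.
pose xs (i : 'I_(size L)) : V := x + ratr r *: lat (nth 0 L i).
have a1 : \sum_i a i = 1 by rewrite -mulr_suml divff // gt_eqF.
have cc : convex_combination X (refinement S) x xs a.
  exists [set x], (fun i : 'I_(size L) => sigma i); split.
  - split=> // i; have [Rs sx sxi _] := hsigma i (ltn_ord i).
    split; first exact: (cell_sub PS Rs).
    exists (q + r *: map_mx intr (nth 0 L i)); rewrite /xs xq.
    by apply/rowP => l; rewrite !mxE rmorphD rmorphM /= ratr_int.
  - split=> // i; apply/andP; split; first by apply: divr_ge0; exact: ltW.
    by rewrite ler_pdivrMr // mul1r.
  - under eq_bigr do rewrite scalerDr.
    rewrite big_split /= -scaler_suml a1 scale1r.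
    suff -> : \sum_(i < size L) a i *: (ratr r *: lat (nth 0 L i)) = 0 by rewrite addr0.
    transitivity ((ratr r / W) *: \sum_(u \in dir x) ratr (wgt x u) *: lat u).
      rewrite (dir_sum_ord X1 balX) // scaler_sumr; apply: eq_bigr => i _.
      by rewrite !scalerA; congr (_ *: _); rewrite /a; ring.
    by rewrite (balance X1 balX Xx) scaler0.
  - by split=> //; exact: refinement_point.
  move=> i; have [Rs sx sxi _] := hsigma i (ltn_ord i); split=> //.
  exact: cell_vertex_face PS Rs (refinement_point Pi0 par Sx) sx.
have := pcf _ PS (size L) x xs a cc.
have -> : \sum_i a i * f (xs i) = f x + ratr r / W * lap f x.
  transitivity (\sum_(i < size L) (a i * f x + a i * (ratr r * slope f x (nth 0 L i)))).
    by apply: eq_bigr => i _; have [_ _ _ E] := hsigma i (ltn_ord i); rewrite /xs E mulrDr.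
  rewrite big_split /= -mulr_suml a1 mul1r; congr (_ + _).
  rewrite /laplacian (dir_sum_ord X1 balX) // mulr_sumr; apply: eq_bigr => i _.
  by rewrite /a; ring.
by rewrite lerDl pmulr_rge0 // divr_gt0.
Qed.

End Subharmonic.

(** * The maximum principle *)

Section Maximum.
Variables (R : realType) (n : nat) (X : set 'rV[R]_n).
Variables (Pi0 : set (set 'rV[R]_n)) (w0 : set 'rV[R]_n -> rat).
Hypothesis X1 : one_dim_polyhedral_space X.
Hypothesis balX : balanced X Pi0 w0.
Variables (ud : set 'rV[R]_n -> 'rV[int]_n) (par : set 'rV[R]_n -> 'rV[R]_n -> R).
Hypothesis hpar : forall e, edges Pi0 e -> edge_coordinate e (ud e) (par e).
Local Notation V := 'rV[R]_n.
Local Notation "'lat' u" := (latv R u) (at level 10, u at level 8).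
Local Notation dir := (dir X).
Local Notation wgt := (wgt Pi0 w0).
Local Notation lap := (laplacian X Pi0 w0).
Local Notation mint := (mint X Pi0 w0).
Local Notation good := (good X Pi0).
Local Notation refinement := (refinement Pi0 par).
Local Notation selection := (selection X).
Local Notation locally_affine := (locally_affine X).
Implicit Types (x y z v : V) (S sigma tau e : set V) (u : 'rV[int]_n) (f g h : V -> R).
Implicit Types (Pi : set (set V)).

(** Near [x] only the cells that contain [x] matter, and they consist of segments issued
    from [x]; there are finitely many directions, so the segments have a common length. *)
Lemma neighbourhood_rays (P : set V) x : X x -> (forall u, dir x u -> germ P x (lat u)) ->
  exists2 r : R, 0 < r & forall y, X y -> `|y - x| < r -> P y.
Proof.
move=> Xx hP; have PS := structure0 balX.
have [r1 r10 h1] : exists2 r : R, 0 < r & forall u, dir x u ->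
    forall s, 0 <= s -> s * `|lat u| < r -> P (x + s *: lat u).
  apply: set_eps (dir_finite X1 balX Xx) _ _ => [u a b h b0 ba s s0 sb|u du].
    by apply: h => //; apply: lt_le_trans ba.
  have [t t0 ht] := hP u du; have u0 : 0 < `|lat u| by rewrite normr_gt0 (lat_neq0 R du.1).
  exists (t * `|lat u|); first by rewrite mulr_gt0.
  by move=> s s0; rewrite ltr_pM2r // => st; apply: ht; rewrite s0 ltW.
have [r2 r20 h2] : exists2 r : R, 0 < r & forall sigma, Pi0 sigma -> sigma x \/
    forall y, sigma y -> r <= `|y - x|.
  apply: set_eps (structure_finite PS) _ _ => [sigma a b [h|h] b0 ba|sigma Ps]; first by left.
    by right=> y /h; exact: le_trans.
  have [sx|nsx] := pselect (sigma x); first by exists 1 => //; left.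
  apply: contrapT => hn; apply: nsx.
  have /closed_epsP := polyhedron_closed (cell_polyhedron PS Ps); apply=> r r0.
  apply: contrapT => hr; apply: hn; exists r => //; right=> y sy; rewrite leNgt.
  by apply/negP => yx; apply: hr; exists y.
exists (Num.min r1 r2); first by rewrite lt_min r10.
move=> y Xy; rewrite lt_min => /andP[y1 y2].
have [sigma Ps sy] : (\bigcup_(sigma in Pi0) sigma) y by case: PS => _ ->.
have [sx|h] := h2 _ Ps; last by have := h _ sy; rewrite leNgt y2.
have [u [t [du t0 yE]]] := cell_ray X1 balX PS Ps sx sy.
rewrite yE; apply: h1 => //; move: y1; rewrite yE addrC addKr normrZ ger0_norm //.
Qed.

Lemma sum_nonneg_eq0 (T : choiceType) (A : set T) (F : T -> R) : finite_set A ->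
  (forall a, A a -> 0 <= F a) -> \sum_(a \in A) F a <= 0 -> forall a, A a -> F a = 0.
Proof.
move=> fA pos le0 a Aa; apply/eqP; rewrite eq_le pos // andbT.
apply: le_trans le0; rewrite (fsbigD1 a) //= lerDl; apply: fsumr_ge0 => b [Ab _].
exact: pos.
Qed.

(** At a maximum all slopes are nonpositive, hence 0 when the Laplacian is nonnegative: the
    maximum is attained in a neighbourhood. *)
Lemma maximum_principle f o : connected X -> selection f -> X o ->
  (forall x, X x -> f x <= f o) -> (forall x, X x -> f x = f o -> 0 <= lap f x) ->
  forall x, X x -> f x = f o.
Proof.
move=> cX sf Xo fmax lf.
have la := selection_locally_affine X1 balX hpar sf.
have cf : {within X, continuous f} by case: sf.
suff : forall x, X x -> [set y | X y /\ f y = f o] x by move=> h x /h[].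
apply: connected_clopen => //; first by move=> y [].
- by exists o.
- move=> x Xx h; split=> //; apply/eqP; rewrite -subr_eq0 -normr_eq0 eq_le normr_ge0 andbT.
  rewrite leNgt; apply/negP => pos.
  have /within_continuousP /(_ _ Xx _ pos) [d d0 hd] := cf.
  have [y [Xy fy] yx] := h _ d0.
  by have := hd _ Xy yx; rewrite fy distrC ltxx.
move=> x [Xx fx].
have s0 u : dir x u -> slope f x u <= 0.
  move=> du; have [t t0 ht] := la _ _ Xx du; have [_ [t' t'0 gX]] := du.
  have m0 : 0 < Num.min t t' by rewrite lt_min t0.
  rewrite -(pmulr_rle0 _ m0) -(lerD2l (f x)) addr0 -ht; last first.
    by rewrite ltW //= ge_min lexx.
  by rewrite fx; apply: fmax; apply: gX; rewrite ltW //= ge_min lexx orbT.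
have wp u : dir x u -> 0 < ratr (wgt x u) :> R.
  by move=> du; rewrite ltr0q; exact: (wgt_gt0 X1 balX du).
have fd := dir_finite X1 balX Xx.
have z u : dir x u -> slope f x u = 0.
  move=> du; apply/eqP; rewrite -oppr_eq0 -(mulrI_eq0 _ (mulfI (lt0r_neq0 (wp _ du)))).
  apply/eqP; apply: (@sum_nonneg_eq0 _ (dir x) (fun u => ratr (wgt x u) * - slope f x u)) => //.
    by move=> w dw; rewrite mulr_ge0 ?oppr_ge0 ?s0 // ltW // wp.
  under eq_fsbigr do rewrite mulrN -mulN1r.
  by rewrite -mulr_fsumr mulN1r oppr_le0 lf.
have gl u : dir x u -> germ [set y | f y = f o] x (lat u).
  move=> du; have [t t0 ht] := la _ _ Xx du; exists t => // s st /=.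
  by rewrite ht // z // mulr0 addr0.
have [r r0 hr] := neighbourhood_rays Xx gl.
by exists r => // y Xy yx; split=> //; exact: hr.
Qed.

(** ** Bounded functions on the cells of a refinement *)

Definition bounded_on f : Prop := exists M : R, forall x, X x -> `|f x| <= M.

Lemma finite_argmax (T : choiceType) (A : set T) (F : T -> R) : finite_set A -> A !=set0 ->
  exists2 a, A a & forall b, A b -> F b <= F a.
Proof.
move=> /finite_seqP[s ->] [a0 /= a0s].
elim: s a0 a0s => // a s IH a0 _.
have [[b bs]|ns] := pselect (exists b, b \in s); last first.
  exists a; first by rewrite /= inE eqxx.
  by move=> c /=; rewrite inE => /orP[/eqP ->//|cs]; case: ns; exists c.
have [c cs hc] := IH b bs.
have [ac|ca] := leP (F a) (F c).
  exists c; first by rewrite /= inE (_ : c \in s) ?orbT.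
  by move=> d /=; rewrite inE => /orP[/eqP ->//|/hc].
exists a; first by rewrite /= inE eqxx.
move=> d /=; rewrite inE => /orP[/eqP ->//|/hc h].
by apply: le_trans h _; exact: ltW.
Qed.

(** A last point of [e] on the ray would be a vertex of [Pi0]. *)
Lemma edge_unbounded e v u : edges Pi0 e -> (u = ud e \/ u = - ud e) -> e v ->
  (forall t, 0 <= t -> e (v + t *: lat u) -> ~ Pi0 [set (v + t *: lat u)]) ->
  forall t, 0 <= t -> e (v + t *: lat u).
Proof.
move=> Ee uE ev stop t t0; apply: contrapT => net.
have PS := structure0 balX; have [k ku _] := hpar Ee.
have pe := cell_polyhedron PS Ee.1.
pose T := [set s : R | 0 <= s /\ e (v + s *: lat u)].
have T0 : T 0 by split=> //; rewrite scale0r addr0.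
have conv s r : T s -> 0 <= r <= s -> T r.
  move=> [s0 es] /andP[r0 rs]; split=> //; have [s00|sn0] := eqVneq s 0.
    by have -> : r = 0 by [lra]; rewrite scale0r addr0.
  apply: (convex_segment PS Ee.1 ev es); first by rewrite lt_neqAle eq_sym sn0.
  by rewrite r0.
have Tub s : T s -> s <= t.
  move=> Ts; rewrite leNgt; apply/negP => ts; apply: net.
  have c : 0 <= t <= s by rewrite t0 ltW.
  by have [] := conv _ _ Ts c.
have hs : has_sup T by split; [exists 0|exists t => s; exact: Tub].
pose m := sup T.
have m0 : 0 <= m by apply: sup_upper_bound.
have Tm : T m.
  split=> //; have /closed_epsP := polyhedron_closed pe; apply=> eps eps0.
  have N0 : 0 < 1 + `|lat u| by rewrite ltr_pwDl.
  have [s Ts ms] := sup_adherent (divr_gt0 eps0 N0) hs.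
  have sm : s <= m by apply: sup_upper_bound.
  exists (v + s *: lat u); first by case: Ts.
  have -> : v + s *: lat u - (v + m *: lat u) = (s - m) *: lat u.
    by rewrite scalerBl opprD addrACA subrr add0r.
  rewrite normrZ distrC ger0_norm ?subr_ge0 //.
  apply: le_lt_trans (_ : (m - s) * (1 + `|lat u|) < _).
    by rewrite ler_wpM2l ?subr_ge0 // lerDr.
  by rewrite -ltr_pdivlMr // ltrBlDr -ltrBlDl.
have [g1 g2] := edge_interior PS Ee ku Tm.2 (stop m m0 Tm.2).
have [d d0 hd] : germ e (v + m *: lat u) (lat u).
  by case: uE => uE'; rewrite {2}uE' ?latvN.
have : T (m + d).
  split; first by apply: addr_ge0 => //; exact: ltW.
  by rewrite scalerDl addrA; apply: hd; rewrite lexx andbT ltW.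
by move=> /(sup_upper_bound hs); rewrite -/m gerDl leNgt d0.
Qed.

Variable S : set V.
Hypothesis gS : good S.
Local Notation cell := (cellS par S).

Let par_shift' e x (t : R) : edges Pi0 e -> par e (x + t *: lat (ud e)) = par e x + t.
Proof. by move=> Ee; rewrite (par_shift hpar). Qed.

Lemma cell_up e x : edges Pi0 e -> e x -> ~ S x ->
  (exists s, [/\ S s, cell e x s & par e x < par e s]) \/
  (forall t, 0 <= t -> cell e x (x + t *: lat (ud e))).
Proof.
move=> Ee ex Sx; have [fS _ _ vS _] := gS.
pose A := [set s | [/\ S s, e s & par e x < par e s]].
have fA : finite_set A by apply: sub_finite_set fS => s [].
have [[s As]|nA] := pselect (A !=set0).
  left; have [a [Sa ea xa] amin] := finite_argmax (fun s => - par e s) fA (ex_intro _ s As).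
  exists a; split=> //; split=> // s' Ss' es'; split=> h; first by apply: ltW (lt_trans h xa).
  by rewrite -lerN2; apply: amin.
right=> t t0.
have et : e (x + t *: lat (ud e)).
  apply: (edge_unbounded Ee _ ex) t0 => [|r r0 er Pr]; first by left.
  have Sr := vS _ Pr; have := par_neq hpar Ee Sr er ex Sx.
  rewrite par_shift' // => ne; apply: nA; exists (x + r *: lat (ud e)); split=> //.
  by rewrite par_shift' // ltrDl lt_neqAle r0 andbT; apply: contra ne => /eqP <-; rewrite addr0.
split=> // s Ss es; rewrite par_shift' //; split=> h.
  by apply: le_trans (ltW h) _; rewrite lerDl.
by case: nA; exists s.
Qed.

Lemma cell_down e x : edges Pi0 e -> e x -> ~ S x ->
  (exists s, [/\ S s, cell e x s & par e s < par e x]) \/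
  (forall t, 0 <= t -> cell e x (x - t *: lat (ud e))).
Proof.
move=> Ee ex Sx; have [fS _ _ vS _] := gS.
pose A := [set s | [/\ S s, e s & par e s < par e x]].
have fA : finite_set A by apply: sub_finite_set fS => s [].
have [[s As]|nA] := pselect (A !=set0).
  left; have [a [Sa ea xa] amin] := finite_argmax (par e) fA (ex_intro _ s As).
  exists a; split=> //; split=> // s' Ss' es'; split=> h; last by apply: ltW (lt_trans xa h).
  by apply: amin.
right=> t t0.
have et : e (x - t *: lat (ud e)).
  rewrite -scalerN -latvN; apply: (edge_unbounded Ee _ ex) t0 => [|r r0 er Pr]; first by right.
  have Sr := vS _ Pr; have := par_neq hpar Ee Sr er ex Sx.
  move: er Sr; rewrite latvN scalerN -scaleNr => er Sr.
  rewrite par_shift' // => ne; apply: nA; exists (x + (- r) *: lat (ud e)); split=> //.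
  by rewrite par_shift' // gtrDl oppr_lt0 lt_neqAle r0 andbT; apply: contra ne => /eqP <-; rewrite oppr0 addr0.
split=> // s Ss es; rewrite -scaleNr par_shift' //; split=> h; last first.
  by apply: le_trans _ (ltW h); rewrite gerDl oppr_le0.
by case: nA; exists s.
Qed.

Definition cell_affine f : Prop := forall e x, edges Pi0 e -> e x -> ~ S x ->
  exists m, forall y, cell e x y -> f y = f x + (par e y - par e x) * m.

Lemma PA_cell_affine f : PA_on X (refinement S) f -> cell_affine f.
Proof.
move=> [_ pa] e x Ee ex Sx; have Rc : refinement S (cell e x) by right; exists e, x.
have [l [c hl]] := pa _ Rc.
exists (pairing (lat (ud e)) (map_mx ratr l)) => y cy.
rewrite (hl _ cy) (hl _ (cellS_self _ _ ex)) {1}(par_pt hpar Ee ex (cellS_sub cy)).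
by rewrite pairingD pairingZ; ring.
Qed.

Lemma bounded_slope (a m M : R) : (forall t, 0 <= t -> `|a + t * m| <= M) -> m = 0.
Proof.
move=> h; apply/eqP; apply: contrapT => /negP m0.
have p : 0 < `|m| by rewrite normr_gt0.
have M0 : 0 <= M by apply: le_trans (h 0 (lexx _)).
have := h ((M + `|a| + 1) / `|m|).
rewrite divr_ge0 ?addr_ge0 // => /(_ isT).
rewrite leNgt => /negP; apply.
rewrite [a + _]addrC; apply: lt_le_trans (lerB_normD _ _).
rewrite normrM ger0_norm ?divr_ge0 ?addr_ge0 // divfK ?gt_eqF //; lra.
Qed.

(** A cell that contains a single point of [S] is a ray, and a bounded affine function on
    a ray is constant. *)
Lemma cell_cases f e x : cell_affine f -> bounded_on f -> edges Pi0 e -> e x -> ~ S x ->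
  (exists s s', [/\ S s, S s', cell e x s, cell e x s' & par e s < par e x < par e s']) \/
  (exists s, [/\ S s, cell e x s, forall s', S s' -> cell e x s' -> s' = s &
     forall y, cell e x y -> f y = f s]).
Proof.
move=> ca [M bM] Ee ex Sx; have [m hm] := ca _ _ Ee ex Sx.
have cX y : cell e x y -> X y by move=> /cellS_sub; exact: (cell_sub (structure0 balX) Ee.1).
have uniq s s' : S s -> S s' -> cell e x s -> cell e x s' ->
    (par e s < par e x) = (par e s' < par e x) -> s = s'.
  move=> Ss Ss' [es hs] [es' hs'] E; apply: (par_inj hpar Ee es es').
  have [a1 a2] := hs' s Ss es; have [b1 b2] := hs s' Ss' es'.
  have n1 := par_neq hpar Ee Ss es ex Sx; have n2 := par_neq hpar Ee Ss' es' ex Sx.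
  move: n1 n2 E a1 a2 b1 b2.
  case: (ltgtP (par e s) (par e x)) => // l1 _; case: (ltgtP (par e s') (par e x)) => // l2 _ _.
    by move=> /(_ isT) h1 _ /(_ isT) h2 _; apply/eqP; rewrite eq_le h1 h2.
  by move=> _ /(_ isT) h1 _ /(_ isT) h2; apply/eqP; rewrite eq_le h1 h2.
have ndown : (forall t, 0 <= t -> cell e x (x - t *: lat (ud e))) ->
    forall s, S s -> e s -> par e s < par e x -> False.
  move=> down s Ss es lt; have t0 : 0 <= par e x - par e s + 1.
    by rewrite addr_ge0 // subr_ge0 ltW.
  have [_ /(_ _ Ss es)[/(_ lt) + _]] := down _ t0.
  by rewrite -scaleNr par_shift' //; lra.
have nup : (forall t, 0 <= t -> cell e x (x + t *: lat (ud e))) ->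
    forall s, S s -> e s -> par e x < par e s -> False.
  move=> up s Ss es lt; have t0 : 0 <= par e s - par e x + 1.
    by rewrite addr_ge0 // subr_ge0 ltW.
  have [_ /(_ _ Ss es)[_ /(_ lt)]] := up _ t0.
  by rewrite par_shift' //; lra.
have [_ _ _ _ /(_ e Ee)[s0 Ss0 es0]] := gS.
have [[s' [Ss' cs' xs']]|up] := cell_up Ee ex Sx; have [[s [Ss cs sx]]|down] := cell_down Ee ex Sx.
- by left; exists s, s'; rewrite sx xs'.
- right; have m0 : m = 0.
    apply/eqP; rewrite -oppr_eq0; apply/eqP; apply: (@bounded_slope (f x) _ M) => t t0.
    have := bM _ (cX _ (down t t0)); rewrite (hm _ (down t t0)) -scaleNr par_shift' //.
    by rewrite addrAC subrr add0r mulNr mulrN.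
  exists s'; split=> //; last by move=> y cy; rewrite (hm _ cy) (hm _ cs') m0 !mulr0.
  move=> s2 Ss2 cs2; apply: uniq => //.
  rewrite (lt_gtF xs'); apply/negP => lt.
  exact: ndown down _ Ss2 (cellS_sub cs2) lt.
- right; have m0 : m = 0.
    apply: (@bounded_slope (f x) _ M) => t t0.
    have := bM _ (cX _ (up t t0)); rewrite (hm _ (up t t0)) par_shift' //.
    by rewrite addrAC subrr add0r.
  exists s; split=> //; last by move=> y cy; rewrite (hm _ cy) (hm _ cs) m0 !mulr0.
  move=> s2 Ss2 cs2; apply: uniq => //; rewrite sx.
  have := par_neq hpar Ee Ss2 (cellS_sub cs2) ex Sx; case: ltgtP => // lt _.
  by case: (nup up _ Ss2 (cellS_sub cs2) lt).
exfalso; have := par_neq hpar Ee Ss0 es0 ex Sx; case: ltgtP => // lt _.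
  exact: ndown down _ Ss0 es0 lt.
exact: nup up _ Ss0 es0 lt.
Qed.

Lemma cell_affine_max f : cell_affine f -> bounded_on f -> X !=set0 ->
  exists2 o, S o & forall x, X x -> f x <= f o.
Proof.
move=> ca bf [x0 Xx0]; have [fS _ _ _ mS] := gS.
have [e0 Ee0 ex0] := space_edge X1 (structure0 balX) Xx0.
have [s0 Ss0 _] := mS _ Ee0.
have [p Sp pmax] := finite_argmax f fS (ex_intro _ s0 Ss0).
exists p => // x Xx; have [Sx|Sx] := pselect (S x); first exact: pmax.
have [e Ee ex] := space_edge X1 (structure0 balX) Xx.
have [[s [s' [Ss Ss' cs cs' /andP[sx xs']]]]|[s [Ss cs _ h]]] := cell_cases ca bf Ee ex Sx; last first.
  by rewrite (h _ (cellS_self par S ex)) pmax.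
have [m hm] := ca _ _ Ee ex Sx.
have := pmax _ Ss; have := pmax _ Ss'; rewrite (hm _ cs) (hm _ cs').
have [m0|m0] := leP 0 m; nra.
Qed.

Lemma cell_affine_zero f : cell_affine f -> bounded_on f -> (forall s, S s -> f s = 0) ->
  forall x, X x -> f x = 0.
Proof.
move=> ca bf f0 x Xx; have [Sx|Sx] := pselect (S x); first exact: f0.
have [e Ee ex] := space_edge X1 (structure0 balX) Xx.
have [[s [s' [Ss Ss' cs cs' /andP[sx xs']]]]|[s [Ss cs _ h]]] := cell_cases ca bf Ee ex Sx; last first.
  by rewrite (h _ (cellS_self par S ex)) f0.
have [m hm] := ca _ _ Ee ex Sx.
have := f0 _ Ss; have := f0 _ Ss'; rewrite (hm _ cs) (hm _ cs').
have [m0|m0|->] := ltgtP m 0; nra.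
Qed.

Lemma cell_affineD f g : cell_affine f -> cell_affine g -> cell_affine (fun x => f x + g x).
Proof.
move=> cf cg e x Ee ex Sx; have [[m hm] [m' hm']] := (cf _ _ Ee ex Sx, cg _ _ Ee ex Sx).
by exists (m + m') => y cy; rewrite (hm _ cy) (hm' _ cy); ring.
Qed.

Lemma cell_affineZ (r : R) f : cell_affine f -> cell_affine (fun x => r * f x).
Proof.
move=> cf e x Ee ex Sx; have [m hm] := cf _ _ Ee ex Sx.
by exists (r * m) => y cy; rewrite (hm _ cy); ring.
Qed.

Lemma bounded_onD f g : bounded_on f -> bounded_on g -> bounded_on (fun x => f x + g x).
Proof.
move=> [M hM] [M' hM']; exists (M + M') => x Xx.
by apply: le_trans (ler_normD _ _) _; rewrite lerD ?hM ?hM'.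
Qed.

Lemma bounded_onZ (r : R) f : bounded_on f -> bounded_on (fun x => r * f x).
Proof. by move=> [M hM]; exists (`|r| * M) => x Xx; rewrite normrM ler_wpM2l ?hM. Qed.

Lemma bounded_on_cst (r : R) : bounded_on (fun=> r).
Proof. by exists `|r|. Qed.

Lemma cell_affine_sum (T : Type) (r : seq T) (c : T -> R) (F : T -> V -> R) :
  (forall i, cell_affine (F i) /\ bounded_on (F i)) ->
  cell_affine (fun x => \sum_(i <- r) c i * F i x) /\
  bounded_on (fun x => \sum_(i <- r) c i * F i x).
Proof.
move=> h; elim: r => [|i r [IH1 IH2]].
  split; last by exists 0 => x _; rewrite big_nil normr0.
  by move=> e x _ _ _; exists 0 => y _; rewrite !big_nil mulr0 addr0.
have -> : (fun x => \sum_(j <- i :: r) c j * F j x) =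
   fun x => c i * F i x + \sum_(j <- r) c j * F j x by apply/funext => x; rewrite big_cons.
have [h1 h2] := h i; split; first by apply: cell_affineD => //; exact: cell_affineZ.
by apply: bounded_onD => //; exact: bounded_onZ.
Qed.

(** ** Interpolation of values prescribed on S *)

(** Affine interpolation between two points of [S], or a constant on a cell that contains
    only one of them. *)
Lemma cell_interpolation (hv : V -> rat) sigma : refinement S sigma ->
  exists lc : 'cV[rat]_n * rat,
    (forall s, S s -> sigma s -> qform lc s = ratr (hv s)) /\
    exists M : R, forall y, sigma y -> `|qform lc y| <= M.
Proof.
have cstE (r : rat) y : qform (0, r) y = ratr r :> R.
  by rewrite /qform /= map_mx0 pairing0r add0r.
have [fS SX rS _ _] := gS.
move=> [[s Ss ->]|[e [x [Ee ex Sx ->]]]].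
  exists (0, hv s); split=> [s' _ /= ->|]; first by rewrite cstE.
  by exists `|ratr (hv s)| => y _; rewrite cstE.
have ca1 : cell_affine (fun=> 0) by move=> *; exists 0 => *; rewrite mulr0 addr0.
have [[s [s' [Ss Ss' cs cs' /andP[sx xs']]]]|[s [Ss cs uniq _]]] :=
    cell_cases ca1 (bounded_on_cst 0) Ee ex Sx; last first.
  exists (0, hv s); split=> [s' Ss' cs'|]; first by rewrite cstE (uniq s').
  by exists `|ratr (hv s)| => y _; rewrite cstE.
have [k [_ uk _] pE] := hpar Ee.
have uk0 : 0 < (ud e 0 k)%:~R :> R by rewrite ltr0z.
have ltE y z : (par e y < par e z) = (y 0 k < z 0 k) by rewrite !pE ltr_pM2r // invr_gt0.
have leE y z : (par e y <= par e z) = (y 0 k <= z 0 k) by rewrite !pE ler_pM2r // invr_gt0.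
have [q sq] := rS _ Ss; have [q' sq'] := rS _ Ss'.
have sk : s 0 k = ratr (q 0 k) by rewrite sq mxE.
have sk' : s' 0 k = ratr (q' 0 k) by rewrite sq' mxE.
have ss' : s 0 k < s' 0 k by rewrite -ltE (lt_trans sx).
have [a aE] : exists a, a = (hv s' - hv s) / (q' 0 k - q 0 k) by eexists.
pose lc := (a *: delta_mx k 0, hv s - a * q 0 k) : 'cV[rat]_n * rat.
have lcE y : qform lc y = ratr (hv s) + ratr a * (y 0 k - s 0 k).
  rewrite /qform /lc /= map_mxZ /= map_delta_mx pairingZr pairing_delta sk.
  by rewrite rmorphB rmorphM /=; ring.
have inC y : cell e x y -> s 0 k <= y 0 k <= s' 0 k.
  move=> [ey hy]; have [/(_ sx) h1 _] := hy _ Ss (cellS_sub cs).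
  by have [_ /(_ xs') h2] := hy _ Ss' (cellS_sub cs'); rewrite -!leE h1 h2.
exists lc; split=> [s2 Ss2 cs2|]; last first.
  exists (`|ratr (hv s)| + `|ratr a| * (s' 0 k - s 0 k)) => y /inC /andP[y1 y2].
  rewrite lcE; apply: le_trans (ler_normD _ _) _; rewrite lerD2l normrM ler_wpM2l //.
  by rewrite ger0_norm ?subr_ge0 // lerB.
have [e2 h2] := cs2; have [ec hc] := cs; have [ec' hc'] := cs'.
have /andP[i1 i2] := inC _ cs2.
have inj y z : e y -> e z -> y 0 k = z 0 k -> y = z.
  by move=> ey ez h; apply: (par_inj hpar Ee ey ez); rewrite !pE h.
have := par_neq hpar Ee Ss2 e2 ex Sx; case: ltgtP => // lt _.
  have -> : s2 = s.
    apply: inj => //; apply/eqP; rewrite eq_le i1 andbT -leE.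
    by have [/(_ lt)] := hc _ Ss2 e2.
  by rewrite lcE subrr mulr0 addr0.
have -> : s2 = s'.
  apply: inj => //; apply/eqP; rewrite eq_le i2 /= -leE.
  by have [_ /(_ lt)] := hc' _ Ss2 e2.
rewrite lcE sk sk' -rmorphB -rmorphM aE divfK ?rmorphB /=; first by ring.
by rewrite subr_eq0; apply/eqP => h; move: ss'; rewrite sk sk' h ltxx.
Qed.

(** Distinct cells meet in points of [S], where the interpolating functions agree. *)
Lemma interpolation (hv : V -> rat) : exists f,
  [/\ PA_on X (refinement S) f, bounded_on f & forall s, S s -> f s = ratr (hv s)].
Proof.
have PS := refinement_structure X1 balX hpar gS.
have ex sigma : exists lc : 'cV[rat]_n * rat, refinement S sigma ->
    (forall s, S s -> sigma s -> qform lc s = ratr (hv s)) /\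
    exists M : R, forall y, sigma y -> `|qform lc y| <= M.
  have [Rs|] := pselect (refinement S sigma); last by exists (0, 0).
  by have [lc h] := cell_interpolation hv Rs; exists lc.
have [lc hlc] := choice ex.
pose cl x := xget set0 [set sigma | refinement S sigma /\ sigma x].
have clP x : X x -> refinement S (cl x) /\ cl x x.
  move=> Xx; have [sigma Rs sx] : (\bigcup_(sigma in refinement S) sigma) x by case: PS => _ ->.
  by apply: (xgetPex set0 (ex_intro [set sigma | _ /\ sigma x] sigma (conj Rs sx))).
pose f x := qform (lc (cl x)) x : R.
have fE sigma x : refinement S sigma -> sigma x -> f x = qform (lc sigma) x.
  move=> Rs sx; have [Rc cx] := clP x (cell_sub PS Rs sx).
  have [E|[s Ss sub]] := refinement_meet X1 balX hpar gS Rs Rc; first by rewrite /f -E.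
  have xs : x = s := sub x (conj sx cx).
  by rewrite /f (hlc _ Rc).1 ?(hlc _ Rs).1 // xs.
have fR := structure_finite PS.
exists f; split.
- split; last first.
    by move=> sigma Rs; exists (lc sigma).1, (lc sigma).2 => x /(fE _ _ Rs).
  apply/within_continuousP => x Xx eps eps0.
  have [d d0 hd] : exists2 d : R, 0 < d & forall sigma, refinement S sigma ->
      forall y, sigma y -> `|y - x| < d -> `|f y - f x| < eps.
    apply: set_eps fR _ _ => [sigma a b h b0 ba y sy yx|sigma Rs].
      by apply: h => //; apply: lt_le_trans ba.
    have [sx|nsx] := pselect (sigma x).
      have [/within_continuousP cq _] := selection_form X (lc sigma).
      have [d d0 hd] := cq x Xx eps eps0; exists d => // y sy yx.
      by rewrite !(fE _ _ Rs) //; apply: hd => //; exact: (cell_sub PS Rs).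
    apply: contrapT => hn; apply: nsx.
    have /closed_epsP := polyhedron_closed (cell_polyhedron PS Rs); apply=> r r0.
    apply: contrapT => hr; apply: hn; exists r => // y sy yx.
    by case: hr; exists y.
  exists d => // y Xy yx.
  have [sigma Rs sy] : (\bigcup_(sigma in refinement S) sigma) y by case: PS => _ ->.
  exact: hd Rs y sy yx.
- have exM sigma : exists M : R, refinement S sigma -> forall y, sigma y -> `|qform (lc sigma) y| <= M.
    have [Rs|] := pselect (refinement S sigma); last by exists 0.
    by have [_ [M hM]] := hlc _ Rs; exists M.
  have [M hM] := choice exM; have [s0 [Rs0|nR]] : exists s0, refinement S s0 \/ ~ (refinement S !=set0).
    have [[s0 Rs0]|nR] := pselect (refinement S !=set0); first by exists s0; left.
    by exists set0; right.
    have [top Rt tmax] := finite_argmax M fR (ex_intro _ s0 Rs0).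
    exists (M top) => x Xx; have [Rc cx] := clP x Xx.
    by apply: le_trans (hM _ Rc _ cx) (tmax _ Rc).
  by exists 0 => x Xx; have [Rc _] := clP x Xx; case: nR; exists (cl x).
move=> s Ss; have Xs : X s by case: gS => _ h _ _ _; exact: h.
by have [Rc cs] := clP s Xs; rewrite /f (hlc _ Rc).1.
Qed.

End Maximum.

(** * Green's identity and dipoles *)

Section Green.
Variables (R : realType) (n : nat) (X : set 'rV[R]_n).
Variables (Pi0 : set (set 'rV[R]_n)) (w0 : set 'rV[R]_n -> rat).
Hypothesis X1 : one_dim_polyhedral_space X.
Hypothesis balX : balanced X Pi0 w0.
Variables (ud : set 'rV[R]_n -> 'rV[int]_n) (par : set 'rV[R]_n -> 'rV[R]_n -> R).
Hypothesis hpar : forall e, edges Pi0 e -> edge_coordinate e (ud e) (par e).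
Local Notation V := 'rV[R]_n.
Local Notation "'lat' u" := (latv R u) (at level 10, u at level 8).
Local Notation dir := (dir X).
Local Notation wgt := (wgt Pi0 w0).
Local Notation lap := (laplacian X Pi0 w0).
Local Notation mint := (mint X Pi0 w0).
Local Notation good := (good X Pi0).
Local Notation refinement := (refinement Pi0 par).
Local Notation selection := (selection X).
Local Notation locally_affine := (locally_affine X).
Local Notation bounded_on := (bounded_on X).
Implicit Types (x y z v s t : V) (S sigma tau e : set V) (u : 'rV[int]_n) (f g h : V -> R).
Implicit Types (Pi : set (set V)).

Lemma laplacian_rat f v : selection f -> X v -> exists r : rat, lap f v = ratr r.
Proof.
move=> /(selection_PA X1 balX hpar)[Pi PS pa] Xv; have fd := dir_finite X1 balX Xv.
have h u : exists r : rat, dir v u -> slope f v u = ratr r.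
  have [du|] := pselect (dir v u); last by exists 0.
  have [e Ee ge] := dir_edge X1 PS du; have [l hl] := pa.2 _ Ee.1.
  exists ((map_mx intr u *m l) 0 0) => _; rewrite (slopeE (linear_part_slope hl ge)).
  have -> : lat u = map_mx ratr (map_mx intr u : 'rV[rat]_n).
    by apply/rowP => j; rewrite !mxE ratr_int.
  by rewrite /pairing -map_mxM mxE.
have [r hr] := choice h.
exists (\sum_(u <- fset_set (dir v)) wgt v u * r u).
rewrite /laplacian fsbig_finite // rmorph_sum /= !big_seq; apply: eq_bigr => u.
by rewrite in_fset_set // inE => du; rewrite rmorphM hr.
Qed.

Section Fixed.
Variable S : set V.
Hypothesis gS : good S.
Local Notation cell := (cellS par S).
Local Notation cell_affine := (cell_affine Pi0 par S).

Let PSR := refinement_structure X1 balX hpar gS.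

Lemma dir_cell s u : dir s u -> exists e x, [/\ edges Pi0 e, e x, ~ S x,
  germ (cell e x) s (lat u) & u = ud e \/ u = - ud e].
Proof.
move=> du; have [sigma Es gu] := dir_edge X1 PSR du.
have [e [x [Ee ex Sx sE]]] := refinement_edge Es; rewrite sE in gu.
exists e, x; split=> //; have [k ku _] := hpar Ee.
by apply: edge_prims ku du.1 _; apply: germS gu; exact: cellS_sub.
Qed.

Lemma cell_pointing e x s t u : edges Pi0 e -> e x -> ~ S x -> S s -> cell e x s ->
  cell e x t -> s <> t -> germ (cell e x) s (lat u) -> u = ud e \/ u = - ud e ->
  t = s + `|par e t - par e s| *: lat u /\ 0 < `|par e t - par e s|.
Proof.
move=> Ee ex Sx Ss cs ct st gu uE; have [es hs] := cs; have [et ht] := ct.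
have ne : par e t != par e s.
  by apply/eqP => h; apply: st; rewrite (par_inj hpar Ee et es h).
split; last by rewrite normr_gt0 subr_eq0.
have tE := par_pt hpar Ee es et; have [d d0 hd] := gu.
have cy := hd d; rewrite lexx (ltW d0) in cy; have {}cy := cy isT.
have [_ hy] := cy; have [h1 h2] := hy _ Ss es; have [h3 h4] := ht _ Ss es.
have nsx := par_neq hpar Ee Ss es ex Sx.
case: uE => uE.
  have pE : par e (s + d *: lat u) = par e s + d by rewrite uE (par_shift hpar).
  rewrite !pE in h1 h2.
  rewrite uE ger0_norm -?tE // subr_ge0.
  move: nsx h1 h2 h3 h4; case: (ltgtP (par e s) (par e x)) => // lt _ h1 h2 h3 h4; first exact: h3 isT.
  by have := h2 isT; lra.
have pE : par e (s + d *: lat u) = par e s - d by rewrite uE latvN scalerN -scaleNr (par_shift hpar).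
rewrite !pE in h1 h2.
rewrite uE ler0_norm ?subr_le0; first by rewrite latvN scalerN scaleNr opprK.
move: nsx h1 h2 h3 h4; case: (ltgtP (par e s) (par e x)) => // lt _ h1 h2 h3 h4; last exact: h4 isT.
by have := h1 isT; lra.
Qed.

Lemma slope_towards f e x s t u : cell_affine f -> edges Pi0 e -> e x -> ~ S x -> S s ->
  cell e x s -> cell e x t -> s <> t -> germ (cell e x) s (lat u) ->
  u = ud e \/ u = - ud e -> slope f s u = (f t - f s) / `|par e t - par e s|.
Proof.
move=> ca Ee ex Sx Ss cs ct st gu uE.
have [tE p] := cell_pointing Ee ex Sx Ss cs ct st gu uE.
have [m hm] := ca _ _ Ee ex Sx; have [d d0 hd] := gu.
have key (c : R) y : cell e x (s + c *: lat u) ->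
    f (s + c *: lat u) = f s + c * (if u == ud e then m else - m).
  move=> cy; rewrite (hm _ cy) (hm _ cs).
  case: uE => ->; first by rewrite eqxx (par_shift hpar) //; ring.
  rewrite latvN scalerN -scaleNr (par_shift hpar) //; case: eqP; last by move=> _; ring.
  by move=> /esym /(prim_neq_opp (ud_prim hpar Ee)).
have ft : f t - f s = `|par e t - par e s| * (if u == ud e then m else - m).
  by rewrite {1}tE key -?tE // addrAC subrr add0r.
rewrite ft mulrAC divff ?gt_eqF // mul1r; apply: slopeE; exists d => // c cd.
by rewrite key //; exact: hd.
Qed.

Lemma slope_alone f e x s u : cell_affine f -> bounded_on f -> edges Pi0 e -> e x -> ~ S x ->
  S s -> germ (cell e x) s (lat u) -> (forall t, S t -> cell e x t -> t = s) ->
  slope f s u = 0.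
Proof.
move=> ca bf Ee ex Sx Ss gu alone; apply: slopeE.
have [[a [b [Sa Sb ca' cb /andP[ax xb]]]]|[a [Sa ca' _ h]]] :=
  cell_cases balX hpar gS ca bf Ee ex Sx.
  by exfalso; have := lt_trans ax xb; rewrite (alone _ Sa ca') (alone _ Sb cb) ltxx.
have [d d0 hd] := gu; exists d => // c cd.
by rewrite h ?(h s) ?mulr0 ?addr0 //; [exact: germ_at gu|exact: hd].
Qed.

Variable eta : V -> V -> R.
Hypothesis heta : forall s, [/\ PA_on X (refinement S) (eta s), bounded_on (eta s) &
  forall t, S t -> eta s t = (t == s)%:R].

Let eta_ca s : cell_affine (eta s).
Proof. by have [h _ _] := heta s; exact: (PA_cell_affine hpar h). Qed.

Let eta_bd s : bounded_on (eta s).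
Proof. by have [_ h _] := heta s. Qed.

(** Along every other direction at [s] the hat function of [t] has slope 0: a cell that contains
    both [s] and [t] is determined by them. *)
Lemma hat_adjacent e x s t : edges Pi0 e -> e x -> ~ S x -> S s -> S t -> s <> t ->
  cell e x s -> cell e x t -> lap (eta t) s = ratr (w0 e) / `|par e t - par e s|.
Proof.
move=> Ee ex Sx Ss St st cs ct; have [_ _ et] := heta t.
have Rc : refinement S (cell e x) by right; exists e, x.
have Xs := cell_sub PSR Rc cs.
have es := cellS_sub cs; have ett := cellS_sub ct.
have [u [uE gu]] : exists u, (u = ud e \/ u = - ud e) /\ germ (cell e x) s (lat u).
  have tE := par_pt hpar Ee es ett; have pc := cell_polyhedron PSR Rc.
  case: (ltgtP (par e s) (par e t)) => lt.
  - exists (ud e); split; first by left.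
    by apply: (germ_convex pc _ cs (t := par e t - par e s)); rewrite ?subr_gt0 // -tE.
  - exists (- ud e); split; first by right.
    apply: (germ_convex pc _ cs (t := par e s - par e t)); rewrite ?subr_gt0 //.
    by rewrite latvN scalerN -scaleNr opprB -tE.
  - by case: st; rewrite (par_inj hpar Ee es ett lt).
have pu : prim u by case: uE => ->; [|apply: primN]; exact: ud_prim hpar _ Ee.
have du : dir s u := germ_dir PSR Rc pu gu.
rewrite /laplacian (fsbigD1 u) //=; last exact: dir_finite X1 balX _ Xs.
have ge : germ e s (lat u) by apply: germS gu; exact: cellS_sub.
rewrite (wgt_edge X1 balX pu Ee ge) (slope_towards (@eta_ca t) Ee ex Sx Ss cs ct st gu uE).
rewrite !et // eqxx (_ : (s == t) = false) ?subr0 ?mul1r; last exact/eqP.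
rewrite fsbig1 ?addr0 // => w [dw wu].
have [e' [x' [Ee' ex' Sx' gw wE]]] := dir_cell dw.
suff -> : slope (eta t) s w = 0 by rewrite mulr0.
have cs' := germ_at gw.
have [[r [Sr cr rs]]|none] := pselect (exists r, [/\ S r, cell e' x' r & s <> r]); last first.
  apply: (slope_alone (@eta_ca t) (@eta_bd t) Ee' ex' Sx' Ss gw) => r Sr cr.
  by apply: contrapT => rs; apply: none; exists r; split=> // /esym.
rewrite (slope_towards (@eta_ca t) Ee' ex' Sx' Ss cs' cr rs gw wE) !et //.
rewrite (_ : (s == t) = false); last exact/eqP.
suff -> : (r == t) = false by rewrite subrr mul0r.
apply/eqP => rt; apply: wu; rewrite rt in cr rs.
have Rc' : refinement S (cell e' x') by right; exists e', x'.
have [E|[q _ sub]] := refinement_meet X1 balX hpar gS Rc Rc'; last first.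
  by case: st; rewrite (sub s (conj cs cs')) (sub t (conj ct cr)).
rewrite -E in gw; have [k ku _] := hpar Ee.
have ge' : germ e s (lat w) by apply: germS gw; exact: cellS_sub.
have w_E := edge_prims ku dw.1 ge'.
have [tE p] := cell_pointing Ee ex Sx Ss cs ct st gu uE.
have [tE' _] := cell_pointing Ee ex Sx Ss cs ct st gw w_E.
apply: (@latv_inj R n); apply: (scalerI (lt0r_neq0 p)).
by apply: (@addrI _ s); rewrite -tE -tE'.
Qed.

Lemma hat_far s t : S s -> S t -> s <> t ->
  ~ (exists e x, [/\ edges Pi0 e, e x, ~ S x, cell e x s & cell e x t]) ->
  lap (eta t) s = 0.
Proof.
move=> Ss St st far; have [_ _ et] := heta t; apply: fsbig1 => u du.
have [e [x [Ee ex Sx gu uE]]] := dir_cell du; have cs := germ_at gu.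
suff -> : slope (eta t) s u = 0 by rewrite mulr0.
have [[r [Sr cr rs]]|none] := pselect (exists r, [/\ S r, cell e x r & s <> r]); last first.
  apply: (slope_alone (@eta_ca t) (@eta_bd t) Ee ex Sx Ss gu) => r Sr cr.
  by apply: contrapT => rs; apply: none; exists r; split=> // /esym.
rewrite (slope_towards (@eta_ca t) Ee ex Sx Ss cs cr rs gu uE) !et //.
rewrite (_ : (s == t) = false); last exact/eqP.
suff -> : (r == t) = false by rewrite subrr mul0r.
by apply/eqP => rt; apply: far; exists e, x; split=> //; rewrite -rt.
Qed.

(** An off-diagonal entry is the conductance of the cell that joins the two points, or 0. *)
Lemma hat_symmetric s t : S s -> S t -> lap (eta t) s = lap (eta s) t.
Proof.
move=> Ss St; have [->//|/eqP st] := eqVneq s t.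
have [[e [x [Ee ex Sx cs ct]]]|far] :=
  pselect (exists e x, [/\ edges Pi0 e, e x, ~ S x, cell e x s & cell e x t]).
  rewrite (hat_adjacent Ee ex Sx Ss St st cs ct).
  by rewrite (hat_adjacent Ee ex Sx St Ss (fun E => st (esym E)) ct cs) distrC.
rewrite hat_far // hat_far //; first by move=> /esym.
by move=> [e [x [? ? ? ? ?]]]; apply: far; exists e, x.
Qed.

Let fS : finite_set S. Proof. by case: gS. Qed.

Lemma eta_selection s : selection (eta s).
Proof. by have [pa _ _] := heta s; apply: PA_selection; exists (refinement S). Qed.

Lemma hat_expansion f : cell_affine f -> bounded_on f ->
  forall x, X x -> f x = \sum_(t <- fset_set S) f t * eta t x.
Proof.
move=> ca bf x Xx; apply/eqP; rewrite -subr_eq0; apply/eqP.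
have [c1 c2] := cell_affine_sum (S := S) (fset_set S) f (fun t => conj (@eta_ca t) (@eta_bd t)).
have := cell_affine_zero X1 balX hpar gS (cell_affineD ca (cell_affineZ (-1) c1))
  (bounded_onD bf (bounded_onZ (-1) c2)).
move=> /(_ _ x Xx); rewrite mulN1r; apply=> s Ss; rewrite mulN1r.
have sS : s \in fset_set S by rewrite in_fset_set // inE.
rewrite (bigD1_seq s) //= ?fset_uniq // big_seq_cond big1 ?addr0.
  by have [_ _ ->] := heta s; rewrite // eqxx mulr1 subrr.
move=> t /andP[_ ts]; have [_ _ ->] := heta t => //.
by rewrite eq_sym (negPf ts) mulr0.
Qed.

Lemma laplacian_hats f s : cell_affine f -> bounded_on f -> S s ->
  lap f s = \sum_(t <- fset_set S) f t * lap (eta t) s.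
Proof.
move=> ca bf Ss; have Xs : X s by case: gS => _ h _ _ _; exact: h.
rewrite (laplacian_eq Pi0 w0 Xs (hat_expansion ca bf)).
rewrite (laplacian_sum X1 balX) // => t.
exact: (selection_locally_affine X1 balX hpar (eta_selection t)).
Qed.

End Fixed.

Lemma hats S : good S -> exists eta : V -> V -> R, forall s,
  [/\ PA_on X (refinement S) (eta s), bounded_on (eta s) & forall t, S t -> eta s t = (t == s)%:R].
Proof.
move=> gS.
have ex s : exists f, [/\ PA_on X (refinement S) f, bounded_on f &
    forall t, S t -> f t = (t == s)%:R].
  have [f [h1 h2 h3]] := interpolation X1 balX hpar gS (fun t => (t == s)%:R).
  by exists f; split=> // t St; rewrite h3 // ratr_nat.
by have [eta heta] := choice ex; exists eta.
Qed.

(** Both functions are combinations of hat functions, for which the identity is the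
    symmetry of the matrix of Laplacians. *)
Lemma green f g : selection f -> selection g -> bounded_on f -> bounded_on g ->
  mint f g = mint g f.
Proof.
move=> sf sg bf bg.
have [||S [gS _ pf pg]] := @selections_good _ _ _ _ _ X1 balX _ _ hpar f g set0 sf sg => //.
have [eta heta] := hats gS; have fS : finite_set S by case: gS.
rewrite !(mintE X1 balX hpar _ gS) //.
have E f' : PA_on X (refinement S) f' -> bounded_on f' -> forall s, s \in fset_set S ->
    lap f' s = \sum_(t <- fset_set S) f' t * lap (eta t) s.
  move=> pa bd s; rewrite in_fset_set // inE => Ss.
  by apply: (laplacian_hats gS heta) => //; exact: (PA_cell_affine hpar pa).
transitivity (\sum_(s <- fset_set S) \sum_(t <- fset_set S) f t * lap (eta t) s * g s).
  by rewrite !big_seq; apply: eq_bigr => s /(E _ pf bf) ->; rewrite mulr_suml.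
rewrite exchange_big /= !big_seq; apply: eq_bigr => t tS.
rewrite (E _ pg bg _ tS) mulr_suml !big_seq; apply: eq_bigr => s sS.
rewrite (hat_symmetric gS heta); first by ring.
  by move: sS; rewrite in_fset_set // inE.
by move: tS; rewrite in_fset_set // inE.
Qed.

End Green.

Section Dipoles.
Variables (R : realType) (n : nat) (X : set 'rV[R]_n).
Variables (Pi0 : set (set 'rV[R]_n)) (w0 : set 'rV[R]_n -> rat).
Hypothesis X1 : one_dim_polyhedral_space X.
Hypothesis balX : balanced X Pi0 w0.
Variables (ud : set 'rV[R]_n -> 'rV[int]_n) (par : set 'rV[R]_n -> 'rV[R]_n -> R).
Hypothesis hpar : forall e, edges Pi0 e -> edge_coordinate e (ud e) (par e).
Local Notation V := 'rV[R]_n.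
Local Notation "'lat' u" := (latv R u) (at level 10, u at level 8).
Local Notation dir := (dir X).
Local Notation wgt := (wgt Pi0 w0).
Local Notation lap := (laplacian X Pi0 w0).
Local Notation mint := (mint X Pi0 w0).
Local Notation good := (good X Pi0).
Local Notation refinement := (refinement Pi0 par).
Local Notation selection := (selection X).
Local Notation locally_affine := (locally_affine X).
Hypothesis cX : connected X.
Local Notation bounded_on := (bounded_on X).
Implicit Types (x y z v s t : V) (S sigma tau e : set V) (u : 'rV[int]_n) (f g h : V -> R).
Implicit Types (Pi : set (set V)).

Lemma ratr_inj : injective (ratr : rat -> R).
Proof. exact: fmorph_inj. Qed.

Lemma bounded_selection_max f : selection f -> bounded_on f -> X !=set0 ->
  exists2 p, X p & forall x, X x -> f x <= f p.
Proof.
move=> sf bf X0.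
have [||S [gS _ pf _]] := @selections_good _ _ _ _ _ X1 balX _ _ hpar f f set0 sf sf => //.
have [p Sp pmax] := cell_affine_max X1 balX hpar gS (PA_cell_affine hpar pf) bf X0.
by exists p => //; case: gS => _ h _ _ _; exact: h.
Qed.

Lemma harmonic_constant f : selection f -> bounded_on f -> (forall x, X x -> lap f x = 0) ->
  forall x y, X x -> X y -> f x = f y.
Proof.
move=> sf bf lf x y Xx Xy.
have [p Xp pmax] := bounded_selection_max sf bf (ex_intro _ x Xx).
have h := maximum_principle X1 balX hpar cX sf Xp pmax.
by rewrite !h // => z Xz _; rewrite lf.
Qed.

Lemma mint_cst f (r : R) : selection f -> bounded_on f -> mint f (fun=> r) = 0.
Proof.
move=> sf bf.
have -> : mint f (fun=> r) = r * mint f (fun=> ratr 1).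
  by rewrite -mintZr; apply: mint_eqr => x _; rewrite rmorph1 mulr1.
rewrite (green X1 balX hpar sf (selection_cst X 1) bf (bounded_on_cst X _)).
by rewrite [X in _ * X]fsbig1 ?mulr0 // => x _; rewrite laplacian_cst mul0r.
Qed.

(** The matrix of the Laplacian on functions interpolated from [S] is symmetric and, by the
    maximum principle, has only the constants in its kernel; so its image consists of all
    vectors of sum zero. *)
Lemma dipole_exists x y : (X `&` @rational_points R n) x -> (X `&` @rational_points R n) y ->
  exists f, [/\ selection f, bounded_on f, f y = 0 &
    forall v, X v -> lap f v = (v == x)%:R - (v == y)%:R].
Proof.
move=> [Xx rx] [Xy ry].
have [||S gS Sxy] := @good_extend _ _ X Pi0 w0 balX [set x; y].
- by rewrite finite_setU; split; exact: finite_set1.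
- by move=> z [->|->].
have Sx : S x by apply: Sxy; left.
have Sy : S y by apply: Sxy; right.
have [fS SX _ _ _] := gS.
have [eta heta] := hats X1 balX hpar gS.
have eta_sel s : selection (eta s) := eta_selection X1 balX hpar gS heta s.
pose L : seq V := fset_set S; pose N := size L.
have memL s : (s \in L) = (s \in S) by rewrite /L in_fset_set.
have uL : uniq L by exact: fset_uniq.
have LS (i : 'I_N) : S (nth 0 L i) by apply/set_mem; rewrite -memL mem_nth.
have ix s : S s -> exists i : 'I_N, s = nth 0 L i.
  move=> Ss; have sL : s \in L by rewrite memL inE.
  have lt : (index s L < N)%N by rewrite index_mem.
  by exists (Ordinal lt); rewrite /= nth_index.
have ratK (i j : 'I_N) : exists r : rat, lap (eta (nth 0 L j)) (nth 0 L i) = ratr r.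
  by apply: (laplacian_rat X1 balX hpar) => //; exact/SX/LS.
have [k hk] : exists k : 'I_N -> 'I_N -> rat, forall i j : 'I_N,
    lap (eta (nth 0 L j)) (nth 0 L i) = ratr (k i j).
  have ex (i : 'I_N) : exists kk : 'I_N -> rat, forall j : 'I_N,
      lap (eta (nth 0 L j)) (nth 0 L i) = ratr (kk j).
    by have [kk hkk] := choice (ratK i); exists kk.
  by have [k hk] := choice ex; exists k.
pose M : 'M[rat]_N := \matrix_(i, j) k i j.
have Msym : M^T = M.
  apply/matrixP => i j; rewrite !mxE; apply: ratr_inj.
  by rewrite -!hk (hat_symmetric X1 balX hpar gS heta).
have interp (h : 'rV[rat]_N) : exists f, [/\ PA_on X (refinement S) f, bounded_on f,
    forall j : 'I_N, f (nth 0 L j) = ratr (h 0 j) &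
    forall i : 'I_N, lap f (nth 0 L i) = ratr ((h *m M) 0 i)].
  pose hv (s : V) := if insub (index s L) is Some j then h 0 j else 0.
  have hvE (j : 'I_N) : hv (nth 0 L j) = h 0 j.
    by rewrite /hv index_uniq // insubT //= => lt; congr (h 0 _); apply: val_inj.
  have [f [pf bf fv]] := interpolation X1 balX hpar gS hv.
  have fE (j : 'I_N) : f (nth 0 L j) = ratr (h 0 j) by rewrite fv ?hvE.
  exists f; split=> // i.
  rewrite (laplacian_hats X1 balX hpar gS heta (PA_cell_affine hpar pf) bf (LS i)).
  rewrite -/L (big_nth 0) big_mkord -Msym mxE rmorph_sum /=; apply: eq_bigr => j _.
  by rewrite fE hk !mxE rmorphM.
have sel f : PA_on X (refinement S) f -> selection f.
  move=> pf; apply: PA_selection; exists (refinement S) => //.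
  exact: (refinement_structure X1 balX hpar gS).
have N0 : (0 < N)%N by have [i _] := ix x Sx; case: (N) i => [[]|].
pose o1 : 'cV[rat]_N := const_mx 1.
have M1 : M *m o1 = 0.
  rewrite -[M *m o1]trmxK trmx_mul Msym; suff -> : o1^T *m M = 0 by rewrite trmx0.
  have [f [pf bf fv fl]] := interp o1^T.
  apply/rowP => i; apply: ratr_inj; rewrite [in RHS]mxE rmorph0 -fl.
  have f1 : forall z, X z -> f z = 1.
    have c1 : cell_affine Pi0 par S (fun=> -1) by move=> *; exists 0 => *; rewrite mulr0 addr0.
    move=> z Xz; apply/eqP; rewrite -subr_eq0; apply/eqP.
    have := cell_affine_zero X1 balX hpar gS (cell_affineD (PA_cell_affine hpar pf) c1)
      (bounded_onD bf (bounded_on_cst X (-1))); apply=> // s /ix[j ->].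
    by rewrite fv !mxE rmorph1 subrr.
  by rewrite (laplacian_eq Pi0 w0 (SX _ (LS i)) f1) laplacian_cst.
have rM : (N.-1 <= \rank M)%N.
  rewrite -(leq_add2r 1) addn1 prednK //.
  suff rK : (\rank (kermx M) <= 1)%N.
    by rewrite mxrank_ker in rK; rewrite -leq_subLR.
  have sub : (kermx M <= o1^T)%MS.
    apply/row_subP => i; set h := row i (kermx M).
    have hM : h *m M = 0 by rewrite /h -row_mul mulmx_ker row0.
    have [f [pf bf fv fl]] := interp h.
    have lf z : X z -> lap f z = 0.
      move=> Xz; have [Sz|Sz] := pselect (S z).
        by have [j ->] := ix _ Sz; rewrite fl hM mxE rmorph0.
      exact: (laplacian_outside X1 balX hpar gS pf Xz Sz).
    have hc (j j' : 'I_N) : h 0 j = h 0 j'.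
      apply: ratr_inj; rewrite -!fv.
      by apply: (harmonic_constant (sel _ pf) bf lf); exact/SX/LS.
    apply/sub_rVP; exists (h 0 (Ordinal N0)); apply/rowP => j.
    by rewrite [RHS]mxE [X in _ * X]mxE [X in _ * X]mxE mulr1; exact: hc.
  by apply: leq_trans (mxrankS sub) _; exact: rank_leq_row.
have o1r : \rank o1 = 1%N.
  apply/eqP; rewrite eqn_leq rank_leq_col lt0n mxrank_eq0; apply/eqP => /colP /(_ (Ordinal N0)).
  by rewrite !mxE => /eqP; rewrite oner_eq0.
have Msub : (M <= kermx o1)%MS by apply/sub_kermxP.
have subM : (kermx o1 <= M)%MS.
  have [_ <-] := mxrank_leqif_sup Msub.
  by rewrite mxrank_ker o1r subn1 eqn_leq rM andbT -subn1 -o1r -mxrank_ker mxrankS.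
have [i xi] := ix x Sx; have [j yj] := ix y Sy.
have : ((delta_mx 0 i - delta_mx 0 j : 'rV[rat]_N) <= M)%MS.
  apply: (submx_trans _ subM); apply/sub_kermxP; rewrite mulmxBl -!rowE.
  by apply/rowP => a; rewrite !mxE subrr.
move=> /submxP[h hE].
have [f [pf bf fv fl]] := interp h.
exists (fun z => f z + ratr (- h 0 j)); split.
- exact: selectionD (sel _ pf) (selection_cst X _).
- by apply: bounded_onD => //; exact: bounded_on_cst.
- by rewrite yj fv rmorphN subrr.
move=> v Xv; rewrite (laplacianD X1 balX Xv); first last.
- exact: locally_affine_cst.
- exact: (selection_locally_affine X1 balX hpar (sel _ pf)).
rewrite laplacian_cst addr0; have [Sv|Sv] := pselect (S v).
  have [a va] := ix v Sv; rewrite {1}va fl -hE !mxE /= rmorphB /= !ratr_nat.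
  by rewrite va xi yj !nth_uniq.
rewrite (laplacian_outside X1 balX hpar gS pf Xv Sv).
have -> : (v == x) = false by apply/eqP => vx; apply: Sv; rewrite vx.
have -> : (v == y) = false by apply/eqP => vy; apply: Sv; rewrite vy.
by rewrite subrr.
Qed.

(** The extrema of [f] are attained at the poles. All slopes at the minimum [x] are
    nonnegative and their weighted sum is 1, which bounds the slope towards [y]; between the
    poles [f] is affine. *)
Lemma dipole_oscillation e x y f : edges Pi0 e -> e x -> e y ->
  selection f -> bounded_on f ->
  (forall v, X v -> lap f v = (v == x)%:R - (v == y)%:R) ->
  forall a b, X a -> X b -> `|f a - f b| <= `|par e y - par e x| / ratr (w0 e).
Proof.
move=> Ee ex ey sf bf lf a b Xa Xb; have PS := structure0 balX.
have [Xx Xy] : X x /\ X y by split; exact: (cell_sub PS Ee.1).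
have we : 0 < w0 e by have [_ h _] := balX; exact: h.
have weR : 0 < ratr (w0 e) :> R by rewrite ltr0q.
have [xy|/eqP xy] := eqVneq x y.
  have -> : f a = f b.
    by apply: (harmonic_constant sf bf) => // v Xv; rewrite lf // xy subrr.
  by rewrite subrr normr0 divr_ge0 // ltW.
have extr g s t : selection g -> bounded_on g -> X t -> s <> t ->
    (forall v, X v -> lap g v = (v == s)%:R - (v == t)%:R) -> X s -> forall z, X z -> g z <= g t.
  move=> sg bg Xt st lg Xs.
  have [p Xp pmax] := bounded_selection_max sg bg (ex_intro _ s Xs).
  have [gt|gt] := eqVneq (g t) (g p); first by move=> z Xz; rewrite gt pmax.
  have c z : X z -> g z = g p.
    apply: (maximum_principle X1 balX hpar cX sg Xp pmax) => w Xw gw.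
    rewrite lg // (_ : (w == t) = false) ?subr0 ?ler0n //.
    by apply/eqP => wt; move: gt; rewrite -wt gw eqxx.
  by case/eqP: gt; exact: c.
have hmax := extr _ _ _ sf bf Xy xy lf Xx.
have hmin z : X z -> f x <= f z.
  move=> Xz; rewrite -lerN2; apply: (extr (fun z => - f z) y x) => //.
  - exact: selectionN.
  - by have [M hM] := bf; exists M => w Xw; rewrite normrN hM.
  - by move=> /esym.
  move=> v Xv; have E w : X w -> - f w = -1 * f w by rewrite mulN1r.
  rewrite (laplacian_eq Pi0 w0 Xv E) laplacianZ // ?lf //; last first.
    exact: (selection_locally_affine X1 balX hpar sf).
  by rewrite mulN1r opprB.
have [u [uE gu yE]] : exists u, [/\ u = ud e \/ u = - ud e, germ e x (lat u) &
    y = x + `|par e y - par e x| *: lat u].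
  have tE := par_pt hpar Ee ex ey; have pe := cell_polyhedron PS Ee.1.
  case: (ltgtP (par e x) (par e y)) => lt.
  - exists (ud e); split; [by left| |by rewrite gtr0_norm ?subr_gt0].
    by apply: (germ_convex pe _ ex (t := par e y - par e x)); rewrite ?subr_gt0 // -tE.
  - exists (- ud e); split; [by right| |].
      apply: (germ_convex pe _ ex (t := par e x - par e y)); rewrite ?subr_gt0 //.
      by rewrite latvN scalerN -scaleNr opprB -tE.
    by rewrite ltr0_norm ?subr_lt0 // latvN scalerN scaleNr opprK.
  - by case: xy; rewrite (par_inj hpar Ee ex ey lt).
have l0 : 0 < `|par e y - par e x|.
  by rewrite normr_gt0 subr_eq0; apply/eqP => h; apply: xy; rewrite (par_inj hpar Ee ey ex h).
have pu : prim u by case: uE => ->; [|apply: primN]; exact: ud_prim hpar _ Ee.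
have du : dir x u := germ_dir PS Ee.1 pu gu.
have la := selection_locally_affine X1 balX hpar sf.
have sp w : dir x w -> 0 <= slope f x w.
  move=> dw; have [t t0 ht] := la _ _ Xx dw; have [_ [t' t'0 gX]] := dw.
  have m0 : 0 < Num.min t t' by rewrite lt_min t0.
  rewrite -(pmulr_rge0 _ m0) -(lerD2l (f x)) addr0 -ht; last first.
    by rewrite ltW //= ge_min lexx.
  by apply: hmin; apply: gX; rewrite ltW //= ge_min lexx orbT.
have D1 : ratr (w0 e) * slope f x u <= 1.
  have lfx : lap f x = 1.
    by rewrite lf // eqxx (_ : (x == y) = false) ?subr0 //; exact/eqP.
  rewrite -lfx /laplacian (fsbigD1 u) //=; last exact: dir_finite X1 balX _ Xx.
  rewrite (wgt_edge X1 balX pu Ee gu) lerDl; apply: fsumr_ge0 => w [dw _].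
  by rewrite mulr_ge0 ?sp // ltW // ltr0q; exact: (wgt_gt0 X1 balX dw).
have up : f y <= f x + `|par e y - par e x| * slope f x u.
  rewrite -lerN2 opprD -mulrN.
  have sE : slope (fun z => - f z) x u = - slope f x u.
    have := has_slopeZ (-1) (la _ _ Xx du); rewrite mulN1r => h; apply: slopeE.
    by move: h => [t t0 h]; exists t => // s st; rewrite -mulN1r h // mulN1r.
  rewrite -sE {2}yE; have := @laplacian_gradient _ _ _ _ _ X1 balX _ _ hpar (fun z => - f z)
    Pi0 e x u `|par e y - par e x| (selectionN sf) _ PS Ee.1 pu ex _ l0.
  apply; last by rewrite -yE.
  move=> s /andP[s0 sl]; have Xs : X (x + s *: lat u).
    apply: (cell_sub PS Ee.1); apply: (convex_segment PS Ee.1 ex _ l0); first by rewrite -yE.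
    by rewrite !ltW.
  have E w : X w -> - f w = -1 * f w by rewrite mulN1r.
  rewrite (laplacian_eq Pi0 w0 Xs E) laplacianZ // lf //.
  have u0 := lat_neq0 R pu.
  have -> : (x + s *: lat u == x) = false.
    apply/eqP => h; have : s *: lat u = 0 by apply: (@addrI _ x); rewrite h addr0.
    by move/eqP; rewrite scaler_eq0 (negPf u0) gt_eqF.
  have -> : (x + s *: lat u == y) = false.
    apply/eqP; rewrite yE => /addrI /eqP; rewrite -subr_eq0 -scalerBl scaler_eq0 (negPf u0) orbF.
    by rewrite subr_eq0 lt_eqF.
  by rewrite subrr mulr0.
have osc : f y - f x <= `|par e y - par e x| / ratr (w0 e).
  rewrite ler_pdivlMr //.
  have h1 : (f y - f x) * ratr (w0 e) <= (`|par e y - par e x| * slope f x u) * ratr (w0 e).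
    by rewrite ler_wpM2r ?(ltW weR) //; lra.
  have h2 : `|par e y - par e x| * (ratr (w0 e) * slope f x u) <= `|par e y - par e x| * 1.
    by rewrite ler_wpM2l // ltW.
  lra.
apply: le_trans osc; rewrite ler_norml.
by have := hmin a Xa; have := hmin b Xb; have := hmax a Xa; have := hmax b Xb; move=> *; apply/andP; split; lra.
Qed.

End Dipoles.

(** * Integration of bounded continuous functions on the space *)

Section Integration.
Variables (R : realType) (n : nat) (X : set 'rV[R]_n).
Hypothesis clX : closed X.
Local Notation V := 'rV[R]_n.
Local Notation T := (borelV R n).
Implicit Types (f g h : V -> R).

Lemma borel_open (A : set V) : open A -> measurable (A : set T).
Proof. by move=> oA; apply: sub_sigma_algebra. Qed.

Lemma borel_closed (A : set V) : closed A -> measurable (A : set T).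
Proof.
move=> cA; rewrite -[A]setCK; apply: measurableC; apply: borel_open.
by rewrite openC.
Qed.

Lemma borel_point (x : V) : measurable ([set x] : set T).
Proof.
apply: borel_closed; apply/closed_epsP => y h /=; apply/eqP; rewrite -subr_eq0 -normr_eq0.
rewrite eq_le normr_ge0 andbT leNgt; apply/negP => yx.
by have [z /= -> ] := h _ yx; rewrite distrC ltxx.
Qed.

(** A union of balls on which the condition holds. *)
Lemma relatively_open (P : set V) :
  (forall x, X x -> P x -> exists2 e : R, 0 < e & forall y, X y -> `|y - x| < e -> P y) ->
  exists2 O : set V, open O & X `&` P = X `&` O.
Proof.
move=> h; exists [set y | exists x, exists2 e : R, 0 < e & `|y - x| < e /\
  forall z, X z -> `|z - x| < e -> P z].
  apply/open_epsP => y [x [e e0 [yx he]]]; exists (e - `|y - x|); first by rewrite subr_gt0.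
  move=> z zy; exists x, e => //; split=> //.
  rewrite (_ : z - x = (z - y) + (y - x)); last by rewrite addrA subrK.
  by apply: le_lt_trans (ler_normD _ _) _; rewrite -ltrBrDr.
apply/seteqP; split=> [y [Xy Py]|y [Xy [x [e e0 [yx he]]]]]; split=> //; last exact: he.
have [e e0 he] := h _ Xy Py; exists y, e => //; split=> //.
by rewrite subrr normr0.
Qed.

Lemma relatively_open_measurable (P : set V) :
  (forall x, X x -> P x -> exists2 e : R, 0 < e & forall y, X y -> `|y - x| < e -> P y) ->
  measurable (X `&` P : set T).
Proof.
move=> /relatively_open[G Gopen ->].
by apply: measurableI; [exact: borel_closed|exact: borel_open].
Qed.

Lemma continuous_measurable g : {within X, continuous g} ->
  measurable_fun (X : set T) (g : T -> R).
Proof.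
move=> /within_continuousP cg; apply: (measurability _ (measurable_realfun.RGenOpens.measurableE R)).
move=> _ [_ [a [b ->] <-]].
rewrite (_ : _ `&` _ = X `&` [set x | a < g x < b]); last first.
  by apply/seteqP; split=> x /= [Xx]; rewrite in_itv.
apply: relatively_open_measurable => x Xx /andP[ax xb].
have [|d d0 hd] := cg x Xx (Num.min (g x - a) (b - g x)).
  by rewrite lt_min !subr_gt0 ax xb.
exists d => // y Xy yx; have := hd y Xy yx.
rewrite lt_min => /andP[]; rewrite !ltr_distl => /andP[h1 h2] /andP[h3 h4].
by apply/andP; split; lra.
Qed.

Lemma bounded_onP g : bounded_on X g <-> [bounded g x | x in X].
Proof.
split=> [[M hM]|[M [_ hM]]].
  exists M; split; first exact: num_real.
  by move=> N MN x Xx; apply: le_trans (hM _ Xx) (ltW MN).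
by exists (M + 1) => x Xx; apply: (hM (M + 1)) => //; rewrite ltrDl.
Qed.

Section OneMeasure.
Variable nu : {measure set T -> \bar R}.
Hypothesis fnu : (nu setT < +oo)%E.
Local Notation I g := (\int[nu]_(x in X) g x).

Let mX : measurable (X : set T). Proof. exact: borel_closed. Qed.

Lemma measure_finite (A : set T) : measurable A -> (nu A < +oo)%E.
Proof. by move=> mA; apply: le_lt_trans fnu; apply: le_measure; rewrite ?inE. Qed.

Lemma measure_fin_num (A : set T) : measurable A -> nu A \is a fin_num.
Proof. by move=> mA; rewrite ge0_fin_numE // measure_finite. Qed.

Lemma integrable_bounded (A : set T) g : measurable A -> A `<=` X -> {within X, continuous g} ->
  bounded_on X g -> nu.-integrable A (EFin \o (g : T -> R)).
Proof.
move=> mA AX cg [M hM]; apply: measurable_bounded_integrable => //.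
- exact: measure_finite.
- by apply: measurable_funS (continuous_measurable cg).
exists M; split; first exact: num_real.
by move=> N MN x Ax; apply: le_trans (hM _ (AX _ Ax)) (ltW MN).
Qed.

Lemma RintegralE (A : set T) g : measurable A -> A `<=` X -> {within X, continuous g} ->
  bounded_on X g -> (\int[nu]_(x in A) (g x)%:E = (\int[nu]_(x in A) g x)%R%:E)%E.
Proof.
by move=> mA AX cg bg; rewrite fineK //; apply: integrable_fin_num => //; exact: integrable_bounded.
Qed.

Lemma Rintegral_bound (A : set T) g M : measurable A -> A `<=` X -> {within X, continuous g} ->
  bounded_on X g -> (forall x, A x -> `|g x| <= M) ->
  `|\int[nu]_(x in A) g x| <= M * fine (nu A).
Proof.
move=> mA AX cg bg hM; have ig := integrable_bounded mA AX cg bg.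
apply: le_trans (le_normr_Rintegral mA ig) _.
rewrite -(Rintegral_cst nu mA M); apply: le_Rintegral => //.
  exact: integrable_norm.
apply: (integrable_bounded mA AX _ (bounded_on_cst X M)).
by apply/within_continuousP => x _ e e0; exists 1 => // y _ _; rewrite subrr normr0.
Qed.

End OneMeasure.
End Integration.

(** * Functions that are Lipschitz along edges *)

Section EdgeLipschitz.
Variables (R : realType) (n : nat) (X : set 'rV[R]_n).
Variables (Pi0 : set (set 'rV[R]_n)) (w0 : set 'rV[R]_n -> rat).
Hypothesis X1 : one_dim_polyhedral_space X.
Hypothesis balX : balanced X Pi0 w0.
Variables (ud : set 'rV[R]_n -> 'rV[int]_n) (par : set 'rV[R]_n -> 'rV[R]_n -> R).
Hypothesis hpar : forall e, edges Pi0 e -> edge_coordinate e (ud e) (par e).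
Local Notation V := 'rV[R]_n.
Local Notation "'lat' u" := (latv R u) (at level 10, u at level 8).
Local Notation dir := (dir X).
Local Notation wgt := (wgt Pi0 w0).
Local Notation lap := (laplacian X Pi0 w0).
Local Notation mint := (mint X Pi0 w0).
Local Notation good := (good X Pi0).
Local Notation refinement := (refinement Pi0 par).
Local Notation selection := (selection X).
Local Notation locally_affine := (locally_affine X).
Hypothesis cX : connected X.
Local Notation bounded_on := (bounded_on X).
Implicit Types (x y z v s t : V) (S sigma tau e : set V) (u : 'rV[int]_n) (f g h : V -> R).

Let PS0 := structure0 balX.

(** The test functions that register little when the mass of a measure is moved a little
    along edges. *)
Definition edge_lipschitz (C : R) g : Prop :=
  forall e x y, edges Pi0 e -> e x -> e y -> `|g x - g y| <= C * `|par e y - par e x|.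

Lemma par_lipschitz e x y : edges Pi0 e -> `|par e y - par e x| <= `|y - x|.
Proof.
move=> Ee; have [k [_ uk _] pE] := hpar Ee; rewrite !pE -mulrBl normrM.
apply: le_trans (_ : `|(y - x) 0 k| <= _); last exact: coord_le_norm.
have u1 : 1 <= (ud e 0 k)%:~R :> R by rewrite ler1z.
have u0 : 0 < (ud e 0 k)%:~R :> R by apply: lt_le_trans u1.
rewrite !mxE normfV (gtr0_norm u0) ler_pdivrMr // -[leLHS]mulr1.
by rewrite ler_wpM2l.
Qed.

Lemma edge_rational_dense e x (d : R) : edges Pi0 e -> e x -> 0 < d ->
  exists y, [/\ e y, rational_points y & `|y - x| < d].
Proof.
move=> Ee ex d0; have pe := cell_polyhedron PS0 Ee.1.
have [q [eq qx]] := polyhedron_rational_dense pe ex d0.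
by exists (map_mx ratr q); split=> //; exists q.
Qed.

Lemma rational_dense x (d : R) : X x -> 0 < d ->
  exists y, [/\ X y, rational_points y & `|y - x| < d].
Proof.
move=> Xx d0; have [e Ee ex] := space_edge X1 PS0 Xx.
have [y [ey ry yx]] := edge_rational_dense Ee ex d0.
by exists y; split=> //; exact: (cell_sub PS0 Ee.1).
Qed.

Lemma rational_eq f g : {within X, continuous f} -> {within X, continuous g} ->
  (forall x, X x -> rational_points x -> f x = g x) -> forall x, X x -> f x = g x.
Proof.
move=> /within_continuousP cf /within_continuousP cg fg x Xx.
apply/eqP; rewrite -subr_eq0 -normr_eq0 eq_le normr_ge0 andbT leNgt; apply/negP => p.
have p2 : 0 < `|f x - g x| / 2 by rewrite divr_gt0.
have [d d0 hd] := cf x Xx _ p2; have [d' d'0 hd'] := cg x Xx _ p2.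
have [|y [Xy ry yx]] := @rational_dense x (Num.min d d') Xx; first by rewrite lt_min d0.
move: yx; rewrite lt_min => /andP[yx yx'].
have h1 := hd y Xy yx; have h2 := hd' y Xy yx'; rewrite (fg y Xy ry) in h1.
suff : `|f x - g x| < `|f x - g x| by rewrite ltxx.
rewrite {1}(_ : f x - g x = (g y - g x) - (g y - f x)); last by ring.
by apply: le_lt_trans (ler_normB _ _) _; lra.
Qed.

Lemma rational_bound f (M : R) : {within X, continuous f} ->
  (forall x, X x -> rational_points x -> `|f x| <= M) -> forall x, X x -> `|f x| <= M.
Proof.
move=> /within_continuousP cf fM x Xx; rewrite leNgt; apply/negP => lt.
have p : 0 < `|f x| - M by rewrite subr_gt0.
have [d d0 hd] := cf x Xx _ p; have [y [Xy ry yx]] := rational_dense Xx d0.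
have h1 := hd y Xy yx; have h2 := fM y Xy ry.
suff : `|f x| < `|f x| by rewrite ltxx.
rewrite {1}(_ : f x = f y - (f y - f x)); last by ring.
by apply: le_lt_trans (ler_normB _ _) _; lra.
Qed.

Lemma inverse_weight_bound : exists2 C : R, 0 < C &
  forall e, edges Pi0 e -> (ratr (w0 e))^-1 <= C.
Proof.
have fE : finite_set (edges Pi0).
  by apply: sub_finite_set (structure_finite PS0) => e [].
have wp e : edges Pi0 e -> 0 < ratr (w0 e) :> R.
  by move=> Ee; rewrite ltr0q; have [_ h _] := balX; exact: h.
have [d d0 hd] : exists2 d : R, 0 < d & forall e, edges Pi0 e -> d <= ratr (w0 e).
  apply: set_eps fE _ _ => [e a b h b0 ba|e Ee]; first exact: le_trans ba h.
  by exists (ratr (w0 e)) => //; exact: wp.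
exists d^-1; first by rewrite invr_gt0.
by move=> e Ee; rewrite lef_pV2 ?posrE ?hd ?wp.
Qed.

Lemma mint_dipole f g x y : X x -> X y ->
  (forall v, X v -> lap f v = (v == x)%:R - (v == y)%:R) -> mint f g = g x - g y.
Proof.
move=> Xx Xy lf; rewrite /mint.
transitivity (\sum_(v \in [set x; y]) lap f v * g v).
  symmetry; apply: fsbig_widen => v /= => [[->|->]//|[Xv /not_orP[/eqP/negPf vx /eqP/negPf vy]]].
  by rewrite lf // vx vy subrr mul0r.
have [xy|/eqP xy] := eqVneq x y.
  rewrite fsbig1 ?xy ?subrr // => v h.
  by have Xv : X v by [case: h => ->]; rewrite lf // xy subrr mul0r.
have d : [set x] `&` [set y] `<=` set0 by move=> w [-> /xy].
rewrite (fsbigU0 _ _ (finite_set1 x) (finite_set1 y) d) !fsbig_set1 !lf // !eqxx.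
have xyF : (x == y) = false by apply/eqP.
have yxF : (y == x) = false by rewrite eq_sym.
by rewrite xyF yxF /= subr0 sub0r mul1r mulN1r.
Qed.

(** Green's identity against the dipole with poles at the two ends turns an estimate
    on [mint g] into an estimate on the difference quotients of [g]. *)
Lemma edge_lipschitz_bound : exists2 C0 : R, 0 < C0 & forall g (B : R), 0 <= B ->
  selection g -> bounded_on g ->
  (forall h (M : R), selection h -> (forall x, X x -> `|h x| <= M) -> `|mint g h| <= B * M) ->
  edge_lipschitz (C0 * B) g.
Proof.
have [C C0 hC] := inverse_weight_bound; exists C => // g B B0 sg bg hB e x y Ee ex ey.
have eX := cell_sub PS0 Ee.1.
have rat x' y' : e x' -> e y' -> rational_points x' -> rational_points y' ->
    `|g x' - g y'| <= C * B * `|par e y' - par e x'|.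
  move=> ex' ey' rx ry; have [Xx Xy] := (eX _ ex', eX _ ey').
  have [h [sh bh hy lh]] := dipole_exists X1 balX hpar cX (conj Xx rx) (conj Xy ry).
  have osc := dipole_oscillation X1 balX hpar cX Ee ex' ey' sh bh lh.
  rewrite -(mint_dipole _ Xx Xy lh) (green X1 balX hpar sh sg bh bg).
  apply: le_trans (hB _ (`|par e y' - par e x'| / ratr (w0 e)) sh _) _.
    by move=> z Xz; have := osc z y' Xz Xy; rewrite hy subr0.
  rewrite [leRHS](_ : _ = B * (`|par e y' - par e x'| * C)); last by ring.
  by rewrite ler_wpM2l // ler_wpM2l //; exact: hC.
rewrite leNgt; apply/negP => lt.
pose K := C * B + 1.
have K0 : 0 < K by rewrite ltr_wpDl // mulr_ge0 // ltW.
pose gap := `|g x - g y| - C * B * `|par e y - par e x|.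
have gap0 : 0 < gap by rewrite subr_gt0.
have g4 : 0 < gap / 4 by rewrite divr_gt0.
have /within_continuousP cg : {within X, continuous g} by case: sg.
have near z : e z -> exists z', [/\ e z', rational_points z', `|g z' - g z| < gap / 4 &
    `|par e z' - par e z| < gap / 4 / K].
  move=> ez; have [d d0 hd] := cg z (eX _ ez) _ g4.
  have [|z' [ez' rz' zz']] := @edge_rational_dense e z (Num.min d (gap / 4 / K)) Ee ez.
    by rewrite lt_min d0 divr_gt0.
  move: zz'; rewrite lt_min => /andP[h1 h2]; exists z'; split=> //.
    by apply: hd => //; exact: eX.
  by apply: le_lt_trans h2; exact: par_lipschitz.
have [x' [ex' rx' gx px]] := near x ex; have [y' [ey' ry' gy py]] := near y ey.
have h := rat _ _ ex' ey' rx' ry'.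
have h1 : `|g x - g y| <= `|g x' - g y'| + `|g x' - g x| + `|g y' - g y|.
  rewrite (_ : g x - g y = (g x' - g y') - (g x' - g x) + (g y' - g y)); last by ring.
  by apply: (le_trans (ler_normD _ _)); rewrite lerD2r; exact: ler_normB.
have h2 : `|par e y' - par e x'| <= `|par e y - par e x| + `|par e x' - par e x| + `|par e y' - par e y|.
  rewrite (_ : par e y' - par e x' = (par e y - par e x) - (par e x' - par e x) + (par e y' - par e y)); last by ring.
  by apply: (le_trans (ler_normD _ _)); rewrite lerD2r; exact: ler_normB.
have CB : 0 <= C * B by rewrite mulr_ge0 // ltW.
rewrite ltr_pdivlMr // in px; rewrite ltr_pdivlMr // in py.
have px' : C * B * `|par e x' - par e x| <= gap / 4.
  apply: le_trans (ltW px); rewrite mulrC ler_wpM2l // /K; lra.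
have py' : C * B * `|par e y' - par e y| <= gap / 4.
  apply: le_trans (ltW py); rewrite mulrC ler_wpM2l // /K; lra.
have := ler_wpM2l CB h2; rewrite !mulrDr => h3.
rewrite /gap in gx gy px' py'; lra.
Qed.

Lemma edge_lipschitz_continuous C g : 0 <= C -> edge_lipschitz C g -> {within X, continuous g}.
Proof.
move=> C0 Lg; apply/within_continuousP => x Xx eps eps0.
have K0 : 0 < C + 1 by rewrite ltr_wpDl.
have [r r0 hr] : exists2 r : R, 0 < r & forall y, X y -> `|y - x| < r ->
    [set y | exists2 e, edges Pi0 e & e x /\ e y] y.
  apply: (neighbourhood_rays X1 balX) => // u du.
  have [e Ee [t t0 ht]] := dir_edge X1 PS0 du.
  exists t => // s st; exists e => //; split; last exact: ht.
  by have := ht 0; rewrite lexx ltW // scale0r addr0; apply.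
exists (Num.min r (eps / (C + 1))); first by rewrite lt_min r0 divr_gt0.
move=> y Xy; rewrite lt_min => /andP[yr]; rewrite ltr_pdivlMr // => ye.
have [e Ee [ex ey]] := hr y Xy yr.
apply: le_lt_trans (Lg e y x Ee ey ex) _; apply: le_lt_trans ye.
rewrite mulrC distrC; apply: ler_pM => //; last by rewrite lerDl.
exact: par_lipschitz.
Qed.

Lemma mint_bound g : selection g -> exists2 B : R, 0 <= B &
  forall h (M : R), (forall x, X x -> `|h x| <= M) -> `|mint g h| <= B * M.
Proof.
move=> sg.
have [||S [gS _ pg _]] := @selections_good _ _ _ _ _ X1 balX _ _ hpar g g set0 sg sg => //.
have [fS SX _ _ _] := gS.
exists (\sum_(v <- fset_set S) `|lap g v|); first by rewrite sumr_ge0.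
move=> h M hM; rewrite (mintE X1 balX hpar _ gS pg).
apply: le_trans (ler_norm_sum _ _ _) _; rewrite mulr_suml !big_seq; apply: ler_sum => v.
by rewrite in_fset_set // inE => Sv; rewrite normrM ler_wpM2l ?hM //; exact: SX.
Qed.

Lemma selection_edge_lipschitz g : selection g -> bounded_on g ->
  exists2 C : R, 0 <= C & edge_lipschitz C g.
Proof.
move=> sg bg; have [C0 C00 h] := edge_lipschitz_bound.
have [B B0 hB] := mint_bound sg.
by exists (C0 * B); [rewrite mulr_ge0 // ltW|apply: h => // h' M _; exact: hB].
Qed.

Lemma dipole_edge_lipschitz : exists2 C : R, 0 < C & forall f x y, X x -> X y ->
  selection f -> bounded_on f ->
  (forall v, X v -> lap f v = (v == x)%:R - (v == y)%:R) -> edge_lipschitz C f.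
Proof.
have [C0 C00 h] := edge_lipschitz_bound; exists (C0 * 2); first by rewrite mulr_gt0.
move=> f x y Xx Xy sf bf lf; apply: h => // g M sg hM.
rewrite (mint_dipole _ Xx Xy lf); apply: le_trans (ler_normB _ _) _.
by rewrite mulr_natl mulr2n lerD ?hM.
Qed.

(** Points reached from [o] along finitely many edges form a clopen set. *)
Lemma edge_lipschitz_diameter o x : X o -> X x ->
  exists2 D : R, 0 <= D & forall C g, 0 <= C -> edge_lipschitz C g -> `|g x - g o| <= C * D.
Proof.
move=> Xo; move: x.
pose Q := [set x | X x /\ exists2 D : R, 0 <= D & forall C g, 0 <= C -> edge_lipschitz C g ->
  `|g x - g o| <= C * D].
suff : forall x, X x -> Q x by move=> h x /h[].
have near x : X x -> exists2 r : R, 0 < r & forall y, X y -> `|y - x| < r ->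
    [set y | exists2 e, edges Pi0 e & e x /\ e y] y.
  move=> Xx; apply: (neighbourhood_rays X1 balX) => // u du.
  have [e Ee [t t0 ht]] := dir_edge X1 PS0 du.
  exists t => // s st; exists e => //; split; last exact: ht.
  by have := ht 0; rewrite lexx ltW // scale0r addr0; apply.
have step x y e : edges Pi0 e -> e x -> e y -> Q x -> Q y.
  move=> Ee ex ey [Xx [D D0 hD]]; split; first exact: (cell_sub PS0 Ee.1).
  exists (`|par e x - par e y| + D); first by rewrite addr_ge0.
  move=> C g C0 Lg; rewrite (_ : g y - g o = (g y - g x) + (g x - g o)); last by ring.
  by apply: le_trans (ler_normD _ _) _; rewrite mulrDr lerD ?hD // Lg.
apply: connected_clopen => //; first by move=> y [].
- by exists o; split=> //; exists 0 => // C g _ _; rewrite subrr normr0 mulr0.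
- move=> x Xx h; have [r r0 hr] := near x Xx.
  have [y Qy yx] := h _ r0; have [e Ee [ex ey]] := hr y Qy.1 yx.
  exact: step Ee ey ex Qy.
move=> x [Xx Qx]; have [r r0 hr] := near x Xx; exists r => // y Xy yx.
by have [e Ee [ex ey]] := hr y Xy yx; apply: step Ee ex ey _.
Qed.

End EdgeLipschitz.

(** * Approximation of measures by rational atoms *)

Section CompactCover.
Variables (R : realType) (n : nat).
Local Notation V := 'rV[R]_n.

Lemma compact_balls (K : set V) (r : V -> R) : compact K -> (forall x, K x -> 0 < r x) ->
  exists s : seq V, (forall x, x \in s -> K x) /\
    forall y, K y -> exists2 x, x \in s & `|y - x| < r x.
Proof.
rewrite compact_cover => cK r0.
have [||D DK hD] := cK V K (fun x => [set y | `|y - x| < r x]).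
- move=> x Kx; apply/open_epsP => y /= yx; exists (r x - `|y - x|); first by rewrite subr_gt0.
  move=> z zy; rewrite (_ : z - x = (z - y) + (y - x)); last by rewrite addrA subrK.
  by apply: le_lt_trans (ler_normD _ _) _; rewrite -ltrBrDr.
- by move=> x Kx; exists x => //=; rewrite subrr normr0 r0.
exists (enum_fset D); split=> [x xD|y Ky].
  by have := DK _ xD; rewrite inE.
by have [x xD yx] := hD _ Ky; exists x.
Qed.

Lemma rat_below (m eta : R) : 0 <= m -> 0 < eta ->
  exists q : rat, [/\ 0 <= q, (ratr q : R) <= m & m - ratr q <= eta].
Proof.
move=> m0 e0; have [->|mn] := eqVneq m 0.
  by exists 0; split; rewrite ?rmorph0 ?subrr ?lexx // ltW.
have mp : Num.max 0 (m - eta) < m.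
  by rewrite gt_max lt0r mn m0 /= gtrBl.
have [q] := rat_in_itvoo mp.
rewrite in_itv /= gt_max => /andP[/andP[q0 qm] mq]; exists q; split.
- by rewrite -(ler0q R) ltW.
- exact: ltW.
by rewrite lerBlDl -lerBlDr ltW.
Qed.

End CompactCover.

Section AtomicApproximation.
Variables (R : realType) (n : nat) (X : set 'rV[R]_n).
Variables (Pi0 : set (set 'rV[R]_n)) (w0 : set 'rV[R]_n -> rat).
Hypothesis X1 : one_dim_polyhedral_space X.
Hypothesis balX : balanced X Pi0 w0.
Variables (ud : set 'rV[R]_n -> 'rV[int]_n) (par : set 'rV[R]_n -> 'rV[R]_n -> R).
Hypothesis hpar : forall e, edges Pi0 e -> edge_coordinate e (ud e) (par e).
Local Notation V := 'rV[R]_n.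
Local Notation "'lat' u" := (latv R u) (at level 10, u at level 8).
Local Notation dir := (dir X).
Local Notation wgt := (wgt Pi0 w0).
Local Notation lap := (laplacian X Pi0 w0).
Local Notation mint := (mint X Pi0 w0).
Local Notation good := (good X Pi0).
Local Notation refinement := (refinement Pi0 par).
Local Notation selection := (selection X).
Local Notation locally_affine := (locally_affine X).
Hypothesis cX : connected X.
Local Notation bounded_on := (bounded_on X).
Local Notation edge_lipschitz := (edge_lipschitz Pi0 par).
Local Notation T := (borelV R n).
Variable mu : {measure set T -> \bar R}.
Hypothesis fmu : (mu setT < +oo)%E.
Variable o : V.
Hypothesis Xo : X o.
Implicit Types (x y z v s t : V) (S sigma tau e : set V) (u : 'rV[int]_n) (f g h : V -> R).

Let PS0 := structure0 balX.
Let clX := space_closed X1.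

(** Smallness as seen by the test functions, which measure distances along edges and not in
    the ambient space. *)
Definition edge_small (d : R) (D : set V) : Prop :=
  exists2 p, (X `&` @rational_points R n) p &
    forall y C g, D y -> 0 <= C -> edge_lipschitz C g -> `|g y - g p| <= C * d.

Lemma edge_small_cover (K : set V) (d : R) : compact K -> K `<=` X -> 0 < d ->
  exists Ds : seq (set V), (forall D, D \in Ds -> [/\ measurable (D : set T), D `<=` X & edge_small d D]) /\
    forall y, K y -> exists2 D, D \in Ds & D y.
Proof.
move=> cK KX d0.
have d2 : 0 < d / 2 by rewrite divr_gt0.
have [s [sK hs]] := compact_balls cK (fun _ _ => d2).
have fE : finite_set (edges Pi0).
  by apply: sub_finite_set (structure_finite PS0) => e [].
pose piece e x : set V := e `&` [set y | `|y - x| < d / 2].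
exists [seq piece e x | e <- fset_set (edges Pi0), x <- s]; split; last first.
  move=> y Ky; have [x xs yx] := hs y Ky.
  have [e Ee ey] := space_edge X1 PS0 (KX _ Ky).
  exists (piece e x); last by split.
  by apply: allpairs_f => //; rewrite in_fset_set // inE.
move=> D /allpairsP[[e x] /= [+ xs ->]]; rewrite in_fset_set // inE => Ee.
have eX := cell_sub PS0 Ee.1.
split; first apply: measurableI.
- by apply: borel_closed; apply: polyhedron_closed; exact: (cell_polyhedron PS0 Ee.1).
- apply: borel_open; apply/open_epsP => y /= yx; exists (d / 2 - `|y - x|); first by rewrite subr_gt0.
  move=> z zy; rewrite (_ : z - x = (z - y) + (y - x)); last by rewrite addrA subrK.
  by apply: le_lt_trans (ler_normD _ _) _; rewrite -ltrBrDr.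
- by move=> y [/eX].
have [[y [ey yx]]|nex] := pselect (piece e x !=set0); last first.
  have [p [Xp rp _]] := rational_dense X1 balX Xo d0.
  by exists p; [split|move=> y C g Dy; case: nex; exists y].
have yx0 : 0 < d / 2 - `|y - x| by rewrite subr_gt0.
have [p [ep rp py]] := edge_rational_dense balX Ee ey yx0.
exists p; first by split=> //; exact: eX.
move=> z C g [ez zx] C0 Lg; apply: le_trans (Lg e z p Ee ez ep) _.
apply: ler_wpM2l => //; apply: (le_trans (par_lipschitz hpar z p Ee)).
rewrite (_ : p - z = (p - y) + (y - x) - (z - x)); last by rewrite opprB !addrA !subrK.
apply: le_trans (ler_normB _ _) _.
have := ler_normD (p - y) (y - x); move: zx => /= zx; move: py; lra.
Qed.

Lemma Rintegral_split (A D : set T) g : measurable A -> A `<=` X -> measurable D ->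
  {within X, continuous g} -> bounded_on g ->
  \int[mu]_(x in A) g x = \int[mu]_(x in A `&` D) g x + \int[mu]_(x in A `\` D) g x.
Proof.
move=> mA AX mD cg bg; rewrite -Rintegral_setU.
- by congr Rintegral; rewrite setUIDK.
- exact: measurableI.
- exact: measurableD.
- rewrite setUIDK; exact: (integrable_bounded clX fmu).
by apply/eqP/seteqP; split=> // y [[_ Dy] [_ nDy]].
Qed.

Let mass (A : set T) : R := fine (mu A).

Lemma mass_split (A D : set T) : measurable A -> measurable D ->
  mass A = mass (A `&` D) + mass (A `\` D).
Proof.
move=> mA mD; rewrite /mass (measureDI mu mA mD) fineD 1?addrC //.
  by apply: (measure_fin_num fmu); exact: measurableD.
by apply: (measure_fin_num fmu); exact: measurableI.
Qed.

(** Masses are rounded down to rationals, and what is not yet carried by a rational atom is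
    left at [o]: its distance from [o] is fixed and its mass arbitrarily small. *)
Lemma atomic_pieces (d : R) (Ds : seq (set V)) :
  (forall D, D \in Ds -> [/\ measurable (D : set T), D `<=` X & edge_small d D]) ->
  forall (A : set T) (eps : R), measurable A -> A `<=` X ->
  (forall y, A y -> exists2 D, D \in Ds & D y) -> 0 < eps ->
  exists l : seq (rat * V),
    [/\ forall a, a \in l -> 0 <= a.1 /\ (X `&` @rational_points R n) a.2,
        \sum_(a <- l) ratr a.1 <= mass A &
        forall C g, 0 <= C -> edge_lipschitz C g -> bounded_on g ->
        `|\int[mu]_(x in A) g x -
          (\sum_(a <- l) ratr a.1 * g a.2 + (mass A - \sum_(a <- l) ratr a.1) * g o)| <=
        C * (d * mass A + eps)].
Proof.
elim: Ds => [|D Ds IH] hDs A eps mA AX cov eps0.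
  have -> : A = set0 by apply/seteqP; split=> // y /cov[].
  exists [::]; split=> // [|C g C0 Lg bg]; first by rewrite big_nil /mass measure0.
  rewrite !big_nil /mass measure0 Rintegral_set0 /= subr0 mul0r addr0 subr0 normr0 mulr0 add0r.
  by rewrite mulr_ge0 // ltW.
have [mD DX [p [Xp rp] hp]] : [/\ measurable (D : set T), D `<=` X & edge_small d D].
  by apply: hDs; rewrite mem_head.
have mA1 : measurable (A `&` D : set T) by exact: measurableI.
have mA2 : measurable (A `\` D : set T) by exact: measurableD.
have A1X : A `&` D `<=` X by move=> y [/AX].
have e2 : 0 < eps / 2 by rewrite divr_gt0.
have hDs' D' : D' \in Ds -> [/\ measurable (D' : set T), D' `<=` X & edge_small d D'].
  by move=> D'D; apply: hDs; rewrite in_cons D'D orbT.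
have A2X : A `\` D `<=` X by move=> y [/AX].
have cov2 y : (A `\` D) y -> exists2 D', D' \in Ds & D' y.
  move=> [Ay nDy]; have [D' + D'y] := cov y Ay.
  by rewrite in_cons => /orP[/eqP E|]; [rewrite E in D'y|exists D'].
have [l [lp lm hl]] := IH hDs' (A `\` D) (eps / 2) mA2 A2X cov2 e2.
have [Dp Dp0 hDp] := @edge_lipschitz_diameter _ _ _ _ _ X1 balX par cX _ _ Xo Xp.
set m := mass (A `&` D); have m0 : 0 <= m by rewrite /m /mass fine_ge0.
have eta0 : 0 < eps / 2 / (Dp + 1) by rewrite !divr_gt0 // ltr_wpDl.
have [q [q0 qm mq]] := rat_below m0 eta0.
exists ((q, p) :: l); split.
- by move=> a; rewrite in_cons => /orP[/eqP ->|/lp].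
- by rewrite big_cons (mass_split mA mD) lerD.
move=> C g C0 Lg bg; have cg := edge_lipschitz_continuous X1 balX hpar C0 Lg.
have h2 := hl C g C0 Lg bg.
rewrite !big_cons /= (mass_split mA mD) -/m (Rintegral_split mA AX mD cg bg).
have h1 : `|\int[mu]_(x in A `&` D) g x - m * g p| <= C * d * m.
  rewrite [m * g p]mulrC /m /mass -(Rintegral_cst mu mA1 (g p)).
  rewrite -RintegralB //; last 2 first.
  - exact: (integrable_bounded clX fmu).
  - apply: (integrable_bounded clX fmu) => //; last exact: bounded_on_cst.
    by apply/within_continuousP => x _ e e0; exists 1 => // y _ _; rewrite subrr normr0.
  apply: (Rintegral_bound clX fmu) => //.
  - apply/within_continuousP => x Xx e e0.
    have /within_continuousP cg' := cg; have [r r0 hr] := cg' x Xx e e0.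
    by exists r => // y Xy yx; rewrite opprB addrA subrK; exact: hr.
  - by apply: (bounded_onD bg (bounded_on_cst X (- g p))).
  by move=> y [_ Dy]; exact: hp.
have h3 : (m - ratr q) * `|g p - g o| <= C * (eps / 2).
  have mq0 : 0 <= m - ratr q by rewrite subr_ge0.
  apply: le_trans (ler_wpM2l mq0 (hDp C g C0 Lg)) _.
  rewrite mulrCA; apply: ler_wpM2l => //.
  apply: le_trans (ler_wpM2r Dp0 mq) _.
  rewrite mulrAC ler_pdivrMr ?ltr_wpDl //.
  by rewrite ler_wpM2l ?lerDl // ltW // divr_gt0.
set I1 := \int[mu]_(x in A `&` D) g x in h1 *.
set I2 := \int[mu]_(x in A `\` D) g x in h2 *.
set m2 := mass (A `\` D) in h2 *.
rewrite (_ : I1 + I2 - _ = (I1 - m * g p) + (m - ratr q) * (g p - g o) +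
  (I2 - (\sum_(a <- l) ratr a.1 * g a.2 + (m2 - \sum_(a <- l) ratr a.1) * g o))); last by ring.
apply: le_trans (ler_normD _ _) _.
rewrite (_ : C * _ = C * d * m + C * (eps / 2) + C * (d * m2 + eps / 2)); last by field.
apply: lerD h2; apply: le_trans (ler_normD _ _) _; apply: lerD h1 _.
by rewrite normrM ger0_norm ?subr_ge0.
Qed.

Lemma atomic_approximation (K : set V) (c : rat) (eps : R) :
  rational_points o -> compact K -> K `<=` X -> mu (~` K) = 0%E -> mu setT = (ratr c)%:E -> 0 < eps ->
  exists l : seq (rat * V),
    [/\ forall a, a \in l -> 0 <= a.1 /\ (X `&` @rational_points R n) a.2,
        \sum_(a <- l) a.1 = c &
        forall C g, 0 <= C -> edge_lipschitz C g -> bounded_on g ->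
        `|\int[mu]_(x in X) g x - \sum_(a <- l) ratr a.1 * g a.2| <= C * eps].
Proof.
move=> ro cK KX muK muT eps0.
have mX : measurable (X : set T) by exact: borel_closed.
have mK : measurable (K : set T).
  by apply: borel_closed; apply: compact_closed cK; exact: norm_hausdorff.
have massK : mass K = ratr c.
  have := @mass_split setT K measurableT mK.
  by rewrite /mass setTI setTD muK addr0 muT.
have c0 : 0 <= ratr c :> R by rewrite -massK /mass fine_ge0.
have K0 : 0 < 2 * (ratr c + 1) :> R by rewrite mulr_gt0 // ltr_wpDl.
have d0 : 0 < eps / (2 * (ratr c + 1)) by rewrite divr_gt0.
have [Ds [hDs cov]] := edge_small_cover cK KX d0.
have e2 : 0 < eps / 2 by rewrite divr_gt0.
have [l [lp lm hl]] := atomic_pieces hDs mK KX cov e2.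
exists ((c - \sum_(a <- l) a.1, o) :: l); split.
- move=> a; rewrite in_cons => /orP[/eqP ->|/lp] //=; split=> //.
  by rewrite subr_ge0 -(ler_rat R) rmorph_sum /= -massK.
- by rewrite big_cons /= subrK.
move=> C g C0 Lg bg; have cg := edge_lipschitz_continuous X1 balX hpar C0 Lg.
have := hl C g C0 Lg bg; rewrite big_cons /= massK.
rewrite (Rintegral_split mX (@subset_refl _ X) mK cg bg) (_ : X `&` K = K); last by apply/setIidPr.
rewrite (_ : \int[mu]_(x in X `\` K) g x = 0); last first.
  have [M hM] := bg; apply/eqP; rewrite -normr_eq0 eq_le normr_ge0 andbT.
  have mXK : measurable (X `\` K : set T) by exact: measurableD.
  apply: le_trans (Rintegral_bound clX fmu mXK _ cg bg (M := M) _) _; rewrite ?subDsetl //.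
    by move=> y [Xy _]; exact: hM.
  have -> : mu (X `\` K) = 0%E.
    by apply: (subset_measure0 mXK (measurableC mK)) muK => y [].
  by rewrite mulr0.
rewrite addr0 rmorphB /= rmorph_sum /= [_ * g o + _]addrC => h; apply: le_trans h _.
apply: ler_wpM2l => //; rewrite [leRHS]splitr lerD2r mulrAC.
rewrite ler_pdivrMr // (_ : eps / 2 * _ = eps * (ratr c + 1)); last by field.
by rewrite ler_wpM2l ?lerDl //; exact: ltW.
Qed.

End AtomicApproximation.

(** * Approximation of continuous functions by piecewise affine ones *)

Section Convergence.
Variable R : realType.

Lemma cvg_epsP (a : nat -> R) (l : R) : a @ \oo --> l <->
  forall e, 0 < e -> exists N, forall j, (N <= j)%N -> `|l - a j| <= e.
Proof.
split=> [/cvgrPdist_le h e /h[N _ hN]|h]; first by exists N => j; exact: hN.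
by apply/cvgrPdist_le => e /h[N hN]; exists N => // j; exact: hN.
Qed.

Lemma cvg_EFin_epsP (a : nat -> R) (l : R) : (a j)%:E @[j --> \oo] --> l%:E <->
  forall e, 0 < e -> exists N, forall j, (N <= j)%N -> `|l - a j| <= e.
Proof.
rewrite -cvg_epsP; split=> [/fine_cvg //|h].
by apply: cvg_EFin => //; exists 0%N.
Qed.

Lemma uniform_epsP (T : choiceType) (X : set T) (f_ : nat -> T -> R) (f : T -> R) :
  {uniform X, f_ @ \oo --> f} <->
  forall e, 0 < e -> exists N, forall j, (N <= j)%N -> forall x, X x -> `|f x - f_ j x| <= e.
Proof.
split=> [h e e0|h].
  have /h[N _ hN] : nbhs (f : {uniform` X -> R}) [set g | forall x, X x -> `|f x - g x| <= e].
    apply/uniform_nbhs; exists [set xy : R * R | ball xy.1 e xy.2]; split.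
      exact: (entourage_ball _ (PosNum e0)).
    by move=> g hg x /hg /ltW.
  by exists N => j /hN.
move=> P /uniform_nbhs[E [+ EP]]; rewrite -entourage_ballE => -[e /= e0 eE].
have e2 : 0 < e / 2 by rewrite divr_gt0.
have [N hN] := h _ e2; exists N => // j /hN hj; apply: EP => x Xx; apply: eE => /=.
by apply: le_lt_trans (hj x Xx) _; rewrite ltr_pdivrMr // mulr_natr mulr2n ltrDl.
Qed.

End Convergence.

Section Approximation.
Variables (R : realType) (n : nat) (X : set 'rV[R]_n).
Variables (Pi0 : set (set 'rV[R]_n)) (w0 : set 'rV[R]_n -> rat).
Hypothesis X1 : one_dim_polyhedral_space X.
Hypothesis balX : balanced X Pi0 w0.
Local Notation V := 'rV[R]_n.
Local Notation selection := (selection X).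
Local Notation bounded_on := (bounded_on X).
Implicit Types (x y z v : V) (f g h : V -> R).

Lemma selection_bigmax (I : Type) (r : seq I) (a : rat) (F : I -> V -> R) :
  (forall i, selection (F i)) -> selection (fun x => \big[Num.max/ratr a]_(i <- r) F i x).
Proof.
move=> sF; elim: r => [|i r IH].
  by apply: selection_eq (selection_cst X a) _ => x _; rewrite big_nil.
by apply: selection_eq (selection_max (sF i) IH) _ => x _; rewrite big_cons.
Qed.

Lemma selection_norm (q : 'rV[rat]_n) : selection (fun x => `|x - map_mx ratr q|).
Proof.
pose c k : 'cV[rat]_n * rat := (delta_mx k 0, - q 0 k).
have cE k x : qform (c k) x = (x - map_mx ratr q) 0 k.
  rewrite /qform /c /= rmorphN !mxE; congr (_ - _).
  have -> : map_mx ratr (delta_mx k 0) = delta_mx k 0 :> 'cV[R]_n.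
    by apply/matrixP => i j; rewrite !mxE ratr_nat.
  by rewrite pairing_delta.
have sc k : selection (fun x => Num.max (qform (c k) x) (- qform (c k) x)).
  by apply: selection_max; [|apply: selectionN]; exact: selection_form.
apply: selection_eq (selection_bigmax (index_enum _) 0 (fun ij : 'I_1 * 'I_n => sc ij.2)) _ => x _.
rewrite rV_normE rmorph0; apply: eq_bigr => -[i k] _ /=.
rewrite (ord1 i) cE; set r := (x - _) 0 k; case: (lerP 0 r) => h.
  by rewrite ger0_norm // max_l //; lra.
by rewrite ltr0_norm // max_r //; lra.
Qed.

(** The integrals of these functions bound the mass that is far from the origin. *)
Definition cutoff (k : nat) (x : V) : R := Num.min 1 (Num.max 0 (`|x| - k%:R)).

Lemma cutoff_selection k : selection (cutoff k).
Proof.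
have s1 : selection (fun=> 1 : R).
  by apply: selection_eq (selection_cst X 1) _ => x _; rewrite rmorph1.
have s0 : selection (fun=> 0 : R).
  by apply: selection_eq (selection_cst X 0) _ => x _; rewrite rmorph0.
apply: selection_min s1 _; apply: selection_max s0 _; apply: selectionB.
  apply: selection_eq (selection_norm 0) _ => x _; congr `|_|.
  by apply/rowP => j; rewrite !mxE rmorph0 subr0.
by apply: selection_eq (selection_cst X k%:R) _ => x _; rewrite ratr_nat.
Qed.

Lemma cutoff_range k x : 0 <= cutoff k x <= 1.
Proof. by rewrite /cutoff ge_min lexx /= le_min ler01 le_max lexx. Qed.

Lemma cutoff_bounded k : bounded_on (cutoff k).
Proof. by exists 1 => x _; have /andP[h1 h2] := cutoff_range k x; rewrite ger0_norm. Qed.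

Lemma cutoff0 k x : `|x| <= k%:R -> cutoff k x = 0.
Proof. by move=> h; rewrite /cutoff max_l ?subr_le0 // min_r. Qed.

Lemma cutoff1 k x : k.+1%:R <= `|x| -> cutoff k x = 1.
Proof.
by rewrite -natr1 => h; rewrite /cutoff min_l // le_max; apply/orP; right; lra.
Qed.

Lemma compact_uniform (K : set V) g (e : R) : compact K -> K `<=` X ->
  {within X, continuous g} -> 0 < e ->
  exists2 d : R, 0 < d & forall x y, K x -> X y -> `|y - x| < d -> `|g y - g x| <= e.
Proof.
move=> cK KX /within_continuousP cg e0; have e2 : 0 < e / 2 by rewrite divr_gt0.
have [r hr] : exists r : V -> R, forall x : V, K x -> 0 < r x /\
    forall y, X y -> `|y - x| < r x -> `|g y - g x| < e / 2.
  suff : forall x, exists d : R, K x -> 0 < d /\ forall y, X y -> `|y - x| < d -> `|g y - g x| < e / 2.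
    by move=> /choice[r hr]; exists r.
  move=> x; have [Kx|nKx] := pselect (K x); last by exists 0.
  by have [d d0 hd] := cg x (KX _ Kx) _ e2; exists d.
have [|s [sK hs]] := compact_balls cK (r := fun x => r x / 2).
  by move=> x /hr[r0 _]; rewrite divr_gt0.
have [d d0 hd] : exists2 d, 0 < d & forall x, x \in s -> d <= r x / 2.
  apply: (seq_eps (P := fun x d => d <= r x / 2)) => [x a b h _ ba|x xs]; first exact: le_trans ba h.
  by have [r0 _] := hr x (sK x xs); exists (r x / 2) => //; rewrite divr_gt0.
exists d => // x y Kx Xy yx; have [z zs xz] := hs x Kx.
have [_ hz] := hr z (sK z zs); have dz := hd z zs.
have xz' : `|x - z| < r z by apply: lt_trans xz _; have [r0 _] := hr z (sK z zs); lra.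
have yz : `|y - z| < r z.
  rewrite (_ : y - z = (y - x) + (x - z)); last by rewrite addrA subrK.
  by apply: le_lt_trans (ler_normD _ _) _; lra.
have h1 := hz x (KX _ Kx) xz'; have h2 := hz y Xy yz.
rewrite (_ : g y - g x = (g y - g z) - (g x - g z)); last by ring.
by apply: le_trans (ler_normB _ _) _; lra.
Qed.

Lemma rat_above (r : R) : exists2 q : rat, 0 < ratr q :> R & r < ratr q.
Proof.
have [|q] := @rat_in_itvoo R (Num.max 0 r) (Num.max 0 r + 1); first by rewrite ltrDl.
by rewrite in_itv /= gt_max => /andP[/andP[h1 h2] _]; exists q.
Qed.

(** The approximant is a maximum of steep cones with rational apexes close to the graph
    of [g], truncated so as not to exceed a bound of [g]. *)
Lemma selection_approximation (K : set V) g (M : rat) (e : R) : compact K -> K `<=` X ->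
  {within X, continuous g} -> 0 <= ratr M :> R -> (forall x, X x -> `|g x| <= ratr M) -> 0 < e ->
  exists h, [/\ selection h, forall x, `|h x| <= ratr M & forall x, K x -> `|g x - h x| <= e].
Proof.
move=> cK KX cg M0 gM e0.
have e3 : 0 < e / 3 by rewrite divr_gt0.
have [d d0 hd] := compact_uniform cK KX cg e3.
have [A A0 hA] := rat_above (2 * ratr M / d).
pose eta := Num.min (d / 2) (e / 3 / 2 / ratr A).
have eta0 : 0 < eta.
  rewrite /eta lt_min; apply/andP; split; do ?apply: divr_gt0 => //.
have eta_d : eta <= d / 2 by rewrite /eta ge_min lexx.
have eta_A : eta * ratr A <= e / 3 / 2 by rewrite -ler_pdivlMr // /eta ge_min lexx orbT.
have [c hc] : exists c : V -> 'rV[rat]_n * rat, forall x, K x ->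
    [/\ X (map_mx ratr (c x).1), `|map_mx ratr (c x).1 - x| < eta,
      g (map_mx ratr (c x).1) - e / 3 < ratr (c x).2 & ratr (c x).2 < g (map_mx ratr (c x).1)].
  suff : forall x, exists c : 'rV[rat]_n * rat, K x ->
      [/\ X (map_mx ratr c.1), `|map_mx ratr c.1 - x| < eta,
      g (map_mx ratr c.1) - e / 3 < ratr c.2 & ratr c.2 < g (map_mx ratr c.1)].
    by move=> /choice[c hc]; exists c.
  move=> x; have [Kx|nKx] := pselect (K x); last by exists (0, 0).
  have [y [Xq [q yq] qx]] := rational_dense X1 balX (KX _ Kx) eta0.
  rewrite yq in Xq qx.
  have [|a] := @rat_in_itvoo R (g (map_mx ratr q) - e / 3) (g (map_mx ratr q)).
    by rewrite ltrBlDr ltrDl.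
  by rewrite in_itv /= => /andP[h1 h2]; exists (q, a).
have [s [sK hs]] := compact_balls cK (fun _ _ => eta0).
pose cone y x : R := ratr (c y).2 - ratr A * `|x - map_mx ratr (c y).1|.
pose h x : R := Num.min (ratr M) (\big[Num.max/ratr (- M)]_(y <- s) cone y x).
have MM : ratr (- M) <= ratr M :> R by rewrite rmorphN; lra.
have low x : ratr (- M) <= \big[Num.max/ratr (- M)]_(y <- s) cone y x.
  by elim: s {sK hs h} => [|y s IH]; rewrite ?big_nil // big_cons le_max IH orbT.
exists h; split.
- apply: selection_min (selection_cst X M) _; apply: selection_bigmax => y.
  apply: selectionB (selection_cst X _) _; apply: selectionZ; exact: selection_norm.
- move=> x; rewrite ler_norml /h ge_min lexx andbT le_min -rmorphN low.
  by rewrite /= MM.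
move=> x Kx; have Xx := KX _ Kx; have := gM x Xx; rewrite ler_norml => /andP[gl gu].
rewrite ler_distl /h; apply/andP; split.
  rewrite lerBlDr ge_min; apply/orP; right.
  rewrite big_seq; apply: bigmax_le => [|y ys]; first by rewrite rmorphN; lra.
  have [Xq qy q1 q2] := hc y (sK y ys); rewrite /cone.
  have [close|far] := ltP `|map_mx ratr (c y).1 - x| d.
    have := hd _ _ Kx Xq close; rewrite ler_distl => /andP[g1 g2].
    have : 0 <= ratr A * `|x - map_mx ratr (c y).1| by rewrite mulr_ge0 // ltW.
    by lra.
  have := gM _ Xq; rewrite ler_norml => /andP[_ gq].
  have : 2 * ratr M <= ratr A * `|x - map_mx ratr (c y).1|.
    apply: (@le_trans _ _ (ratr A * d)); first by rewrite -ler_pdivrMr // ltW.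
    by rewrite ler_wpM2l ?(ltW A0) // distrC.
  by lra.
have [y ys xy] := hs x Kx; have [Xq qy q1 q2] := hc y (sK y ys).
have near : `|map_mx ratr (c y).1 - x| < 2 * eta.
  rewrite (_ : _ - x = (map_mx ratr (c y).1 - y) - (x - y)); last first.
    by rewrite opprB addrA subrK.
  by apply: le_lt_trans (ler_normB _ _) _; lra.
have close : `|map_mx ratr (c y).1 - x| < d by apply: lt_le_trans near _; lra.
have := hd _ _ Kx Xq close; rewrite ler_distl => /andP[g1 g2].
have hA2 : ratr A * `|x - map_mx ratr (c y).1| <= e / 3.
  rewrite distrC; apply: le_trans (ler_wpM2l (ltW A0) (ltW near)) _.
  by rewrite mulrCA [ratr A * _]mulrC; lra.
have cone_le : cone y x <= \big[Num.max/ratr (- M)]_(z <- s) cone z x.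
  elim: (s) ys => // z s' IH; rewrite in_cons big_cons le_max.
  by move=> /orP[/eqP ->|/IH ->]; rewrite ?lexx ?orbT.
rewrite -lerBlDr le_min; apply/andP; split; first by lra.
apply: le_trans cone_le; rewrite /cone; lra.
Qed.

End Approximation.

(** * The Monge-Ampere pairing of a regularizable function *)

Section Inner.
Variables (R : realType) (n : nat) (X : set 'rV[R]_n).
Local Notation V := 'rV[R]_n.
Local Notation T := (borelV R n).
Variable nu : {measure set T -> \bar R}.
Hypothesis fnu : (nu setT < +oo)%E.

Lemma radon_inner (B : set T) (e : R) : radon_on X nu -> measurable B -> 0 < e ->
  exists K : set V, [/\ compact K, K `<=` B & fine (nu B) <= fine (nu K) + e].
Proof.
move=> [_ inner _] mB e0; pose S := [set nu K | K in [set K : set V | compact K /\ K `<=` B]].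
have SB : nu B = ereal_sup S := inner B mB.
have fB := measure_fin_num fnu mB; have fS : ereal_sup S \is a fin_num by rewrite -SB.
have [_ [K [cK KB] <-]] := ub_ereal_sup_adherent e0 fS.
rewrite -SB => h; exists K; split=> //.
have mK : measurable (K : set T).
  by apply: borel_closed; apply: compact_closed cK; exact: norm_hausdorff.
rewrite -(fineK fB) -(fineK (measure_fin_num fnu mK)) -EFinB lte_fin in h.
by rewrite -lerBlDr ltW.
Qed.

Lemma radon_intro : (forall (B : set T) (e : R), measurable B -> 0 < e ->
    exists K : set V, [/\ compact K, K `<=` B & fine (nu B) <= fine (nu K) + e]) ->
  nu (~` X) = 0%E -> radon_on X nu.
Proof.
have mK (K : set V) : compact K -> measurable (K : set T).
  by move=> cK; apply: borel_closed; apply: compact_closed cK; exact: norm_hausdorff.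
move=> inner nuX; split=> // [K cK|B mB]; first exact: measure_finite (mK _ cK).
apply/eqP; rewrite eq_le; apply/andP; split; last first.
  apply: ge_ereal_sup => _ [K [cK KB] <-].
  by apply: le_measure; rewrite ?inE //; exact: mK.
rewrite -(fineK (measure_fin_num fnu mB)); apply/lee_addgt0Pr => e e0.
have [K [cK KB hK]] := inner B e mB e0.
apply: (@le_trans _ _ (nu K + e%:E)%E).
  by rewrite -(fineK (measure_fin_num fnu (mK _ cK))) -EFinD lee_fin.
by rewrite leeD2r //; apply: ereal_sup_ubound; exists K.
Qed.

End Inner.

Section Pairing.
Variables (R : realType) (n : nat) (X : set 'rV[R]_n).
Variables (Pi0 : set (set 'rV[R]_n)) (w0 : set 'rV[R]_n -> rat).
Hypothesis X1 : one_dim_polyhedral_space X.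
Hypothesis balX : balanced X Pi0 w0.
Variables (ud : set 'rV[R]_n -> 'rV[int]_n) (par : set 'rV[R]_n -> 'rV[R]_n -> R).
Hypothesis hpar : forall e, edges Pi0 e -> edge_coordinate e (ud e) (par e).
Local Notation V := 'rV[R]_n.
Local Notation "'lat' u" := (latv R u) (at level 10, u at level 8).
Local Notation dir := (dir X).
Local Notation wgt := (wgt Pi0 w0).
Local Notation lap := (laplacian X Pi0 w0).
Local Notation mint := (mint X Pi0 w0).
Local Notation good := (good X Pi0).
Local Notation refinement := (refinement Pi0 par).
Local Notation selection := (selection X).
Local Notation locally_affine := (locally_affine X).
Hypothesis cX : connected X.
Local Notation bounded_on := (bounded_on X).
Local Notation T := (borelV R n).
Variable gam : V -> R.
Hypothesis hgam : PAPC X gam.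
Implicit Types (x y z v s t : V) (S sigma tau e : set V) (u : 'rV[int]_n) (f g h : V -> R).

Let PS0 := structure0 balX.
Let clX := space_closed X1.
Let sgam : selection gam := PA_selection hgam.1.
Local Notation dg := (mint gam (fun=> 1)).

Lemma continuous_onD f g : {within X, continuous f} -> {within X, continuous g} ->
  {within X, continuous (fun x => f x + g x)}.
Proof.
apply: (continuous_lipschitz2 (K := 1) (F := fun a b => a + b)) => // a b a' b'.
by rewrite mul1r opprD addrACA ler_normD.
Qed.

Lemma continuous_onB f g : {within X, continuous f} -> {within X, continuous g} ->
  {within X, continuous (fun x => f x - g x)}.
Proof.
apply: (continuous_lipschitz2 (K := 1) (F := fun a b => a - b)) => // a b a' b'.
by rewrite mul1r (_ : a - b - _ = (a - a') - (b - b')) ?ler_normB //; ring.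
Qed.

Lemma continuous_on_cst (r : R) : {within X, continuous (fun=> r)}.
Proof. by apply/within_continuousP => x _ e e0; exists 1 => // y _ _; rewrite subrr normr0. Qed.

Lemma deg_mint : deg X Pi0 w0 gam = dg.
Proof. by rewrite /deg (integral_MA_PAE X1 balX hpar _ hgam.1). Qed.

Lemma PAPC_bdd_selection f : PAPC_bdd X gam f ->
  [/\ selection f, bounded_on (fun x => f x - gam x) & forall x, X x -> 0 <= lap f x].
Proof.
move=> [[pf pc] /bounded_onP bf]; have sf := PA_selection pf; split=> // x Xx.
exact: (PC_laplacian X1 balX hpar).
Qed.

(** By Green's identity this is [mint f g] when [f] belongs to PAPC(X, gam) and [g] is
    bounded piecewise affine, but it makes sense for any [f]: the Laplacian of the
    difference with [gam] is moved to the test function. *)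
Definition MA_form f g : R := mint gam g + mint g (fun x => f x - gam x).

Lemma MA_formE f g : MA_form f g = mint gam g + mint g (fun x => f x - gam x).
Proof. by []. Qed.

Lemma MA_form_mint f g : PAPC_bdd X gam f -> selection g -> bounded_on g ->
  MA_form f g = mint f g.
Proof.
move=> /PAPC_bdd_selection[sf bf _] sg bg; rewrite /MA_form.
rewrite (green X1 balX hpar sg (selectionB sf sgam) bg bf).
rewrite -(mintDl X1 balX hpar _ sgam (selectionB sf sgam)).
by apply: mint_eql => // x Xx; rewrite addrC subrK.
Qed.

Lemma mint_cstl (r : R) h : mint (fun=> r) h = 0.
Proof. by apply: fsbig1 => v _; rewrite laplacian_cst mul0r. Qed.

Lemma MA_formD f g h : selection g -> selection h ->
  MA_form f (fun x => g x + h x) = MA_form f g + MA_form f h.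
Proof.
move=> sg sh; rewrite /MA_form (mintDr X1 balX hpar _ _ sgam).
by rewrite (mintDl X1 balX hpar _ sg sh); ring.
Qed.

Lemma MA_formZ (r : R) f g : selection g -> MA_form f (fun x => r * g x) = r * MA_form f g.
Proof. by move=> sg; rewrite /MA_form mintZr (mintZl X1 balX hpar _ _ sg) mulrDr. Qed.

Lemma MA_form_cst f (r : R) : MA_form f (fun=> r) = r * dg.
Proof.
rewrite /MA_form mint_cstl addr0 -mintZr.
by apply: mint_eqr => x _; rewrite mulr1.
Qed.

Lemma MA_form_cvg (f_ : nat -> V -> R) f g : (forall j, PAPC_bdd X gam (f_ j)) -> {uniform X, f_ @ \oo --> f} ->
  selection g -> bounded_on g ->
  forall e : R, 0 < e -> exists N, forall j, (N <= j)%N -> `|MA_form f g - mint (f_ j) g| <= e.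
Proof.
move=> hf /uniform_epsP uf sg bg e e0; have [B B0 hB] := mint_bound X1 balX hpar sg.
have [|N hN] := uf (e / (B + 1)); first by rewrite divr_gt0 // ltr_wpDl.
exists N => j /hN hj; rewrite -(MA_form_mint (hf j) sg bg) /MA_form.
rewrite (_ : _ - _ = mint g (fun x => f x - f_ j x)); last first.
  rewrite opprD addrACA subrr add0r -mintNr -(mintDr X1 balX hpar _ _ sg).
  by apply: mint_eqr => x _; ring.
apply: le_trans (hB _ _ hj) _; rewrite mulrA ler_pdivrMr ?ltr_wpDl //.
by rewrite mulrC ler_wpM2l ?lerDl // ltW.
Qed.

Lemma le_eps0 (a : R) : (forall e : R, 0 < e -> a <= e) -> a <= 0.
Proof. by move=> h; rewrite leNgt; apply/negP => a0; have := h (a / 2); rewrite divr_gt0 //; lra. Qed.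

Lemma MA_form_ge0 f g : PCreg X gam f -> selection g -> bounded_on g ->
  (forall x, X x -> 0 <= g x) -> 0 <= MA_form f g.
Proof.
move=> [f_ hf uf] sg bg g0; rewrite -oppr_le0; apply: le_eps0 => e e0.
have [N /(_ N (leqnn N))] := MA_form_cvg hf uf sg bg e0.
have [sN _ pN] := PAPC_bdd_selection (hf N).
have := mint_le X1 balX hpar sN pN g0; rewrite (_ : mint (f_ N) (fun=> 0) = 0); last first.
  by apply: fsbig1 => v _; rewrite mulr0.
by rewrite ler_norml => h1 /andP[h2 _]; lra.
Qed.

Lemma MA_form_bound f g (M : rat) : PCreg X gam f -> selection g ->
  (forall x, X x -> `|g x| <= ratr M) -> `|MA_form f g| <= ratr M * dg.
Proof.
move=> rf sg gM; have sM := selection_cst X M.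
have bg : bounded_on g by exists (ratr M).
have b1 : bounded_on (fun x => ratr M + g x) by apply: bounded_onD; [exact: bounded_on_cst|].
have b2 : bounded_on (fun x => ratr M + - g x).
  by apply: bounded_onD; [exact: bounded_on_cst|case: bg => B hB; exists B => x /hB; rewrite normrN].
have p1 x : X x -> 0 <= ratr M + g x by move=> /gM; rewrite ler_norml => /andP[]; lra.
have p2 x : X x -> 0 <= ratr M + - g x by move=> /gM; rewrite ler_norml => /andP[]; lra.
have h1 := MA_form_ge0 rf (selectionD sM sg) b1 p1.
have h2 := MA_form_ge0 rf (selectionD sM (selectionN sg)) b2 p2.
rewrite MA_formD // MA_form_cst in h1.
rewrite MA_formD ?MA_form_cst // in h2; last exact: selectionN.
rewrite (_ : MA_form f (fun x => - g x) = - MA_form f g) in h2; last first.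
  by rewrite -mulN1r -MA_formZ //; congr MA_form; apply/funext => x; rewrite mulN1r.
by rewrite ler_norml; apply/andP; split; lra.
Qed.

Lemma mint_norm_le f g h : selection f -> (forall x, X x -> 0 <= lap f x) ->
  (forall x, X x -> `|g x| <= h x) -> `|mint f g| <= mint f h.
Proof.
move=> sf pf gh; rewrite ler_norml -mintNr; apply/andP; split; apply: (mint_le X1 balX hpar sf pf).
  by move=> x /gh; rewrite ler_norml => /andP[].
by move=> x /gh; rewrite ler_norml => /andP[].
Qed.

Section Representing.
Variable nu : {measure set T -> \bar R}.
Variable f : V -> R.
Hypothesis nuT : nu setT = dg%:E.

Let fnu : (nu setT < +oo)%E. Proof. by rewrite nuT ltry. Qed.
Let mX : measurable (X : set T). Proof. exact: borel_closed. Qed.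
Local Notation I g := (\int[nu]_(x in X) g x).

Lemma MA_reg_form : is_MA_reg X Pi0 w0 gam f nu ->
  forall g, selection g -> bounded_on g -> I g = MA_form f g.
Proof.
move=> [[f_ hf uf] _ _ hnu] g sg bg; have cg : {within X, continuous g} by case: sg.
have := hnu f_ hf uf g cg (proj1 (bounded_onP X g) bg).
rewrite (RintegralE clX fnu mX) // => /cvg_EFin_epsP h.
apply/eqP; rewrite -subr_eq0 -normr_eq0 eq_le normr_ge0 andbT; apply: le_eps0 => e e0.
have e2 : 0 < e / 2 by rewrite divr_gt0.
have [N hN] := h _ e2; have [N' hN'] := MA_form_cvg hf uf sg bg e2.
have := hN _ (leq_maxl N N'); have := hN' _ (leq_maxr N N').
rewrite (integral_MA_PAE X1 balX hpar _ (hf _).1.1) => h1 h2.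
rewrite (_ : I g - _ = (I g - mint (f_ (maxn N N')) g) - (MA_form f g - mint (f_ (maxn N N')) g)); last by ring.
by apply: le_trans (ler_normB _ _) _; lra.
Qed.

(** Testing against bounded piecewise affine functions suffices: inner regularity
    makes the approximating measures tight, and on compact sets continuous functions are
    uniform limits of piecewise affine ones. *)
Lemma form_MA_reg : PCreg X gam f -> radon_on X nu ->
  (forall g, selection g -> bounded_on g -> I g = MA_form f g) -> is_MA_reg X Pi0 w0 gam f nu.
Proof.
move=> rf rnu rep; split=> //; first by rewrite deg_mint.
move=> f_ hf uf g cg /bounded_onP bg.
rewrite (RintegralE clX fnu mX) //; apply/cvg_EFin_epsP => e e0.
have D0 : 0 <= dg by rewrite -lee_fin -nuT.
have [M M0 gM] : exists2 M : rat, 0 < ratr M :> R & forall x, X x -> `|g x| <= ratr M.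
  have [B hB] := bg; have [M M0 BM] := rat_above B.
  by exists M => // x Xx; apply: le_trans (hB x Xx) (ltW BM).
(* The sum of all errors below, in units of the tolerance. *)
pose c := 2 * dg + 6 * ratr M + 1; have c0 : 0 < c by rewrite /c; lra.
have [e' e'E] : exists e' : R, e' = e / c by exists (e / c).
have e'0 : 0 < e' by rewrite e'E divr_gt0.
have [K [cK KX hK]] := radon_inner fnu rnu mX e'0.
have [k hk] : exists k : nat, forall x, K x -> `|x| <= k%:R.
  have [B [_ hB]] := compact_bounded cK; exists (Num.bound (`|B| + 1)) => x Kx.
  apply: (@le_trans _ _ (`|B| + 1)); last by apply/ltW/archi_boundP; rewrite addr_ge0.
  by apply: (hB (`|B| + 1)) => //; apply: le_lt_trans (ler_norm _) _; rewrite ltrDl.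
have mK : measurable (K : set T).
  by apply: borel_closed; apply: compact_closed cK; exact: norm_hausdorff.
have schi := cutoff_selection X k; have bchi := cutoff_bounded X k.
have Ichi : I (cutoff k) <= e'.
  have cchi : {within X, continuous (cutoff k : V -> R)} by case: schi.
  have mXK : measurable (X `\` K : set T) by exact: measurableD.
  have KX' : X `&` K = K by apply/setIidPr.
  rewrite (Rintegral_split X1 fnu mX (@subset_refl _ X) mK cchi bchi) KX'.
  have h0 := Rintegral_bound clX fnu mK KX cchi bchi (M := 0) _.
  have h1 := Rintegral_bound clX fnu mXK (@subDsetl _ _ _) cchi bchi (M := 1) _.
  have := mass_split fnu mX mK; rewrite KX' => hm.
  have {}h0 : `|\int[nu]_(x in K) cutoff k x| <= 0.
    by apply: le_trans (h0 _) _; rewrite ?mul0r // => x Kx; rewrite cutoff0 ?normr0 // hk.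
  have {}h1 : `|\int[nu]_(x in X `\` K) cutoff k x| <= fine (nu (X `\` K)).
    apply: le_trans (h1 _) _; rewrite ?mul1r // => x _.
    by have /andP[a0 a1] := cutoff_range k x; rewrite ger0_norm.
  have := le_trans (ler_norm _) h0; have := le_trans (ler_norm _) h1.
  by rewrite hm in hK; lra.
pose K2 : set V := X `&` [set x | `|x| <= k.+1%:R].
have cK2 : compact K2.
  apply: bounded_closed_compact.
    exists k.+1%:R; split; first exact: num_real.
    by move=> B kB x [_ xk]; apply: le_trans xk (ltW kB).
  apply: closedI => //; apply/closed_epsP => x hx /=; rewrite leNgt; apply/negP => lt.
  have [|y /= yk yx] := hx (`|x| - k.+1%:R); first by rewrite subr_gt0.
  have := ler_normB y (y - x); rewrite (_ : y - (y - x) = x); last by rewrite opprB addrC subrK.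
  by lra.
have [h [sh hM gh]] := selection_approximation X1 balX cK2 (@subIsetl _ _ _) cg (ltW M0) gM e'0.
have bh : bounded_on h by exists (ratr M) => x _.
(* Where the cutoff is 1 only the common bound of [g] and [h] is available. *)
have diff x : X x -> `|g x - h x| <= e' + 2 * ratr M * cutoff k x.
  move=> Xx; have /andP[a0 a1] := cutoff_range k x.
  have [xk|xk] := leP `|x| k.+1%:R.
    apply: le_trans (gh x (conj Xx xk)) _; rewrite lerDl mulr_ge0 // mulr_ge0 //; exact: ltW.
  rewrite (cutoff1 (ltW xk)) mulr1; apply: (le_trans (ler_normB _ _)).
  by have := gM x Xx; have := hM x; lra.
have [N1 hN1] := MA_form_cvg hf uf schi bchi e'0.
have [N2 hN2] := MA_form_cvg hf uf sh bh e'0.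
exists (maxn N1 N2) => j; rewrite geq_max => /andP[/hN1 h1 /hN2 h2].
rewrite (integral_MA_PAE X1 balX hpar _ (hf _).1.1).
have [sj _ pj] := PAPC_bdd_selection (hf j).
have d1 : `|mint (f_ j) (fun x => g x + - h x)| <= e' * dg + 2 * ratr M * mint (f_ j) (cutoff k).
  apply: le_trans (mint_norm_le sj pj diff) _.
  rewrite (mintDr X1 balX hpar _ _ sj) mintZr lerD2r.
  have s1 : selection (fun=> 1 : R).
    by apply: selection_eq (selection_cst X 1) _ => x _; rewrite rmorph1.
  rewrite (_ : mint (f_ j) (fun=> e') = e' * mint (f_ j) (fun=> 1)); last first.
    by rewrite -mintZr; apply: mint_eqr => x _; rewrite mulr1.
  by rewrite -(MA_form_mint (hf j) s1 (bounded_on_cst X 1)) MA_form_cst mul1r.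
rewrite (mintDr X1 balX hpar _ _ sj) mintNr in d1.
have ch : {within X, continuous h} by case: sh.
have cgh : {within X, continuous (fun x => g x - h x)}.
  exact: continuous_onB.
have bgh : bounded_on (fun x => g x - h x).
  have [B hB] := bg; exists (B + ratr M) => x Xx.
  by apply: (le_trans (ler_normB _ _)); rewrite lerD ?hB ?hM.
have d2 : `|I g - I h| <= e' * dg + 2 * ratr M * I (cutoff k).
  have cchi : {within X, continuous (cutoff k : V -> R)} by case: schi.
  have s1 : selection (fun=> 1 : R).
    by apply: selection_eq (selection_cst X 1) _ => x _; rewrite rmorph1.
  have int h' : {within X, continuous h'} -> bounded_on h' -> nu.-integrable X (EFin \o (h' : T -> R)).
    by move=> ch' bh'; exact: (integrable_bounded clX fnu).
  have ce : {within X, continuous (fun=> e' : R)} by exact: continuous_on_cst.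
  have sc : {within X, continuous (fun x => 2 * ratr M * cutoff k x)}.
    have E : 2 * ratr M = ratr (2 * M) :> R by rewrite rmorphM /= rmorph_nat.
    by rewrite E; have [] := selectionZ (2 * M) schi.
  rewrite -RintegralB ?int //; apply: le_trans (le_normr_Rintegral mX (int _ cgh bgh)) _.
  apply: (@le_trans _ _ (\int[nu]_(x in X) (e' + 2 * ratr M * cutoff k x))).
    apply: le_Rintegral => //.
      exact: integrable_norm (int _ cgh bgh).
    by apply: int; [exact: continuous_onD|apply: bounded_onD; [exact: bounded_on_cst|exact: bounded_onZ]].
  rewrite RintegralD ?int //; [|exact: bounded_on_cst|exact: bounded_onZ].
  rewrite RintegralZl ?int // Rintegral_cst // lerD2r.
  suff -> : fine (nu X) = dg by [].
  have [_ _ nuX] := rnu; have := @mass_split _ _ _ fnu [set: T] X measurableT mX.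
  by rewrite setTI setTD nuX nuT /= addr0.
rewrite -(rep _ schi bchi) in h1; rewrite -(rep _ sh bh) in h2.
set a := mint (f_ j) g in d1 *; set b := mint (f_ j) h in d1 h2 *.
set w := mint (f_ j) (cutoff k) in d1 h1.
have M2 : 0 <= 2 * ratr M :> R by rewrite mulr_ge0 // ltW.
have w2 : w <= 2 * e' by move: h1; rewrite ler_distl => /andP[]; lra.
have := ler_wpM2l M2 w2; have := ler_wpM2l M2 Ichi => m1 m2.
rewrite (_ : I g - a = (I g - I h) + (I h - b) - (a - b)); last by ring.
apply: le_trans (ler_normB _ _) _; apply: le_trans (lerD (ler_normD _ _) (lexx _)) _.
have -> : e = c * e' by rewrite e'E mulrCA divff ?mulr1 // gt_eqF.
rewrite /c; lra.
Qed.

End Representing.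
End Pairing.

(** * Construction of the solution *)

Section Existence.
Variables (R : realType) (n : nat) (X : set 'rV[R]_n).
Variables (Pi0 : set (set 'rV[R]_n)) (w0 : set 'rV[R]_n -> rat).
Hypothesis X1 : one_dim_polyhedral_space X.
Hypothesis balX : balanced X Pi0 w0.
Variables (ud : set 'rV[R]_n -> 'rV[int]_n) (par : set 'rV[R]_n -> 'rV[R]_n -> R).
Hypothesis hpar : forall e, edges Pi0 e -> edge_coordinate e (ud e) (par e).
Local Notation V := 'rV[R]_n.
Local Notation "'lat' u" := (latv R u) (at level 10, u at level 8).
Local Notation dir := (dir X).
Local Notation wgt := (wgt Pi0 w0).
Local Notation lap := (laplacian X Pi0 w0).
Local Notation mint := (mint X Pi0 w0).
Local Notation good := (good X Pi0).
Local Notation refinement := (refinement Pi0 par).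
Local Notation selection := (selection X).
Local Notation locally_affine := (locally_affine X).
Hypothesis cX : connected X.
Hypothesis smX : polyhedrally_smooth X Pi0 w0.
Local Notation bounded_on := (bounded_on X).
Local Notation edge_lipschitz := (edge_lipschitz Pi0 par).
Local Notation T := (borelV R n).
Variable gam : V -> R.
Hypothesis hgam : PAPC X gam.
Implicit Types (x y z v s t : V) (S sigma tau e : set V) (u : 'rV[int]_n) (f g h : V -> R).

Let PS0 := structure0 balX.
Let clX := space_closed X1.
Let sgam : selection gam := PA_selection hgam.1.
Local Notation dg := (mint gam (fun=> 1)).
Local Notation MA_form := (MA_form X Pi0 w0 gam).

Lemma mint_point f v : X v -> mint f (fun x => (x == v)%:R) = lap f v.
Proof.
move=> Xv; rewrite /mint; transitivity (\sum_(y \in [set v]) lap f y * (y == v)%:R).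
  symmetry; apply: fsbig_widen => y /= => [->//|[_ /eqP/negPf ->]].
  by rewrite mulr0.
by rewrite fsbig_set1 eqxx mulr1.
Qed.

Lemma laplacian_atoms f : selection f -> exists l : seq (rat * V),
  (forall a, a \in l -> (X `&` @rational_points R n) a.2) /\
  forall g, mint f g = \sum_(a <- l) ratr a.1 * g a.2.
Proof.
move=> sf; have [r hr] : exists r : V -> rat, forall v, X v -> lap f v = ratr (r v).
  suff : forall v, exists q : rat, X v -> lap f v = ratr q by move=> /choice[r hr]; exists r.
  move=> v; have [Xv|nXv] := pselect (X v); last by exists 0.
  by have [q hq] := laplacian_rat X1 balX hpar sf Xv; exists q.
have [||S [gS _ pf _]] := @selections_good _ _ _ _ _ X1 balX _ _ hpar f f set0 sf sf => //.
have [fS SX _ _ _] := gS.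
exists [seq (r v, v) | v <- fset_set S]; split.
  move=> _ /mapP[v + ->] /=; rewrite in_fset_set // inE => Sv.
  by split; [exact: SX|exact: (good_rational gS)].
move=> g; rewrite (mintE X1 balX hpar _ gS pf) big_map !big_seq; apply: eq_bigr => v.
by rewrite in_fset_set // inE => /SX Xv; rewrite hr.
Qed.

Variable o : V.
Hypothesis Xo : (X `&` @rational_points R n) o.

Lemma dipoles : exists dip : V -> V -> R, forall x,
  [/\ selection (dip x), bounded_on (dip x), dip x o = 0 &
    (X `&` @rational_points R n) x -> forall v, X v -> lap (dip x) v = (v == x)%:R - (v == o)%:R].
Proof.
suff : forall x, exists h, [/\ selection h, bounded_on h, h o = 0 &
    (X `&` @rational_points R n) x -> forall v, X v -> lap h v = (v == x)%:R - (v == o)%:R].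
  by move=> /choice[dip hdip]; exists dip.
move=> x; have [Xx|nXx] := pselect ((X `&` @rational_points R n) x); last first.
  exists (fun=> 0); split=> //; last exact: bounded_on_cst.
  by apply: selection_eq (selection_cst X 0) _ => y _; rewrite rmorph0.
by have [h [sh bh ho lh]] := dipole_exists X1 balX hpar cX Xx Xo; exists h.
Qed.

Lemma atoms_potential (l : seq (rat * V)) :
  (forall a, a \in l -> (X `&` @rational_points R n) a.2) ->
  exists f, [/\ selection f, bounded_on f, f o = 0 &
    forall g, mint f g = \sum_(a <- l) ratr a.1 * (g a.2 - g o)].
Proof.
have [dip hdip] := dipoles; elim: l => [|a l IH] hl.
  exists (fun=> 0); split=> //; last by move=> g; rewrite big_nil mint_cstl.
    by apply: selection_eq (selection_cst X 0) _ => y _; rewrite rmorph0.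
  exact: bounded_on_cst.
have [|f [sf bf fo hf]] := IH; first by move=> b bl; apply: hl; rewrite in_cons bl orbT.
have al : (X `&` @rational_points R n) a.2 by apply: hl; rewrite mem_head.
have [sd bd d0 ld] := hdip a.2; have sad := selectionZ a.1 sd.
exists (fun x => ratr a.1 * dip a.2 x + f x); split.
- exact: selectionD.
- by apply: bounded_onD => //; exact: bounded_onZ.
- by rewrite d0 fo mulr0 addr0.
move=> g; rewrite (mintDl X1 balX hpar _ sad sf) (mintZl X1 balX hpar _ _ sd).
by rewrite (mint_dipole g al.1 Xo.1 (ld al)) big_cons hf.
Qed.

Lemma PAPC_bdd_intro f : selection f -> bounded_on (fun x => f x - gam x) ->
  (forall x, X x -> 0 <= lap f x) -> PAPC_bdd X gam f.
Proof.
move=> sf bf pf; split; last exact/bounded_onP.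
split; first exact: (selection_PA X1 balX hpar).
exact: (laplacian_PC X1 balX hpar).
Qed.

(** Adding the potential of the prescribed atoms and subtracting that of the atoms of [gam]
    leaves the prescribed atoms; the poles at [o] cancel because the total masses agree. *)
Lemma atoms_solution (l : seq (rat * V)) :
  (forall a, a \in l -> 0 <= a.1 /\ (X `&` @rational_points R n) a.2) ->
  \sum_(a <- l) ratr a.1 = dg ->
  exists f, [/\ PAPC_bdd X gam f, f o = gam o & forall g, mint f g = \sum_(a <- l) ratr a.1 * g a.2].
Proof.
move=> hl ml; have [lg [hlg glg]] := laplacian_atoms sgam.
have [|f [sf bf fo hf]] := @atoms_potential l; first by move=> a /hl[].
have [f' [sf' bf' fo' hf']] := atoms_potential hlg.
pose p x := gam x + (f x - f' x).
have sff := selectionB sf sf'; have sp : selection p by exact: selectionD.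
have hp g : mint p g = \sum_(a <- l) ratr a.1 * g a.2.
  have sf'N := selectionN sf'.
  rewrite (mintDl X1 balX hpar _ sgam sff) (mintDl X1 balX hpar _ sf sf'N).
  rewrite (_ : mint (fun x => - f' x) g = - mint f' g); last first.
    have := mintZl X1 balX hpar g (-1) sf'; rewrite mulN1r => <-.
    by congr mint; apply/funext => x; rewrite mulN1r.
  have split_sum (l' : seq (rat * V)) : \sum_(a <- l') ratr a.1 * (g a.2 - g o) =
      \sum_(a <- l') ratr a.1 * g a.2 - (\sum_(a <- l') ratr a.1 * 1) * g o.
    by rewrite mulr_suml -sumrB; apply: eq_bigr => a _; rewrite mulrBr mulr1.
  rewrite hf hf' !split_sum -(glg (fun=> 1)) -glg (_ : \sum_(a <- l) ratr a.1 * 1 = dg); last first.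
    by rewrite -ml; apply: eq_bigr => a _; rewrite mulr1.
  by ring.
exists p; split=> //; last by rewrite /p fo fo' subrr addr0.
apply: PAPC_bdd_intro => //.
  have [B hB] := bf; have [B' hB'] := bf'; exists (B + B') => x Xx.
  by rewrite /p addrC addKr; apply: (le_trans (ler_normB _ _)); rewrite lerD ?hB ?hB'.
move=> x Xx; rewrite -mint_point // hp big_seq; apply: sumr_ge0 => a /hl[a0 _].
by rewrite mulr_ge0 // ler0q.
Qed.

Lemma PAPC_bdd_shift f (c : rat) : PAPC_bdd X gam f -> PAPC_bdd X gam (fun x => f x + ratr c).
Proof.
move=> hf; have [sf bf pf] := PAPC_bdd_selection X1 balX hpar hf.
have sc := selection_cst X c; apply: PAPC_bdd_intro; first exact: selectionD.
  have [B hB] := bf; exists (B + `|ratr c|) => x Xx.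
  by rewrite addrAC; apply: (le_trans (ler_normD _ _)); rewrite lerD2r hB.
move=> x Xx; rewrite (laplacianD X1 balX Xx) ?laplacian_cst ?addr0 ?pf //.
  exact: (selection_locally_affine X1 balX hpar).
exact: locally_affine_cst.
Qed.

(** The supremum of the lower bounds [a i - d i] satisfies all upper bounds. *)
Lemma limit_with_rate (a d : nat -> R) : (forall i j, `|a i - a j| <= d i + d j) ->
  exists l, forall i, `|l - a i| <= d i.
Proof.
move=> h; pose A := range (fun i => a i - d i).
have ub j : ubound A (a j + d j).
  by move=> _ [i _ <-]; have := h i j; rewrite ler_norml => /andP[_]; lra.
exists (sup A) => i; rewrite ler_distl; apply/andP; split.
  by apply: sup_upper_bound; [split; [exists (a 0%N - d 0%N); exists 0%N|exists (a 0%N + d 0%N)]|exists i].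
by apply: sup_le_ub => //; exists (a 0%N - d 0%N); exists 0%N.
Qed.

Lemma half_pow_small (c e : R) : 0 < e -> exists N, forall j, (N <= j)%N -> c * 2^-1 ^+ j <= e.
Proof.
move=> e0; have : (fun j => 2^-1 ^+ j : R) @ \oo --> (0 : R).
  by apply: cvg_expr; rewrite ger0_norm ?invf_lt1 // ltr1n.
move=> /cvg_epsP /(_ (e / (`|c| + 1))) []; first by rewrite divr_gt0 // ltr_wpDl.
move=> N hN; exists N => j /hN; rewrite sub0r normrN ger0_norm ?exprn_ge0 // => hj.
apply: le_trans (ler_wpM2r _ (ler_norm c)) _; first exact: exprn_ge0.
apply: le_trans (ler_wpM2l _ hj) _ => //.
by rewrite mulrCA ler_piMr ?(ltW e0) // ler_pdivrMr ?ltr_wpDl // mul1r lerDl.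
Qed.

Variable mu : {measure set T -> \bar R}.
Hypothesis muT : mu setT = dg%:E.
Hypothesis cmu : compactly_supported X mu.
Let fmu : (mu setT < +oo)%E. Proof. by rewrite muT ltry. Qed.

Lemma approximate_solution (eps : R) : 0 < eps -> exists f, [/\ PAPC_bdd X gam f, f o = gam o &
  forall (C : R) g, 0 <= C -> edge_lipschitz C g -> bounded_on g ->
    `|\int[mu]_(x in X) g x - mint f g| <= C * eps].
Proof.
move=> eps0; have [lg [hlg glg]] := laplacian_atoms sgam.
have [K [cK KX muK]] := cmu.
have dgE : dg = ratr (\sum_(a <- lg) a.1).
  by rewrite glg rmorph_sum; apply: eq_bigr => a _; rewrite mulr1.
have muT' : mu setT = (ratr (\sum_(a <- lg) a.1))%:E by rewrite -dgE.
have [l [hl ml Cl]] := atomic_approximation X1 balX hpar cX fmu Xo.1 Xo.2 cK KX muK muT' eps0.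
have [|f [pf fo hf]] := atoms_solution hl; first by rewrite dgE -ml rmorph_sum.
by exists f; split=> // C g C0 Lg bg; rewrite hf; exact: Cl.
Qed.

(** By testing against dipoles with one pole at [o], approximate solutions that are
    normalized at [o] form a uniform Cauchy sequence with a known rate. *)
Lemma solution : exists f, [/\ PSH X gam f, PCreg X gam f, bounded_on (fun x => f x - gam x) &
  forall g, selection g -> bounded_on g -> \int[mu]_(x in X) g x = MA_form f g].
Proof.
have [C0 C00 hC0] := dipole_edge_lipschitz X1 balX hpar cX.
have p0 j : 0 < 2^-1 ^+ j / C0 :> R by rewrite divr_gt0 // exprn_gt0.
have [f_ hf_] := choice (fun j => approximate_solution (p0 j)).
have hf j : PAPC_bdd X gam (f_ j) by have [] := hf_ j.
have fo j : f_ j o = gam o by have [] := hf_ j.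
have If j (C : R) g : 0 <= C -> edge_lipschitz C g -> bounded_on g ->
    `|\int[mu]_(x in X) g x - mint (f_ j) g| <= C * (2^-1 ^+ j / C0).
  by have [_ _ h] := hf_ j; exact: h.
have cf j : {within X, continuous (fun x => f_ j x - gam x)}.
  have [sf _ _] := PAPC_bdd_selection X1 balX hpar (hf j).
  by apply: continuous_onB; [case: sf|case: sgam].
(* At a rational point the potential is an integral against the dipole based there. *)
have rate i j x : X x -> `|f_ i x - f_ j x| <= 2^-1 ^+ i + 2^-1 ^+ j.
  move=> Xx; rewrite (_ : f_ i x - f_ j x = (f_ i x - gam x) - (f_ j x - gam x)); last by ring.
  apply: (rational_bound X1 balX (f := fun x => (f_ i x - gam x) - (f_ j x - gam x))) Xx.
    exact: continuous_onB.
  move=> y Xy ry; have [h [sh bh ho lh]] := dipole_exists X1 balX hpar cX (conj Xy ry) Xo.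
  have Lh := hC0 h y o Xy Xo.1 sh bh lh.
  have pot k : `|\int[mu]_(x in X) h x - mint gam h - (f_ k y - gam y)| <= 2^-1 ^+ k.
    have := If k _ _ (ltW C00) Lh bh; rewrite [C0 * _]mulrC divfK ?gt_eqF //.
    rewrite -(MA_form_mint X1 balX hpar hgam (hf k) sh bh) /MA_form.
    by rewrite (mint_dipole _ Xy Xo.1 lh) fo subrr subr0 opprD addrA.
  have := pot i; have := pot j; rewrite !ler_norml => /andP[a1 a2] /andP[b1 b2].
  by apply/andP; split; lra.
have [w hw] : exists w : V -> R, forall x, X x -> forall i, `|w x - f_ i x| <= 2^-1 ^+ i.
  suff : forall x, exists l : R, X x -> forall i, `|l - f_ i x| <= 2^-1 ^+ i.
    by move=> /choice[w hw]; exists w.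
  move=> x; have [Xx|nXx] := pselect (X x); last by exists 0.
  have [l hl] := @limit_with_rate (fun i => f_ i x) (fun i => 2^-1 ^+ i) (fun i j => rate i j x Xx).
  by exists l.
have uf : {uniform X, f_ @ \oo --> w}.
  apply/uniform_epsP => e e0; have [N hN] := half_pow_small 1 e0.
  exists N => j /hN hj x Xx; apply: le_trans (hw x Xx j) _.
  by rewrite -[leLHS]mul1r.
have Rw : PCreg X gam w by exists f_.
(* Consecutive terms differ by at most 3/2 of the rate, less than the drop of
   the constant, which is twice the rate. *)
pose d j : rat := 4 * 2^-1 ^+ j.
have dE j : ratr (d j) = 4 * 2^-1 ^+ j :> R by rewrite rmorphM rmorphXn /= fmorphV !rmorph_nat.
exists w; split=> //.
- exists (fun j x => f_ j x + ratr (d j)); split.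
  + by move=> j; exact: PAPC_bdd_shift.
  + move=> x Xx; apply/nonincreasing_seqP => j.
    have := rate j j.+1 x Xx; rewrite !dE exprS ler_norml => /andP[h1 h2].
    have : 0 < 2^-1 ^+ j :> R by rewrite exprn_gt0.
    by lra.
  + move=> x Xx; apply/cvg_epsP => e e0; have [N hN] := half_pow_small 5 e0.
    exists N => j /hN hj; apply: le_trans hj; rewrite dE opprD addrA.
    apply: le_trans (ler_normB _ _) _; have := hw x Xx j.
    rewrite [X in _ + X <= _]ger0_norm ?mulr_ge0 ?exprn_ge0 //.
    by move=> h1; rewrite (_ : 5 = 1 + 4 :> R) ?mulrDl ?mul1r ?lerD2r //; ring.
- have [_ [B hB] _] := PAPC_bdd_selection X1 balX hpar (hf 0%N); exists (1 + B) => x Xx.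
  rewrite (_ : w x - gam x = (w x - f_ 0%N x) + (f_ 0%N x - gam x)); last by ring.
  by apply: le_trans (ler_normD _ _) _; rewrite lerD ?hB // (le_trans (hw x Xx 0%N)) // expr0.
move=> g sg bg; apply/eqP; rewrite -subr_eq0 -normr_eq0 eq_le normr_ge0 andbT; apply: le_eps0 => e e0.
have e2 : 0 < e / 2 by rewrite divr_gt0.
have [N hN] := MA_form_cvg X1 balX hpar hgam hf uf sg bg e2.
have [C Cge Lg] := selection_edge_lipschitz X1 balX hpar cX sg bg.
have [N' hN'] := half_pow_small (C / C0) e2.
have h1 := hN _ (leq_maxl N N'); have h2 := hN' _ (leq_maxr N N').
have h3 := If (maxn N N') C g Cge Lg bg.
rewrite (_ : _ - _ = (\int[mu]_(x in X) g x - mint (f_ (maxn N N')) g) -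
  (MA_form w g - mint (f_ (maxn N N')) g)); last by ring.
apply: le_trans (ler_normB _ _) _; rewrite [leRHS]splitr; apply: lerD => //.
by apply: le_trans h3 _; rewrite mulrCA mulrC.
Qed.

End Existence.

(** * Restrictions, atoms and truncations *)

Section Measures.
Variables (R : realType) (n : nat) (X : set 'rV[R]_n).
Hypothesis X1 : one_dim_polyhedral_space X.
Local Notation V := 'rV[R]_n.
Local Notation T := (borelV R n).
Local Notation bounded_on := (bounded_on X).
Implicit Types (x y z v : V) (f g h : V -> R).

Let clX := space_closed X1.
Let mX : measurable (X : set T). Proof. exact: borel_closed. Qed.

Lemma restriction_measure (mu : {measure set T -> \bar R}) (U : set T) :
  (mu setT < +oo)%E -> radon_on X mu -> measurable U -> U `<=` X ->
  exists nu : {measure set T -> \bar R}, [/\ (nu setT < +oo)%E, radon_on X nu &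
    forall g, {within X, continuous g} -> bounded_on g ->
      \int[nu]_(x in X) g x = \int[mu]_(x in U) g x].
Proof.
move=> fmu rmu mU UX; pose nu : {measure set T -> \bar R} := mrestr mu mU.
have nuE A : nu A = mu (A `&` U) by [].
have fnu : (nu setT < +oo)%E by rewrite nuE setTI; exact: measure_finite.
exists nu; split=> //.
  apply: (radon_intro fnu); last by rewrite nuE (_ : _ `&` _ = set0) ?measure0 //;
    apply/seteqP; split=> // x [nXx /UX].
  move=> B e mB e0; have [|K [cK KB hK]] := radon_inner fmu (B := B `&` U) rmu _ e0.
    exact: measurableI.
  have KU : K `&` U = K by apply/setIidPl => x /KB[].
  by exists K; rewrite !nuE KU; split=> // x /KB[].
move=> g cg bg; rewrite (Rintegral_split X1 fnu mX (@subset_refl _ X) mU cg bg).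
have XU : X `&` U = U by apply/setIidPr.
have mXU : measurable (X `\` U : set T) by exact: measurableD.
have [M hM] := bg; rewrite (_ : \int[nu]_(x in X `\` U) g x = 0); last first.
  apply/eqP; rewrite -normr_eq0 eq_le normr_ge0 andbT.
  apply: le_trans (Rintegral_bound clX fnu mXU (@subDsetl _ _ _) cg bg (M := M) _) _.
    by move=> x [Xx _]; exact: hM.
  rewrite nuE (_ : _ `&` _ = set0) ?measure0 ?mulr0 //.
  by apply/seteqP; split=> // x [[_ nUx] Ux].
rewrite addr0 XU; congr fine; apply: eq_measure_integral => A mA AU.
by rewrite nuE; congr (mu _); apply/setIidPl.
Qed.

Lemma add_atom (nu : {measure set T -> \bar R}) (c : R) p :
  (nu setT < +oo)%E -> radon_on X nu -> 0 <= c -> X p ->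
  exists nu' : {measure set T -> \bar R}, [/\ (nu' setT < +oo)%E, radon_on X nu' &
    forall g, {within X, continuous g} -> bounded_on g ->
      \int[nu']_(x in X) g x = \int[nu]_(x in X) g x + c * g p].
Proof.
move=> fnu rnu c0 Xp; pose at_p : {measure set T -> \bar R} := mscale (NngNum c0) (dirac (p : T)).
pose nu' : {measure set T -> \bar R} := measure_add nu at_p.
have atE (A : set T) : at_p A = (c * (p \in A)%:R)%:E.
  by rewrite /at_p /= /mscale /= diracE EFinM.
have nuE (A : set T) : nu' A = (nu A + (c * (p \in A)%:R)%:E)%E.
  by transitivity (nu A + at_p A)%E; [exact: measure_addE|rewrite atE].
have fnu' : (nu' setT < +oo)%E by rewrite nuE lte_add_pinfty // ltry.
have fat : (at_p setT < +oo)%E by rewrite atE ltry.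
have fineE (A : set T) : measurable A -> fine (nu' A) = fine (nu A) + c * (p \in A)%:R.
  by move=> mA; rewrite nuE fineD //; exact: measure_fin_num.
have mK (K : set V) : compact K -> measurable (K : set T).
  by move=> cK; apply: borel_closed; apply: compact_closed cK; exact: norm_hausdorff.
exists nu'; split=> //.
  apply: (radon_intro fnu'); last first.
    have [_ _ nuX] := rnu; rewrite nuE nuX add0e (_ : p \in ~` X = false) ?mulr0 //.
    by apply/negbTE/negP; rewrite inE => /(_ Xp).
  move=> B e mB e0; have [K [cK KB hK]] := radon_inner fnu rnu mB e0.
  have [Bp|nBp] := boolP (p \in B); last first.
    exists K; split=> //; rewrite !fineE //; last exact: mK.
    rewrite (negbTE nBp) (_ : p \in K = false) ?mulr0 ?addr0 //.
    by apply: contraNF nBp; rewrite !inE => /KB.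
  have cKp : compact (K `|` [set p]) by apply: compactU => //; exact: compact_set1.
  exists (K `|` [set p]); split=> //.
    by move=> x [/KB //|->]; move: Bp; rewrite inE.
  rewrite !fineE // ?Bp; [|exact: mK].
  have pKp : p \in (K `|` [set p] : set V) by rewrite inE; right.
  rewrite pKp mulr1.
  rewrite addrAC lerD2r; apply: le_trans hK _; rewrite lerD2r fine_le ?(measure_fin_num fnu) //.
  - exact: mK.
  - exact: mK.
  apply: le_measure; rewrite ?inE; [exact: mK|exact: mK|by move=> x; left].
move=> g cg bg; have i1 := integrable_bounded clX fnu mX (@subset_refl _ X) cg bg.
have i2 := integrable_bounded clX fat mX (@subset_refl _ X) cg bg.
have mg := measurable_int nu i1.
rewrite /Rintegral integral_measure_add // fineD; [|exact: integrable_fin_num|exact: integrable_fin_num].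
congr (_ + _); rewrite -/(Rintegral at_p X g).
have m1 : measurable ([set p] : set T) by exact: borel_point.
rewrite (Rintegral_split X1 fat mX (@subset_refl _ X) m1 cg bg).
have Xp' : X `&` [set p] = [set p] by apply/setIidPr => x ->.
have mXp : measurable (X `\` [set p] : set T) by exact: measurableD.
have [M hM] := bg; rewrite (_ : \int[at_p]_(x in X `\` [set p]) g x = 0); last first.
  apply/eqP; rewrite -normr_eq0 eq_le normr_ge0 andbT.
  apply: le_trans (Rintegral_bound clX fat mXp (@subDsetl _ _ _) cg bg (M := M) _) _.
    by move=> x [Xx _]; exact: hM.
  have np : p \in X `\` [set p] = false by apply/negbTE/negP; rewrite inE => -[_]; apply.
  by rewrite atE np mulr0 mulr0.
rewrite addr0 Xp' (@eq_Rintegral _ _ _ _ _ (fun=> g p)); last by move=> x /[!inE] ->.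
rewrite Rintegral_cst // mulrC; congr (_ * _).
have pp : p \in [set p] by rewrite inE.
by rewrite atE pp mulr1.
Qed.

Lemma add_atoms (l : seq (R * V)) (nu : {measure set T -> \bar R}) :
  (nu setT < +oo)%E -> radon_on X nu -> (forall a, a \in l -> 0 <= a.1 /\ X a.2) ->
  exists nu' : {measure set T -> \bar R}, [/\ (nu' setT < +oo)%E, radon_on X nu' &
    forall g, {within X, continuous g} -> bounded_on g ->
      \int[nu']_(x in X) g x = \int[nu]_(x in X) g x + \sum_(a <- l) a.1 * g a.2].
Proof.
elim: l nu => [|a l IH] nu fnu rnu hl.
  by exists nu; split=> // g _ _; rewrite big_nil addr0.
have [a0 Xa] : 0 <= a.1 /\ X a.2 by apply: hl; rewrite mem_head.
have [nu1 [f1 r1 h1]] := add_atom fnu rnu a0 Xa.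
have [|nu2 [f2 r2 h2]] := IH nu1 f1 r1; first by move=> b bl; apply: hl; rewrite in_cons bl orbT.
by exists nu2; split=> // g cg bg; rewrite h2 // h1 // big_cons addrA.
Qed.

End Measures.

Section Truncation.
Variables (R : realType) (n : nat) (X : set 'rV[R]_n).
Variables (Pi0 : set (set 'rV[R]_n)) (w0 : set 'rV[R]_n -> rat).
Hypothesis X1 : one_dim_polyhedral_space X.
Hypothesis balX : balanced X Pi0 w0.
Variables (ud : set 'rV[R]_n -> 'rV[int]_n) (par : set 'rV[R]_n -> 'rV[R]_n -> R).
Hypothesis hpar : forall e, edges Pi0 e -> edge_coordinate e (ud e) (par e).
Local Notation V := 'rV[R]_n.
Local Notation "'lat' u" := (latv R u) (at level 10, u at level 8).
Local Notation dir := (dir X).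
Local Notation wgt := (wgt Pi0 w0).
Local Notation lap := (laplacian X Pi0 w0).
Local Notation mint := (mint X Pi0 w0).
Local Notation good := (good X Pi0).
Local Notation refinement := (refinement Pi0 par).
Local Notation selection := (selection X).
Local Notation locally_affine := (locally_affine X).
Hypothesis cX : connected X.
Hypothesis smX : polyhedrally_smooth X Pi0 w0.
Local Notation bounded_on := (bounded_on X).
Variable gam : V -> R.
Hypothesis hgam : PAPC X gam.
Implicit Types (x y z v s t : V) (S sigma tau e : set V) (u : 'rV[int]_n) (f g h : V -> R).

Let sgam : selection gam := PA_selection hgam.1.

Lemma max_dist (a b a' b' e : R) : `|a - a'| <= e -> `|b - b'| <= e ->
  `|Num.max a b - Num.max a' b'| <= e.
Proof.
rewrite !ler_norml => /andP[h1 h2] /andP[h3 h4].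
by apply/andP; split; case: (lerP a b); case: (lerP a' b') => h h'; lra.
Qed.

Lemma PAPC_bdd_max f g : PAPC_bdd X gam f -> PAPC_bdd X gam g ->
  PAPC_bdd X gam (fun x => Num.max (f x) (g x)).
Proof.
move=> [[pf [cf hf]] /bounded_onP[B hB]] [[pg [cg hg]] /bounded_onP[B' hB']].
have sm := selection_max (PA_selection pf) (PA_selection pg).
split; last first.
  apply/bounded_onP; exists (Num.max B B') => x Xx; have h1 := hB x Xx; have h2 := hB' x Xx.
  by rewrite le_max; case: (lerP (f x) (g x)) => _; rewrite ?h1 ?h2 ?orbT.
split; first exact: (selection_PA X1 balX hpar).
split=> [|Pi PS m x xs a cc]; first by case: sm.
have a0 i : 0 <= a i by have [tau [sigma [_ [/(_ i)/andP[]]]]] := cc.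
rewrite ge_max; apply/andP; split.
  apply: le_trans (hf Pi PS m x xs a cc) _; apply: ler_sum => i _.
  by rewrite ler_wpM2l // le_max lexx.
apply: le_trans (hg Pi PS m x xs a cc) _; apply: ler_sum => i _.
by rewrite ler_wpM2l // le_max lexx orbT.
Qed.

Lemma PCreg_continuous f : PCreg X gam f -> {within X, continuous f}.
Proof.
move=> [f_ hf /uniform_epsP uf]; apply/within_continuousP => x Xx e e0.
have e4 : 0 < e / 4 by rewrite divr_gt0.
have [N hN] := uf _ e4; have {}hN := hN N (leqnn N).
have [[sN _] _ _] := PAPC_bdd_selection X1 balX hpar (hf N).
have /within_continuousP/(_ x Xx _ e4)[d d0 hd] := sN; exists d => // y Xy yx.
have h1 := hN x Xx; have h2 := hN y Xy; have h3 := hd y Xy yx.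
rewrite (_ : f y - f x = (f y - f_ N y) + (f_ N y - f_ N x) - (f x - f_ N x)); last by ring.
apply: le_lt_trans (ler_normB _ _) _; have := ler_normD (f y - f_ N y) (f_ N y - f_ N x).
by lra.
Qed.

Lemma PAPC_bdd_self : PAPC_bdd X gam gam.
Proof. by split=> //; apply/bounded_onP; exists 0 => x _; rewrite subrr normr0. Qed.

Lemma rat_near (r e : R) : 0 < e -> exists q : rat, `|r - ratr q| <= e.
Proof.
move=> e0; have [|q] := @rat_in_itvoo R (r - e) (r + e); first by lra.
by rewrite in_itv /= => /andP[h1 h2]; exists q; rewrite ler_norml; apply/andP; split; lra.
Qed.

(** The level is approximated by rationals, since the constants of piecewise affine
    functions are rational. *)
Lemma PCreg_truncation f (t : R) : PCreg X gam f -> PCreg X gam (truncation gam f t).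
Proof.
move=> [f_ hf /uniform_epsP uf].
have p0 j : 0 < 2^-1 ^+ j :> R by rewrite exprn_gt0.
have [q hq] := choice (fun j => rat_near t (p0 j)).
exists (fun j x => Num.max (f_ j x) (gam x + ratr (- q j))).
  by move=> j; apply: PAPC_bdd_max => //; by apply: (PAPC_bdd_shift X1 balX hpar smX); exact: PAPC_bdd_self.
apply/uniform_epsP => e e0; have [N hN] := uf e e0; have [N' hN'] := half_pow_small 1 e0.
exists (maxn N N') => j; rewrite geq_max => /andP[/hN h1 /hN' h2] x Xx.
apply: max_dist; first exact: h1.
rewrite rmorphN (_ : _ - _ = - (t - ratr (q j))); last by ring.
by rewrite normrN (le_trans (hq j)) // -[leLHS]mul1r.
Qed.

End Truncation.

(** * The boundary of a superlevel set is finite *)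

Section Boundary.
Variables (R : realType) (n : nat) (X : set 'rV[R]_n).
Variables (Pi0 : set (set 'rV[R]_n)) (w0 : set 'rV[R]_n -> rat).
Hypothesis X1 : one_dim_polyhedral_space X.
Hypothesis balX : balanced X Pi0 w0.
Variables (ud : set 'rV[R]_n -> 'rV[int]_n) (par : set 'rV[R]_n -> 'rV[R]_n -> R).
Hypothesis hpar : forall e, edges Pi0 e -> edge_coordinate e (ud e) (par e).
Local Notation V := 'rV[R]_n.
Local Notation "'lat' u" := (latv R u) (at level 10, u at level 8).
Local Notation dir := (dir X).
Local Notation wgt := (wgt Pi0 w0).
Local Notation lap := (laplacian X Pi0 w0).
Local Notation mint := (mint X Pi0 w0).
Local Notation good := (good X Pi0).
Local Notation refinement := (refinement Pi0 par).
Local Notation selection := (selection X).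
Local Notation locally_affine := (locally_affine X).
Hypothesis cX : connected X.
Local Notation bounded_on := (bounded_on X).
Variable gam : V -> R.
Hypothesis hgam : PAPC X gam.
Implicit Types (x y z v s t : V) (S sigma tau e : set V) (u : 'rV[int]_n) (f g h : V -> R).

Let PS0 := structure0 balX.
Let sgam : selection gam := PA_selection hgam.1.

Lemma laplacianB f g v : X v -> locally_affine f -> locally_affine g ->
  lap (fun x => f x - g x) v = lap f v - lap g v.
Proof.
move=> Xv lf lg; rewrite -[- lap g v]mulN1r -laplacianZ // -(laplacianD X1 balX Xv lf).
  by apply: (laplacian_eq Pi0 w0 Xv) => y _; rewrite mulN1r.
exact: locally_affineZ.
Qed.

Lemma par_shift_between e a p b (r : R) : edges Pi0 e -> e a -> e p -> e b ->
  par e a <= par e p + r <= par e b -> e (p + r *: lat (ud e)).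
Proof.
move=> Ee ea ep eb h; have pE := par_pt hpar Ee ea ep.
rewrite (_ : p + _ = a + (par e p + r - par e a) *: lat (ud e)).
  exact: (par_between balX hpar Ee ea eb h).
by rewrite {1}pE -addrA -scalerDl; congr (_ + _ *: _); ring.
Qed.

(** One of the two slopes at [p] is nonnegative, and the function stays above the
    corresponding tangent. *)
Lemma subharmonic_between f e a p b : selection f -> edges Pi0 e -> e a -> e p -> e b ->
  par e a < par e p -> par e p < par e b ->
  (forall y, e y -> par e a < par e y -> par e y < par e b -> 0 <= lap f y) ->
  f p <= Num.max (f a) (f b).
Proof.
move=> sf Ee ea ep eb ap pb pos; have pu := ud_prim hpar Ee.
have pN : prim (- ud e) by exact: primN.
have pE := par_pt hpar Ee ea ep; have bE := par_pt hpar Ee ep eb.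
have bE' := par_pt hpar Ee ea eb.
have aE : a = p + (par e p - par e a) *: lat (- ud e) by rewrite latvN scalerN {1}pE addrK.
have ebp : e (p + (par e b - par e p) *: lat (ud e)) by rewrite -bE.
have eap : e (p + (par e p - par e a) *: lat (- ud e)) by rewrite -aE.
have eab : e (a + (par e b - par e a) *: lat (ud e)) by rewrite -bE'.
have pb0 : 0 < par e b - par e p by rewrite subr_gt0.
have ap0 : 0 < par e p - par e a by rewrite subr_gt0.
have inseg (s : R) : par e a - par e p < s -> s < par e b - par e p ->
    e (p + s *: lat (ud e)) /\ 0 <= lap f (p + s *: lat (ud e)).
  move=> s1 s2; have es : e (p + s *: lat (ud e)).
    by apply: (par_shift_between Ee ea ep eb); apply/andP; split; lra.
  by split=> //; apply: pos; rewrite ?(par_shift hpar) //; lra.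
have h1 : f p + (par e b - par e p) * slope f p (ud e) <= f b.
  rewrite {2}bE; apply: (laplacian_gradient X1 balX hpar sf _ PS0 Ee.1 pu ep ebp pb0).
  by move=> s /andP[s0 s1]; apply: (inseg s _ s1).2; lra.
have h2 : f p + (par e p - par e a) * slope f p (- ud e) <= f a.
  rewrite {2}aE; apply: (laplacian_gradient X1 balX hpar sf _ PS0 Ee.1 pN ep eap ap0).
  move=> s /andP[s0 s1]; rewrite latvN scalerN -scaleNr.
  by apply: (inseg (- s) _ _).2; lra.
have sb : 0 < par e p - par e a < par e b - par e a by apply/andP; split; lra.
have [Xp du dN dE] := dir_segment X1 PS0 Ee.1 pu ea eab sb.
rewrite -pE in Xp du dN dE.
have := pos p ep ap pb; rewrite (laplacian_line X1 balX f Xp pu dE) pmulr_rge0 ?ltr0q; last first.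
  exact: (wgt_gt0 X1 balX).
move=> sum0; rewrite le_max; apply/orP; have [s0|s0] := leP 0 (slope f p (ud e)).
  by right; apply: le_trans h1; rewrite lerDl mulr_ge0 // ltW.
have s0' : 0 <= slope f p (- ud e) by lra.
by left; apply: le_trans h2; rewrite lerDl mulr_ge0 // ltW.
Qed.

Variables (phi : V -> R) (t : R).
Hypothesis rphi : PCreg X gam phi.

Definition superlevel : set V := [set x | X x /\ gam x - t < phi x].

(** The points where the truncation can have mass that comes neither from the measure of
    [phi] nor from that of [gam]. *)
Definition contact_boundary : set V := [set x | [/\ X x, phi x <= gam x - t &
  forall r : R, 0 < r -> exists2 y, superlevel y & `|y - x| < r]].

Lemma finite_ordered (A : set V) e : edges Pi0 e -> A `<=` e ->
  (forall a p b, A a -> A p -> A b -> par e a < par e p -> par e p < par e b -> False) ->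
  finite_set A.
Proof.
move=> Ee Ae three; have [[a Aa]|nA] := pselect (A !=set0); last first.
  by apply: sub_finite_set (finite_set0 V) => a Aa; apply: nA; exists a.
have [[b [Ab ba]]|nb] := pselect (exists b, A b /\ b <> a); last first.
  apply: sub_finite_set (finite_set1 a) => b Ab /=.
  by apply: contrapT => ba; apply: nb; exists b.
apply: sub_finite_set (finite_set2 a b) => c Ac /=.
apply: contrapT => /not_orP[ca cb].
have neq x y : A x -> A y -> x <> y -> par e x != par e y.
  by move=> Ax Ay xy; apply/eqP => /(par_inj hpar Ee (Ae _ Ax) (Ae _ Ay)).
have nab := neq _ _ Ab Aa ba; have nca := neq _ _ Ac Aa ca; have ncb := neq _ _ Ac Ab cb.
case/orP: (lt_total nab) => [hba|hab].
  case/orP: (lt_total ncb) => [hcb|hbc]; first exact: (three c b a).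
  by case/orP: (lt_total nca) => [hca|hac]; [exact: (three b c a)|exact: (three b a c)].
case/orP: (lt_total nca) => [hca|hac]; first exact: (three c a b).
by case/orP: (lt_total ncb) => [hcb|hbc]; [exact: (three a c b)|exact: (three a b c)].
Qed.

(** Where [gam] is affine [phi - gam] is convex, so that between two contact points of
    the same cell there is nothing but contact points. *)
Lemma contact_boundary_finite : finite_set contact_boundary.
Proof.
have [||S [gS _ pg _]] := @selections_good _ _ _ _ _ X1 balX _ _ hpar gam gam set0 sgam sgam => //.
have PSR := refinement_structure X1 balX hpar gS.
have -> : contact_boundary = \bigcup_(sigma in refinement S) (contact_boundary `&` sigma).
  apply/seteqP; split=> [x bx|x [sigma _ []]//].
  have Xx : X x by case: bx.
  have : (\bigcup_(sigma in refinement S) sigma) x by case: PSR => _ ->.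
  by move=> [sigma Rs sx]; exists sigma.
apply: bigcup_finite => [|sigma]; first exact: structure_finite PSR.
move=> [[s Ss ->]|[e [x [Ee ex Sx ->]]]].
  by apply: sub_finite_set (finite_set1 s) => y [].
apply: (finite_ordered Ee) => [y [_ /cellS_sub]//|a p b [Ba ca] [Bp cp] [Bb cb] ap pb].
have [[ea ep] eb] := (cellS_sub ca, cellS_sub cp, cellS_sub cb).
have harmonic y : e y -> par e a < par e y -> par e y < par e b -> lap gam y = 0.
  move=> ey ay yb; apply: (laplacian_outside X1 balX hpar gS pg); first exact: (cell_sub PS0 Ee.1).
  move=> Sy; have [_ /(_ y Sy ey)[h1 _]] := ca; have [_ /(_ y Sy ey)[_ h2]] := cb.
  case: (ltgtP (par e y) (par e x)) => [yx|xy|yx].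
  - by have := h1 yx; rewrite leNgt ay.
  - by have := h2 xy; rewrite leNgt yb.
  by have := par_neq hpar Ee Sy ey ex Sx; rewrite yx eqxx.
have [f_ hf /uniform_epsP uf] := rphi.
have below y : e y -> par e a < par e y -> par e y < par e b -> phi y <= gam y - t.
  move=> ey ay yb; rewrite -subr_le0; apply: le_eps0 => d d0.
  have d2 : 0 < d / 2 by rewrite divr_gt0.
  have [N hN] := uf _ d2; have {}hN := hN N (leqnn N).
  have [sN _ pN] := PAPC_bdd_selection X1 balX hpar (hf N).
  have [Xa Xy Xb] : [/\ X a, X y & X b] by split; exact: (cell_sub PS0 Ee.1).
  have := subharmonic_between (selectionB sN sgam) Ee ea ey eb ay yb.
  have [[_ wa _] [_ wb _]] := (Ba, Bb).
  have := hN y Xy; have := hN a Xa; have := hN b Xb.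
  rewrite !ler_norml => /andP[b1 b2] /andP[a1 a2] /andP[y1 y2] h.
  have {}h : f_ N y - gam y <= Num.max (f_ N a - gam a) (f_ N b - gam b).
    apply: h => z ez az zb; have Xz := cell_sub PS0 Ee.1 ez.
    rewrite laplacianB ?harmonic ?subr0 ?pN //; exact: (selection_locally_affine X1 balX hpar).
  by move: h; rewrite le_max => /orP[]; lra.
have pu := ud_prim hpar Ee.
have bE' := par_pt hpar Ee ea eb; have pE := par_pt hpar Ee ea ep.
have eab : e (a + (par e b - par e a) *: lat (ud e)) by rewrite -bE'.
have sb : 0 < par e p - par e a < par e b - par e a by apply/andP; split; lra.
have [Xp _ _ dE] := dir_segment X1 PS0 Ee.1 pu ea eab sb.
rewrite -pE in Xp dE.
have inseg (s : R) : par e a - par e p < s -> s < par e b - par e p ->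
    e (p + s *: lat (ud e)) /\ par e (p + s *: lat (ud e)) = par e p + s.
  move=> s1 s2; rewrite (par_shift hpar) //; split=> //.
  by apply: (par_shift_between Ee ea ep eb); apply/andP; split; lra.
pose Q y := [/\ e y, par e a < par e y & par e y < par e b].
have [d d0 hd] : exists2 r : R, 0 < r & forall y, X y -> `|y - p| < r -> Q y.
  apply: (neighbourhood_rays X1 balX) => // u; rewrite dE => -[|] ->.
    exists ((par e b - par e p) / 2); first by rewrite divr_gt0 // subr_gt0.
    by move=> s /andP[s0 s1]; have [|| h1 h2] := inseg s; rewrite /Q ?h2; [lra|lra|split=> //; lra].
  exists ((par e p - par e a) / 2); first by rewrite divr_gt0 // subr_gt0.
  move=> s /andP[s0 s1]; rewrite latvN scalerN -scaleNr.
  by have [|| h1 h2] := inseg (- s); rewrite /Q ?h2; [lra|lra|split=> //; lra].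
have [_ _ /(_ d d0)[y [Xy lt] yp]] := Bp; have [ey ay yb] := hd y Xy yp.
by have := below y ey ay yb; rewrite leNgt lt.
Qed.

End Boundary.

(** * The Monge-Ampere measure of a truncation *)

Section TruncationMeasure.
Variables (R : realType) (n : nat) (X : set 'rV[R]_n).
Variables (Pi0 : set (set 'rV[R]_n)) (w0 : set 'rV[R]_n -> rat).
Hypothesis X1 : one_dim_polyhedral_space X.
Hypothesis balX : balanced X Pi0 w0.
Variables (ud : set 'rV[R]_n -> 'rV[int]_n) (par : set 'rV[R]_n -> 'rV[R]_n -> R).
Hypothesis hpar : forall e, edges Pi0 e -> edge_coordinate e (ud e) (par e).
Local Notation V := 'rV[R]_n.
Local Notation "'lat' u" := (latv R u) (at level 10, u at level 8).
Local Notation dir := (dir X).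
Local Notation wgt := (wgt Pi0 w0).
Local Notation lap := (laplacian X Pi0 w0).
Local Notation mint := (mint X Pi0 w0).
Local Notation good := (good X Pi0).
Local Notation refinement := (refinement Pi0 par).
Local Notation selection := (selection X).
Local Notation locally_affine := (locally_affine X).
Hypothesis smX : polyhedrally_smooth X Pi0 w0.
Local Notation bounded_on := (bounded_on X).
Local Notation T := (borelV R n).
Variable gam : V -> R.
Hypothesis hgam : PAPC X gam.
Variables (phi : V -> R) (t : R).
Hypothesis rphi : PCreg X gam phi.
Variable mu : {measure set T -> \bar R}.
Local Notation dg := (mint gam (fun=> 1)).
Local Notation MA_form := (MA_form X Pi0 w0 gam).
Hypothesis muT : mu setT = dg%:E.
Hypothesis rmu : radon_on X mu.
Hypothesis rep : forall g, selection g -> bounded_on g -> \int[mu]_(x in X) g x = MA_form phi g.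
Implicit Types (x y z v s p : V) (S sigma tau e : set V) (u : 'rV[int]_n) (f g h : V -> R).

Let PS0 := structure0 balX.
Let clX := space_closed X1.
Let sgam : selection gam := PA_selection hgam.1.
Let fmu : (mu setT < +oo)%E. Proof. by rewrite muT ltry. Qed.
Let mX : measurable (X : set T). Proof. exact: borel_closed. Qed.

Local Notation U := (superlevel X gam phi t).
Local Notation P := (contact_boundary X gam phi t).
Local Notation ft := (truncation gam phi t).

Let finP : finite_set P. Proof. exact: (contact_boundary_finite X1 balX hpar hgam t rphi). Qed.
Let rft : PCreg X gam ft. Proof. exact: (PCreg_truncation X1 balX hpar smX hgam). Qed.
Let UX : U `<=` X. Proof. by move=> x []. Qed.

Lemma superlevel_near x : U x -> exists2 r : R, 0 < r & forall y, X y -> `|y - x| < r -> U y.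
Proof.
have cphi := PCreg_continuous X1 balX hpar rphi.
have /within_continuousP cw := continuous_onB cphi sgam.1.
move=> [Xx Ux]; have [|d d0 hd] := cw x Xx (phi x - (gam x - t)); first by rewrite subr_gt0.
exists d => // y Xy yx; split=> //; have := hd y Xy yx; rewrite ltr_norml => /andP[]; lra.
Qed.

Lemma off_superlevel_near x : X x -> ~ U x -> ~ P x ->
  exists2 r : R, 0 < r & forall y, X y -> `|y - x| < r -> ~ U y.
Proof.
move=> Xx nU nP; apply: contrapT => h; apply: nP; split=> //.
  by rewrite leNgt; apply/negP => lt; apply: nU.
move=> r r0; apply: contrapT => h'; apply: h; exists r => // y Xy yx Uy.
by apply: h'; exists y.
Qed.

Let mU : measurable (U : set T).
Proof.
rewrite (_ : U = X `&` U); last by apply/esym/setIidPr.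
by apply: (relatively_open_measurable clX) => x Xx /superlevel_near.
Qed.

Lemma truncation_in x : U x -> ft x = phi x.
Proof. by move=> [_ lt]; rewrite /truncation max_l // ltW. Qed.

Lemma truncation_off x : X x -> ~ U x -> ft x = gam x - t.
Proof.
by move=> Xx nU; rewrite /truncation max_r // leNgt; apply/negP => lt; apply: nU.
Qed.

Lemma plateau p (r : R) : 0 < r -> exists h, [/\ selection h, forall x, 0 <= h x <= 1,
  exists2 d : R, 0 < d & forall x, `|x - p| < d -> h x = 1 & forall x, r <= `|x - p| -> h x = 0].
Proof.
move=> r0; have [A A0 rA] := rat_above (4 / r).
have Ar : 4 < ratr A * r by rewrite -ltr_pdivrMr.
have d0 : 0 < (2 * ratr A)^-1 :> R by rewrite invr_gt0 mulr_gt0.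
have dA : ratr A * (2 * ratr A)^-1 = 2^-1 :> R.
  by rewrite invfM mulrCA divff ?mulr1 // gt_eqF.
have [q qp] := rational_row_dense p d0.
exists (fun x => Num.min (ratr 1) (Num.max (ratr 0) (ratr 2 - ratr A * `|x - map_mx ratr q|))).
split.
- apply: selection_min (selection_cst X 1) _; apply: selection_max (selection_cst X 0) _.
  apply: selectionB (selection_cst X 2) _; apply: selectionZ; exact: selection_norm.
- by move=> x; rewrite rmorph1 rmorph0 ge_min lexx le_min ler01 le_max lexx.
- exists (2 * ratr A)^-1 => // x xp; rewrite rmorph1 rmorph0 ratr_nat min_l // le_max; apply/orP; right.
  have : `|x - map_mx ratr q| <= (2 * ratr A)^-1 + (2 * ratr A)^-1.
    rewrite (_ : x - _ = (x - p) - (map_mx ratr q - p)); last by rewrite opprB addrA subrK.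
    by apply: le_trans (ler_normB _ _) _; lra.
  by move=> /(ler_wpM2l (ltW A0)); rewrite mulrDr dA; lra.
move=> x xp; rewrite rmorph1 rmorph0 ratr_nat max_l ?min_r // subr_le0.
have : r - (2 * ratr A)^-1 <= `|x - map_mx ratr q|.
  have := ler_normD (x - map_mx ratr q) (map_mx ratr q - p); rewrite addrA subrK; lra.
by move=> /(ler_wpM2l (ltW A0)); rewrite mulrBr dA; lra.
Qed.

Definition vanishes_near_boundary g := exists2 r : R, 0 < r &
  forall p x, P p -> X x -> `|x - p| < r -> g x = 0.

Definition inside g x : R := if x \in U then g x else 0.
Definition outside g x : R := if x \in U then 0 else g x.

Lemma inside_off_near g x : vanishes_near_boundary g -> X x -> ~ U x ->
  exists2 r : R, 0 < r & forall y, X y -> `|y - x| < r -> inside g y = 0.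
Proof.
move=> [r r0 hr] Xx nU; have [Px|nP] := pselect (P x).
  by exists r => // y Xy yx; rewrite /inside (hr x y) //; case: ifP.
have [d d0 hd] := off_superlevel_near Xx nU nP; exists d => // y Xy yx.
by rewrite /inside memNset //; exact: hd.
Qed.

Lemma inside_selection g : vanishes_near_boundary g -> selection g -> selection (inside g).
Proof.
move=> vg [cg [L hL]]; split; last first.
  exists ((0, 0) :: L) => x Xx; rewrite /inside; case: ifP => _.
    by have [c cL gx] := hL x Xx; exists c => //; rewrite in_cons cL orbT.
  exists (0, 0); first exact: mem_head.
  by rewrite /qform /= map_mx0 pairing0r rmorph0 addr0.
move: cg => /within_continuousP cg; apply/within_continuousP => x Xx e e0.
have [Ux|nU] := pselect (U x).
  have [r r0 hr] := superlevel_near Ux; have [d d0 hd] := cg x Xx e e0.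
  exists (Num.min r d); first by rewrite lt_min r0.
  move=> y Xy; rewrite lt_min => /andP[yr yd].
  by rewrite /inside !mem_set //; [exact: hd|exact: hr].
have [r r0 hr] := inside_off_near vg Xx nU; exists r => // y Xy yx.
by rewrite !hr ?subrr ?normr0.
Qed.

Lemma inside_bounded g : bounded_on g -> bounded_on (inside g).
Proof.
move=> [M hM]; exists M => x Xx; have := hM x Xx; rewrite /inside; case: ifP => // _.
by rewrite normr0; apply: le_trans.
Qed.

Lemma mint_support g h h' : (forall v, X v -> h v <> h' v -> lap g v = 0) -> mint g h = mint g h'.
Proof.
move=> e; apply: eq_fsbigr => v; rewrite inE => Xv.
by have [->//|/e ->//] := pselect (h v = h' v); rewrite !mul0r.
Qed.

Lemma laplacian_vanishing g v (r : R) : X v -> 0 < r ->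
  (forall y, X y -> `|y - v| < r -> g y = 0) -> lap g v = 0.
Proof.
move=> Xv r0 h; rewrite -(laplacian_cst X Pi0 w0 0 v).
exact: (laplacian_near Pi0 w0 Xv r0).
Qed.

Section Fixed.
Variable S : set V.
Hypothesis gS : good S.
Hypothesis pg : PA_on X (refinement S) gam.

Let fS : finite_set S. Proof. by case: gS. Qed.
Let SX : S `<=` X. Proof. by case: gS. Qed.

Definition exterior_atoms : seq V := [seq v <- fset_set S | (v \notin U) && (v \notin P)].

Lemma exterior_atomsP v : v \in exterior_atoms -> [/\ X v, ~ U v & ~ P v].
Proof.
rewrite mem_filter => /andP[/andP[/negP vU /negP vP]]; rewrite in_fset_set // inE => /SX Xv.
by split=> // h; [apply: vU|apply: vP]; rewrite inE.
Qed.

(** What is left of the pairing with the truncation for the boundary to carry. *)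
Definition boundary_form g : R := MA_form ft g - \int[mu]_(x in U) g x -
  \sum_(v <- exterior_atoms) lap gam v * g v.

(** Off the boundary the truncation is locally either [phi] or [gam - t], and the test
    function splits accordingly. *)
Lemma boundary_form_vanishing g : selection g -> bounded_on g -> vanishes_near_boundary g ->
  boundary_form g = 0.
Proof.
move=> sg bg vg; have s1 := inside_selection vg sg; have b1 := inside_bounded bg.
have s2 : selection (outside g).
  apply: selection_eq (selectionB sg s1) _ => x _; rewrite /inside /outside.
  by case: ifP => _; rewrite ?subrr ?subr0.
have b2 : bounded_on (outside g).
  have [M hM] := bg; exists M => x Xx; have := hM x Xx; rewrite /outside; case: ifP => // _.
  by rewrite normr0; apply: le_trans.
have gE : MA_form ft g = MA_form ft (inside g) + MA_form ft (outside g).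
  rewrite -(MA_formD X1 balX hpar hgam _ s1 s2); congr MA_form.
  by apply/funext => x; rewrite /inside /outside; case: ifP => _; rewrite ?addr0 ?add0r.
have c1 : {within X, continuous (inside g)} by case: s1.
have e1 : MA_form ft (inside g) = \int[mu]_(x in U) g x.
  rewrite (_ : MA_form ft (inside g) = MA_form phi (inside g)); last first.
    rewrite !MA_formE; congr (_ + _); apply: mint_support => v Xv neq.
    have nU : ~ U v by move=> Uv; apply: neq; rewrite truncation_in.
    have [r r0 hr] := inside_off_near vg Xv nU.
    exact: laplacian_vanishing r0 hr.
  rewrite -rep // (Rintegral_split X1 fmu mX (@subset_refl _ X) mU c1 b1).
  have -> : X `&` U = U by apply/setIidPr.
  rewrite [X in _ + X](_ : _ = 0); last first.
    rewrite (@eq_Rintegral _ _ _ _ _ (fun=> 0)); last first.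
      by move=> x; rewrite inE => -[_ nUx]; rewrite /inside memNset.
    by rewrite Rintegral_cst ?mul0r //; exact: measurableD.
  rewrite addr0; apply: eq_Rintegral => x xU; by rewrite /inside xU.
have e2 : MA_form ft (outside g) = \sum_(v <- exterior_atoms) lap gam v * g v.
  rewrite MA_formE (@mint_support (outside g) _ (fun=> - t)) => [|v Xv neq]; last first.
    have Uv : U v by apply: contrapT => nU; apply: neq; rewrite truncation_off //; ring.
    have [r r0 hr] := superlevel_near Uv; apply: (laplacian_vanishing Xv r0) => y Xy yv.
    by rewrite /outside mem_set //; exact: hr.
  rewrite (mint_cst X1 balX hpar _ s2 b2) addr0 (mintE X1 balX hpar _ gS pg).
  rewrite /exterior_atoms big_filter [RHS]big_mkcond !big_seq; apply: eq_bigr => v.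
  rewrite in_fset_set // inE => /SX Xv; rewrite /outside.
  case: (v \in U) => /=; first by rewrite mulr0.
  case: ifPn => //; rewrite negbK inE => Pv.
  by have [r r0 hr] := vg; rewrite (hr v v) ?mulr0 // subrr normr0.
by rewrite /boundary_form gE e1 e2; ring.
Qed.

Lemma boundary_formD g h : selection g -> bounded_on g -> selection h -> bounded_on h ->
  boundary_form (fun x => g x + h x) = boundary_form g + boundary_form h.
Proof.
move=> sg bg sh bh; rewrite /boundary_form (MA_formD X1 balX hpar hgam) // RintegralD //; last 2 first.
- by apply: (integrable_bounded clX fmu); [|exact: UX|case: sg|].
- by apply: (integrable_bounded clX fmu); [|exact: UX|case: sh|].
rewrite (_ : \sum_(v <- exterior_atoms) lap gam v * (g v + h v) =
  \sum_(v <- exterior_atoms) lap gam v * g v + \sum_(v <- exterior_atoms) lap gam v * h v); first by ring.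
by rewrite -big_split; apply: eq_bigr => v _; rewrite mulrDr.
Qed.

Lemma boundary_formZ (q : R) g : selection g -> bounded_on g ->
  boundary_form (fun x => q * g x) = q * boundary_form g.
Proof.
move=> sg bg; rewrite /boundary_form (MA_formZ X1 balX hpar) // RintegralZl //; last first.
  by apply: (integrable_bounded clX fmu); [|exact: UX|case: sg|].
rewrite (_ : \sum_(v <- exterior_atoms) lap gam v * (q * g v) =
  q * \sum_(v <- exterior_atoms) lap gam v * g v); first by ring.
by rewrite mulr_sumr; apply: eq_bigr => v _; rewrite mulrCA.
Qed.

Lemma boundary_form_bound : exists2 C : R, 0 <= C & forall g (M : rat), selection g ->
  (forall x, X x -> `|g x| <= ratr M) -> `|boundary_form g| <= ratr M * C.
Proof.
have D0 : 0 <= dg by rewrite -lee_fin -muT.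
exists (dg + fine (mu U) + \sum_(v <- exterior_atoms) `|lap gam v|).
  by apply: addr_ge0; [apply: addr_ge0 => //; exact: fine_ge0|exact: sumr_ge0].
move=> g M sg gM; have bg : bounded_on g by exists (ratr M).
have h1 := MA_form_bound X1 balX hpar hgam rft sg gM.
have h2 : `|\int[mu]_(x in U) g x| <= ratr M * fine (mu U).
  by apply: (Rintegral_bound clX fmu) => //; [case: sg|move=> x /UX/gM].
have h3 : `|\sum_(v <- exterior_atoms) lap gam v * g v| <= ratr M * \sum_(v <- exterior_atoms) `|lap gam v|.
  apply: le_trans (ler_norm_sum _ _ _) _; rewrite mulr_sumr !big_seq; apply: ler_sum => v.
  by move=> /exterior_atomsP[Xv _ _]; rewrite normrM mulrC ler_wpM2r // gM.
rewrite /boundary_form !mulrDr; apply: le_trans (ler_normB _ _) _; apply: lerD h3.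
by apply: le_trans (ler_normB _ _) _; apply: lerD.
Qed.

(** Clipping [g] at height [q] does not change it near the boundary. *)
Lemma boundary_form_small : exists2 C : R, 0 <= C & forall g (q : rat), selection g -> bounded_on g ->
  (forall p, P p -> `|g p| < ratr q) -> 0 < ratr q :> R -> `|boundary_form g| <= ratr q * C.
Proof.
have [C C0 hC] := boundary_form_bound; exists C => // g q sg bg gq q0.
pose c x : R := Num.max (ratr (- q)) (Num.min (ratr q) (g x)).
have sc : selection c.
  by apply: selection_max (selection_cst X _) _; apply: selection_min (selection_cst X _) _.
have cq x : `|c x| <= ratr q.
  rewrite ler_norml /c le_max rmorphN lexx /= ge_max; apply/andP; split; first lra.
  by rewrite ge_min lexx.
have bc : bounded_on c by exists (ratr q).
have sN := selectionN sc.
have bN : bounded_on (fun x => - c x) by exists (ratr q) => x _; rewrite normrN.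
have E : boundary_form (fun x => g x + - c x) = boundary_form g + - boundary_form c.
  rewrite boundary_formD //; congr (_ + _).
  rewrite -mulN1r -boundary_formZ //; congr boundary_form; apply/funext => x.
  by rewrite mulN1r.
have V0 : boundary_form (fun x => g x + - c x) = 0.
  apply: boundary_form_vanishing; first exact: selectionD.
    exact: bounded_onD.
  have /within_continuousP cg : {within X, continuous g} by case: sg.
  have [d d0 hd] : exists2 d : R, 0 < d & forall p, P p ->
      forall x, X x -> `|x - p| < d -> g x + - c x = 0.
    apply: set_eps finP _ _ => [p a b h b0 ba x Xx xp|p Pp]; first exact: h x Xx (lt_le_trans xp ba).
    have Xp : X p by case: Pp.
    have [|d d0 hd] := cg p Xp (ratr q - `|g p|); first by rewrite subr_gt0 gq.
    exists d => // x Xx xp; have := hd x Xx xp => h.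
    have : `|g x| < ratr q.
      by rewrite -[g x](subrK (g p)); apply: le_lt_trans (ler_normD _ _) _; rewrite -ltrBrDr.
    rewrite ltr_norml => /andP[l1 l2]; rewrite /c rmorphN (min_r (ltW l2)).
    by rewrite (max_r (ltW l1)) subrr.
  by exists d => // p x Pp Xx xp; exact: (hd p Pp x Xx xp).
have -> : boundary_form g = boundary_form c.
  by apply/eqP; rewrite -subr_eq0; apply/eqP; rewrite -E.
by apply: hC.
Qed.

Lemma boundary_form_sum (I : Type) (l : seq I) (q : I -> rat) (F : I -> V -> R) :
  (forall i, selection (F i) /\ bounded_on (F i)) ->
  [/\ selection (fun x => \sum_(i <- l) ratr (q i) * F i x),
    bounded_on (fun x => \sum_(i <- l) ratr (q i) * F i x) &
    boundary_form (fun x => \sum_(i <- l) ratr (q i) * F i x) =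
    \sum_(i <- l) ratr (q i) * boundary_form (F i)].
Proof.
move=> hF; elim: l => [|i l [s1 b1 IH]].
  have z : (fun x => \sum_(i <- [::]) ratr (q i) * F i x) = (fun x : V => 0 : R).
    by apply/funext => x; rewrite big_nil.
  rewrite z big_nil; split; last 2 first.
  - exact: bounded_on_cst.
  - apply: boundary_form_vanishing; [|exact: bounded_on_cst|by exists 1].
    by apply: selection_eq (selection_cst X 0) _ => y _; rewrite rmorph0.
  by apply: selection_eq (selection_cst X 0) _ => y _; rewrite rmorph0.
have z : (fun x => \sum_(j <- i :: l) ratr (q j) * F j x) =
    (fun x => ratr (q i) * F i x + \sum_(j <- l) ratr (q j) * F j x).
  by apply/funext => x; rewrite big_cons.
have [sF bF] := hF i; have sZ := selectionZ (q i) sF; have bZ := bounded_onZ (ratr (q i)) bF.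
rewrite z big_cons boundary_formD // boundary_formZ // IH; split=> //.
  exact: selectionD.
exact: bounded_onD.
Qed.

Lemma boundary_plateaus : exists hp : V -> V -> R, forall p,
  [/\ selection (hp p), bounded_on (hp p) & P p -> hp p p = 1 /\ forall p', P p' -> p' <> p -> hp p p' = 0].
Proof.
suff : forall p, exists h, [/\ selection h, bounded_on h &
    P p -> h p = 1 /\ forall p', P p' -> p' <> p -> h p' = 0].
  by move=> /choice[hp hhp]; exists hp.
move=> p; have [r r0 hr] : exists2 r : R, 0 < r & forall p', P p' -> p' <> p -> r <= `|p' - p|.
  apply: set_eps finP _ _ => [p' a b h _ ba /h|p' _]; first exact: le_trans.
  have [->|/eqP ne] := eqVneq p' p; first by exists 1.
  by exists `|p' - p| => //; rewrite normr_gt0 subr_eq0; apply/eqP.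
have [h [sh h01 [d d0 hd] h0]] := plateau p r0; exists h; split=> //.
  by exists 1 => x _; have /andP[a0 a1] := h01 x; rewrite ger0_norm.
move=> _; split; first by apply: hd; rewrite subrr normr0.
by move=> p' Pp' ne; apply: h0; exact: hr.
Qed.

(** By the preceding bound the form only depends on the values at the finitely many boundary
    points, and it is continuous in them; additivity gives the formula for rational
    combinations of plateaus. *)
Lemma boundary_formE : exists c : V -> R, forall g, selection g -> bounded_on g ->
  boundary_form g = \sum_(p <- fset_set P) g p * c p.
Proof.
have [hp hhp] := boundary_plateaus; exists (fun p => boundary_form (hp p)) => g sg bg.
have [C C0 small] := boundary_form_small.
set B := \sum_(p <- fset_set P) `|boundary_form (hp p)|.
have B0 : 0 <= B by rewrite sumr_ge0.
apply/eqP; rewrite -subr_eq0 -normr_eq0 eq_le normr_ge0 andbT; apply: le_eps0 => e e0.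
have CB : 0 < C + B + 1 by rewrite ltr_wpDl // addr_ge0.
have [eta [eta0 eta_e]] := @rat_between R (e / (C + B + 1)) (divr_gt0 e0 CB).
have eta2 : 0 < ratr eta / 2 :> R by rewrite divr_gt0.
have [q hq] := choice (fun p => rat_near (g p) eta2).
have hF p : selection (hp p) /\ bounded_on (hp p) by have [] := hhp p.
have [ss bs es] := boundary_form_sum (fset_set P) q hF.
pose k x := \sum_(p <- fset_set P) ratr (q p) * hp p x.
have kp p : P p -> k p = ratr (q p).
  move=> Pp; have pP : p \in fset_set P by rewrite in_fset_set // inE.
  have [_ _ /(_ Pp)[hpp _]] := hhp p.
  rewrite /k (bigD1_seq p) ?fset_uniq //= hpp mulr1 big_seq_cond big1 ?addr0 // => p' /andP[p'P /eqP ne].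
  have Pp' : P p' by move: p'P; rewrite in_fset_set // inE.
  have [_ _ /(_ Pp')[_ hpp']] := hhp p'.
  by rewrite (hpp' p Pp) ?mulr0 // => pp'; apply: ne.
have bN : bounded_on (fun x => - k x) by have [M hM] := bs; exists M => x Xx; rewrite normrN hM.
have := small (fun x => g x + - k x) eta (selectionD sg (selectionN ss)) (bounded_onD bg bN).
have E : boundary_form (fun x => g x + - k x) = boundary_form g + - boundary_form k.
  rewrite boundary_formD //; last exact: selectionN.
  congr (_ + _); rewrite -mulN1r -boundary_formZ //; congr boundary_form; apply/funext => x.
  by rewrite mulN1r.
move=> /(_ _ eta0) h1; have {}h1 : `|boundary_form g - boundary_form k| <= ratr eta * C.
  rewrite -E; apply: h1 => p Pp; rewrite kp //; apply: le_lt_trans (hq p) _.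
  by rewrite ltr_pdivrMr // ltr_pMr // ltr1n.
have h2 : `|boundary_form k - \sum_(p <- fset_set P) g p * boundary_form (hp p)| <= ratr eta * B.
  rewrite /k es -sumrB; apply: le_trans (ler_norm_sum _ _ _) _; rewrite mulr_sumr.
  apply: ler_sum => p _; rewrite -mulrBl normrM ler_wpM2r // distrC.
  by apply: le_trans (hq p) _; rewrite ler_pdivrMr // ler_peMr ?ler1n // ltW.
rewrite (_ : _ - _ = (boundary_form g - boundary_form k) +
  (boundary_form k - \sum_(p <- fset_set P) g p * boundary_form (hp p))); last by ring.
apply: le_trans (ler_normD _ _) _; apply: le_trans (lerD h1 h2) _.
rewrite -mulrDr; move/ltW: eta_e; rewrite ler_pdivlMr //; apply: le_trans.
by rewrite ler_wpM2l ?lerDl // ltW.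
Qed.

(** Plateaus shrinking to [p] pick up the atom at [p], while their integrals over the
    superlevel set, which does not contain [p], tend to 0. *)
Lemma boundary_form_ge0 (c : V -> R) : (forall g, selection g -> bounded_on g ->
  boundary_form g = \sum_(p <- fset_set P) g p * c p) -> forall p, P p -> 0 <= c p.
Proof.
move=> hc p Pp; rewrite -oppr_le0; apply: le_eps0 => e e0.
have [Xp pU _] := Pp; have nU : ~ U p by move=> [_]; rewrite ltNge pU.
have [K [cK KU hK]] := radon_inner fmu rmu mU e0.
have clK : closed K by apply: compact_closed cK; exact: norm_hausdorff.
have [r1 r10 h1] : exists2 r : R, 0 < r & forall y, K y -> r <= `|y - p|.
  apply: contrapT => h; apply: nU; apply: KU; move/closed_epsP: clK; apply => r r0.
  apply: contrapT => h'; apply: h; exists r => // y Ky; rewrite leNgt; apply/negP => lt.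
  by apply: h'; exists y.
have [r2 r20 h2] : exists2 r : R, 0 < r & forall v, v \in exterior_atoms -> r <= `|v - p|.
  apply: (seq_eps (P := fun v r => r <= `|v - p|)) => [v a b h _ ba|v /exterior_atomsP[_ _ nP]].
    exact: le_trans ba h.
  exists `|v - p| => //; rewrite normr_gt0 subr_eq0; apply/eqP => vp.
  by apply: nP; rewrite vp.
have [r3 r30 h3] : exists2 r : R, 0 < r & forall p', P p' -> p' <> p -> r <= `|p' - p|.
  apply: set_eps finP _ _ => [p' a b h _ ba /h|p' _]; first exact: le_trans.
  have [->|/eqP ne] := eqVneq p' p; first by exists 1.
  by exists `|p' - p| => //; rewrite normr_gt0 subr_eq0; apply/eqP.
(* A plateau of this radius meets neither [K], nor the exterior atoms, nor other points of
   the boundary. *)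
have rr : 0 < Num.min r1 (Num.min r2 r3) by rewrite !lt_min r10 r20.
have [h [sh h01 [d d0 hd] h0]] := plateau p rr.
have bh : bounded_on h by exists 1 => x _; have /andP[a0 a1] := h01 x; rewrite ger0_norm.
have hz y : r1 <= `|y - p| \/ r2 <= `|y - p| \/ r3 <= `|y - p| -> h y = 0.
  move=> hy; apply: h0; rewrite !ge_min; case: hy => [->//|[]->]; by rewrite ?orbT.
have hp1 : h p = 1 by apply: hd; rewrite subrr normr0.
have cE : boundary_form h = c p.
  have pP : p \in fset_set P by rewrite in_fset_set // inE.
  rewrite hc // (bigD1_seq p) ?fset_uniq //= hp1 mul1r big_seq_cond big1 ?addr0 // => p' /andP[p'P /eqP ne].
  have Pp' : P p' by move: p'P; rewrite in_fset_set // inE.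
  by rewrite hz ?mul0r //; right; right; exact: h3.
have ch : {within X, continuous h} by case: sh.
have mK : measurable (K : set T) by exact: borel_closed.
have UK : U `&` K = K by apply/setIidPr.
have hI : \int[mu]_(x in U) h x <= e.
  rewrite (Rintegral_split X1 fmu mU UX mK ch bh) UK (@eq_Rintegral _ _ _ _ _ (fun=> 0)); last first.
    by move=> x; rewrite inE => Kx; apply: hz; left; exact: h1.
  rewrite Rintegral_cst // mul0r add0r.
  have mUK : measurable (U `\` K : set T) by exact: measurableD.
  have UKX : U `\` K `<=` X by move=> x [/UX].
  have := Rintegral_bound clX fmu mUK UKX ch bh (M := 1).
  have := mass_split fmu mU mK; rewrite UK mul1r => hm hb.
  apply: le_trans (ler_norm _) _; apply: le_trans (hb _) _; last by lra.
  by move=> x _; have /andP[a0 a1] := h01 x; rewrite ger0_norm.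
have hE : \sum_(v <- exterior_atoms) lap gam v * h v = 0.
  rewrite big_seq; apply: big1 => v vE; rewrite hz ?mulr0 //; right; left; exact: h2.
have := MA_form_ge0 X1 balX hpar hgam rft sh bh (fun x _ => proj1 (andP (h01 x))).
by rewrite -cE /boundary_form hE; lra.
Qed.

End Fixed.

(** The restriction of [mu], the atoms of [gam] off the closure of the superlevel set, and
    the coefficients of the boundary form. *)
Lemma truncation_measure : exists nu : {measure set T -> \bar R}, is_MA_reg X Pi0 w0 gam ft nu.
Proof.
have [||S [gS _ pg _]] := @selections_good _ _ _ _ _ X1 balX _ _ hpar gam gam set0 sgam sgam => //.
have [c hc] := boundary_formE gS pg; have c0 := boundary_form_ge0 gS hc.
have [nu0 [f0 r0 i0]] := restriction_measure X1 fmu rmu mU UX.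
pose l := [seq (lap gam v, v) | v <- exterior_atoms S] ++ [seq (c p, p) | p <- fset_set P].
have [|nu [fnu rnu inu]] := add_atoms X1 f0 r0 (l := l).
  move=> a; rewrite mem_cat => /orP[/mapP[v vE ->]|/mapP[p + ->]] /=.
    have [Xv _ _] := exterior_atomsP gS vE; split=> //.
    exact: (PC_laplacian X1 balX hpar sgam hgam.2).
  by rewrite in_fset_set // inE => Pp; split; [exact: c0|case: Pp].
have rep' g : selection g -> bounded_on g -> \int[nu]_(x in X) g x = MA_form ft g.
  move=> sg bg; have cg : {within X, continuous g} by case: sg.
  rewrite inu // i0 // big_cat !big_map /=.
  have := hc g sg bg; rewrite /boundary_form => h.
  rewrite (_ : \sum_(p <- fset_set P) c p * g p = \sum_(p <- fset_set P) g p * c p).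
    by rewrite -h; ring.
  by apply: eq_bigr => p _; rewrite mulrC.
exists nu; apply: (form_MA_reg X1 balX hpar hgam) => //.
have s1 : selection (fun=> 1 : R).
  by apply: selection_eq (selection_cst X 1) _ => x _; rewrite rmorph1.
have := rep' _ s1 (bounded_on_cst X 1); rewrite MA_form_cst mul1r Rintegral_cst // mul1r => <-.
have [_ _ nuX] := rnu; have := @mass_split _ _ _ fnu [set: T] X measurableT mX.
rewrite setTI setTD nuX /= addr0 => <-.
by rewrite fineK // (measure_fin_num fnu).
Qed.

End TruncationMeasure.

(** * Existence and uniqueness *)

Section Conclusion.
Variables (R : realType) (n : nat) (X : set 'rV[R]_n).
Variables (Pi0 : set (set 'rV[R]_n)) (w0 : set 'rV[R]_n -> rat).
Hypothesis X1 : one_dim_polyhedral_space X.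
Hypothesis balX : balanced X Pi0 w0.
Variables (ud : set 'rV[R]_n -> 'rV[int]_n) (par : set 'rV[R]_n -> 'rV[R]_n -> R).
Hypothesis hpar : forall e, edges Pi0 e -> edge_coordinate e (ud e) (par e).
Local Notation V := 'rV[R]_n.
Local Notation "'lat' u" := (latv R u) (at level 10, u at level 8).
Local Notation dir := (dir X).
Local Notation wgt := (wgt Pi0 w0).
Local Notation lap := (laplacian X Pi0 w0).
Local Notation mint := (mint X Pi0 w0).
Local Notation good := (good X Pi0).
Local Notation refinement := (refinement Pi0 par).
Local Notation selection := (selection X).
Local Notation locally_affine := (locally_affine X).
Hypothesis cX : connected X.
Hypothesis smX : polyhedrally_smooth X Pi0 w0.
Local Notation bounded_on := (bounded_on X).
Local Notation T := (borelV R n).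
Variable gam : V -> R.
Hypothesis hgam : PAPC X gam.
Variable mu : {measure set T -> \bar R}.
Local Notation dg := (mint gam (fun=> 1)).
Local Notation MA_form := (MA_form X Pi0 w0 gam).
Hypothesis muT : mu setT = dg%:E.
Hypothesis rmu : radon_on X mu.
Hypothesis cmu : compactly_supported X mu.
Implicit Types (x y z v s p : V) (S sigma tau e : set V) (u : 'rV[int]_n) (f g h : V -> R).

Let clX := space_closed X1.
Let sgam : selection gam := PA_selection hgam.1.
Let fmu : (mu setT < +oo)%E. Proof. by rewrite muT ltry. Qed.
Let mX : measurable (X : set T). Proof. exact: borel_closed. Qed.

Definition represents f := forall g, selection g -> bounded_on g ->
  \int[mu]_(x in X) g x = MA_form f g.

Lemma bounded_solution : exists f,
  [/\ PSH X gam f, PCreg X gam f, bounded_on (fun x => f x - gam x) & represents f].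
Proof.
have [[x Xx]|X0] := pselect (X !=set0).
  have [ o [Xo ro _]] := rational_dense X1 balX Xx (ltr01 : 0 < 1 :> R).
  exact: (solution X1 balX hpar cX smX hgam (conj Xo ro) muT cmu).
have nX x : ~ X x by move=> Xx; apply: X0; exists x.
have gg := PAPC_bdd_self hgam.
exists gam; split.
- by exists (fun=> gam); split=> // x /nX.
- by exists (fun=> gam) => //; apply/uniform_epsP => e _; exists 0%N => j _ x /nX.
- by exists 0 => x /nX.
move=> g _ _; have XE : X = set0 by apply/seteqP; split=> // x /nX.
have m0 f h : mint f h = 0 by apply: fsbig1 => v /nX.
by rewrite [in LHS]XE Rintegral_set0 MA_formE !m0 addr0.
Qed.

(** Since [f - gam] is bounded, the truncations agree with [f] on the space once their
    parameter is large. *)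
Lemma solution_MA f : PCreg X gam f -> bounded_on (fun x => f x - gam x) -> represents f ->
  is_MA_PSH X Pi0 w0 gam f mu.
Proof.
move=> rf [B hB] rep.
have [nu hnu] : exists nu : R -> {measure set T -> \bar R}, forall t,
    is_MA_reg X Pi0 w0 gam (truncation gam f t) (nu t) /\ (B < t -> nu t = mu).
  suff : forall t : R, exists nu : {measure set T -> \bar R},
      is_MA_reg X Pi0 w0 gam (truncation gam f t) nu /\ (B < t -> nu = mu).
    by move=> /choice[nu hnu]; exists nu.
  move=> t; have [Bt|tB] := ltP B t; last first.
    by have [nu hnu] := truncation_measure X1 balX hpar smX hgam t rf muT rmu rep; exists nu.
  exists mu; split=> //; apply: (form_MA_reg X1 balX hpar hgam muT) => //.
    exact: (PCreg_truncation X1 balX hpar smX hgam).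
  move=> g sg bg; rewrite rep // !MA_formE; congr (_ + _); apply: mint_eqr => x Xx.
  rewrite /truncation max_l //; have := hB x Xx; rewrite ler_norml => /andP[]; lra.
exists nu; split=> [t|g cg _ bg]; first by have [] := hnu t.
apply: cvg_near_cst; exists B; split; first exact: num_real.
move=> t Bt; have [_ ->] := hnu t; last exact: Bt.
rewrite (_ : X `&` _ = X) //; apply/setIidPl => x Xx /=.
by have := hB x Xx; rewrite ler_norml => /andP[]; lra.
Qed.

Variable psi : V -> R.
Hypothesis MApsi : is_MA_PSH X Pi0 w0 gam psi mu.

Lemma truncation_PCreg t : PCreg X gam (truncation gam psi t).
Proof. by have [nu [/(_ t)[]]] := MApsi. Qed.

Lemma truncation_superlevel x (t : R) :
  superlevel X gam (truncation gam psi t) t x <-> X x /\ gam x - t < psi x.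
Proof.
by rewrite /superlevel /truncation /=; split=> -[Xx]; rewrite lt_max ltxx orbF.
Qed.

(** Near every point [psi] agrees with one of its truncations. *)
Lemma solution_continuous : {within X, continuous psi}.
Proof.
apply/within_continuousP => x Xx e e0.
(* A parameter for which the truncation is inactive at [x]. *)
pose t := gam x - psi x + 1; have rt := truncation_PCreg t.
have Ux : superlevel X gam (truncation gam psi t) t x.
  by apply/truncation_superlevel; split=> //; rewrite /t; lra.
have [r r0 hr] := superlevel_near X1 balX hpar hgam rt Ux.
have /within_continuousP/(_ x Xx e e0)[d d0 hd] := PCreg_continuous X1 balX hpar rt.
have E y : superlevel X gam (truncation gam psi t) t y -> truncation gam psi t y = psi y.
  by move=> /truncation_superlevel[_ lt]; rewrite /truncation max_l // ltW.
exists (Num.min r d); first by rewrite lt_min r0.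
move=> y Xy; rewrite lt_min => /andP[yr yd].
by rewrite -(E y (hr y Xy yr)) -(E x Ux); exact: hd.
Qed.

(** The total masses force the truncated measures to leave the sublevel sets, so that
    pairing with the truncations tends to integration against the limit measure. *)
Lemma truncations_pairing h : selection h -> bounded_on h -> (forall x, X x -> 0 <= h x) ->
  forall d : R, 0 < d -> exists A, forall t, A < t ->
    `|\int[mu]_(x in X) h x - MA_form (truncation gam psi t) h| <= d.
Proof.
have [nu [hnu lnu]] := MApsi; move=> sh bh h0 d d0.
have [M0 hM0] := bh; pose M := Num.max M0 0.
have hM x : X x -> `|h x| <= M by move=> Xx; rewrite le_max hM0.
have M1 : 0 < M + 2 by rewrite ltr_wpDl // le_max lexx orbT.
have e0 : 0 < d / (M + 2) by rewrite divr_gt0.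
set e := d / (M + 2) in e0.
pose Ut t : set V := X `&` [set x | gam x - t < psi x].
have mUt t : measurable (Ut t : set T).
  have rt := truncation_PCreg t.
  have E : Ut t = X `&` superlevel X gam (truncation gam psi t) t.
    by apply/seteqP; split=> x; [move=> [Xx lt]; split=> //; apply/truncation_superlevel|
      move=> [Xx /truncation_superlevel[]]].
  rewrite E; apply: (relatively_open_measurable clX) => x Xx.
  exact: (superlevel_near X1 balX hpar hgam rt).
have UtX t : Ut t `<=` X by move=> x [].
have nuT t : nu t setT = dg%:E.
  by have [_ _ -> _] := hnu t; rewrite (deg_mint X1 balX hpar hgam).
have fnu t : (nu t setT < +oo)%E by rewrite nuT ltry.
have near g : {within X, continuous g} -> bounded_on g -> (forall x, X x -> 0 <= g x) ->
    exists A, forall t, A < t -> `|\int[mu]_(x in X) g x - \int[nu t]_(x in Ut t) g x| <= e.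
  move=> cg bg g0; have := lnu g cg g0 (proj1 (bounded_onP X g) bg).
  rewrite (RintegralE clX fmu mX) // => /fine_cvg /cvgrPdist_le /(_ e e0)[A [_ hA]].
  by exists A => t /hA.
have ch : {within X, continuous h} by case: sh.
have s1 : selection (fun=> 1 : R).
  by apply: selection_eq (selection_cst X 1) _ => x _; rewrite rmorph1.
have [A hA] := near h ch bh h0.
have [A' hA'] := near (fun=> 1) s1.1 (bounded_on_cst X 1) (fun _ _ => ler01).
exists (Num.max A A') => t; rewrite gt_max => /andP[/hA a /hA' a'].
have massX (m : {measure set T -> \bar R}) : radon_on X m -> m setT = dg%:E -> fine (m X) = dg.
  move=> [_ _ mX0] mT; have fm : (m setT < +oo)%E by rewrite mT ltry.
  have := @mass_split _ _ _ fm [set: T] X measurableT mX.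
  by rewrite setTI setTD mX0 mT /= addr0.
have rnu : radon_on X (nu t) by have [] := hnu t.
rewrite !Rintegral_cst // !mul1r massX // -(massX _ rnu (nuT t)) in a'.
have XU : X `&` Ut t = Ut t by apply/setIidPr.
have mXU : measurable (X `\` Ut t : set T) by exact: measurableD.
have := mass_split (fnu t) mX (mUt t); rewrite XU => hm.
(* Tested against 1, the defect is the mass that the truncated measure has left outside. *)
rewrite hm addrAC subrr add0r in a'; have {}a' := le_trans (ler_norm _) a'.
rewrite -(MA_reg_form X1 balX hpar hgam (nuT t) (hnu t) sh bh).
rewrite (Rintegral_split X1 (fnu t) mX (@subset_refl _ X) (mUt t) ch bh) XU opprD addrA.
apply: le_trans (ler_normB _ _) _.
have := Rintegral_bound clX (fnu t) mXU (@subDsetl _ _ _) ch bh (M := M).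
move=> /(_ (fun x xU => hM x xU.1)) b; apply: le_trans (lerD a b) _.
have M0' : 0 <= M by rewrite le_max lexx orbT.
have := ler_wpM2l M0' a'; have -> : d = e * (M + 2) by rewrite divfK // gt_eqF.
by have := ltW e0; lra.
Qed.

(** A dipole with poles [x] and [o], made nonnegative by adding a constant, is paired with a
    truncation through the difference of its values at the two poles. *)
Lemma solution_unique f : represents f -> {within X, continuous f} ->
  exists c : R, forall x, X x -> psi x = f x + c.
Proof.
move=> rep cf; have [[x0 Xx0]|X0] := pselect (X !=set0); last first.
  by exists 0 => x Xx; case: X0; exists x.
have [ o [Xo ro _]] := rational_dense X1 balX Xx0 (ltr01 : 0 < 1 :> R).
exists (psi o - f o); apply: (rational_eq X1 balX) => [||x Xx rx]; first exact: solution_continuous.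
  by apply: continuous_onD => //; exact: continuous_on_cst.
have [k [sk bk _ lk]] := dipole_exists X1 balX hpar cX (conj Xx rx) (conj Xo ro).
have [M M0 kM] : exists2 M : rat, 0 < ratr M :> R & forall y, X y -> `|k y| <= ratr M.
  have [B hB] := bk; have [M M0 BM] := rat_above B.
  by exists M => // y Xy; apply: le_trans (hB y Xy) (ltW BM).
pose h y := k y + ratr M.
have sM := selection_cst X M; have sh : selection h by exact: selectionD.
have bh : bounded_on h by apply: bounded_onD => //; exact: bounded_on_cst.
have h0 y : X y -> 0 <= h y by move=> /kM; rewrite /h ler_norml => /andP[]; lra.
have lh v : X v -> lap h v = (v == x)%:R - (v == o)%:R.
  move=> Xv; rewrite (laplacianD X1 balX Xv) ?laplacian_cst ?addr0 ?lk //.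
    exact: (selection_locally_affine X1 balX hpar).
  exact: locally_affine_cst.
have formE g : MA_form g h = mint gam h + (g x - gam x - (g o - gam o)).
  by rewrite MA_formE (mint_dipole _ Xx Xo lh).
apply/eqP; rewrite -subr_eq0 -normr_eq0 eq_le normr_ge0 andbT; apply: le_eps0 => d d0.
have [A hA] := truncations_pairing sh bh h0 d0.
pose t := Num.max A (Num.max (gam x - psi x) (gam o - psi o)) + 1.
have : Num.max A (Num.max (gam x - psi x) (gam o - psi o)) < t by rewrite ltrDl.
rewrite !gt_max => /andP[tA /andP[tx to]].
have := hA t tA; rewrite rep // !formE /truncation !max_l; [|lra|lra].
apply: le_trans; rewrite -normrN le_eqVlt; apply/orP; left; apply/eqP; congr `|_|.
by ring.
Qed.

End Conclusion.

Theorem theorem1p4 (R : realType) (n : nat) (X : set 'rV[R]_n)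
    (Pi0 : set (set 'rV[R]_n)) (w0 : set 'rV[R]_n -> rat)
    (gamma : 'rV[R]_n -> R) (mu : {measure set (borelV R n) -> \bar R}) :
  one_dim_polyhedral_space X ->
  connected X ->
  balanced X Pi0 w0 ->
  polyhedrally_smooth X Pi0 w0 ->
  PAPC X gamma ->
  positive_at_infinity X gamma ->
  radon_on X mu ->
  compactly_supported X mu ->
  mu setT = (deg X Pi0 w0 gamma)%:E ->
  exists phi : 'rV[R]_n -> R,
    [/\ PSH X gamma phi,
        is_MA_PSH X Pi0 w0 gamma phi mu,
        forall psi : 'rV[R]_n -> R,
          PSH X gamma psi -> is_MA_PSH X Pi0 w0 gamma psi mu ->
          exists c : R, forall x, X x -> psi x = phi x + c
      & strictly_convex X gamma -> PCreg X gamma phi].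
Proof.
move=> X1 cX balX smX hgam _ rmu cmu muT.
have [ud [par hpar]] := edge_coordinateP X1 balX.
rewrite (deg_mint X1 balX hpar hgam) in muT.
have [phi [pshphi rphi bphi rep]] := bounded_solution X1 balX hpar cX smX hgam muT cmu.
exists phi; split=> //; first exact: (solution_MA X1 balX hpar smX hgam muT rmu rphi bphi rep).
move=> psi _ MApsi; apply: (solution_unique X1 balX hpar cX hgam muT rmu MApsi rep).
exact: (PCreg_continuous X1 balX hpar rphi).
Qed.
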